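(* Let $\Gamma$ be fixed data satisfying the Injectivity Assumption and let $\mathbf s$ be a seed. The scattering diagram $\mathfrak D_{\mathbf s}$ is equivalent to a scattering diagram all of whose walls $(\mathfrak d,f_{\mathfrak d})$ satisfy $f_{\mathfrak d}=(1+z^m)^c$ for some $m=p^*(n)$, $n\in N^+$, and $c$ a positive integer. In particular, all nonzero coefficients of $f_{\mathfrak d}$ are positive integers.
   Context: $\Bbbk$ is a field of characteristic $0$. FIXED DATA $\Gamma$: a lattice $N$ of rank $n$ with a skew-symmetric form $\{\cdot,\cdot\}:N\times N\to\mathbb Q$; a saturated sublattice $N_{uf}\subseteq N$; $I=\{1,\dots,n\}\supseteq I_{uf}$ with $|I_{uf}|=\operatorname{rank}N_{uf}$; positive integers $d_i$ ($i\in I$) with gcd $1$; a finite-index sublattice $N^\circ\subseteq N$ with $\{N_{uf},N^\circ\}\subseteq\mathbb Z$ and $\{N,N_{uf}\cap N^\circ\}\subseteq\mathbb Z$. $M=\operatorname{Hom}(N,\mathbb Z)\subseteq M^\circ=\operatorname{Hom}(N^\circ,\mathbb Z)$, $M_{\mathbb R}=M\otimes\mathbb R$. A seed is a basis $\mathbf s=(e_i)_{i\in I}$ of $N$ with $(e_i)_{i\in I_{uf}}$ a basis of $N_{uf}$ and $(d_ie_i)_{i\in I}$ a basis of $N^\circ$. For $n\in N_{uf}$ put $p^*(n)=p_1^*(n)=\{n,\cdot\}\in M^\circ$ and $v_i=p^*(e_i)$, $i\in I_{uf}$. Injectivity Assumption: $p_1^*:N_{uf}\to M^\circ$ is injective.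 $N^+=\{\sum_{i\in I_{uf}}a_ie_i:a_i\in\mathbb Z_{\ge0},\ \sum a_i>0\}$, $\deg\sum a_ie_i=\sum a_i$. Choose a strictly convex top-dimensional rational cone $\sigma\subset M_{\mathbb R}$ with $v_i\in P\setminus\{0\}$ for all $i\in I_{uf}$, where $P=\sigma\cap M^\circ$; $\widehat{\Bbbk[P]}$ is the completion of $\Bbbk[P]$ at the monomial ideal $P\setminus\{0\}$. A wall is a pair $(\mathfrak d,f_{\mathfrak d})$ with $\mathfrak d\subset n_0^\perp\subset M_{\mathbb R}$ a $(\operatorname{rank}N-1)$-dimensional convex (not necessarily strictly convex) rational polyhedral cone, $n_0\in N^+$ primitive, $f_{\mathfrak d}=1+\sum_{j\ge1}c_jz^{jp^*(n_0)}\in\widehat{\Bbbk[P]}$. A scattering diagram is a set of walls such that for each $k>0$ only finitely many walls have some $c_j\ne0$ with $\deg(jn_0)\le k$. Its singular locus is the union of the boundaries of walls and of the codimension-two intersections of walls. If a path $\gamma$ crosses $\mathfrak d$ transversally at time $t$ (away from the singular locus), the associated automorphism of $\widehat{\Bbbk[P]}$ is $z^m\mapsto z^mf_{\mathfrak d}^{\varepsilon\langle n_0',m\rangle}$ where $n_0'$ generates $\mathbb R_{\ge0}n_0\cap N^\circ$ and $\varepsilon=-\operatorname{sgn}\langle n_0,\gamma'(t)\rangle$; the path-ordered product $\theta_{\gamma,\mathfrak D}$ is the composition of these in order of crossing (limit over orders $k$). Two diagrams are equivalent if their path-ordered products agree for all paths for which both are defined. A diagram is consistent if $\theta_{\gamma,\mathfrak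 D}$ depends only on the endpoints of $\gamma$. A wall $\mathfrak d\subset n_0^\perp$ is incoming if $p^*(n_0)\in\mathfrak d$, otherwise outgoing. $\mathfrak D_{\mathbf s}$ is the scattering diagram, unique up to equivalence, which is consistent, contains $\mathfrak D_{in,\mathbf s}=\{(e_i^\perp,1+z^{v_i}):i\in I_{uf}\}$, and such that $\mathfrak D_{\mathbf s}\setminus\mathfrak D_{in,\mathbf s}$ consists only of outgoing walls. *)

(* Defs.v *)
From HB Require Import structures.
From mathcomp Require Import all_boot all_order all_algebra.
From mathcomp Require Import all_classical all_reals all_analysis.

Set Implicit Arguments.
Unset Strict Implicit.
Unset Printing Implicit Defensive.
Import Order.TTheory GRing.Theory Num.Theory.
Import numFieldNormedType.Exports.

Local Open Scope classical_set_scope.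
Local Open Scope ring_scope.

(* Coordinates.  The lattice N of rank n is 'rV[int]_n, and its dual M is       *)
(* identified with 'rV[int]_n through the standard pairing (pairing below), so  *)
(* that M_Q = 'rV[rat]_n and M_R = 'rV[R]_n.                                    *)

Section Lattices.
Context {n : nat}.
Implicit Types (A : set 'rV[int]_n) (x y : 'rV[int]_n).

Definition pairing (F : fieldType) x (m : 'rV[F]_n) : F :=
  (map_mx intr x *m m^T) 0 0.

Definition sublattice A := A 0 /\ forall x y, A x -> A y -> A (x - y).

Definition saturated A := forall (a : int) x, a != 0 -> A (a *: x) -> A x.

Definition finite_index A :=
  exists s : seq 'rV[int]_n, forall x, exists2 y, y \in s & A (x - y).

(* The family (b j), for j in D, is a basis of the sublattice A. *)
Definition Zbasis (J : finType) (D : {set J}) A (b : J -> 'rV[int]_n) :=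
  [/\ forall j, j \in D -> A (b j),
      forall a : J -> int, \sum_(j in D) a j *: b j = 0 ->
        forall j, j \in D -> a j = 0
    & forall x, A x -> exists a : J -> int, x = \sum_(j in D) a j *: b j].

Definition lattice_rank A r :=
  exists b : 'I_r -> 'rV[int]_n, Zbasis [set: 'I_r]%SET A b.

Definition primitive x :=
  x != 0 /\ forall (a : int) y, x = a *: y -> `|a| = 1.

(* C is a convex rational polyhedral cone, generated by the rows of G; its      *)
(* linear span is then the row space of G, so C has codimension c.              *)
Definition rational_cone (R : realType) (c : nat) (C : set 'rV[R]_n) :=
  exists r (G : 'M[int]_(r, n)),
    (\rank (map_mx intr G : 'M[rat]_(r, n)) + c)%N = n /\
    C = [set m | exists2 a : 'rV[R]_r,
           forall j, 0 <= a 0 j & m = a *m map_mx intr G].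

Definition strictly_convex (R : realType) (C : set 'rV[R]_n) :=
  forall m, C m -> C (- m) -> m = 0.

End Lattices.

Record fixed_data (n : nat) := FixedData {
  form_mx : 'M[rat]_n;
  Nuf : set 'rV[int]_n;
  Iuf : {set 'I_n};
  dd : 'I_n -> nat;
  Ncirc : set 'rV[int]_n
}.

Section FixedData.
Context {n : nat} (Gamma : fixed_data n).
Implicit Types (x y : 'rV[int]_n) (m : 'rV[rat]_n) (e : 'I_n -> 'rV[int]_n).

Definition form x y : rat :=
  (map_mx intr x *m form_mx Gamma *m (map_mx intr y)^T) 0 0.

Definition is_fixed_data :=
  [/\ [/\ forall x y, form x y = - form y x,
          sublattice (Nuf Gamma), saturated (Nuf Gamma)
        & lattice_rank (Nuf Gamma) #|Iuf Gamma|],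
      (forall i, 0 < dd Gamma i)%N /\ (\big[gcdn/0]_i dd Gamma i = 1)%N,
      sublattice (Ncirc Gamma) /\ finite_index (Ncirc Gamma),
      forall x y, Nuf Gamma x -> Ncirc Gamma y -> form x y \is a Num.int
    & forall x y, Nuf Gamma y -> Ncirc Gamma y -> form x y \is a Num.int].

Definition is_seed e :=
  [/\ Zbasis [set: 'I_n]%SET setT e,
      Zbasis (Iuf Gamma) (Nuf Gamma) e
    & Zbasis [set: 'I_n]%SET (Ncirc Gamma) (fun i => e i *+ dd Gamma i)].

(* As Ncirc has finite index in N, every homomorphism Ncirc -> Z extends        *)
(* uniquely to N -> Q: Hom(Ncirc, Z) is this lattice in M_Q.                    *)
Definition Mcirc : set 'rV[rat]_n :=
  [set m | forall y, Ncirc Gamma y -> pairing y m \is a Num.int].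

(* pairing y (pstar x) = form x y *)
Definition pstar x : 'rV[rat]_n := map_mx intr x *m form_mx Gamma.

Definition injectivity_assumption :=
  forall x y, Nuf Gamma x -> Nuf Gamma y -> pstar x = pstar y -> x = y.

Definition has_degree e x (k : nat) :=
  exists a : 'I_n -> nat,
    x = \sum_(i in Iuf Gamma) e i *+ a i /\
    k = (\sum_(i in Iuf Gamma) a i)%N.

Definition Nplus e : set 'rV[int]_n :=
  [set x | exists2 k, (0 < k)%N & has_degree e x k].

(* The monoid P = sigma \cap Mcirc. *)
Definition monP (R : realType) (sigma : set 'rV[R]_n) : set 'rV[rat]_n :=
  [set m | Mcirc m /\ sigma (map_mx ratr m)].

Definition good_cone e (R : realType) (sigma : set 'rV[R]_n) :=
  [/\ rational_cone 0 sigma, strictly_convex sigma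
    & forall i, i \in Iuf Gamma ->
        monP sigma (pstar (e i)) /\ pstar (e i) != 0].

End FixedData.

(* For sigma rational polyhedral and strictly convex, an element of P is a sum  *)
(* of elements of P \ {0} in finitely many ways only; hence the completion of   *)
(* k[P] at the ideal P \ {0} consists of all formal sums \sum_(q in P) h_q z^q, *)
(* represented by their coefficients.  For the same reason all the sums         *)
(* \sum_(_ \in _) below have finite support.                                    *)
Section Completion.
Context {n : nat} (Gamma : fixed_data n) {R : realType} (k : fieldType).
Context (sigma : set 'rV[R]_n).
Local Notation P := (monP Gamma sigma).

Definition phat := P -> k.
Implicit Types (f g h : phat) (q : P).

Definition zmon (m : 'rV[rat]_n) : phat := fun q => (val q == m)%:R.

Definition hmul f g : phat := fun q =>
  \sum_(x \in [set x : P * P | val x.1 + val x.2 = val q]) f x.1 * g x.2.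

Definition hexp f (j : nat) : phat := iter j (hmul f) (zmon 0).

(* The inverse \sum_j (1 - f)^j of a series f with constant term 1. *)
Definition hinv f : phat := fun q =>
  \sum_(j \in [set: nat]) hexp (fun p => zmon 0 p - f p) j q.

Definition hexpz f (a : int) : phat :=
  match a with Posz j => hexp f j | Negz j => hexp (hinv f) j.+1 end.

(* The continuous k-linear map sending z^m to F m, when F m is in z^m phat. *)
Definition hsubst (F : P -> phat) : phat -> phat := fun h q =>
  \sum_(m \in [set: P]) h m * F m q.

End Completion.

(* The vector wdir, called n_0 in is_wall, is determined by wsupp, as it is     *)
(* primitive, lies in Nplus and is orthogonal to wsupp, of codimension 1.       *)
Record wall {n : nat} (Gamma : fixed_data n) {R : realType} (k : fieldType)
    (sigma : set 'rV[R]_n) := Wall {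
  wsupp : set 'rV[R]_n;
  wdir : 'rV[int]_n;
  wfun : phat Gamma k sigma
}.

HB.instance Definition _ n (Gamma : fixed_data n) (R : realType)
  (k : fieldType) (sigma : set 'rV[R]_n) := gen_eqMixin (wall Gamma k sigma).
HB.instance Definition _ n (Gamma : fixed_data n) (R : realType)
  (k : fieldType) (sigma : set 'rV[R]_n) :=
  gen_choiceMixin (wall Gamma k sigma).

Section Scattering.
Context {n : nat} (Gamma : fixed_data n) (e : 'I_n -> 'rV[int]_n).
Context {R : realType} {k : fieldType} {sigma : set 'rV[R]_n}.
Local Notation P := (monP Gamma sigma).
Local Notation wall := (wall Gamma k sigma).
Local Notation phat := (phat Gamma k sigma).
Local Notation pstar := (pstar Gamma).
Implicit Types (w : wall) (D : set wall) (gamma : R -> 'rV[R]_n) (t : R).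

Definition perp (x : 'rV[int]_n) : set 'rV[R]_n := [set m | pairing x m = 0].

(* f = 1 + \sum_(j >= 1) c_j z^(j p^*(n0)) *)
Definition wall_series (n0 : 'rV[int]_n) (f : phat) (c : nat -> k) :=
  f = fun q => zmon k 0 q +
    \sum_(j \in [set j | (0 < j)%N]) c j * zmon k (pstar n0 *+ j) q.

Definition is_wall w :=
  [/\ rational_cone 1 (wsupp w), wsupp w `<=` perp (wdir w),
      primitive (wdir w), Nplus Gamma e (wdir w)
    & exists c, wall_series (wdir w) (wfun w) c].

Definition nontrivial_to_order (l : nat) w :=
  exists c j d, [/\ wall_series (wdir w) (wfun w) c, (0 < j)%N, c j != 0,
    has_degree Gamma e (wdir w *+ j) d & (d <= l)%N].

Definition is_scattering_diagram D :=
  (forall w, D w -> is_wall w) /\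
  (forall l, (0 < l)%N -> finite_set (D `&` nontrivial_to_order l)).

Definition support D : set 'rV[R]_n := \bigcup_(w in D) wsupp w.

(* Boundary of the closed set wsupp w relative to the hyperplane it spans. *)
Definition wall_boundary w : set 'rV[R]_n :=
  [set m | wsupp w m /\
           ~ (\forall m' \near m, perp (wdir w) m' -> wsupp w m')].

Definition singular_locus D : set 'rV[R]_n :=
  [set m | (exists2 w, D w & wall_boundary w m) \/
           (exists w w', [/\ D w, D w',
              rational_cone 2 (wsupp w `&` wsupp w')
            & (wsupp w `&` wsupp w') m])].

(* Path-ordered products are defined for smooth immersions [0, 1] -> M_R that   *)
(* avoid the singular locus, have end points off the support and cross walls    *)
(* transversally.  A smooth map on [0, 1] is the restriction of one on R.       *)
Definition admissible D gamma :=
  [/\ forall i t, derivable (derive1n i gamma) t 1,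
      forall t, 0 <= t <= 1 -> derive1 gamma t != 0,
      forall t, 0 <= t <= 1 -> ~ singular_locus D (gamma t),
      ~ support D (gamma 0) /\ ~ support D (gamma 1)
    & forall t w, 0 <= t <= 1 -> D w -> wsupp w (gamma t) ->
        pairing (wdir w) (derive1 gamma t) != 0].

(* n0' is the generator of the monoid R_{>= 0} n0 \cap Ncirc. *)
Definition circ_generator (n0 n0' : 'rV[int]_n) :=
  forall x : 'rV[int]_n,
    (Ncirc Gamma x /\
     exists2 r : R, 0 <= r & map_mx intr x = r *: map_mx intr n0)
    <-> exists j : nat, x = n0' *+ j.

Definition circ_gen (n0 : 'rV[int]_n) := xget 0 (circ_generator n0).

(* z^m |-> z^m f^(eps <n0', m>); the rational number <n0', m> is an integer for *)
(* m in P.                                                                      *)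
Definition wall_crossing gamma t w : phat -> phat :=
  let eps := - sgz (pairing (wdir w) (derive1 gamma t)) in
  hsubst (fun m : P => hmul (zmon k (val m))
    (hexpz (wfun w)
       (eps * Num.floor (pairing (circ_gen (wdir w)) (val m))))).

(* s lists, in order of time, the crossings of gamma with the walls of D that   *)
(* are nontrivial to order l; the automorphisms of simultaneous crossings       *)
(* commute.                                                                     *)
Definition crossing_seq D gamma (l : nat) (s : seq (R * wall)) :=
  [/\ uniq s, sorted (fun u v => u.1 <= v.1) s
    & forall t w, (t, w) \in s <->
        [/\ 0 <= t <= 1, D w, nontrivial_to_order l w & wsupp w (gamma t)]].

Definition path_product_order D gamma (l : nat) : phat -> phat :=
  foldl (fun theta u => wall_crossing gamma u.1 u.2 \o theta) id
    (xget [::] (crossing_seq D gamma l)).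

(* Limit over l, in the adic topology: coefficients are eventually constant. *)
Definition path_product D gamma : phat -> phat := fun h q =>
  xget 0 [set a | \forall l \near \oo, path_product_order D gamma l h q = a].

Definition equivalent D D' := forall gamma,
  admissible D gamma -> admissible D' gamma ->
  path_product D gamma = path_product D' gamma.

Definition consistent D := forall gamma gamma',
  admissible D gamma -> admissible D gamma' ->
  gamma 0 = gamma' 0 -> gamma 1 = gamma' 1 ->
  path_product D gamma = path_product D gamma'.

Definition incoming w := wsupp w (map_mx ratr (pstar (wdir w))).

Definition one_plus_z (m : 'rV[rat]_n) : phat :=
  fun q => zmon k 0 q + zmon k m q.

Definition initial_diagram : set wall :=
  [set w | exists2 i, i \in Iuf Gamma &
     w = Wall (perp (e i)) (e i) (one_plus_z (pstar (e i)))].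

(* The properties characterizing D_s up to equivalence. *)
Definition is_cluster_diagram D :=
  [/\ is_scattering_diagram D, consistent D, initial_diagram `<=` D
    & forall w, D w -> ~ initial_diagram w -> ~ incoming w].

End Scattering.

(* Main.v *)
(* Factor each wall function into powers of 1 + z^(p^*(v)), v in N^+; the product of the walls
   through a general point m of v^perp has an exponent c_v(m) at v, and the exponents determine
   the path-ordered products.  If c_v is known to be a natural number in all degrees below deg v,
   consistency along two arcs which cross the hyperplanes through a point in opposite orders,
   together with the positivity of the rank-two reordering (iterated pentagon identities),
   shows that c_v(y - p) - c_v(y + p) is a natural number for p a positive multiple of p^*(v).
   Moving from infinity in the direction p^*(v), where only incoming, hence initial, walls
   occur, to m, one gets that c_v(m) is a natural number.  The same comparison shows that c_v
   is constant on the finitely many cells of v^perp cut out by the hyperplanes of degree at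
   most deg v, and the cells with (1 + z^(p^*(v)))^(c_v) are the required diagram. *)
Require Import Defs.
From mathcomp Require Import all_boot all_order all_algebra.
From mathcomp Require Import all_classical all_reals all_analysis.
From mathcomp Require Import ring lra zify.
Import Order.TTheory GRing.Theory Num.Theory.
Local Open Scope classical_set_scope.
Local Open Scope ring_scope.

Set Implicit Arguments.
Unset Strict Implicit.
Unset Printing Implicit Defensive.
Import numFieldNormedType.Exports.

(** * Generalized binomial coefficients *)

(** Positivity and integrality have to be obtained separately. Wall functions are arbitrary series
    over [k] and the form is rational, so a letter carries a scalar exponent; the pentagon identity
    is available for letters scaled by -1/{a, b}, and reordering therefore gives exponents in the
    image of the nonnegative rationals. Integrality comes from the operators: integral exponents
    give integral coefficients, from which the factors of an ordered product can be read back. The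
    unit [dl v] makes both together mean a natural number, since [dl v] times v generates [Ncirc] on
    the ray of v. Walls of the given diagram may end anywhere, so no local structure around a
    codimension-two cone is at hand. Consistency is used only for two parabolas with common end
    points, perturbed so as to avoid all rational subspaces of codimension two at once. The slopes
    <x, w> / deg x along a direction w decide in which order hyperplanes are crossed; for w a
    multiple of p^*(v) they are related to the form, which is why exponents are followed in that
    direction. *)

Section GeneralizedBinomials.
Context {k : fieldType} (char0 : [pchar k] =i pred0).
Implicit Types (x y : k) (p q : {poly k}).

Lemma char0_natr_eq0 (n : nat) : (n%:R == 0 :> k) = (n == 0%N).
Proof. by move/pcharf0P: char0. Qed.

Lemma char0_natr_inj : injective (fun n : nat => n%:R : k).
Proof.
have sub (m n : nat) : (m <= n)%N -> m%:R = n%:R :> k -> m = n.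
  move=> le_mn E; apply/eqP; rewrite eqn_leq le_mn -subn_eq0.
  by rewrite -char0_natr_eq0 natrB // E subrr eqxx.
move=> m n E; case: (leqP m n) => [|/ltnW] le; first exact: sub.
by apply/esym/sub.
Qed.

Lemma char0_intr_eq0 (z : int) : (z%:~R == 0 :> k) = (z == 0).
Proof.
by case: z => n; rewrite ?NegzE ?mulrNz ?oppr_eq0 -pmulrn char0_natr_eq0.
Qed.

(** In characteristic 0 the natural numbers are infinitely many points of [k]. The main identities
    for [gbin] are proved at natural arguments and extended to [k] in this way. *)
Lemma poly_eq_on_nat p q : (forall n : nat, p.[n%:R] = q.[n%:R]) -> p = q.
Proof.
move=> E; apply/eqP; rewrite -subr_eq0; apply/negPn/negP => nz.
pose rs : seq k := [seq i%:R | i <- iota 0 (size (p - q))].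
have : (size rs < size (p - q)%R)%N.
  apply: max_poly_roots nz _ _.
    by apply/allP => _ /mapP [i _ ->]; rewrite /root hornerD hornerN E subrr.
  by rewrite map_inj_uniq ?iota_uniq //; exact: char0_natr_inj.
by rewrite size_map size_iota ltnn.
Qed.

(** [ratr] is computed from the reduced fraction, and cross-multiplication compares it with any
    other fraction. All denominators being invertible in [k], it follows that [ratr] is a ring
    morphism into [k]. *)
Lemma ratr_frac (a b : int) : b != 0 ->
  ratr (a%:~R / b%:~R) = a%:~R / b%:~R :> k.
Proof.
move=> b0; set r : rat := _ / _.
have d0 : (denq r)%:~R != 0 :> k by rewrite char0_intr_eq0 denq_neq0.
have bk : b%:~R != 0 :> k by rewrite char0_intr_eq0.
have bq : b%:~R != 0 :> rat by rewrite intr_eq0.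
rewrite /ratr; apply/eqP; rewrite eqr_div // -!intrM; apply/eqP; congr (_%:~R).
have /eqP : (numq r)%:~R / (denq r)%:~R = a%:~R / b%:~R :> rat by rewrite divq_num_den.
rewrite eqr_div ?intr_eq0 ?denq_neq0 // -!intrM eqr_int => /eqP.
by [].
Qed.

Lemma ratrE (r : rat) : ratr r = (numq r)%:~R / (denq r)%:~R :> k.
Proof. by []. Qed.

Lemma char0_ratrD (r s : rat) : ratr (r + s) = ratr r + ratr s :> k.
Proof.
have nz (u : rat) : (denq u)%:~R != 0 :> rat by rewrite intr_eq0 denq_neq0.
have nzk (u : rat) : (denq u)%:~R != 0 :> k by rewrite char0_intr_eq0 denq_neq0.
rewrite -{1}(divq_num_den r) -{1}(divq_num_den s) addf_div //.
rewrite -!intrM -intrD ratr_frac ?mulf_neq0 ?denq_neq0 //.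
by rewrite !ratrE addf_div // intrD !intrM.
Qed.

Lemma char0_ratrM (r s : rat) : ratr (r * s) = ratr r * ratr s :> k.
Proof.
rewrite -{1}(divq_num_den r) -{1}(divq_num_den s) mulf_div.
rewrite -!intrM ratr_frac ?mulf_neq0 ?denq_neq0 //.
by rewrite !ratrE mulf_div !intrM.
Qed.

Lemma char0_ratr_int (z : int) : ratr z%:~R = z%:~R :> k.
Proof. by rewrite ratrE numq_int denq_int divr1. Qed.

Lemma char0_ratrN (r : rat) : ratr (- r) = - ratr r :> k.
Proof. by rewrite -mulN1r char0_ratrM -[-1]/((-1)%:~R) char0_ratr_int mulN1r. Qed.

Lemma char0_ratrB (r s : rat) : ratr (r - s) = ratr r - ratr s :> k.
Proof. by rewrite char0_ratrD char0_ratrN. Qed.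

Lemma char0_ratr_eq0 (r : rat) : (ratr r == 0 :> k) = (r == 0).
Proof.
rewrite ratrE mulf_eq0 invr_eq0 !char0_intr_eq0 (negPf (denq_neq0 _)) orbF.
by rewrite numq_eq0.
Qed.

Lemma char0_ratr_inj : injective (ratr : rat -> k).
Proof.
move=> r s E; apply/eqP; rewrite -subr_eq0 -char0_ratr_eq0 char0_ratrB E.
by rewrite subrr.
Qed.

(** The upper argument is a scalar because the exponents of wall functions lie a priori anywhere in
    [k]. *)
Definition gbin x (j : nat) : k := (\prod_(i < j) (x - i%:R)) / (j`!)%:R.

Lemma gbin0 x : gbin x 0 = 1.
Proof. by rewrite /gbin big_ord0 fact0 divr1. Qed.

Lemma gbin1 x : gbin x 1 = x.
Proof. by rewrite /gbin big_ord1 subr0 divr1. Qed.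

Lemma gbinS x j : j.+1%:R * gbin x j.+1 = gbin x j * (x - j%:R).
Proof.
rewrite /gbin big_ord_recr /= factS natrM invfM.
have nz : j.+1%:R != 0 :> k by rewrite char0_natr_eq0.
by rewrite mulrCA (mulrA j.+1%:R) divff // mul1r mulrAC.
Qed.

Lemma gbin_nat (m j : nat) : gbin m%:R j = 'C(m, j)%:R.
Proof.
elim: j => [|j IH]; first by rewrite gbin0 bin0.
have nz : j.+1%:R != 0 :> k by rewrite char0_natr_eq0.
apply: (mulfI nz); rewrite gbinS IH -natrM mul_bin_left natrM mulrC.
case: (leqP j m) => [h|h]; first by rewrite natrB.
by rewrite bin_small // !mulr0.
Qed.

Lemma gbin_0 j : gbin 0 j = (j == 0%N)%:R.
Proof. by rewrite -[0 in LHS]/(0%:R) gbin_nat bin0n; case: j. Qed.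

Fact gbin_poly_exists :
  {f : nat -> {poly k} | forall j x, (f j).[x] = gbin x j}.
Proof.
exists (fun j => (\prod_(i < j) ('X - i%:R%:P)) * ((j`!)%:R^-1)%:P) => j x.
rewrite hornerM hornerC horner_prod; congr (_ * _).
by apply: eq_bigr => i _; rewrite hornerXsubC.
Qed.

Definition gbinp (j : nat) : {poly k} := sval gbin_poly_exists j.

Lemma gbinpE x j : (gbinp j).[x] = gbin x j.
Proof. exact: (svalP gbin_poly_exists). Qed.

Lemma gbinp_shift c x j : (gbinp j \Po ('X + c%:P)).[x] = gbin (x + c) j.
Proof. by rewrite horner_comp hornerD hornerX hornerC gbinpE. Qed.

Lemma gbin_pascal x j : gbin (x + 1) j.+1 = gbin x j.+1 + gbin x j.
Proof.
have : gbinp j.+1 \Po ('X + 1%:P) = gbinp j.+1 + gbinp j.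
  apply: poly_eq_on_nat => n; rewrite gbinp_shift hornerD !gbinpE.
  by rewrite natr1 !gbin_nat binS natrD.
by move/(congr1 (horner^~ x)); rewrite gbinp_shift hornerD !gbinpE.
Qed.

Lemma gbin_vandermonde x y m :
  gbin (x + y) m = \sum_(i < m.+1) gbin x i * gbin y (m - i).
Proof.
have nat_case (n : nat) z l :
    gbin (n%:R + z) l = \sum_(i < l.+1) gbin n%:R i * gbin z (l - i).
  elim: n z l => [|n IH] z l.
    rewrite add0r big_ord_recl gbin_0 mul1r subn0 big1 ?addr0 // => i _.
    by rewrite gbin_0 mul0r.
  rewrite -natr1 -addrA [1 + z]addrC addrA.
  case: l => [|l]; first by rewrite big_ord1 !gbin0 mul1r.
  rewrite gbin_pascal !IH [RHS]big_ord_recl /= gbin0 mul1r subn0.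
  rewrite [in RHS](eq_bigr (fun i : 'I_l.+1 => gbin n%:R i.+1 * gbin z (l.+1 - i.+1)
     + gbin n%:R i * gbin z (l - i))); last first.
    by move=> i _; rewrite /bump /= natr1 -natr1 gbin_pascal mulrDl subSS.
  rewrite big_split /= addrA; congr (_ + _).
  by rewrite big_ord_recl /= gbin0 mul1r subn0.
(* Pascal's rule has settled natural x; for fixed y both sides are polynomials in x. *)
have : gbinp m \Po ('X + y%:P) = \sum_(i < m.+1) gbinp i * (gbin y (m - i))%:P.
  apply: poly_eq_on_nat => n; rewrite gbinp_shift nat_case horner_sum.
  by apply: eq_bigr => i _; rewrite hornerM hornerC gbinpE.
move/(congr1 (horner^~ x)); rewrite gbinp_shift => ->; rewrite horner_sum.
by apply: eq_bigr => i _; rewrite hornerM hornerC gbinpE.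
Qed.

(* The coefficient of [x^i y^j] in the two sides of
   [(1+y)^b (1+x+xy)^a = (1+x)^a sum_m C(b,m) (y/(1+x))^m (1+xy/(1+x))^(a+b-m)]. *)
Lemma gbin_pentagon x y i j :
  gbin x i * gbin (y + i%:R) j =
  \sum_(l < j.+1) if (l <= i)%N then
    gbin y (j - l) * gbin (x + y - (j - l)%:R) l * gbin (x - j%:R) (i - l)
  else 0.
Proof.
(* Trinomial revision C(x, a) C(a, b) = C(x, b) C(x - b, a - b). It is the case y = 0 of the claim,
   where only the summand l = j survives. *)
have rev a b : (b <= a)%N ->
    gbin x a * gbin a%:R b = gbin x b * gbin (x - b%:R) (a - b).
  move=> ba; have : gbinp a * (gbin a%:R b)%:P =
      gbinp b * (gbinp (a - b) \Po ('X + (- b%:R)%:P)).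
    apply: poly_eq_on_nat => n; rewrite !hornerM gbinp_shift hornerC !gbinpE.
    case: (leqP b n) => [bn|nb].
      rewrite -natrB // !gbin_nat -!natrM; congr (_%:R).
      rewrite mulnC; have [an|na] := leqP a n; last first.
        by rewrite (bin_small na) muln0 (@bin_small (n - b)) ?muln0 //; lia.
      apply/eqP; rewrite -(eqn_pmul2r (m := (n - a)`!)) ?fact_gt0 //.
      rewrite -(eqn_pmul2r (m := b`! * (a - b)`!)) ?muln_gt0 ?fact_gt0 //.
      have e1 := bin_fact an; have e2 := bin_fact ba; have e3 := bin_fact bn.
      have e4 : 'C(n - b, a - b) * ((a - b)`! * (n - a)`!) = (n - b)`!.
        by rewrite -(@bin_fact (n - b) (a - b)) ?leq_sub2r //; congr (_ * (_ * _`!)); lia.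
      apply/eqP; transitivity (n`!).
        by rewrite -e1 -e2; ring.
      by rewrite -e3 -e4; ring.
    by rewrite !gbin_nat (bin_small nb) (bin_small (leq_trans nb ba)) !mul0r.
  by move/(congr1 (horner^~ x)); rewrite !hornerM gbinp_shift hornerC !gbinpE.
pose R y i j := \sum_(l < j.+1) if (l <= i)%N then
    gbin y (j - l) * gbin (x + y - (j - l)%:R) l * gbin (x - j%:R) (i - l)
  else 0.
(* The right side obeys Pascal's rule in y: [F] and [G] come from Pascal's rule for its last
   binomial, and [T] is its summand with j raised by one. *)
have rec (z : k) a b : R (z + 1) a b.+1 = R z a b.+1 + R z a b.
  pose F l := if (l <= a)%N then
    gbin z (b - l) * gbin (x + z - (b - l)%:R) l * gbin (x - b.+1%:R) (a - l) else 0.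
  pose G l := if (l < a)%N then
    gbin z (b - l) * gbin (x + z - (b - l)%:R) l * gbin (x - b.+1%:R) (a - l.+1) else 0.
  pose T w l := if (l <= a)%N then gbin w (b.+1 - l) *
    gbin (x + w - (b.+1 - l)%:R) l * gbin (x - b.+1%:R) (a - l) else 0.
  have RE : R z a b = \sum_(l < b.+1) F l + \sum_(l < b.+1) G l.
    rewrite -big_split; apply: eq_bigr => l _; rewrite /F /G /=.
    case: (ltngtP l a) => [la|_|->]; last 2 first.
    - by rewrite addr0.
    - by rewrite subnn !gbin0 addr0.
    rewrite -mulrDr; congr (_ * _).
    have -> : x - b%:R = x - b.+1%:R + 1 by rewrite -natr1; ring.
    by rewrite -[(a - l)%N]prednK ?subn_gt0 // gbin_pascal -subnS.
  have TE (l : nat) : (l <= b.+1)%N -> T (z + 1) l =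
      T z l + ((if (l <= b)%N then F l else 0) + (if l is l'.+1 then G l' else 0)).
    move=> lb1; rewrite /T /F /G.
    have sh (m : nat) : x + (z + 1) - m.+1%:R = x + z - m%:R.
      by rewrite -natr1; ring.
    have sh1 (m : nat) : x + z - m%:R = x + z - m.+1%:R + 1.
      by rewrite -natr1; ring.
    case: (leqP l b) => lb.
      rewrite subSn // gbin_pascal sh.
      case: l lb {lb1} => [|l] lb.
        by rewrite leq0n !gbin0 !subn0; ring.
      case: (ltnP l a) => la; last by rewrite !addr0.
      have -> : (b - l)%N = (b - l.+1).+1 by lia.
      by rewrite (sh1 (b - l.+1)%N) [gbin (_ + 1) _]gbin_pascal; ring.
    have -> : l = b.+1 by apply/eqP; rewrite eqn_leq lb1.
    rewrite subnn !gbin0 !mul1r !subr0 add0r subnn gbin0 mul1r subr0.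
    case: (ltnP b a) => ba; last by rewrite addr0.
    by rewrite addrA gbin_pascal mulrDl.
  rewrite RE /R -/(T (z + 1)) (eq_bigr (fun l : 'I_b.+2 => T z l +
    ((if (l <= b)%N then F l else 0) + (if l : nat is l'.+1 then G l' else 0)))); last first.
    by move=> l _; rewrite -TE // -ltnS.
  rewrite big_split /= big_split /=; congr (_ + (_ + _)).
    rewrite big_ord_recr /= ltnn addr0; apply: eq_bigr => l _.
    by rewrite -ltnS ltn_ord.
  by rewrite big_ord_recl /= add0r; apply: eq_bigr.
have natc (m : nat) a b : gbin x a * gbin (m%:R + a%:R) b = R m%:R a b.
  elim: m b => [|m IH] b.
    rewrite add0r /R; case: (leqP b a) => ba.
      rewrite rev // big_ord_recr /= ba subnn gbin0 mul1r addr0 subr0 big1 ?add0r // => l _.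
      by case: ifP => // _; rewrite gbin_0 subn_eq0 leqNgt ltn_ord !mul0r.
    rewrite gbin_nat bin_small // mulr0 big1 // => l _; case: ifP => // la.
    by rewrite gbin_0 subn_eq0 leqNgt (leq_ltn_trans la ba) !mul0r.
  case: b => [|b].
    rewrite gbin0 mulr1 /R big_ord1 leq0n !subn0 !gbin0 !mul1r.
    by rewrite subr0.
  by rewrite -natr1 rec -!IH -mulrDr addrAC gbin_pascal.
(* Natural y is done; with x fixed, both sides are polynomials in y. *)
have : (gbin x i)%:P * (gbinp j \Po ('X + i%:R%:P)) = \sum_(l < j.+1)
    if (l <= i)%N then gbinp (j - l) * (gbinp l \Po ('X + (x - (j - l)%:R)%:P)) *
      (gbin (x - j%:R) (i - l))%:P else 0.
  apply: poly_eq_on_nat => m; rewrite hornerM hornerC gbinp_shift natc horner_sum.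
  apply: eq_bigr => l _; case: ifP => _; last by rewrite horner0.
  by rewrite !hornerM hornerC gbinp_shift gbinpE -addrA [_ + (x - _)]addrCA !addrA.
move/(congr1 (horner^~ y)); rewrite hornerM hornerC gbinp_shift => ->.
rewrite horner_sum; apply: eq_bigr => l _; case: ifP => _; last by rewrite horner0.
by rewrite !hornerM hornerC gbinp_shift gbinpE -addrA [_ + (x - _)]addrCA !addrA.
Qed.

Definition intk x := exists z : int, x = z%:~R.

Lemma intk_nat (m : nat) : intk m%:R. Proof. by exists m%:Z; rewrite -pmulrn. Qed.

Lemma intk0 : intk 0. Proof. exact: (intk_nat 0). Qed.

Lemma intkD x y : intk x -> intk y -> intk (x + y).
Proof. by case=> a -> [b ->]; exists (a + b); rewrite intrD. Qed.

Lemma intkN x : intk x -> intk (- x).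
Proof. by case=> a ->; exists (- a); rewrite intrN. Qed.

Lemma intkB x y : intk x -> intk y -> intk (x - y).
Proof. by move=> ix iy; apply: intkD => //; apply: intkN. Qed.

Lemma intkM x y : intk x -> intk y -> intk (x * y).
Proof. by case=> a -> [b ->]; exists (a * b); rewrite intrM. Qed.

Lemma intk_sum (I : Type) (r : seq I) (P : pred I) (F : I -> k) :
  (forall i, P i -> intk (F i)) -> intk (\sum_(i <- r | P i) F i).
Proof. by move=> H; elim/big_rec: _ => [|i z Pi iz]; [exact: intk0|apply: intkD; auto]. Qed.

(** For negative integers Pascal's rule is run backwards. *)
Lemma intk_gbin x j : intk x -> intk (gbin x j).
Proof.
case=> -[m|m] ->; first by rewrite -pmulrn gbin_nat; exact: intk_nat.
rewrite NegzE mulrNz -pmulrn; elim: {m}m.+1 j => [|m IH] j.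
  by rewrite oppr0 gbin_0; exact: intk_nat.
elim: j => [|j IHj]; first by rewrite gbin0; exact: (intk_nat 1).
have := gbin_pascal (- m.+1%:R) j; rewrite -{1}natr1 opprD subrK => E.
rewrite (_ : gbin _ _ = gbin (- m%:R) j.+1 - gbin (- m.+1%:R) j); last first.
  by rewrite E addrK.
exact: intkB.
Qed.

End GeneralizedBinomials.

Lemma big_triangle (V : nmodType) (N : nat) (F : nat -> nat -> V) :
  (forall i j, (N <= i + j)%N -> F i j = 0) ->
  \sum_(i < N) \sum_(j < N) F i j = \sum_(m < N) \sum_(i < m.+1) F i (m - i)%N.
Proof.
move=> F0.
transitivity (\sum_(i < N) \sum_(m < N | (i <= m)%N) F i (m - i)%N).
  apply: eq_bigr => i _.
  rewrite -(big_mkord xpredT (F i)) (big_cat_nat (n := (N - i)%N)) //= ?leq_subr //.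
  rewrite [X in _ + X]big1_seq ?addr0; last first.
    by move=> j /andP [_]; rewrite mem_index_iota leq_subLR => /andP [/F0].
  rewrite -(big_mkord (fun m => (i <= m)%N) (fun m => F i (m - i)%N)).
  rewrite [RHS](big_cat_nat (n := i)) //= ?(ltnW (ltn_ord i)) //.
  rewrite [X in _ = X + _]big_nat_cond [X in _ = X + _]big_pred0 ?add0r; last first.
    by move=> m; case: (ltnP m i) => h; rewrite ?andbF //; apply/negbTE; lia.
  rewrite -[X in index_iota X N]add0n big_addn.
  rewrite big_nat_cond [RHS]big_nat_cond; apply: eq_big => j.
    by rewrite leq_addl andbT.
  by rewrite addnK.
rewrite (exchange_big_dep xpredT) //=; apply: eq_bigr => m _.
by rewrite (big_ord_widen N (fun i => F i (m - i)%N)).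
Qed.

(** * Words of wall-crossing operators *)

Section WallOperators.
Context {k : fieldType} (char0 : [pchar k] =i pred0).
Context {X : zmodType} (deg : X -> int) (B : X -> X -> rat) (K : nat).
Hypothesis degD : {morph deg : x y / x + y}.
Hypothesis BDl : forall z, {morph B^~ z : x y / x + y}.
Hypothesis B_skew : forall x y, B x y = - B y x.
Implicit Types (x y z n m a b : X) (l mu : k) (ell h : X -> k) (w : seq (X * k)).

Definition lin ell := {morph ell : x y / x + y}.

Lemma lin0 (V : zmodType) (f : X -> V) : {morph f : x y / x + y} -> f 0 = 0.
Proof. by move=> fD; apply: (addIr (f 0)); rewrite -fD !add0r. Qed.

Lemma linN (V : zmodType) (f : X -> V) : {morph f : x y / x + y} ->
  {morph f : x / - x}.
Proof. by move=> fD x; apply: (addIr (f x)); rewrite -fD !addNr lin0. Qed.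

Lemma linB (V : zmodType) (f : X -> V) : {morph f : x y / x + y} ->
  {morph f : x y / x - y}.
Proof. by move=> fD x y; rewrite fD linN. Qed.

Lemma linMn (V : zmodType) (f : X -> V) : {morph f : x y / x + y} ->
  forall j, {morph f : x / x *+ j}.
Proof.
by move=> fD j x; elim: j => [|j IH]; rewrite ?mulr0n ?lin0 // !mulrSr fD IH.
Qed.

Lemma BDr z : {morph B z : x y / x + y}.
Proof. by move=> x y; rewrite B_skew BDl opprD -!B_skew. Qed.

Lemma B_alt x : B x x = 0.
Proof. by have := B_skew x x; lra. Qed.

Definition bk x y : k := ratr (B x y).

Lemma bkDl z : {morph bk^~ z : x y / x + y}.
Proof. by move=> x y; rewrite /bk BDl char0_ratrD. Qed.

Lemma bkDr z : {morph bk z : x y / x + y}.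
Proof. by move=> x y; rewrite /bk BDr char0_ratrD. Qed.

Lemma bk_skew x y : bk x y = - bk y x.
Proof. by rewrite /bk B_skew char0_ratrN. Qed.

Lemma bk_alt x : bk x x = 0.
Proof. by rewrite /bk B_alt -[0]/(0%:~R) char0_ratr_int. Qed.

(* Crossing a wall with function (1 + z^n)^l, on coefficient functions along q + p^*(X):
   the exponent at z^(q + p^*(x)) is l times ell n + B x n = <n, q + p^*(x)>. *)
Definition wop ell n l h x : k :=
  \sum_(j < K.+1) gbin (l * (ell n + bk x n)) j * h (x - n *+ j).

(** With support in degrees >= 0 and comparison only up to degree K, the terms j > K of (1 + z^n)^l
    drop out when deg n > 0. The cut-off in [wop] relies on this. *)
Definition supp h := forall x, deg x < 0 -> h x = 0.
Definition agree h h' := forall x, deg x <= K%:Z -> h x = h' x.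

Lemma deg_subMn x n j : deg (x - n *+ j) = deg x - deg n *+ j.
Proof. by rewrite linB // linMn. Qed.

Lemma wop_supp ell n l h : 0 <= deg n -> supp h -> supp (wop ell n l h).
Proof.
move=> n0 sh x x0; rewrite /wop big1 // => j _; rewrite sh ?mulr0 //.
rewrite deg_subMn; have : 0 <= deg n *+ j by rewrite mulrn_wge0.
lia.
Qed.

Lemma wop_agree ell n l h h' : 0 <= deg n -> agree h h' ->
  agree (wop ell n l h) (wop ell n l h').
Proof.
move=> n0 hh x xK; apply: eq_bigr => j _; congr (_ * _); apply: hh.
rewrite deg_subMn; have : 0 <= deg n *+ j by rewrite mulrn_wge0.
lia.
Qed.

(** The last letter acts first, so the word of a path lists its crossings by decreasing time. *)
Definition run ell w h := foldr (fun f h => wop ell f.1 f.2 h) h w.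
Definition wf w := all (fun f => 0 < deg f.1) w.

Lemma run_cat ell w w' h : run ell (w ++ w') h = run ell w (run ell w' h).
Proof. by rewrite /run foldr_cat. Qed.

Lemma wf_cat w w' : wf (w ++ w') = wf w && wf w'.
Proof. exact: all_cat. Qed.

Lemma run_supp ell w h : wf w -> supp h -> supp (run ell w h).
Proof.
elim: w => //= f w IH /andP [f0 ww] sh.
by apply: wop_supp; [exact: ltW|exact: IH].
Qed.

Lemma run_agree ell w h h' : wf w -> agree h h' ->
  agree (run ell w h) (run ell w h').
Proof.
elim: w => //= f w IH /andP [f0 ww] hh.
by apply: wop_agree; [exact: ltW|exact: IH].
Qed.

(** Quantifying over all linear [ell] makes the identity hold at every base point at once; the
    integrality arguments then evaluate it at functionals of their own choice. *)
Definition eqv w w' := forall ell, lin ell -> forall h, supp h ->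
  agree (run ell w h) (run ell w' h).

Lemma eqv_refl w : eqv w w. Proof. by []. Qed.

Lemma eqv_sym w w' : eqv w w' -> eqv w' w.
Proof. by move=> e ell le h sh x xK; rewrite e. Qed.

Lemma eqv_trans w w' w'' : eqv w w' -> eqv w' w'' -> eqv w w''.
Proof. by move=> e e' ell le h sh x xK; rewrite e // e'. Qed.

Lemma eqv_ctx u v w w' : wf u -> wf v -> eqv w w' ->
  eqv (u ++ w ++ v) (u ++ w' ++ v).
Proof.
move=> wu wv e ell le h sh; rewrite !run_cat; apply: run_agree => //.
by apply: e => //; apply: run_supp.
Qed.

Lemma eqv_cat w1 w1' w2 w2' : wf w1' -> wf w2 -> eqv w1 w1' -> eqv w2 w2' ->
  eqv (w1 ++ w2) (w1' ++ w2').
Proof.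
move=> wu wv e1 e2; apply: (@eqv_trans _ (w1' ++ w2)).
  exact: (@eqv_ctx [::] w2).
by have := @eqv_ctx w1' [::] w2 w2' wu isT e2; rewrite !cats0.
Qed.

Lemma supp_far h x n j : supp h -> 0 < deg n -> deg x <= K%:Z -> (K < j)%N ->
  h (x - n *+ j) = 0.
Proof.
move=> sh n0 xK Kj; apply: sh; rewrite deg_subMn.
have : (j%:Z <= deg n *+ j) by rewrite -[j%:Z]natz ler_wMn2r //; lia.
lia.
Qed.

Lemma wop_id ell n h x : wop ell n 0 h x = h x.
Proof.
rewrite /wop big_ord_recl gbin0 mul1r mulr0n subr0 big1 ?addr0 // => j _.
by rewrite mul0r gbin_0 // mul0r.
Qed.

Lemma eqv_0 n : eqv [:: (n, 0)] [::].
Proof. by move=> ell le h sh x xK /=; rewrite wop_id. Qed.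

Lemma wop_head ell n l h x : wop ell n l h x = h x +
  \sum_(j < K) gbin (l * (ell n + bk x n)) j.+1 * h (x - n *+ j.+1).
Proof. by rewrite /wop big_ord_recl gbin0 mul1r mulr0n subr0. Qed.

Lemma eqv_big n l : K%:Z < deg n -> eqv [:: (n, l)] [::].
Proof.
move=> nK ell le h sh x xK /=; rewrite wop_head big1 ?addr0 // => j _.
rewrite sh ?mulr0 // deg_subMn mulrSr.
have : 0 <= deg n *+ j by rewrite mulrn_wge0 //; lia.
lia.
Qed.

Lemma bk_subMn x n m j : bk (x - n *+ j) m = bk x m - bk n m *+ j.
Proof. by rewrite (linB (bkDl m)) (linMn (bkDl m)). Qed.

Lemma bk_subMn_self x n j : bk (x - n *+ j) n = bk x n.
Proof. by rewrite bk_subMn bk_alt mul0rn subr0. Qed.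

(** As [bk n n = 0], shifting by multiples of n does not change the exponent of the other letter,
    and Vandermonde's identity applies. *)
Lemma eqv_add n l mu : 0 < deg n ->
  eqv [:: (n, l); (n, mu)] [:: (n, l + mu)].
Proof.
move=> n0 ell le h sh x xK /=; rewrite {1}/wop.
pose c := ell n + bk x n.
pose F i j := gbin (l * c) i * (gbin (mu * c) j * h (x - n *+ (i + j))).
transitivity (\sum_(i < K.+1) \sum_(j < K.+1) F i j).
  apply: eq_bigr => i _; rewrite /wop bk_subMn_self -/c mulr_sumr.
  by apply: eq_bigr => j _; rewrite -addrA -opprD -mulrnDr.
rewrite big_triangle; last first.
  by move=> i j ij; rewrite /F supp_far // !mulr0.
rewrite /wop -/c; apply: eq_bigr => m _; rewrite mulrDl gbin_vandermonde // mulr_suml.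
by apply: eq_bigr => i _; rewrite /F (subnKC (ltnSE (ltn_ord i))) mulrA.
Qed.

Lemma eqv_comm n m l mu : B n m = 0 -> eqv [:: (n, l); (m, mu)] [:: (m, mu); (n, l)].
Proof.
move=> nm ell le h sh x xK /=; rewrite /wop.
have nmk : bk n m = 0 by rewrite /bk nm -[0]/(0%:~R) char0_ratr_int.
have mnk : bk m n = 0 by rewrite bk_skew nmk oppr0.
under eq_bigr do rewrite bk_subMn nmk mul0rn subr0 mulr_sumr.
under [RHS]eq_bigr do rewrite bk_subMn mnk mul0rn subr0 mulr_sumr.
rewrite exchange_big; apply: eq_bigr => j _; apply: eq_bigr => i _ /=.
by rewrite mulrCA -!addrA [- (m *+ j) + _]addrC.
Qed.

(** Both orders give [h] plus the two increments taken separately, since a term using both letters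
    descends by more than K. *)
Lemma eqv_comm_deg n m l mu : 0 < deg n -> 0 < deg m -> K%:Z < deg n + deg m ->
  eqv [:: (n, l); (m, mu)] [:: (m, mu); (n, l)].
Proof.
have H a b la lb ell h x : 0 < deg a -> 0 < deg b -> K%:Z < deg a + deg b ->
    supp h -> deg x <= K%:Z ->
    wop ell a la (wop ell b lb h) x = h x
      + \sum_(j < K) gbin (lb * (ell b + bk x b)) j.+1 * h (x - b *+ j.+1)
      + \sum_(j < K) gbin (la * (ell a + bk x a)) j.+1 * h (x - a *+ j.+1).
  move=> a0 b0 ab sh xK; rewrite wop_head wop_head; congr (_ + _).
  apply: eq_bigr => j _; congr (_ * _); rewrite wop_head big1 ?addr0 // => i _.
  rewrite sh ?mulr0 // -addrA -opprD linB // degD !linMn // !mulrSr.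
  have : 0 <= deg a *+ j by rewrite mulrn_wge0 //; lia.
  have : 0 <= deg b *+ i by rewrite mulrn_wge0 //; lia.
  lia.
move=> n0 m0 nm ell le h sh x xK; rewrite /= !H //; last by rewrite addrC.
by rewrite -!addrA [X in _ + X]addrC.
Qed.

(** By the normalization of [l], each step along a raises the exponent of 1 + z^b by one. The
    coefficients of h (x - i a - j b) on the two sides are then those of [gbin_pentagon], with s and
    t for its arguments. *)
Lemma eqv_pentagon a b l : 0 < deg a -> 0 < deg b -> l * bk a b = -1 ->
  eqv [:: (a, l); (b, l)] [:: (b, l); (a + b, l); (a, l)].
Proof.
move=> a0 b0 lab ell le h sh x xK /=.
pose s := l * (ell a + bk x a); pose t := l * (ell b + bk x b).
have far i j : ~~ ((i <= K)%N && (j <= K)%N) -> h (x - a *+ i - b *+ j) = 0.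
  rewrite negb_and -!ltnNge => ij; apply: sh; rewrite !deg_subMn.
  have i0 : (i%:Z <= deg a *+ i) by rewrite -[i%:Z]natz ler_wMn2r //; lia.
  have j0 : (j%:Z <= deg b *+ j) by rewrite -[j%:Z]natz ler_wMn2r //; lia.
  by case/orP: ij; lia.
transitivity (\sum_(j < K.+1) \sum_(i < K.+1)
    gbin s i * gbin (t + i%:R) j * h (x - a *+ i - b *+ j)).
  rewrite exchange_big; apply: eq_bigr => i _; rewrite mulr_sumr.
  apply: eq_bigr => j _; rewrite mulrA bk_subMn; congr (_ * gbin _ _ * _).
  by rewrite addrA mulrDr -/t mulrN mulrnAr lab mulNrn opprK.
(* On the right, j1, p1 and i2 count the steps along b, a + b and a. The sum is regrouped by the
   totals i = i2 + p1 along a and j = j1 + p1 along b. *)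
pose G j1 p1 i2 := gbin t j1 * (gbin (s + t - j1%:R) p1 *
    (gbin (s - (j1 + p1)%:R) i2 * h (x - a *+ (i2 + p1) - b *+ (j1 + p1)))).
transitivity (\sum_(j1 < K.+1) \sum_(p1 < K.+1) \sum_(i2 < K.+1) G j1 p1 i2); last first.
  rewrite /wop; apply: eq_bigr => j1 _; rewrite mulr_sumr.
  have lba : l * bk b a = 1 by rewrite bk_skew mulrN lab opprK.
  have lD : l * (ell (a + b) + bk x (a + b)) = s + t.
    by rewrite le bkDr /s /t; ring.
  apply: eq_bigr => p1 _; rewrite !mulr_sumr; apply: eq_bigr => i2 _.
  rewrite /G bk_subMn; congr (gbin _ _ * _).
  have -> : gbin (l * (ell (a + b) + (bk x (a + b) - bk b (a + b) *+ j1))) p1 =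
      gbin (s + t - j1%:R) p1.
    by rewrite addrA mulrBr lD bkDr bk_alt addr0 mulrnAr lba.
  have -> : x - b *+ j1 - (a + b) *+ p1 - a *+ i2 = x - a *+ (i2 + p1) - b *+ (j1 + p1).
    rewrite mulrnDl !mulrnDr !opprD !addrA; rewrite -!addrA; congr (_ + _).
    rewrite !addrA [LHS]addrC !addrA; congr (_ + _).
    by rewrite addrAC [- (a *+ i2) + _]addrC -!addrA; congr (_ + _); rewrite addrC.
  congr (_ * (gbin _ _ * _)).
  rewrite !bk_subMn bkDl bk_alt add0r natrD addrA mulrBr addrA mulrBr -/s.
  by rewrite !mulrnAr lba opprD addrA.
pose F j1 p1 := \sum_(i < K.+1) if (p1 <= i)%N then
   gbin t j1 * (gbin (s + t - j1%:R) p1 * (gbin (s - (j1 + p1)%:R) (i - p1) *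
     h (x - a *+ i - b *+ (j1 + p1)))) else 0.
transitivity (\sum_(j1 < K.+1) \sum_(p1 < K.+1) F j1 p1); last first.
  apply: eq_bigr => j1 _; apply: eq_bigr => p1 _; rewrite /F -big_mkcond /=.
  rewrite -(big_mkord (fun i => (p1 <= i)%N) (fun i => gbin t j1 * (gbin (s + t - j1%:R) p1 *
    (gbin (s - (j1 + p1)%:R) (i - p1) * h (x - a *+ i - b *+ (j1 + p1)))))).
  rewrite (big_cat_nat (n := p1)) //= ?(ltnW (ltn_ord p1)) //.
  rewrite [X in X + _]big_nat_cond [X in X + _]big_pred0 ?add0r; last first.
    by move=> m; case: (ltnP m p1) => hm; rewrite ?andbF //; apply/negbTE; lia.
  rewrite -[X in index_iota X K.+1]add0n big_addn.
  rewrite -(big_mkord xpredT (G j1 p1)).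
  rewrite [RHS](big_cat_nat (n := (K.+1 - p1)%N)) //= ?leq_subr //.
  rewrite [X in _ = _ + X]big1_seq ?addr0; last first.
    move=> i /andP [_]; rewrite mem_index_iota leq_subLR => /andP [hi _].
    rewrite /G far ?mulr0 //; lia.
  rewrite big_nat_cond [RHS]big_nat_cond; apply: eq_big => i.
    by rewrite leq_addl andbT.
  by rewrite addnK.
rewrite big_triangle; last first.
  move=> j1 p1 hh; rewrite /F big1 // => i _; case: ifP => // _.
  rewrite far ?mulr0 //; lia.
apply: eq_bigr => j _; rewrite /F exchange_big /=; apply: eq_bigr => i _.
rewrite gbin_pentagon // mulr_suml.
rewrite [LHS](reindex_inj rev_ord_inj); apply: eq_bigr => p1 _ /=.
rewrite subSS (subKn (ltnSE (ltn_ord p1))).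
case: ifP => _; last by rewrite mul0r.
by rewrite (subnKC (ltnSE (ltn_ord p1))) -!mulrA.
Qed.

Lemma run_low ell w h z : wf w -> supp h -> deg z <= 0 -> run ell w h z = h z.
Proof.
move=> ww sh z0; elim: w ww => //= f w IH /andP [f0 ww].
rewrite wop_head big1 ?addr0; first exact: IH.
move=> j _; rewrite (run_supp _ ww sh) ?mulr0 // deg_subMn mulrSr.
have : 0 <= deg f.1 *+ j by rewrite mulrn_wge0 //; lia.
lia.
Qed.

(** The coefficient function of the monomial at the base point; exponents are read off from words
    applied to it. *)
Definition delta0 x : k := (x == 0)%:R.

Lemma supp_delta0 : supp delta0.
Proof.
move=> x; rewrite /delta0; case: eqP => // ->.
by rewrite (lin0 degD) ltxx.
Qed.

(* Modulo degree > g, the letters of degree g are central and act linearly. *)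
Lemma run_top ell w (g : int) y : lin ell -> wf w -> 0 < g -> g <= K%:Z ->
  deg y <= g ->
  run ell w delta0 y = run ell [seq f <- w | deg f.1 < g] delta0 y +
    (deg y == g)%:R * \sum_(f <- w | f.1 == y) f.2 * ell y.
Proof.
move=> le + g0 gK; elim: w y => [|[n l] w IH] y ww yg.
  by rewrite /= big_nil mulr0 addr0.
case/andP: (ww) => /= n0 ww'.
have wff : wf [seq f <- w | deg f.1 < g].
  by apply/allP => f; rewrite mem_filter => /andP [_]; exact: (allP ww').
have far j : deg (y - n *+ j.+1) <= deg y - deg n.
  rewrite deg_subMn mulrSr.
  have : 0 <= deg n *+ j by rewrite mulrn_wge0 //; lia.
  lia.
rewrite wop_head IH // big_cons /=.
case: (ltP (deg n) g) => ng /=.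
  rewrite wop_head [in RHS]addrAC -!addrA; congr (_ + _).
  have E : \sum_(j < K) gbin (l * (ell n + bk y n)) j.+1 * run ell w delta0 (y - n *+ j.+1)
     = \sum_(j < K) gbin (l * (ell n + bk y n)) j.+1 *
          run ell [seq f <- w | deg f.1 < g] delta0 (y - n *+ j.+1).
    apply: eq_bigr => j _; rewrite IH //; last by have := far j; lia.
    by have := far j; case: eqP => [|_]; rewrite ?mul0r ?addr0 //; lia.
  rewrite E; congr (_ + _).
  case: eqP => yg'; last by rewrite !mul0r.
  case: eqP => // ny.
  by move: ng; rewrite ny yg' ltxx.
rewrite -addrA; congr (_ + _).
(* A letter of degree at least [g] contributes its linear term only: with two or more steps one
   lands in negative degree. *)
have K0 : (0 < K)%N by lia.
rewrite (bigD1 (Ordinal K0)) //= [X in _ + (_ + X)]big1 ?addr0; last first.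
  move=> j j0; rewrite (run_supp _ ww' supp_delta0) ?mulr0 //.
  have {}j0 : (0 < j)%N by rewrite lt0n.
  rewrite deg_subMn; have : deg n *+ 2 <= deg n *+ j.+1 by apply: ler_wpMn2l; lia.
  rewrite mulr2n; lia.
rewrite gbin1 run_low ?mulr1n //; last first.
- by rewrite linB //; lia.
- exact: supp_delta0.
rewrite /delta0 subr_eq0 [y == n]eq_sym.
case: (n =P y) => [E|_]; last by rewrite mulr0 addr0.
have -> : deg y = g by apply/eqP; rewrite eq_le yg -E.
by rewrite eqxx !mul1r -E bk_alt addr0 mulr1 addrC.
Qed.

(** Binomials of integers are integers. The exponent of a letter at x is known to be integral only
    at points x reachable by letters, so the set [S] of these points is carried along with the
    support. *)
Lemma run_int (S : X -> Prop) ell w :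
  S 0 -> (forall x f, S x -> f \in w -> S (x + f.1)) ->
  (forall f, f \in w -> intk (f.2 * ell f.1)) ->
  (forall x f, S x -> f \in w -> intk (f.2 * bk x f.1)) ->
  forall x, intk (run ell w delta0 x) /\ (run ell w delta0 x != 0 -> S x).
Proof.
move=> S0; elim: w => [|[n l] w IH] SD il ib x.
  rewrite /= /delta0; split; first exact: intk_nat.
  by case: (x =P 0) => [->//|_]; rewrite eqxx.
have sw f : f \in w -> f \in (n, l) :: w by move=> fw; rewrite in_cons fw orbT.
have {}IH y := IH (fun x f Sx fw => SD x f Sx (sw f fw))
  (fun f fw => il f (sw f fw)) (fun x f Sx fw => ib x f Sx (sw f fw)) y.
have SDn y j : S y -> S (y + n *+ j).
  move=> Sy; elim: j => [|j IHj]; first by rewrite mulr0n addr0.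
  by rewrite mulrSr addrA; apply: (SD _ (n, l)); rewrite ?mem_head.
rewrite /=; split.
  apply: intk_sum => j _; case: (IH (x - n *+ j)) => i1.
  case: eqP => [->|_ /(_ isT) Sx]; first by rewrite mulr0 => _; exact: intk0.
  apply: intkM => //; apply: intk_gbin => //; rewrite -(bk_subMn_self x n j) mulrDr.
  apply: intkD; first exact: (il (n, l) (mem_head _ _)).
  exact: (ib _ (n, l) Sx (mem_head _ _)).
rewrite /wop; case: (pselect (exists j : 'I_K.+1, run ell w delta0 (x - n *+ j) != 0)).
  by case=> j /(IH _).2 Sx _; rewrite -(subrK (n *+ j) x); apply: SDn.
move=> H; rewrite big1 ?eqxx // => j _; apply/eqP; rewrite mulf_eq0; apply/orP; right.
by apply/negPn/negP => Hj; apply: H; exists j.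
Qed.

(* Integrality is inherited by the factors of a product with distinct letters:
   a factor of lowest degree is read off from a single coefficient. *)
Lemma int_factors (L : (X -> k) -> Prop) w w' :
  (forall ell, L ell -> lin ell) -> L (bk 0) ->
  (forall x f, L (bk x) -> f \in w ++ w' -> L (bk (x + f.1))) ->
  (forall f ell, f \in w -> L ell -> intk (f.2 * ell f.1)) ->
  wf w -> wf w' -> uniq (map fst w') -> (forall f, f \in w' -> deg f.1 <= K%:Z) ->
  (forall ell, L ell -> agree (run ell w delta0) (run ell w' delta0)) ->
  forall f ell, f \in w' -> L ell -> intk (f.2 * ell f.1).
Proof.
move=> Ll L0 LD il ww ww' uw' wK E.
suff H (g : nat) : forall f ell, f \in w' -> deg f.1 <= g%:Z -> L ell -> intk (f.2 * ell f.1).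
  move=> f ell fw' Lell; apply: (H `|deg f.1|%N) => //.
  by have := allP ww' _ fw' => /= ?; lia.
elim: g => [|g IH] f ell fw' fg Lell.
  by have := allP ww' _ fw'; rewrite /= ltNge fg.
have f0 : 0 < deg f.1 := allP ww' _ fw'.
have := run_top (Ll _ Lell) ww' f0 (wK _ fw') (lexx _).
rewrite eqxx mul1r -(E _ Lell _ (wK _ fw')).
(* The letters of [w'] are distinct, so the correction term in [run_top] is the single number
   sought. The other two terms are integral, one by hypothesis on [w], one by induction for the
   letters of smaller degree. *)
have -> : \sum_(f0 <- w' | f0.1 == f.1) f0.2 * ell f.1 = f.2 * ell f.1.
  rewrite (big_rem f) //= eqxx big_seq_cond big1 ?addr0 // => f' /andP [f'w /eqP Ef].
  have : count_mem f.1 (map fst w') = 1%N by rewrite count_uniq_mem ?map_f.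
  rewrite count_map (permP (perm_to_rem fw')) /= eqxx => -[].
  move/eqP; rewrite -leqn0 leqNgt -has_count => /negP []; apply/hasP.
  by exists f' => //=; rewrite Ef.
move=> E'; have -> : f.2 * ell f.1 = run ell w delta0 f.1 -
    run ell [seq f0 <- w' | deg f0.1 < deg f.1] delta0 f.1.
  by rewrite E' addrAC subrr add0r.
pose S x := L (bk x).
apply: intkB.
  apply: (run_int (S := S) L0 _ _ _ _).1 => // [x f' Sx f'w|f' f'w|x f' Sx f'w].
  - by apply: LD => //; rewrite mem_cat f'w.
  - exact: il.
  - exact: il.
have flt f' : f' \in [seq f0 <- w' | deg f0.1 < deg f.1] -> f' \in w' /\ deg f'.1 <= g%:Z.
  rewrite mem_filter => /andP [lt f'w]; split => //.
  by move: (lt_le_trans lt fg); rewrite -addn1 PoszD ltzD1.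
apply: (run_int (S := S) L0 _ _ _ _).1 => [x f' Sx /flt [f'w _]|f' /flt [f'w ?]|x f' Sx /flt [f'w ?]].
- by apply: LD => //; rewrite mem_cat f'w orbT.
- exact: IH.
- exact: IH.
Qed.

(** * Collection process: sorting words into the order of [Ls] *)

Context (Ls : seq X).
Hypothesis Ls_uniq : uniq Ls.
Hypothesis Ls_pos : forall n, n \in Ls -> 0 < deg n.
Hypothesis Ls_deg : forall n, n \in Ls -> deg n <= K%:Z.
Hypothesis Ls_closed : forall n m i j, n \in Ls -> m \in Ls ->
  (0 < i)%N -> (0 < j)%N -> deg (n *+ i + m *+ j) <= K%:Z -> n *+ i + m *+ j \in Ls.
Hypothesis Ls_ord : forall n m, n \in Ls -> m \in Ls ->
  (index n Ls < index m Ls)%N -> 0 <= B n m.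

Definition dg (f : X * k) := deg f.1.
Definition ix (f : X * k) := index f.1 Ls.
(** Inversions are counted by total degree. Exchanging neighbours f and g inserts letters of degree
    at least dg f + dg g, and any pair with an inserted letter is heavier still. So the counts below
    dg f + dg g stay, and the count at that degree drops by one. *)
Definition invpair (d : nat) (f g : X * k) :=
  (ix g < ix f)%N && (dg f + dg g == d%:Z).
Fixpoint ninv (d : nat) w : nat :=
  if w is f :: w' then (count (invpair d f) w' + ninv d w')%N else 0%N.

Lemma lex_ind (T : Type) (mu : T -> nat -> nat) (m : nat) (P : T -> Prop) :
  (forall t, (forall t', (exists g, [/\ (g < m)%N, (mu t' g < mu t g)%N &
       forall g', (g' < g)%N -> mu t' g' = mu t g']) -> P t') -> P t) ->
  forall t, P t.
Proof.
elim: m P => [|m IH] P H t; first by apply: H => t' [g []]; rewrite ltn0.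
suff Hw : forall t'', (forall g, (g < m)%N -> mu t'' g = mu t g) -> P t'' by exact: Hw.
move: t; apply: (IH (fun t => forall t'', (forall g, (g < m)%N -> mu t'' g = mu t g) ->
  P t'')) => t IHw.
suff Hn (N : nat) : forall t'', (mu t'' m < N)%N ->
    (forall g, (g < m)%N -> mu t'' g = mu t g) -> P t'' by move=> t'' ?; apply: (Hn (mu t'' m).+1).
elim: N => // N IHN t'' tN E; apply: H => t' [g [gm gw gE]].
have [gm'|] := ltnP g m.
  apply: (IHw t') => //; exists g; split => // [|g' g'g]; first by rewrite -E.
  by rewrite gE // E // (ltn_trans g'g).
move=> mg; have Eg : g = m by apply/eqP; rewrite eqn_leq mg -ltnS gm.
apply: IHN; first by rewrite -Eg; apply: leq_trans gw _; rewrite Eg -ltnS.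
by move=> g' g'm; rewrite gE ?Eg // E.
Qed.

Lemma count_invpair_far d (e : X * k) mid (D : int) : (0 < dg e) -> d%:Z <= D ->
  (forall c, c \in mid -> D <= dg c) -> count (invpair d e) mid = 0%N.
Proof.
move=> e0 dD Hm; apply/eqP; rewrite -leqn0 leqNgt -has_count; apply/hasPn => c hm.
rewrite /invpair negb_and; apply/orP; right; by apply/eqP; have := Hm c hm; lia.
Qed.

Lemma ninv_mid d mid w (D : int) : wf mid -> wf w -> d%:Z <= D ->
  (forall c, c \in mid -> D <= dg c) -> ninv d (mid ++ w) = ninv d w.
Proof.
move=> + ww dD; elim: mid => //= e mid IH /andP [e0 wm] Hm.
rewrite IH //; last by move=> c hm; apply: Hm; rewrite in_cons hm orbT.
rewrite -[RHS]add0n; congr (_ + _)%N; apply/eqP; rewrite -leqn0 leqNgt -has_count.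
apply/hasPn => c; rewrite mem_cat => hw.
have c0 : 0 < dg c.
  by case/orP: hw => hw; [exact: (allP wm _ hw)|exact: (allP ww _ hw)].
rewrite /invpair negb_and; apply/orP; right.
by apply/eqP; have := Hm e (mem_head _ _); move: c0; lia.
Qed.

Lemma ninv_swap d u v f g mid : wf u -> wf (f :: g :: v) -> wf mid ->
  (ix g < ix f)%N -> (forall c, c \in mid -> dg f + dg g <= dg c) ->
  d%:Z <= dg f + dg g ->
  (ninv d (u ++ g :: mid ++ f :: v) + (dg f + dg g == d%:Z)%R =
   ninv d (u ++ f :: g :: v))%N.
Proof.
move=> + /and3P [f0 g0 wv] wm gf Hm dD; elim: u => [_|e u IH /andP [e0 wu]] /=.
  rewrite (ninv_mid wm _ dD Hm); last by rewrite /= f0.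
  rewrite count_cat (count_invpair_far g0 dD Hm) /=.
  have -> : invpair d g f = false by rewrite /invpair ltnNge (ltnW gf).
  have -> : invpair d f g = (dg f + dg g == d%:Z) by rewrite /invpair gf.
  lia.
rewrite -(IH wu) !count_cat /= count_cat (count_invpair_far e0 dD Hm) /=.
lia.
Qed.

Lemma not_sorted_split w : ~~ sorted (fun f g => (ix f <= ix g)%N) w ->
  exists u v f g, w = u ++ f :: g :: v /\ (ix g < ix f)%N.
Proof.
elim: w => // f [|g w] IH //=; rewrite negb_and -ltnNge => /orP [gf|].
  by exists [::], w, f, g.
by case/IH => u [v [f' [g' [-> lt]]]]; exists (f :: u), v, f', g'.
Qed.

(** [k] carries no order; positivity of a scalar means being the image of a nonnegative rational. *)
Definition Qpos l := exists2 r : rat, 0 <= r & l = ratr r.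

(** [Good] holds for all letters and [M] for the inserted ones. Recording the result as a
    permutation of [w ++ ms] keeps the multiplicities of the original letters, which [exchange] has
    to recover. *)
Lemma sort_word (Good M : X * k -> Prop) :
  (forall f, Good f -> f.1 \in Ls) -> (forall f, M f -> Good f) ->
  (forall f g, Good f -> Good g -> (ix g < ix f)%N -> exists mid,
     (forall c, c \in mid -> M c /\ dg f + dg g <= dg c) /\
     eqv [:: f; g] (g :: mid ++ [:: f])) ->
  forall w, (forall f, f \in w -> Good f) -> exists w' ms,
    [/\ perm_eq w' (w ++ ms), forall f, f \in ms -> M f,
        sorted (fun f g => (ix f <= ix g)%N) w' & eqv w w'].
Proof.
(* Letters have degree at most K, so pairs have total degree at most K + K, and that many counts
   decrease lexicographically. *)
move=> GL MG Hex; apply: (@lex_ind _ (fun w d => ninv d w) (K + K).+1) => w IH Gw.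
have Gwf w0 : (forall f, f \in w0 -> Good f) -> wf w0.
  by move=> G0; apply/allP => f /G0/GL/Ls_pos.
case: (boolP (sorted (fun f g => (ix f <= ix g)%N) w)) => [sw|/not_sorted_split].
  by exists w, [::]; rewrite cats0; split => //; exact: eqv_refl.
move=> [u [v [f [g [Ew gf]]]]].
have Gu c : c \in u -> Good c by move=> xu; apply: Gw; rewrite Ew mem_cat xu.
have Gv c : c \in v -> Good c.
  by move=> xv; apply: Gw; rewrite Ew mem_cat !in_cons xv !orbT.
have Gf : Good f by apply: Gw; rewrite Ew mem_cat !in_cons eqxx !orbT.
have Gg : Good g by apply: Gw; rewrite Ew mem_cat !in_cons eqxx !orbT.
have [mid [Hmid Emid]] := Hex f g Gf Gg gf.
have Gm c : c \in mid -> Good c by case/Hmid => /MG.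
pose w1 := u ++ g :: mid ++ f :: v.
have Gw1 c : c \in w1 -> Good c.
  rewrite mem_cat in_cons mem_cat in_cons.
  by case/or3P => [/Gu//|/eqP->//|/or3P [/Gm//|/eqP->//|/Gv]].
have f0 : 0 < dg f := Ls_pos (GL _ Gf); have g0 : 0 < dg g := Ls_pos (GL _ Gg).
have fK : dg f <= K%:Z := Ls_deg (GL _ Gf); have gK : dg g <= K%:Z := Ls_deg (GL _ Gg).
have Hsw d : d%:Z <= dg f + dg g -> (ninv d w1 + (dg f + dg g == d%:Z)%R =
   ninv d w)%N.
  move=> dle; rewrite Ew; apply: ninv_swap => //; first exact: Gwf.
  - by apply: Gwf => c; rewrite !in_cons => /or3P [/eqP->//|/eqP->//|/Gv].
  - exact: Gwf.
  - by move=> c /Hmid [].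
have [S ES] : exists S : nat, dg f + dg g = S%:Z.
  by exists (absz (dg f + dg g)); rewrite gtz0_abs // addr_gt0.
have [|w' [ms [pw Hms sw' ew']]] := IH w1 _ Gw1.
  exists S; split; first by lia.
    by rewrite -(Hsw S) ?ES // eqxx addn1.
  move=> g' g'l; rewrite -(Hsw g'); last by rewrite ES lez_nat ltnW.
  by rewrite ES eqz_nat gtn_eqF ?addn0.
exists w', (mid ++ ms); split => //.
- apply: perm_trans pw _; rewrite /w1 Ew -!catA perm_cat2l /= catA.
  rewrite -cat_cons -(cat1s f) -(cat1s g) -!catA.
  apply/permP => p; rewrite !count_cat /= !count_cat /=; lia.
- by move=> c; rewrite mem_cat => /orP [/Hmid []|/Hms].
- apply: eqv_trans ew'; rewrite Ew /w1.
  have -> : u ++ [:: f, g & v] = u ++ [:: f; g] ++ v by [].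
  have -> : u ++ g :: mid ++ f :: v = u ++ (g :: mid ++ [:: f]) ++ v.
    by rewrite /= -catA.
  by apply: eqv_ctx => //; exact: Gwf.
Qed.

Lemma merge_word (Good : X * k -> Prop) w :
  (forall n l l', Good (n, l) -> Good (n, l') -> Good (n, l + l')) ->
  (forall f, f \in w -> f.1 \in Ls) ->
  (forall f, f \in w -> Good f) -> sorted (fun f g => (ix f <= ix g)%N) w ->
  exists w', [/\ sorted (fun f g => (ix f < ix g)%N) w', forall f, f \in w' -> Good f,
    {subset map fst w' <= map fst w} & eqv w w'].
Proof.
move=> GD; elim: w => [|f w IH] wL Gw sw.
  by exists [::]; split => //; exact: eqv_refl.
have [|||w' [sw' Gw' sub ew']] := IH.
- by move=> c hw; apply: wL; rewrite in_cons hw orbT.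
- by move=> c hw; apply: Gw; rewrite in_cons hw orbT.
- exact: path_sorted sw.
have Gf := Gw _ (mem_head _ _); have fL := wL _ (mem_head _ _).
have f0 := Ls_pos fL.
have le c : c \in w' -> (ix f <= ix c)%N.
  move=> /(map_f fst)/sub/mapP [c' c'w E].
  have -> : ix c = ix c' by rewrite /ix E.
  have := sw; rewrite /= path_sortedE => [/andP [/allP H _]|]; first exact: H.
  by move=> ? ? ?; exact: leq_trans.
have wfw' : wf w'.
  apply/allP => c /(map_f fst)/sub/mapP [c' c'w ->].
  by apply: Ls_pos; apply: wL; rewrite in_cons c'w orbT.
have efw : eqv (f :: w) (f :: w').
  by have := @eqv_ctx [:: f] [::] w w' _ isT ew'; rewrite !cats0; apply; rewrite /wf /= f0.
have subc : {subset map fst (f :: w') <= map fst (f :: w)}.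
  by move=> x; rewrite /= !in_cons => /orP [->//|/sub ->]; rewrite orbT.
case: w' sw' Gw' sub ew' le wfw' efw subc => [|g w'] sw' Gw' sub ew' le wfw' efw subc.
  exists [:: f]; split => //.
  by move=> c; rewrite in_cons orbF => /eqP ->.
case: (eqVneq f.1 g.1) => [E|ne].
  exists ((f.1, f.2 + g.2) :: w'); split => //.
  - by case: w' sw' {Gw' sub ew' le wfw' efw subc} => //= c w' ; rewrite /ix /= E.
  - move=> c; rewrite in_cons => /orP [/eqP ->|hw]; last by apply: Gw'; rewrite in_cons hw orbT.
    apply: GD; first by rewrite -surjective_pairing.
    by rewrite E -surjective_pairing; apply: Gw'; rewrite mem_head.
  - by move=> x xw; apply: subc; move: xw; rewrite /= !in_cons => /orP [->//|->]; rewrite !orbT.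
  - apply: eqv_trans efw _.
    apply: (@eqv_ctx [::] w' [:: f; g] [:: (f.1, f.2 + g.2)]) => //.
      by case/andP: wfw'.
    have := @eqv_add f.1 f.2 g.2 f0.
    by rewrite {2}E -!surjective_pairing.
exists (f :: g :: w'); split => //=.
  rewrite /= in sw'; rewrite sw' andbT.
  rewrite ltn_neqAle le ?mem_head // andbT; apply: contra ne => /eqP E; apply/eqP.
  have gL : g.1 \in Ls.
    by have /mapP [c cw ->] := sub g.1 (mem_head _ _); apply: wL; rewrite in_cons cw orbT.
  by rewrite -(nth_index 0 fL) -/(ix f) E nth_index.
move=> c; rewrite in_cons => /orP [/eqP -> //|/Gw' //].
Qed.

Lemma Qpos0 : Qpos 0.
Proof. by exists 0 => //; rewrite -[0 in RHS]/(0%:~R) char0_ratr_int. Qed.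

Lemma QposD l mu : Qpos l -> Qpos mu -> Qpos (l + mu).
Proof.
case=> r r0 -> [s s0 ->]; exists (r + s); first exact: addr_ge0.
by rewrite char0_ratrD.
Qed.

Lemma QposM l mu : Qpos l -> Qpos mu -> Qpos (l * mu).
Proof.
case=> r r0 -> [s s0 ->]; exists (r * s); first exact: mulr_ge0.
by rewrite char0_ratrM.
Qed.

Lemma Qpos_nat (i : nat) : Qpos i%:R.
Proof. by exists i%:R => //; rewrite -[X in ratr X]/((Posz i)%:~R) char0_ratr_int. Qed.

Lemma Qpos_intk l : Qpos l -> intk l -> exists N : nat, l = N%:R.
Proof.
case=> r r0 -> [z E]; exists (absz z).
have rz : r = z%:~R by apply: (char0_ratr_inj char0); rewrite char0_ratr_int.
by rewrite E pmulrn gez0_abs // -(ler0z rat) -rz.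
Qed.

Lemma eqv_nseq n l i : 0 < deg n -> eqv [:: (n, l *+ i)] (nseq i (n, l)).
Proof.
move=> n0; elim: i => [|i IH]; first by rewrite mulr0n; exact: eqv_0.
rewrite mulrS; apply: (@eqv_trans _ [:: (n, l); (n, l *+ i)]); first exact/eqv_sym/eqv_add.
have := @eqv_ctx [:: (n, l)] [::] _ _ _ isT IH.
by rewrite !cats0; apply; rewrite /wf /= n0.
Qed.

Lemma sorted_split (p : pred (X * k)) w :
  (forall f g, (ix f <= ix g)%N -> p g -> p f) ->
  sorted (fun f g => (ix f <= ix g)%N) w ->
  w = [seq f <- w | p f] ++ [seq f <- w | ~~ p f].
Proof.
move=> Hp; elim: w => // f w IH sw; rewrite /=.
have {}IH := IH (path_sorted sw); case: ifP => pf /=; first by rewrite -IH.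
have all_np : all (fun g => ~~ p g) w.
  move: sw; rewrite /= path_sortedE => [/andP [/allP H _]|]; last by move=> ? ? ?; exact: leq_trans.
  by apply/allP => g /H fg; apply/negP => /(Hp _ _ fg); rewrite pf.
have -> : [seq g <- w | p g] = [::].
  by apply/eqP; rewrite -size_eq0 size_filter -leqn0 leqNgt -has_count -all_predC.
by rewrite /=; congr (_ :: _); apply/esym/all_filterP.
Qed.

Lemma le_mulrn_pos (d : int) i : 0 < d -> (0 < i)%N -> d <= d *+ i.
Proof. by move=> d0 i0; rewrite -{1}[d]mulr1n; apply: ler_wpMn2l => //; exact: ltW. Qed.

Lemma lt_sum_mulrn (d e : int) i j : 0 < d -> 0 < e -> (0 < i)%N -> (0 < j)%N ->
  (2 < i + j)%N -> d + e < d *+ i + e *+ j.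
Proof.
move=> d0 e0 i0 j0 ij; have := le_mulrn_pos d0 i0; have := le_mulrn_pos e0 j0.
have : (1 < i)%N || (1 < j)%N by lia.
case/orP => H.
  have : d *+ 2 <= d *+ i by apply: ler_wpMn2l => //; exact: ltW.
  rewrite mulr2n; lia.
have : e *+ 2 <= e *+ j by apply: ler_wpMn2l => //; exact: ltW.
rewrite mulr2n; lia.
Qed.

Definition combo a b n := exists i j, [/\ (0 < i)%N, (0 < j)%N & n = a *+ i + b *+ j].

(** The inserted letters are at least as heavy as f and g together, hence different from both. The
    reordered word thus has distinct letters, as [int_factors] requires, and [:: f; g] supplies the
    integrality. *)
Lemma exchange_int (L : (X -> k) -> Prop) (f g : X * k) mid :
  f.1 \in Ls -> g.1 \in Ls -> (ix g < ix f)%N ->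
  (forall ell, L ell -> lin ell) -> L (bk 0) ->
  (forall x f', L (bk x) -> f' \in f :: g :: mid -> L (bk (x + f'.1))) ->
  (forall ell, L ell -> intk (f.2 * ell f.1)) ->
  (forall ell, L ell -> intk (g.2 * ell g.1)) ->
  (forall f', f' \in mid -> f'.1 \in Ls /\ combo f.1 g.1 f'.1) ->
  uniq (map fst mid) -> eqv [:: f; g] (g :: mid ++ [:: f]) ->
  forall f' ell, f' \in mid -> L ell -> intk (f'.2 * ell f'.1).
Proof.
move=> fL gL gf Ll L0 LD intf intg Hmid umid emid f' ell f'm Lell.
have f0 : 0 < dg f := Ls_pos fL; have g0 : 0 < dg g := Ls_pos gL.
have cd f1 : f1 \in mid -> dg f + dg g <= dg f1.
  case/Hmid => _ [i [j [i0 j0 E]]]; rewrite /dg E degD !linMn //.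
  by apply: lerD; apply: le_mulrn_pos.
have wfm : wf mid by apply/allP => f1 /Hmid [/Ls_pos].
apply: (@int_factors L [:: f; g] (g :: mid ++ [:: f])) => //.
- move=> x f1 Lx Hf1; apply: LD => //; move: Hf1.
  rewrite !(in_cons, mem_cat, in_nil) orbF.
  by case: (f1 == f); case: (f1 == g); case: (f1 \in mid).
- by move=> f1 ell'; rewrite !inE => /orP [] /eqP ->; auto.
- by apply/and3P; split.
- by rewrite -cat1s !wf_cat wfm /=; apply/andP; split; apply/andP; split.
- rewrite /= map_cat mem_cat negb_or cat_uniq umid /= !inE orbF andbT.
  rewrite -andbA; apply/and3P; split.
  + apply/mapP => -[c' c'm E]; have := cd c' c'm; rewrite /dg -E.
    by move: f0; rewrite /dg; clear; lia.
  + by apply: contraTN gf => /eqP E; rewrite /ix E ltnn.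
  + apply/mapP => -[c' c'm E]; have := cd c' c'm; rewrite /dg -E.
    by move: g0; rewrite /dg; clear; lia.
- move=> c'; rewrite in_cons mem_cat inE => /or3P [/eqP ->|c'm|/eqP ->];
    [exact: Ls_deg|by have [/Ls_deg] := Hmid _ c'm|exact: Ls_deg].
- by move=> ell' /Ll le'; apply: emid => //; exact: supp_delta0.
- by rewrite in_cons mem_cat f'm orbT.
Qed.

(* Splitting [(a, l)] and [(b, mu)] into copies of unit letters, for which the
   pentagon identity applies, all the other exchanges needed in sorting involve
   letters of larger total degree. *)
Lemma exchange (m : nat) a b l mu : a \in Ls -> b \in Ls ->
  (index b Ls < index a Ls)%N -> Qpos l -> Qpos mu ->
  intk (l * bk a b) -> intk (mu * bk a b) -> K%:Z < deg a + deg b + m%:Z ->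
  exists mid, [/\ forall f, f \in mid -> [/\ f.1 \in Ls, Qpos f.2 & combo a b f.1],
     uniq (map fst mid) & eqv [:: (a, l); (b, mu)] ((b, mu) :: mid ++ [:: (a, l)])].
Proof.
elim: m a b l mu => [|m IH] a b l mu aL bL ba ql qmu il imu Km.
  exists [::]; split => //; apply: eqv_comm_deg; [exact: Ls_pos|exact: Ls_pos|lia].
have a0 := Ls_pos aL; have b0 := Ls_pos bL.
case: (ltP K%:Z (deg a + deg b)) => [lt|abK].
  by exists [::]; split => //; apply: eqv_comm_deg.
have Bab : B a b <= 0 by rewrite B_skew oppr_le0; apply: Ls_ord.
case: (eqVneq (B a b) 0) => [E|nz]; first by exists [::]; split => //; exact: eqv_comm.
have {nz}Bab : B a b < 0 by rewrite lt_neqAle nz.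
have anb : a != b by apply: contraTN ba => /eqP ->; rewrite ltnn.
(* The exponent at which the pentagon identity applies to a and b. By the integrality hypotheses [l]
   and [mu] are natural multiples of it. *)
pose u : k := ratr (- (B a b)^-1).
have qu : Qpos u by exists (- (B a b)^-1) => //; rewrite oppr_ge0 invr_le0 ltW.
have uab : u * bk a b = -1.
  rewrite /u /bk -char0_ratrM // mulNr mulVf ?lt_eqF //.
  by rewrite char0_ratrN // -[X in ratr X]/(1%:~R) char0_ratr_int.
have uba : u * bk b a = 1 by rewrite bk_skew mulrN uab opprK.
have split_unit c : Qpos c -> intk (c * bk a b) -> exists i : nat, c = u *+ i.
  move=> qc ic; have qb : Qpos (c * bk b a).
    by apply: QposM => //; exists (B b a) => //; rewrite B_skew oppr_ge0 ltW.
  have [|i E] := Qpos_intk qb; first by rewrite bk_skew mulrN; exact: intkN.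
  by exists i; rewrite -mulr_natr -E mulrCA uba mulr1.
have [k1 El] := split_unit l ql il; have [k2 Emu] := split_unit mu qmu imu.
pose L' ell := [/\ lin ell, intk (u * ell a) & intk (u * ell b)].
pose D (f : X * k) := [/\ f.1 \in Ls, Qpos f.2, exists i j, f.1 = a *+ i + b *+ j
  & forall ell, L' ell -> intk (f.2 * ell f.1)].
pose M f := D f /\ combo a b f.1.
pose Good f := D f /\ (f = (a, u) \/ f = (b, u) \/ combo a b f.1).
have L'bk i j : L' (bk (a *+ i + b *+ j)).
  have E c : bk (a *+ i + b *+ j) c = bk a c *+ i + bk b c *+ j.
    by rewrite bkDl !(linMn (bkDl c)).
  split; first exact: bkDr.
    rewrite E bk_alt mul0rn add0r mulrnAr uba; exact: intk_nat.
  rewrite E bk_alt mul0rn addr0 mulrnAr uab mulNrn; exact/intkN/intk_nat.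
have combo_big (f : X * k) : combo a b f.1 -> deg a + deg b <= dg f.
  case=> i [j [i0 j0 E]]; rewrite /dg E degD !linMn //.
  by apply: lerD; apply: le_mulrn_pos.
have combo_na (f : X * k) : combo a b f.1 -> f.1 != a /\ f.1 != b.
  move=> cf; have H := combo_big f cf; rewrite /dg in H; split; apply/eqP => E; rewrite E in H; lia.
have MG (f : X * k) : M f -> Good f by case=> Df cf; split => //; right; right.
have Da : D (a, u).
  by split => //; [exists 1%N, 0%N; rewrite mulr0n addr0|move=> ell []].
have Db : D (b, u).
  by split => //; [exists 0%N, 1%N; rewrite mulr0n add0r|move=> ell []].
have Hex f g : Good f -> Good g -> (ix g < ix f)%N -> exists mid : seq (X * k),
     (forall c, c \in mid -> M c /\ dg f + dg g <= dg c) /\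
     eqv [:: f; g] (g :: mid ++ [:: f]).
  move=> [[fL qf [i1 [j1 Ef]] intf] Hf] [[gL qg [i2 [j2 Eg]] intg] Hg] gf.
  have Bfg : B f.1 g.1 <= 0 by rewrite B_skew oppr_le0; apply: Ls_ord.
  case: (eqVneq (B f.1 g.1) 0) => [E|nz].
    exists [::]; split => //; have := @eqv_comm f.1 g.1 f.2 g.2 E.
    by rewrite -!surjective_pairing.
  have {nz}Bfg : B f.1 g.1 < 0 by rewrite lt_neqAle nz.
  (* One has B f g = (i1 j2 - j1 i2) B a b with both forms negative; this forces i1 and j2 to be
     positive. *)
  have det : (j1 * i2 < i1 * j2)%N.
    have E : B f.1 g.1 = ((i1 * j2)%:R - (j1 * i2)%:R) * B a b.
      rewrite Ef Eg BDl !(linMn (BDl _)) !BDr !(linMn (BDr _)) !B_alt (B_skew b a).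
      by rewrite !natrM; ring.
    move: Bfg; rewrite E nmulr_llt0 // subr_gt0 ltr_nat.
    done.
  have i10 : (0 < i1)%N by case: (i1) det.
  have j20 : (0 < j2)%N by case: (j2) det; rewrite ?muln0.
  case: (boolP [&& i1 == 1%N, j1 == 0%N, i2 == 0%N & j2 == 1%N]).
    case/and4P=> /eqP i11 /eqP j10 /eqP i20 /eqP j21.
    have fa : f.1 = a by rewrite Ef i11 j10 mulr0n addr0.
    have gb : g.1 = b by rewrite Eg i20 j21 mulr0n add0r.
    have -> : f = (a, u).
      case: Hf => [//|[E|/combo_na []]]; last by rewrite fa eqxx.
      by move: anb; rewrite -fa E eqxx.
    have -> : g = (b, u).
      case: Hg => [E|[//|/combo_na []]]; last by rewrite gb eqxx.
      by move: anb; rewrite -gb E eqxx.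
    have cab : combo a b (a + b) by exists 1%N, 1%N.
    exists [:: (a + b, u)]; split; last exact: eqv_pentagon.
    move=> c; rewrite inE => /eqP ->; split; last by rewrite /dg /= degD.
    split => //; split => //=.
    - by apply: (Ls_closed (i := 1) (j := 1)) => //; rewrite !mulr1n degD.
    - by exists 1%N, 1%N.
    - by move=> ell [le ia ib]; rewrite le mulrDr; exact: intkD.
  move=> nu; have dsum : deg a + deg b < dg f + dg g.
    have E : dg f + dg g = deg a *+ (i1 + i2) + deg b *+ (j1 + j2).
      by rewrite /dg Ef Eg !degD !linMn // !mulrnDr; ring.
    rewrite E; apply: lt_sum_mulrn => //.
    - by rewrite addn_gt0 i10.
    - by rewrite addn_gt0 j20 orbT.
    by move: nu i10 j20; clear; rewrite !negb_and; lia.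
  have f0 : 0 < dg f := Ls_pos fL; have g0 : 0 < dg g := Ls_pos gL.
  have [|||mid [Hmid umid emid]] := IH f.1 g.1 f.2 g.2 fL gL gf qf qg.
  - by rewrite bk_skew mulrN Eg; apply: intkN; apply: intf.
  - by rewrite Ef; apply: intg.
  - by apply: lt_le_trans Km _; move: dsum; rewrite /dg -addn1 PoszD; clear; lia.
  rewrite -!surjective_pairing in emid.
  have cfg c : c \in mid -> combo a b c.1 /\ dg f + dg g <= dg c.
    case/Hmid => cL _ [i [j [i0 j0 E]]]; split; last first.
      rewrite /dg E degD !linMn //.
      by apply: lerD; apply: le_mulrn_pos.
    exists (i1 * i + i2 * j)%N, (j1 * i + j2 * j)%N; split.
    - by rewrite addn_gt0 muln_gt0 i10 i0.
    - by rewrite addn_gt0 !muln_gt0 j20 j0 orbT.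
    - by rewrite E Ef Eg !mulrnDl !mulrnDr !mulrnA addrACA.
  exists mid; split => // c cm; have [cc cd] := cfg c cm; have [cL qc _] := Hmid c cm.
  split => //; split => //; split => //.
    by case: cc => i [j [_ _ ->]]; exists i, j.
  move=> ell Lell.
  have cab c' : c' \in f :: g :: mid -> exists i j, c'.1 = a *+ i + b *+ j.
    rewrite !in_cons => /or3P [/eqP ->|/eqP ->|c'm]; [by exists i1, j1|by exists i2, j2|].
    by have [[i [j [_ _ ->]]] _] := cfg _ c'm; exists i, j.
  apply: (@exchange_int L' f g mid) => //.
  - by move=> ? [].
  - by have := L'bk 0%N 0%N; rewrite !mulr0n addr0.
  - move=> x c' [Lx ia ib] /cab [i [j ->]]; have [_ ja jb] := L'bk i j.
    by split; [exact: bkDr|rewrite bkDl mulrDr; exact: intkD..].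
  - by move=> c' /Hmid [? _ ?].
have GL f : Good f -> f.1 \in Ls by case=> -[].
(* Both letters are expanded into unit letters, the word is sorted, and equal letters are merged
   again. *)
pose w0 := nseq k1 (a, u) ++ nseq k2 (b, u).
have [|w' [ms [pw Hms sw' ew']]] := sort_word GL MG Hex (w := w0).
  move=> f; rewrite mem_cat !mem_nseq => /orP [] /andP [_ /eqP ->]; split; auto.
have Gw' f : f \in w' -> f = (a, u) \/ f = (b, u) \/ M f.
  rewrite (perm_mem pw) !mem_cat !mem_nseq -orbA.
  by case/or3P=> [/andP [_ /eqP]|/andP [_ /eqP]|/Hms]; auto.
(* For a combination f both B f b and B a f are negative, so f is sorted strictly between b and a.
   The copies of b and a therefore stand at the two ends, in their original number. *)
have Mix f : M f -> (index b Ls < ix f < index a Ls)%N.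
  case=> -[fL _ _ _] cf; have [na nb] := combo_na f cf.
  have [i [j [i0 j0 E]]] := cf.
  rewrite !ltn_neqAle; apply/andP; split; apply/andP; split.
  - apply: contra nb => /eqP H; apply/eqP.
    by rewrite -(nth_index 0 fL) -/(ix f) -H nth_index.
  - rewrite leqNgt; apply/negP => lt; have := Ls_ord fL bL lt.
    rewrite E BDl !(linMn (BDl _)) B_alt mul0rn addr0 pmulrn_lge0 // leNgt Bab.
    done.
  - apply: contra na => /eqP H; apply/eqP.
    by rewrite -(nth_index 0 fL) -/(ix f) H nth_index.
  - rewrite leqNgt; apply/negP => lt; have := Ls_ord aL fL lt.
    rewrite E BDr !(linMn (BDr _)) B_alt mul0rn add0r pmulrn_lge0 // leNgt Bab.
    done.
pose pb (f : X * k) := (ix f <= index b Ls)%N.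
pose pa (f : X * k) := (ix f < index a Ls)%N.
pose mm := [seq f <- [seq f <- w' | ~~ pb f] | pa f].
have w'E : w' = nseq k2 (b, u) ++ mm ++ nseq k1 (a, u).
  rewrite {1}(sorted_split (p := pb) _ sw'); last by move=> f g fg; apply: leq_trans.
  rewrite (sorted_split (p := pa) (w := [seq f <- w' | ~~ pb f])); last 2 first.
  - by move=> f g fg; apply: leq_ltn_trans.
  - by apply: sorted_filter => // ? ? ?; exact: leq_trans.
  congr (_ ++ (_ ++ _)).
    have : all (pred1 (b, u)) [seq f <- w' | pb f].
      apply/allP => f; rewrite mem_filter => /andP [pf /Gw' [E|[->|/Mix]]].
      - by move: pf; rewrite /pb E /ix /= leqNgt ba.
      - by rewrite /= eqxx.
      - by rewrite ltnNge -/(pb f) pf.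
    move/all_pred1P => ->; congr nseq.
    rewrite size_filter (permP pw) !count_cat !count_nseq /pb /ix /= leqnn leqNgt ba.
    rewrite mul0n mul1n add0n -[RHS]addn0; congr (_ + _)%N.
    apply/eqP; rewrite -leqn0 leqNgt -has_count; apply/hasPn => f /Hms/Mix/andP [H _].
    by rewrite /= -ltnNge.
  have : all (pred1 (a, u)) [seq f <- [seq f <- w' | ~~ pb f] | ~~ pa f].
    apply/allP => f; rewrite !mem_filter => /and3P [pf pf2 /Gw' [->|[E|/Mix]]].
    - by rewrite /= eqxx.
    - by move: pf2; rewrite /pb E /ix /= leqnn.
    - by case/andP => _ H; move: pf; rewrite /pa H.
  move/all_pred1P => ->; congr nseq.
  rewrite size_filter count_filter (permP pw) !count_cat !count_nseq /= /pa /pb /ix /=.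
  rewrite leqnn ltnn -ltnNge ba /= ?mul1n ?mul0n ?add0n addn0 -[RHS]addn0.
  congr (_ + _)%N; apply/eqP; rewrite -leqn0 leqNgt -has_count; apply/hasPn => f /Hms/Mix/andP [_ H].
  by rewrite /= -/(ix f) H.
have Mmm f : f \in mm -> M f.
  rewrite !mem_filter => /and3P [pf pf2 /Gw' [E|[E|//]]].
    by move: pf; rewrite /pa E /ix /= ltnn.
  by move: pf2; rewrite /pb E /ix /= leqnn.
pose GM (f : X * k) := [/\ f.1 \in Ls, Qpos f.2 & combo a b f.1].
have [||||mid [smid Gmid _ emid]] := @merge_word GM mm.
- by move=> n c c' [nL qc cn] [_ qc' _]; split => //; exact: QposD.
- by move=> f /Mmm [[]].
- by move=> f /Mmm [[fL qf _ _] cf].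
- by do 2 (apply: sorted_filter => [? ? ?|]; first exact: leq_trans).
exists mid; split => //.
  apply: (@sorted_uniq _ (fun x y => index x Ls < index y Ls)%N) => [? ? ?|?|].
  - exact: ltn_trans.
  - exact: ltnn.
  - by rewrite sorted_map.
have eu c i (x : X) : 0 < deg x -> c = u *+ i -> eqv [:: (x, c)] (nseq i (x, u)).
  by move=> x0 ->; exact: eqv_nseq.
have wfn i (x : X) : 0 < deg x -> wf (nseq i (x, u)) by move=> x0; rewrite /wf all_nseq /= x0 orbT.
have wfmm : wf mm by apply/allP => f /Mmm [[/Ls_pos]].
have wfmid : wf mid by apply/allP => f /Gmid [/Ls_pos].
have wf1 (x : X) c : 0 < deg x -> wf [:: (x, c)] by move=> x0; rewrite /wf /= x0.
apply: (@eqv_trans _ w0).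
  apply: (@eqv_cat [:: (a, l)] _ [:: (b, mu)]); [exact: wfn|exact: wf1|exact: eu|exact: eu].
apply: (@eqv_trans _ w' _ ew'); rewrite w'E.
apply: (@eqv_cat _ [:: (b, mu)]); [exact: wf1| |exact/eqv_sym/eu|].
  by rewrite wf_cat wfmm; exact: wfn.
by apply: eqv_cat; [exact: wfmid|exact: wfn|exact: emid|exact/eqv_sym/eu].
Qed.

Lemma sorted_index_Ls : sorted (fun x y => index x Ls < index y Ls)%N Ls.
Proof.
rewrite -(@sorted_map _ _ (index^~ Ls) ltn).
have -> : [seq index x Ls | x <- Ls] = iota 0 (size Ls).
  apply: (@eq_from_nth _ 0%N); first by rewrite size_map size_iota.
  move=> i; rewrite size_map => iL; rewrite (nth_map 0) // nth_iota // add0n.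
  exact: index_uniq.
exact: iota_ltn_sorted.
Qed.

Lemma run_drop0 ell (p : pred X) (C : X -> k) s h :
  (forall m, m \in s -> ~~ p m -> C m = 0) ->
  run ell [seq (m, C m) | m <- s] h = run ell [seq (m, C m) | m <- s & p m] h.
Proof.
elim: s => // m s IH H /=.
have {}IH := IH (fun m' m's => H m' (mem_behead (s := m :: s) m's)).
case: ifP => pm /=; first by rewrite IH.
by apply/funext => x; rewrite H ?mem_head ?pm // wop_id IH.
Qed.

(** The letters of degree below K in the first word have natural exponents. Sorting them produces
    exponents that are both nonnegative and integral, hence natural multiples of [delta]. Letters of
    degree K are central modulo higher degree and are simply added. A sorted word determines its
    exponents, so in degree K the second word has [Cp n] plus such a natural number. *)
Theorem rank2_positivity (delta : X -> k) (L : (X -> k) -> Prop) (Cp Cm : X -> k)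
    (Lp : seq X) :
  perm_eq Lp Ls ->
  (forall n, n \in Ls -> Qpos (delta n) /\ delta n != 0) ->
  (forall n m, n \in Ls -> m \in Ls -> intk (delta n * bk m n)) ->
  (forall ell n, L ell -> n \in Ls -> intk (delta n * ell n)) ->
  (forall ell, L ell -> lin ell) ->
  (forall n, n \in Ls -> exists2 ell, L ell & ell n != 0) ->
  (forall n l, n \in Ls -> Qpos l -> (forall ell, L ell -> intk (l * ell n)) ->
     exists N : nat, l = N%:R * delta n) ->
  (forall n, n \in Ls -> deg n < K%:Z -> exists N : nat, Cp n = N%:R) ->
  (forall ell, L ell ->
     agree (run ell [seq (n, Cp n * delta n) | n <- Lp] delta0)
           (run ell [seq (n, Cm n * delta n) | n <- Ls] delta0)) ->
  forall n, n \in Ls -> deg n = K%:Z -> exists N : nat, Cm n = Cp n + N%:R.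
Proof.
move=> pLp dpos dB dL Ll nondeg dconv Cpnat rel.
(* [L'] contains [bk x] for all sums x of letters, which [int_factors] asks for, and it contains
   [L], so that integrality on [L'] suffices for [dconv]. *)
pose L' ell := lin ell /\ forall n, n \in Ls -> intk (delta n * ell n).
have LL' ell : L ell -> L' ell.
  by move=> Lell; split => [|n nL]; [exact: Ll|exact: dL].
have L'bk x n : L' (bk x) -> n \in Ls -> L' (bk (x + n)).
  move=> [_ Lx] nL; split => [|m mL]; first exact: bkDr.
  by rewrite bkDl mulrDr; apply: intkD; [exact: Lx|exact: dB].
have L'0 : L' (bk 0).
  split => [|m mL]; first exact: bkDr.
  by rewrite (lin0 (bkDl m)) mulr0; exact: intk0.
pose Good (f : X * k) := [/\ f.1 \in Ls, Qpos f.2 & forall ell, L' ell -> intk (f.2 * ell f.1)].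
have GL (f : X * k) : Good f -> f.1 \in Ls by case.
have Hex (f g : X * k) : Good f -> Good g -> (ix g < ix f)%N -> exists mid : seq (X * k),
     (forall c, c \in mid -> Good c /\ dg f + dg g <= dg c) /\
     eqv [:: f; g] (g :: mid ++ [:: f]).
  move=> [fL qf intf] [gL qg intg] gf.
  have Lb n : n \in Ls -> L' (bk n) by move=> nL; rewrite -[n]add0r; exact: L'bk.
  have [||//|mid [Hmid umid emid]] := exchange (m := K) fL gL gf qf qg.
  - by rewrite bk_skew mulrN; apply/intkN/intf/Lb.
  - by apply/intg/Lb.
  - by have := Ls_pos fL; have := Ls_pos gL; clear; lia.
  rewrite -!surjective_pairing in emid.
  exists mid; split => // c cm; have [cL qc cc] := Hmid c cm; split; last first.
    have [i [j [i0 j0 E]]] := cc; rewrite /dg E degD !linMn //.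
    by apply: lerD; apply: le_mulrn_pos => //; exact: Ls_pos.
  split => // ell Lell; apply: (@exchange_int L' f g mid) => //.
  - by move=> ? [].
  - move=> x c' Lx c'w; apply: L'bk => //; move: c'w.
    by rewrite !in_cons => /or3P [/eqP ->|/eqP ->|/Hmid []].
  - by move=> c' /Hmid [].
pose wp := [seq (n, Cp n * delta n) | n <- Lp].
pose wlow := [seq f <- wp | dg f < K%:Z].
pose wm := [seq (n, Cm n * delta n) | n <- Ls].
have wpL f : f \in wp -> f.1 \in Ls /\ f.2 = Cp f.1 * delta f.1.
  by case/mapP => n; rewrite (perm_mem pLp) => nL ->.
have Gwlow f : f \in wlow -> Good f.
  rewrite mem_filter => /andP [fK /wpL [fL E]].
  have [N EN] := Cpnat _ fL fK; have [qd _] := dpos _ fL.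
  split => // [|ell [_ Lell]]; rewrite E EN; first by apply: QposM => //; exact: Qpos_nat.
  by rewrite -mulrA; apply: intkM; [exact: intk_nat|exact: Lell].
have [ws [ms [pws Gms sws ews]]] := sort_word GL (M := Good) (fun f Gf => Gf) Hex Gwlow.
have Gws f : f \in ws -> Good f.
  by rewrite (perm_mem pws) mem_cat => /orP [/Gwlow|/Gms].
have [||||wM [swM GwM _ ewM]] := @merge_word Good ws.
- move=> n c c' [nL qc ic] [_ qc' ic']; split => // [|ell Lell]; first exact: QposD.
  by rewrite mulrDl; apply: intkD; [exact: ic|exact: ic'].
- by move=> f /Gws [].
- exact: Gws.
- exact: sws.
pose Lam n := \sum_(f <- wM | f.1 == n) f.2.
have ltix_trans : transitive (fun x y => index x Ls < index y Ls)%N.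
  by move=> ? ? ?; exact: ltn_trans.
have uM : uniq (map fst wM).
  apply: (sorted_uniq ltix_trans) => [?|]; first exact: ltnn.
  by rewrite sorted_map.
have LamE f : f \in wM -> Lam f.1 = f.2.
  move=> fw; rewrite /Lam (big_rem f) //= eqxx big_seq_cond big1 ?addr0 //.
  move=> f' /andP [f'w /eqP Ef].
  have : count_mem f.1 (map fst wM) = 1%N by rewrite count_uniq_mem ?map_f.
  rewrite count_map (permP (perm_to_rem fw)) /= eqxx => -[].
  move/eqP; rewrite -leqn0 leqNgt -has_count => /negP []; apply/hasP.
  by exists f' => //=; rewrite Ef.
have wME : wM = [seq (n, Lam n) | n <- Ls & n \in map fst wM].
  have -> : [seq n <- Ls | n \in map fst wM] = map fst wM.
    apply: (@irr_sorted_eq _ (fun x y => index x Ls < index y Ls)%N) => //.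
    - by move=> ?; exact: ltnn.
    - exact: sorted_filter sorted_index_Ls.
    - by rewrite sorted_map.
    - move=> n; rewrite mem_filter; case: (boolP (n \in _)) => //= /mapP [f fw ->].
      by have [->] := GwM f fw.
  rewrite -map_comp -[LHS]map_id; apply/eq_in_map => f fw /=.
  by rewrite LamE // -surjective_pairing.
have Lam0 n : n \notin map fst wM -> Lam n = 0.
  move=> nw; rewrite /Lam big_seq_cond big1 // => f /andP [fw /eqP E].
  by move: nw; rewrite -E map_f.
have filt (C : X -> k) (g : int) s : [seq f <- [seq (n, C n) | n <- s] | deg f.1 < g] =
    [seq (n, C n) | n <- s & deg n < g] by rewrite filter_map.
have sumC (C : X -> k) s n (c : k) : uniq s -> n \in s ->
    \sum_(f <- [seq (m, C m) | m <- s] | f.1 == n) f.2 * c = C n * c.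
  move=> us ns; rewrite big_map /= (big_rem n) //= eqxx big_seq_cond big1 ?addr0 //.
  by move=> m; rewrite mem_rem_uniq // inE => /andP [/andP [/negbTE ->]].
have wf_all (C : X -> k) s : {subset s <= Ls} -> wf [seq (n, C n) | n <- s].
  by move=> sL; apply/allP => _ /mapP [n /sL nL ->]; exact: Ls_pos.
have LpL : {subset Lp <= Ls} by move=> n; rewrite (perm_mem pLp).
have wfM : wf wM by apply/allP => f /GwM [/Ls_pos].
have uLp : uniq Lp by rewrite (perm_uniq pLp).
(* The coefficients at n are compared by [run_top]. The letters of degree K, left out of [wlow],
   enter as the extra summand; everything of lower degree agrees by assumption. *)
have key n ell : n \in Ls -> L ell ->
    (forall m, m \in Ls -> deg m < deg n -> Lam m = Cm m * delta m) ->
    (Lam n + (deg n == K%:Z)%:R * (Cp n * delta n)) * ell n = Cm n * delta n * ell n.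
  move=> nL Lell IH; have n0 := Ls_pos nL; have nK := Ls_deg nL.
  have le := Ll _ Lell.
  have E1 := run_top le (wf_all (fun n => Cp n * delta n) _ LpL) n0 nK (lexx _).
  have E2 := run_top le (wf_all (fun n => Cm n * delta n) _ (fun _ => id)) n0 nK (lexx _).
  have E3 := run_top le wfM n0 nK (lexx _).
  have wfl : wf wlow.
    by apply/allP => f /Gwlow [/Ls_pos].
  have E4 := run_top le wfl n0 nK (lexx _).
  have E5 := ews _ le _ supp_delta0 n nK; have E6 := ewM _ le _ supp_delta0 n nK.
  have nLp : n \in Lp by rewrite (perm_mem pLp).
  have E7 := rel _ Lell n nK.
  move: E1 E2 E3 E4; rewrite !eqxx !mul1r !sumC // => E1 E2 E3 E4.
  have EM : run ell [seq f <- wM | deg f.1 < deg n] delta0 n =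
            run ell [seq f <- wm | deg f.1 < deg n] delta0 n.
    rewrite [in LHS]wME /wm !filt -filter_predI.
    congr (_ n); rewrite (@run_drop0 ell (mem (map fst wM)) _ [seq n0 <- Ls | deg n0 < deg n]).
      rewrite -filter_predI; congr run.
      have -> : [seq x <- Ls | predI (mem (map fst wM)) (fun n0 => deg n0 < deg n) x] =
         [seq x <- Ls | predI (fun n0 => deg n0 < deg n) (mem (map fst wM)) x].
        by apply: eq_filter => m /=; rewrite andbC.
      apply/eq_in_map => m; rewrite mem_filter /= => /andP [/andP [mn _] mL].
      by rewrite IH.
    by move=> m; rewrite mem_filter => /andP [mn mL] /Lam0; rewrite IH.
  have ES : \sum_(f <- wM | f.1 == n) f.2 * ell n = Lam n * ell n by rewrite mulr_suml.
  have Elow : [seq f <- wlow | deg f.1 < deg n] = [seq f <- wp | deg f.1 < deg n].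
    rewrite -filter_predI; apply: eq_filter => f /=.
    by case: (ltP (deg f.1) (deg n)) => //= h1; rewrite /dg (lt_le_trans h1).
  have Ewl : \sum_(f <- wlow | f.1 == n) f.2 * ell n =
      (deg n < K%:Z)%R%:R * (Cp n * delta n * ell n).
    rewrite big_filter_cond; case: ltP => h1.
      rewrite mul1r -(sumC (fun n => Cp n * delta n) Lp n (ell n)) //.
      by apply: eq_bigl => f /=; case: eqP => [E|_]; rewrite ?andbF // /dg E h1.
    rewrite mul0r big1 // => f /andP [h2 /eqP E].
    by move: h2; rewrite /dg E ltNge h1.
  rewrite mulrDl -ES.
  have -> : \sum_(f <- wM | f.1 == n) f.2 * ell n =
     run ell wM delta0 n - run ell [seq f <- wM | deg f.1 < deg n] delta0 n.
    by rewrite E3 addrAC subrr add0r.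
  have -> : Cm n * delta n * ell n =
     run ell wm delta0 n - run ell [seq f <- wm | deg f.1 < deg n] delta0 n.
    by rewrite E2 addrAC subrr add0r.
  rewrite EM -E6 -E5 E4 Ewl Elow -E7 E1 -/wp.
  have -> : (deg n == K%:Z) = ~~ (deg n < K%:Z) by rewrite -leNgt eq_le nK.
  by case: (deg n < K%:Z) => /=; ring.
have low (g : nat) : forall n, n \in Ls -> deg n <= g%:Z -> deg n < K%:Z ->
    Lam n = Cm n * delta n.
  elim: g => [|g IH] n nL ng nK; first by move: ng; rewrite leNgt Ls_pos.
  have [ell Lell nz] := nondeg n nL.
  apply: (mulIf nz); rewrite -(key n ell nL Lell).
    by rewrite (lt_eqF nK) mul0r addr0.
  move=> m mL mn; apply: IH => //; last exact: lt_trans nK.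
  by move: (lt_le_trans mn ng); rewrite -addn1 PoszD ltzD1.
move=> n nL nK; have [ell Lell nz] := nondeg n nL.
have := key n ell nL Lell; rewrite nK eqxx mul1r => E.
have {}E : Lam n + Cp n * delta n = Cm n * delta n.
  apply: (mulIf nz); apply: E => m mL mK; apply: (low (absz (deg m))) => //.
  by rewrite gez0_abs // ltW // Ls_pos.
have [|ell' L'ell'|N EN] := dconv n (Lam n) nL.
- case: (boolP (n \in map fst wM)) => [/mapP [f fw ->]|/Lam0 ->]; last exact: Qpos0.
  by rewrite LamE //; have [] := GwM f fw.
- case: (boolP (n \in map fst wM)) => [/mapP [f fw ->]|/Lam0 ->]; last first.
    by rewrite mul0r; exact: intk0.
  by rewrite LamE //; have [_ _] := GwM f fw; apply; exact: LL'.
exists N; have [_ d0] := dpos n nL.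
by apply: (mulIf d0); rewrite -E EN mulrDl addrC.
Qed.

End WallOperators.

(** * Factorization of power series *)

Section TruncatedSeries.
Context {k : fieldType} (char0 : [pchar k] =i pred0).
Implicit Types (p q r : {poly k}) (F G e : nat -> k).

Definition eqm (N : nat) p q := forall i, (i < N)%N -> p`_i = q`_i.

Lemma eqm_sym N p q : eqm N p q -> eqm N q p.
Proof. by move=> e i iN; rewrite e. Qed.

Lemma eqm_trans N p q r : eqm N p q -> eqm N q r -> eqm N p r.
Proof. by move=> e e' i iN; rewrite e // e'. Qed.

Lemma eqmM N p p' q q' : eqm N p p' -> eqm N q q' -> eqm N (p * q) (p' * q').
Proof.
move=> ep eq i iN; rewrite !coefM; apply: eq_bigr => -[j ji] _ /=.
by rewrite ep ?eq //; apply: leq_ltn_trans iN; rewrite ?leq_subr -1?ltnS.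
Qed.

Lemma eqmX N p q a : eqm N p q -> eqm N (p ^+ a) (q ^+ a).
Proof. by move=> e; elim: a => // a IH; rewrite !exprS; exact: eqmM. Qed.

(** The binomial series (1 + X^i)^c modulo X^N. *)
Definition bser (N i : nat) (c : k) : {poly k} := (\poly_(j < N) gbin c j) \Po 'X^i.

Lemma coef_bser N i c m : (0 < i)%N -> (m < N)%N ->
  (bser N i c)`_m = if (i %| m)%N then gbin c (m %/ i) else 0.
Proof.
move=> i0 mN; rewrite coef_comp_poly_Xn //; case: ifP => // _.
by rewrite coef_poly (leq_ltn_trans (leq_div _ _) mN).
Qed.

Lemma bserD N i c c' : (0 < i)%N -> eqm N (bser N i (c + c')) (bser N i c * bser N i c').
Proof.
move=> i0 m mN; rewrite -comp_polyM !coef_comp_poly_Xn //; case: ifP => // _.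
have lt := leq_ltn_trans (leq_div m i) mN.
rewrite coefM coef_poly lt gbin_vandermonde //; apply: eq_bigr => -[j jm] _ /=.
by rewrite !coef_poly !(leq_ltn_trans _ lt) // ?leq_subr // -ltnS.
Qed.

Lemma bser0 N i : (0 < i)%N -> eqm N (bser N i 0) 1.
Proof.
move=> i0 m mN; rewrite coef_bser // coef1 gbin_0 //.
case: m mN => [|m] mN; first by rewrite dvdn0 div0n.
by case: ifP => // /dvdnP [[|a] E]; rewrite ?[in LHS]E ?mulnK.
Qed.

Lemma bserMn N i c a : (0 < i)%N -> eqm N (bser N i (a%:R * c)) (bser N i c ^+ a).
Proof.
move=> i0; elim: a => [|a IH]; first by rewrite mul0r; exact: bser0.
rewrite -natr1 mulrDl mul1r exprSr; apply: (eqm_trans (@bserD N i _ _ i0)).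
by apply: eqmM => // j.
Qed.

Definition bprod (N : nat) e := \prod_(1 <= i < N) bser N i (e i).

Lemma eqm_prod_nat N a b (f g : nat -> {poly k}) :
  (forall i, (a <= i < b)%N -> eqm N (f i) (g i)) ->
  eqm N (\prod_(a <= i < b) f i) (\prod_(a <= i < b) g i).
Proof.
move=> fg; rewrite big_nat_cond [X in eqm _ _ X]big_nat_cond.
apply: (big_ind2 (eqm N)) => // [? ? ? ?|i]; first exact: eqmM.
by rewrite andbT; exact: fg.
Qed.

Lemma bprodD N e e' : eqm N (bprod N (fun i => e i + e' i)) (bprod N e * bprod N e').
Proof.
rewrite /bprod -big_split; apply: eqm_prod_nat => i /andP [i0 _].
exact: bserD.
Qed.

Lemma bprod0 N : eqm N (bprod N (fun=> 0)) 1.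
Proof.
apply: (@eqm_trans _ _ (\prod_(1 <= i < N) 1)); last by rewrite big1_eq.
by apply: eqm_prod_nat => i /andP [i0 _]; exact: bser0.
Qed.

Lemma bprodMn N e a : eqm N (bprod N (fun i => a%:R * e i)) (bprod N e ^+ a).
Proof.
rewrite /bprod -prodrXl; apply: eqm_prod_nat => i /andP [i0 _].
exact: bserMn.
Qed.

Lemma bser_const N i c : (0 < i)%N -> (0 < N)%N -> (bser N i c)`_0 = 1.
Proof. by move=> i0 N0; rewrite coef_bser // dvdn0 div0n gbin0. Qed.

Definition low (N : nat) e := fun i => if (i < N)%N then e i else 0.

Lemma bprod_const N e : (0 < N)%N -> (bprod N e)`_0 = 1.
Proof.
move=> N0; rewrite -horner_coef0 /bprod horner_prod big_nat_cond big1 // => i.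
by rewrite andbT => /andP [i0 _]; rewrite horner_coef0 bser_const.
Qed.

(* Only the factor of index m involves e m in the coefficient of X^m. *)
Lemma coef_bprod N e m : (0 < m)%N -> (m < N)%N ->
  (bprod N e)`_m = e m + (bprod m.+1 (low m e))`_m.
Proof.
move=> m0 mN.
have Ebig : eqm m.+1 (bprod N e) (bprod m.+1 e).
  rewrite /bprod (big_cat_nat (n := m.+1)) //= -[X in eqm _ _ X]mulr1; apply: eqmM.
    apply: eqm_prod_nat => i /andP [i0 im] j jm.
    by rewrite !coef_bser // (leq_trans jm).
  apply: (@eqm_trans _ _ (\prod_(m.+1 <= i < N) 1)); last by rewrite big1_eq.
  apply: eqm_prod_nat => i /andP [mi iN] j jm.
  have i0 : (0 < i)%N by apply: leq_trans mi.
  rewrite coef_bser //; last by apply: leq_trans mN.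
  rewrite coef1; case: j jm => [|j] jm; first by rewrite dvdn0 div0n gbin0.
  case: ifP => // /dvdn_leq => /(_ isT); rewrite leqNgt (leq_trans jm) //.
rewrite Ebig // /bprod !big_nat_recr //=.
have -> : low m e m = 0 by rewrite /low ltnn.
have E : \prod_(1 <= i < m) bser m.+1 i (low m e i) = \prod_(1 <= i < m) bser m.+1 i (e i).
  by apply: eq_big_nat => i /andP [_ im]; rewrite /low im.
rewrite E; set Q := \prod_(1 <= i < m) _.
have Q0 : Q`_0 = 1.
  rewrite -horner_coef0 /Q horner_prod big_nat_cond big1 // => i.
  by rewrite andbT => /andP [i0 _]; rewrite horner_coef0 bser_const.
have small c j : (j < m)%N -> (bser m.+1 m c)`_j = (j == 0%N)%:R.
  move=> jm; rewrite coef_bser //; last by apply: leqW.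
  case: j jm => [|j] jm; first by rewrite dvdn0 div0n gbin0.
  by case: ifP => // /dvdn_leq => /(_ isT); rewrite leqNgt jm.
rewrite !coefM !big_ord_recl !subn0 !coef_bser // dvdnn divnn m0 gbin1 gbin_0 // Q0.
rewrite !mul1r add0r; congr (_ + _); apply: eq_bigr => i _.
by rewrite !small ?ltn_subrL ?m0 ?andbT.
Qed.

Lemma bprod_inj N e e' : eqm N (bprod N e) (bprod N e') ->
  forall i, (0 < i < N)%N -> e i = e' i.
Proof.
move=> E i; elim/ltn_ind: i => i IH /andP [i0 iN].
have := E i iN; rewrite (@coef_bprod N e) // (@coef_bprod N e') //.
have -> : bprod i.+1 (low i e) = bprod i.+1 (low i e').
  apply: eq_big_nat => j /andP [j0 _]; rewrite /low; case: ifP => // ji.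
  by rewrite IH // j0 (ltn_trans ji).
exact: addIr.
Qed.

(** The whole table of exponents up to m is carried, because the next one is the defect between F
    and the product of all earlier factors. *)
Fixpoint decs F (m : nat) : nat -> k :=
  if m is m'.+1 then fun i =>
    if i == m then F m - (bprod m.+1 (low m (decs F m')))`_m else decs F m' i
  else fun=> 0.

(* The exponents in the factorization of a series into factors (1 + X^i)^(e_i). *)
Definition dec F i := decs F i i.

Lemma decsE F m i : (i <= m)%N -> decs F m i = dec F i.
Proof.
elim: m => [|m IH]; first by rewrite leqn0 => /eqP ->.
rewrite leq_eqVlt => /orP [/eqP -> //|im] /=.
by rewrite (ltn_eqF im) IH.
Qed.

Lemma decP F N : F 0%N = 1 -> eqm N (\poly_(i < N) F i) (bprod N (dec F)).
Proof.
move=> F0 [|m] mN; first by rewrite coef_poly mN bprod_const.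
rewrite coef_poly mN coef_bprod // [dec F _]/= /dec /= eqxx.
have -> : bprod m.+2 (low m.+1 (decs F m)) = bprod m.+2 (low m.+1 (dec F)).
  by apply: eq_big_nat => j _; rewrite /low; case: ifP => // jm; rewrite decsE.
by rewrite -/(dec F) subrK.
Qed.

Lemma eqm_mulIr N p q r : r`_0 = 1 -> eqm N (p * r) (q * r) -> eqm N p q.
Proof.
move=> r0 E i; elim/ltn_ind: i => i IH iN.
have := E i iN; rewrite !coefM !big_ord_recr /= subnn r0 !mulr1.
suff -> : \sum_(j < i) p`_j * r`_(i - j) = \sum_(j < i) q`_j * r`_(i - j).
  exact: addrI.
by apply: eq_bigr => -[j ji] _ /=; rewrite IH // (ltn_trans ji).
Qed.

(** [conv], [spow], [sinv] and [spowz] are [hmul], [hexp], [hinv] and [hexpz] on the coefficient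
    sequences along one ray. *)
Definition conv F G := fun m => \sum_(i < m.+1) F i * G (m - i)%N.
Definition ser1 : nat -> k := fun j => (j == 0%N)%:R.
Definition spow F (j : nat) := iter j (conv F) ser1.
Definition sinv F := fun m => \sum_(j < m.+1) spow (fun i => ser1 i - F i) j m.
Definition spowz F (a : int) :=
  match a with Posz j => spow F j | Negz j => spow (sinv F) j.+1 end.

Lemma conv_poly F G N : eqm N (\poly_(i < N) conv F G i) ((\poly_(i < N) F i) * (\poly_(i < N) G i)).
Proof.
move=> m mN; rewrite coef_poly mN coefM; apply: eq_bigr => -[j jm] _ /=.
by rewrite !coef_poly !(leq_ltn_trans _ mN) // ?leq_subr // -ltnS.
Qed.

Lemma ser1_poly N : eqm N (\poly_(i < N) ser1 i) 1.
Proof. by move=> i iN; rewrite coef_poly iN coef1. Qed.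

Lemma spow_poly F j N : eqm N (\poly_(i < N) spow F j i) ((\poly_(i < N) F i) ^+ j).
Proof.
elim: j => [|j IH]; first exact: ser1_poly.
by rewrite exprS; apply: eqm_trans (@conv_poly _ _ N) _; apply: eqmM.
Qed.

Lemma spow_low F j m : F 0%N = 0 -> (m < j)%N -> spow F j m = 0.
Proof.
move=> F0; elim: j m => // j IH m; rewrite ltnS => mj.
rewrite /spow iterS -/(spow F j) /conv big1 // => -[[|i] im] _ /=; first by rewrite F0 mul0r.
rewrite (IH (m - i.+1)%N) ?mulr0 //; apply: leq_trans mj.
by rewrite ltn_subrL (leq_trans _ (ltnSE im)).
Qed.

Lemma sinv_poly F N : F 0%N = 1 ->
  eqm N ((\poly_(i < N) sinv F i) * (\poly_(i < N) F i)) 1.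
Proof.
move=> F0; pose T := fun i => ser1 i - F i; pose p : {poly k} := \poly_(i < N) T i.
have pE : eqm N (1 - p) (\poly_(i < N) F i).
  by move=> i iN; rewrite coefB coef1 !coef_poly iN /T /ser1 opprB addrC subrK.
have sE : eqm N (\poly_(i < N) sinv F i) (\sum_(j < N) p ^+ j).
  move=> m mN; rewrite coef_poly mN coef_sum /sinv.
  have E (j : nat) : (p ^+ j)`_m = spow T j m.
    by rewrite -(spow_poly T j (N := N)) // coef_poly mN.
  rewrite (eq_bigr (fun j : 'I_N => spow T j m)) => [|j _]; last exact: E.
  rewrite -[RHS](big_mkord xpredT (fun j => spow T j m)).
  rewrite [RHS](big_cat_nat (n := m.+1)) //=.
  rewrite [X in _ = _ + X]big_nat_cond [X in _ = _ + X]big1 ?addr0 ?big_mkord // => j.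
  by rewrite andbT => /andP [mj _]; rewrite spow_low // /T /ser1 F0 subrr.
apply: eqm_trans (eqmM sE (eqm_sym pE)) _ => m mN.
have -> : (\sum_(j < N) p ^+ j) * (1 - p) = 1 - p ^+ N.
  by rewrite -[RHS]opprB subrX1 mulrC -mulNr opprB.
rewrite coefB -(spow_poly T N (N := N)) // coef_poly mN spow_low ?subr0 //.
by rewrite /T /ser1 F0 subrr.
Qed.

(** A power multiplies all exponents of the factorization. For negative powers, [sinv] is the
    geometric series inverting F modulo X^N, and inverses are unique. So the crossing z^m -> z^m f^a
    splits into binomial letters. *)
Lemma spowz_poly F e N a : F 0%N = 1 -> eqm N (\poly_(i < N) F i) (bprod N e) ->
  eqm N (\poly_(i < N) spowz F a i) (bprod N (fun i => a%:~R * e i)).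
Proof.
move=> F0 FE; case: a => a /=.
  apply: eqm_trans (@spow_poly _ _ N) _; apply: eqm_trans (eqmX a FE) _.
  apply: eqm_sym; rewrite -pmulrn; exact: bprodMn.
have FI : eqm N (\poly_(i < N) sinv F i) (bprod N (fun i => - e i)).
  case: N FE => [|N] FE; first by [].
  apply: (@eqm_mulIr _ _ _ (\poly_(i < N.+1) F i)); first by rewrite coef_poly.
  apply: eqm_trans (@sinv_poly _ N.+1 F0) _; apply: eqm_sym.
  apply: eqm_trans (eqmM (fun _ _ => erefl) FE) _.
  apply: eqm_trans (eqm_sym (@bprodD N.+1 _ _)) _.
  have -> : bprod N.+1 (fun i => - e i + e i) = bprod N.+1 (fun=> 0).
    by apply: eq_bigr => i _; rewrite addNr.
  exact: bprod0.
apply: eqm_trans (@spow_poly _ a.+1 N) _; apply: eqm_trans (eqmX a.+1 FI) _.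
apply: eqm_sym.
have -> : bprod N (fun i => (Negz a)%:~R * e i) = bprod N (fun i => a.+1%:R * - e i).
  by apply: eq_bigr => i _; rewrite NegzE mulrNz -pmulrn mulrN mulNr.
exact: bprodMn.
Qed.

End TruncatedSeries.

(** * Series supported on a ray of P *)

Section RaySeries.
Context {n : nat} (Gamma : fixed_data n) {R : realType} (k : fieldType).
Context (sigma : set 'rV[R]_n).
Local Notation P := (monP Gamma sigma).
Local Notation phat := (phat Gamma k sigma).
Hypothesis P0 : P 0.
Hypothesis PD : forall x y, P x -> P y -> P (x + y).
Implicit Types (f g h : phat) (v x : 'rV[rat]_n) (q : P) (F G : nat -> k).

Definition mkP v (Pv : P v) : P := SigSub (mem_set Pv).

Lemma Pval q : P (val q). Proof. exact: set_mem (valP q). Qed.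

(** Extension by zero off P, so that coefficients are indexed by all rational vectors and can be
    shifted freely. *)
Definition hext h v : k :=
  match pselect (P v) with left Pv => h (mkP Pv) | right _ => 0 end.

Lemma hextE h q : hext h (val q) = h q.
Proof.
rewrite /hext; case: pselect => [Pv|/(_ (Pval q))//].
by congr h; apply: val_inj.
Qed.

Lemma hext_mkP h v (Pv : P v) : hext h v = h (mkP Pv).
Proof. by rewrite -hextE. Qed.

Lemma hext_out h v : ~ P v -> hext h v = 0.
Proof. by rewrite /hext; case: pselect. Qed.

Lemma PMn v j : P v -> P (v *+ j).
Proof. by move=> Pv; elim: j => [|j IH]; rewrite ?mulr0n ?mulrSr //; exact: PD. Qed.

Lemma rV_mulrn_inj v : v != 0 -> injective (fun j : nat => v *+ j).
Proof.
move=> v0 i j; rewrite -!scaler_nat => /eqP; rewrite -subr_eq0 -scalerBl scaler_eq0.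
by rewrite (negbTE v0) orbF subr_eq0 eqr_nat => /eqP.
Qed.

(** The series with coefficient F j at z^(j v), described by its values since the sum is
    infinite. *)
Definition isser v F f :=
  (forall q j, val q = v *+ j -> f q = F j) /\
  (forall q, (forall j, val q <> v *+ j) -> f q = 0).

Lemma isser_inj v F f g : isser v F f -> isser v F g -> f = g.
Proof.
move=> [f1 f2] [g1 g2]; apply/funext => q.
case: (pselect (exists j, val q = v *+ j)) => [[j E]|H]; first by rewrite (f1 q j) ?(g1 q j).
by rewrite f2 ?g2 // => j E; apply: H; exists j.
Qed.

Lemma fsbig_mem (T : choiceType) (A : set T) (s : seq T) (H : T -> k) :
  uniq s -> {subset s <= A} -> (forall t : T, A t -> t \notin s -> H t = 0) ->
  \sum_(t \in A) H t = \sum_(t <- s) H t.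
Proof.
move=> us sA H0; rewrite (fsbigE s) // => [|t /= /sA/set_mem //].
by rewrite big_seq_cond [RHS]big_seq; apply: eq_bigl => t; case: (boolP (t \in s)) => //= /sA.
Qed.

Lemma wall_seriesE (n0 : 'rV[int]_n) f c : pstar Gamma n0 != 0 ->
  wall_series n0 f c <->
  isser (pstar Gamma n0) (fun j => if (0 < j)%N then c j else 1) f.
Proof.
move=> v0; set v := pstar Gamma n0; set F := fun j : nat => _.
suff H : isser v F (fun q => zmon k 0 q +
    \sum_(j \in [set j | (0 < j)%N]) c j * zmon k (pstar Gamma n0 *+ j) q).
  split; first by rewrite /wall_series => ->.
  by move=> sf; exact: isser_inj sf H.
split => q.
  move=> j E; rewrite /zmon E; case: j E => [|j] E.
    rewrite mulr0n eqxx fsbig1 ?addr0 // => i i0.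
    rewrite -[X in X == _](mulr0n v) (inj_eq (rV_mulrn_inj v0)).
    by move: i0 => /=; case: i => // i _; rewrite mulr0.
  rewrite -[X in _ == X](mulr0n v) (inj_eq (rV_mulrn_inj v0)) add0r /F /=.
  rewrite (fsbig_mem (s := [:: j.+1])) //; first by rewrite big_seq1 eqxx mulr1.
    by move=> i; rewrite inE => /eqP ->; apply: mem_set.
  move=> i _; rewrite inE => ij; rewrite (inj_eq (rV_mulrn_inj v0)) eq_sym.
  by rewrite (negbTE ij) mulr0.
move=> H; rewrite /zmon fsbig1 ?addr0.
  by case: eqP => // E; case: (H 0%N); rewrite mulr0n.
by move=> j _; case: eqP => [/H//|_]; rewrite mulr0.
Qed.

Lemma isser_mul v F G f g : P v -> v != 0 -> isser v F f -> isser v G g ->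
  isser v (conv F G) (hmul f g).
Proof.
move=> Pv v0 [f1 f2] [g1 g2]; have PM j := PMn j Pv; split => q.
  (* A factorization of z^(m v) contributes only if both exponents lie on the ray. *)
  move=> m E; pose pr (i : nat) : P * P := (mkP (PM i), mkP (PM (m - i)%N)).
  rewrite /hmul (fsbig_mem (s := [seq pr i | i <- iota 0 m.+1])).
  - rewrite big_map /conv -(big_mkord xpredT (fun i => F i * G (m - i)%N)).
    rewrite /index_iota subn0; apply: eq_bigr => i _ /=.
    by rewrite (f1 _ i) // (g1 _ (m - i)%N).
  - rewrite map_inj_in_uniq ?iota_uniq // => i j _ _ /(congr1 (fun t => val t.1)) /=.
    exact: (rV_mulrn_inj v0).
  - move=> _ /mapP [i + ->]; rewrite mem_iota add0n ltnS => /andP [_ im].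
    by apply: mem_set; rewrite /= -mulrnDr subnKC.
  - move=> [x1 x2] /= Ex nin.
    case: (pselect (exists i, val x1 = v *+ i)) => [[i E1]|H]; last first.
      by rewrite f2 ?mul0r // => i Ei; apply: H; exists i.
    case: (pselect (exists j, val x2 = v *+ j)) => [[j E2]|H]; last first.
      by rewrite g2 ?mulr0 // => j Ej; apply: H; exists j.
    have Em : (i + j = m)%N.
      by apply: (rV_mulrn_inj v0); rewrite /= mulrnDr -E1 -E2 -E.
    case/negP: nin; have -> : (x1, x2) = pr i.
      by congr pair; apply: val_inj; rewrite /= ?E1 ?E2 // -Em addKn.
    by apply: (@map_f _ (P * P)%type pr (iota 0 m.+1) i); rewrite mem_iota add0n ltnS -Em leq_addr.
move=> H; rewrite /hmul fsbig1 // => -[x1 x2] /= Ex.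
case: (pselect (exists i, val x1 = v *+ i)) => [[i E1]|H1]; last first.
  by rewrite f2 ?mul0r // => i Ei; apply: H1; exists i.
case: (pselect (exists j, val x2 = v *+ j)) => [[j E2]|H2]; last first.
  by rewrite g2 ?mulr0 // => j Ej; apply: H2; exists j.
by case: (H (i + j)%N); rewrite mulrnDr -E1 -E2; exact: esym Ex.
Qed.

Lemma isser_one v : v != 0 -> isser v ser1 (zmon k 0 : phat).
Proof.
move=> v0; split => q; rewrite /zmon.
  by move=> j ->; rewrite -(mulr0n v) (inj_eq (rV_mulrn_inj v0)).
by move=> H; case: eqP => // E; case: (H 0%N); rewrite mulr0n.
Qed.

Lemma isser_exp v F f j : P v -> v != 0 -> isser v F f -> isser v (spow F j) (hexp f j).
Proof.
move=> Pv v0 sf; elim: j => [|j IH]; first exact: isser_one.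
exact: isser_mul.
Qed.

Lemma isser_inv v F f : P v -> v != 0 -> F 0%N = 1 -> isser v F f ->
  isser v (sinv F) (hinv f).
Proof.
move=> Pv v0 F0 sf; pose T i := ser1 i - F i.
have sT : isser v T (fun p => zmon k 0 p - f p).
  have [z1 z2] := isser_one v0; have [f1 f2] := sf; split => q.
    by move=> j E; rewrite (z1 _ j) ?(f1 _ j).
  by move=> H; rewrite z2 // f2 // subrr.
have T0 : T 0%N = 0 by rewrite /T F0 subrr.
have sP j := isser_exp j Pv v0 sT.
split => q.
  move=> m E; rewrite /hinv (fsbig_mem (s := iota 0 m.+1)).
  - rewrite /sinv -(big_mkord xpredT (fun j => spow T j m)) /index_iota subn0.
    by apply: eq_bigr => j _; have [H1 _] := sP j; rewrite (H1 _ m).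
  - exact: iota_uniq.
  - by move=> j _; apply: mem_set.
  - move=> j _; rewrite mem_iota add0n ltnS /= -ltnNge => mj.
    by have [H1 _] := sP j; rewrite (H1 _ m) // spow_low.
by move=> H; rewrite /hinv fsbig1 // => j _; have [_ H2] := sP j; rewrite H2.
Qed.

Lemma isser_expz v F f a : P v -> v != 0 -> F 0%N = 1 -> isser v F f ->
  isser v (spowz F a) (hexpz f a).
Proof.
move=> Pv v0 F0 sf; case: a => a; first exact: isser_exp.
by apply: isser_exp => //; exact: isser_inv.
Qed.

(* The operator z^m |-> z^m f^(a m), for a linear form a vanishing at v. *)
Lemma hsubst_ser v F f (a : 'rV[rat]_n -> int) h q N : P v -> v != 0 -> F 0%N = 1 ->
  isser v F f -> (forall x j, a (x - v *+ j) = a x) ->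
  (forall j, (N <= j)%N -> ~ P (val q - v *+ j)) ->
  hsubst (fun m : P => hmul (zmon k (val m)) (hexpz f (a (val m)))) h q =
  \sum_(j < N) spowz F (a (val q)) j * hext h (val q - v *+ j).
Proof.
move=> Pv v0 F0 sf aE HN.
(* Multiplication by z^m shifts coefficients; only the m = q - j v in P are left in the sum. *)
have mulE (m : P) g : hmul (zmon k (val m)) g q = hext g (val q - val m).
  case: (pselect (P (val q - val m))) => [Pq|nPq]; last first.
    rewrite hext_out // /hmul fsbig1 // => -[x1 x2] /= Ex; rewrite /zmon.
    case: eqP => [E|_]; last by rewrite mul0r.
    by case: nPq; rewrite -[val q]Ex E addrC addKr; exact: Pval.
  rewrite (hext_mkP _ Pq) /hmul (fsbig_mem (s := [:: (m, mkP Pq)])) //.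
  - by rewrite big_seq1 /zmon eqxx mul1r.
  - by move=> x; rewrite inE => /eqP ->; apply: mem_set => /=; rewrite addrC subrK.
  - move=> [x1 x2] /= Ex nin; rewrite /zmon; case: eqP => [E|_]; last by rewrite mul0r.
    case/negP: nin; rewrite inE; apply/eqP; congr pair; apply: val_inj => //=.
    by rewrite -[val q]Ex E addrC addKr.
rewrite /hsubst.
pose js := [seq j <- iota 0 N | `[< P (val q - v *+ j) >]].
pose mk j : P := match pselect (P (val q - v *+ j)) with
                 | left H => mkP H | right _ => q end.
have valmk j : j \in js -> val (mk j) = val q - v *+ j.
  by rewrite mem_filter /mk => /andP [/asboolP Pj _]; case: pselect.
rewrite (fsbig_mem (s := [seq mk j | j <- js])).
- rewrite big_map big_filter -(big_mkord xpredT (fun j => spowz F (a (val q)) j *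
    hext h (val q - v *+ j))) /index_iota subn0 [RHS](bigID (fun j => `[< P (val q - v *+ j) >])) /=.
  rewrite [X in _ = _ + X]big1 ?addr0; last first.
    by move=> j /asboolPn nP; rewrite hext_out ?mulr0.
  rewrite big_seq_cond [RHS]big_seq_cond; apply: eq_bigr => j /andP [jN Pj].
  have jjs : j \in js by rewrite mem_filter Pj.
  rewrite mulE -(hextE h (mk j)) (valmk j jjs).
  have -> : a (sval (mk j)) = a (sval q) by rewrite [sval _]valmk // aE.
  rewrite mulrC; congr (_ * _).
  rewrite opprB addrC subrK (hext_mkP _ (PMn j Pv)).
  by have [H1 _] := isser_expz (a (val q)) Pv v0 F0 sf; rewrite (H1 _ j).
- rewrite map_inj_in_uniq ?filter_uniq ?iota_uniq // => i j ijs jjs /(congr1 val).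
  by rewrite !valmk // => /addrI/oppr_inj/(rV_mulrn_inj v0).
- by move=> m _; apply: mem_set.
- move=> m _ nin; rewrite mulE; case: (pselect (P (val q - val m))) => [Pq|nPq]; last first.
    by rewrite hext_out ?mulr0.
  rewrite (hext_mkP _ Pq).
  case: (pselect (exists j, val q - val m = v *+ j)) => [[j E]|H]; last first.
    have [_ H2] := isser_expz (a (val m)) Pv v0 F0 sf.
    by rewrite H2 ?mulr0 // => j Ej; apply: H; exists j.
  have Em : val m = val q - v *+ j by rewrite -E opprB addrC subrK.
  have Pm : P (val q - v *+ j) by rewrite -Em; exact: Pval.
  case/negP: nin; apply/mapP.
  have jjs : j \in js.
    rewrite mem_filter mem_iota add0n /=; apply/andP; split; first exact/asboolP.
    by rewrite ltnNge; apply/negP => /HN.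
  by exists j => //; apply: val_inj; rewrite valmk.
Qed.

End RaySeries.

(** * Rational cones *)

Section Cones.
Context {R : realType} {n : nat}.
Implicit Types (m v w : 'rV[R]_n) (x y : 'rV[int]_n).

Definition dot (v w : 'rV[R]_n) : R := (v *m w^T) 0 0.

Lemma dotE v w : dot v w = \sum_i v 0 i * w 0 i.
Proof. by rewrite /dot mxE; apply: eq_bigr => i _; rewrite mxE. Qed.

Lemma dotC v w : dot v w = dot w v.
Proof. by rewrite !dotE; apply: eq_bigr => i _; rewrite mulrC. Qed.

Lemma dotDl v v' w : dot (v + v') w = dot v w + dot v' w.
Proof. by rewrite /dot mulmxDl mxE. Qed.

Lemma dotZl a v w : dot (a *: v) w = a * dot v w.
Proof. by rewrite /dot -scalemxAl mxE. Qed.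

Lemma dotDr v w w' : dot v (w + w') = dot v w + dot v w'.
Proof. by rewrite !(dotC v) dotDl. Qed.

Lemma dotZr a v w : dot v (a *: w) = a * dot v w.
Proof. by rewrite !(dotC v) dotZl. Qed.

Lemma dot0l w : dot 0 w = 0. Proof. by rewrite /dot mul0mx mxE. Qed.
Lemma dot0r v : dot v 0 = 0. Proof. by rewrite dotC dot0l. Qed.

Lemma dotNl v w : dot (- v) w = - dot v w.
Proof. by rewrite -scaleN1r dotZl mulN1r. Qed.

Lemma dotNr v w : dot v (- w) = - dot v w.
Proof. by rewrite dotC dotNl dotC. Qed.

Lemma dot_suml (J : Type) (s : seq J) (p : pred J) (f : J -> 'rV[R]_n) w :
  dot (\sum_(j <- s | p j) f j) w = \sum_(j <- s | p j) dot (f j) w.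
Proof. by elim/big_rec2: _ => [|j a b _ <-]; rewrite ?dot0l ?dotDl. Qed.

(** Induction on the number of generators. If the functional w separating v from the others is
    negative on g0, everything is projected along g0 onto the kernel of w. A combination of the
    projections lifts with a nonnegative coefficient at g0, and a functional u on the projections
    lifts to one vanishing at g0. *)
Lemma farkas r (g : 'I_r -> 'rV[R]_n) v :
  (exists2 a : 'I_r -> R, (forall j, 0 <= a j) & v = \sum_j a j *: g j) \/
  (exists w, (forall j, 0 <= dot (g j) w) /\ dot v w < 0).
Proof.
elim: r g v => [|r IH] g v.
  case: (eqVneq v 0) => [->|nz]; [left|right].
    by exists (fun=> 0) => //; rewrite big_ord0.
  exists (- v); split => [[]//|].
  have : 0 <= dot v v by rewrite dotE sumr_ge0 // => i _; rewrite -expr2 sqr_ge0.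
  rewrite dotNr oppr_lt0 le_eqVlt => /orP [|//]; rewrite eq_sym dotE => v0.
  case/negP: nz; apply/eqP/rowP => i; rewrite mxE; apply/eqP.
  rewrite -sqrf_eq0 expr2; move: v0.
  rewrite psumr_eq0 => [/allP/(_ i (mem_index_enum _))//|j _].
  by rewrite -expr2 sqr_ge0.
pose g0 := g ord0; pose g' j := g (lift ord0 j).
have [[a a0 E]|[w [gw vw]]] := IH g' v.
  left; exists (fun j => if unlift ord0 j is Some j' then a j' else 0).
    by move=> j; case: unliftP.
  rewrite big_ord_recl unlift_none scale0r add0r E.
  by apply: eq_bigr => j _; rewrite liftK.
have [g0w|g0w] := leP 0 (dot g0 w).
  by right; exists w; split => // j; case: (unliftP ord0 j) => [j' ->|->] //; exact: gw.
pose pr v := v - (dot v w / dot g0 w) *: g0.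
have [[a a0 E]|[u [gu vu]]] := IH (fun j => pr (g' j)) (pr v).
  left; pose c := dot v w / dot g0 w - \sum_j a j * (dot (g' j) w / dot g0 w).
  exists (fun j => if unlift ord0 j is Some j' then a j' else c).
    move=> j; case: unliftP => // _; rewrite /c subr_ge0.
    apply: (@le_trans _ _ 0); last by rewrite ltW // nmulr_rgt0 ?invr_lt0.
    apply: sumr_le0 => j' _; apply: mulr_ge0_le0 => //.
    by rewrite mulr_ge0_le0 ?gw // invr_le0 ltW.
  rewrite big_ord_recl unlift_none -/g0.
  have -> : \sum_(i < r) (if unlift ord0 (lift ord0 i) is Some j' then a j' else c) *: g (lift ord0 i)
    = \sum_i a i *: g' i by apply: eq_bigr => j _; rewrite liftK.
  have -> : c *: g0 = (dot v w / dot g0 w) *: g0 - \sum_j (a j * (dot (g' j) w / dot g0 w)) *: g0.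
    by rewrite /c scalerBl scaler_suml.
  have Es : \sum_j a j *: pr (g' j) = \sum_j a j *: g' j -
      \sum_j (a j * (dot (g' j) w / dot g0 w)) *: g0.
    by rewrite -sumrB; apply: eq_bigr => j _; rewrite /pr scalerBr scalerA.
  rewrite -addrA [- _ + _]addrC -Es -E /pr addrC subrK //.
right; pose z := u - (dot g0 u / dot g0 w) *: w.
have dz v' : dot v' z = dot (pr v') u.
  rewrite /z /pr dotDr dotDl dotNr dotNl dotZl dotZr; ring.
exists z; split; last by rewrite dz.
move=> j; rewrite dz; case: (unliftP ord0 j) => [j' ->|->]; first exact: gu.
rewrite -/g0 /pr divff ?lt_eqF // scale1r subrr dot0l //.
Qed.

Definition rv x : 'rV[R]_n := map_mx intr x.

Lemma rvD x y : rv (x + y) = rv x + rv y. Proof. exact: map_mxD. Qed.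
Lemma rvN x : rv (- x) = - rv x. Proof. exact: map_mxN. Qed.
Lemma rv0 : rv 0 = 0. Proof. exact: map_mx0. Qed.
Lemma rvZ (a : int) x : rv (a *: x) = a%:~R *: rv x. Proof. exact: map_mxZ. Qed.
Lemma rv_eq0 x : (rv x == 0) = (x == 0).
Proof.
apply/eqP/eqP => [E|->]; last exact: rv0.
apply/rowP => i; move/rowP: E => /(_ i); rewrite !mxE => /eqP.
by rewrite intr_eq0 => /eqP.
Qed.

Lemma pairing_dot x m : pairing x m = dot (rv x) m. Proof. by []. Qed.

Definition fcone (J : finType) (g : J -> 'rV[int]_n) : set 'rV[R]_n :=
  [set m | exists2 a : J -> R, (forall j, 0 <= a j) & m = \sum_j a j *: rv (g j)].

Lemma fcone_farkas (J : finType) (g : J -> 'rV[int]_n) m : ~ fcone g m ->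
  exists w, (forall j, 0 <= dot (rv (g j)) w) /\ dot m w < 0.
Proof.
move=> nm; have [[a a0 E]|[w [gw mw]]] := farkas (fun i : 'I_#|J| => rv (g (enum_val i))) m.
  case: nm; exists (fun j => a (enum_rank j)) => //.
  rewrite E (reindex enum_rank) /=; last exact/onW_bij/enum_rank_bij.
  by apply: eq_bigr => i _; rewrite enum_rankK.
by exists w; split => // j; have := gw (enum_rank j); rewrite enum_rankK.
Qed.

Lemma fcone_ge0 (J : finType) (g : J -> 'rV[int]_n) w m :
  (forall j, 0 <= dot (rv (g j)) w) -> fcone g m -> 0 <= dot m w.
Proof.
move=> gw [a a0 ->]; rewrite dot_suml sumr_ge0 // => j _.
by rewrite dotZl mulr_ge0.
Qed.

Lemma fconeD (J : finType) (g : J -> 'rV[int]_n) m m' :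
  fcone g m -> fcone g m' -> fcone g (m + m').
Proof.
move=> [a a0 ->] [b b0 ->]; exists (fun j => a j + b j) => [j|]; first exact: addr_ge0.
by rewrite -big_split; apply: eq_bigr => j _; rewrite scalerDl.
Qed.

Lemma fconeZ (J : finType) (g : J -> 'rV[int]_n) c m : 0 <= c ->
  fcone g m -> fcone g (c *: m).
Proof.
move=> c0 [a a0 ->]; exists (fun j => c * a j) => [j|]; first exact: mulr_ge0.
by rewrite scaler_sumr; apply: eq_bigr => j _; rewrite scalerA.
Qed.

Lemma fcone0 (J : finType) (g : J -> 'rV[int]_n) : fcone g 0.
Proof. by exists (fun=> 0) => //; rewrite big1 // => j _; rewrite scale0r. Qed.

Lemma fcone_sum (J : finType) (g : J -> 'rV[int]_n) (I : Type) (s : seq I) (p : pred I)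
  (f : I -> 'rV[R]_n) : (forall i, p i -> fcone g (f i)) -> fcone g (\sum_(i <- s | p i) f i).
Proof.
move=> H; elim/big_rec: _ => [|i a pi Ha]; first exact: fcone0.
by apply: fconeD => //; exact: H.
Qed.

Lemma fcone_gen (J : finType) (g : J -> 'rV[int]_n) j : fcone g (rv (g j)).
Proof.
exists (fun j' => (j' == j)%:R); first by move=> j'; rewrite ler0n.
rewrite (bigD1 j) //= eqxx scale1r big1 ?addr0 // => j' /negbTE ->.
by rewrite scale0r.
Qed.

(** No dimension is prescribed, so half-space cuts, images and intersections stay in this class;
    [Vcone_rational] restores the codimension. *)
Definition Vcone (C : set 'rV[R]_n) :=
  exists (J : finType) (g : J -> 'rV[int]_n), C = fcone g.

Lemma dot_int x y : dot (rv x) (rv y) = (\sum_i x 0 i * y 0 i)%:~R.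
Proof.
by rewrite dotE rmorph_sum; apply: eq_bigr => i _; rewrite /= !mxE intrM.
Qed.

(* A half-space cuts the cone over the generators g in the cone over the g_j with
   h(g_j) >= 0 and the combinations h(g_i) g_j - h(g_j) g_i with h(g_i) >= 0 > h(g_j). *)
Lemma Vcone_half (C : set 'rV[R]_n) y : Vcone C ->
  Vcone [set m | C m /\ 0 <= pairing y m].
Proof.
case=> J [g ->]; pose h j : int := \sum_i y 0 i * g j 0 i.
have hE j : dot (rv y) (rv (g j)) = (h j)%:~R by rewrite dot_int.
pose g' (t : J + J * J) := match t with
  | inl j => if 0 <= h j then g j else 0
  | inr (i, j) => if (0 <= h i) && (h j < 0) then h i *: g j - h j *: g i else 0
  end.
exists (J + J * J)%type, g'; apply/seteqP; split => m /=; last first.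
  move=> [a a0 ->]; split.
    apply: fcone_sum => -[j|[i j]] _; apply: fconeZ => //=; case: ifP => [|_]; rewrite ?rv0;
      try exact: fcone0; first by move=> _; exact: fcone_gen.
    case/andP => hi hj; rewrite rvD rvN !rvZ -scaleNr; apply: fconeD.
      by apply: fconeZ; [rewrite ler0z|exact: fcone_gen].
    by apply: fconeZ; [rewrite oppr_ge0 lerz0 ltW|exact: fcone_gen].
  rewrite pairing_dot dotC dot_suml sumr_ge0 // => -[j|[i j]] _; rewrite dotZl mulr_ge0 //=.
    by case: ifP => hj; rewrite dotC ?hE ?ler0z // rv0 dot0r.
  case: ifP => [/andP [hi hj]|_]; last by rewrite rv0 dot0l.
  rewrite rvD rvN !rvZ dotDl dotNl !dotZl !(dotC _ (rv y)) !hE mulrC subrr //.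
move=> [[a a0 Em] ym].
pose Sp := \sum_(i | 0 <= h i) a i * (h i)%:~R.
pose Sn := \sum_(j | h j < 0) a j * - (h j)%:~R.
have Sp0 : 0 <= Sp by apply: sumr_ge0 => i hi; rewrite mulr_ge0 // ler0z.
have Sn0 : 0 <= Sn by apply: sumr_ge0 => i hi; rewrite mulr_ge0 // oppr_ge0 lerz0 ltW.
have yE : pairing y m = Sp - Sn.
  rewrite pairing_dot Em dotC dot_suml (bigID (fun j => 0 <= h j)) /=; congr (_ + _).
    by apply: eq_bigr => i _; rewrite dotZl dotC hE.
  rewrite /Sn -sumrN; apply: eq_big => [j|j _]; first by rewrite ltNge.
  by rewrite dotZl dotC hE mulrN opprK.
have mE : m = \sum_(i | 0 <= h i) a i *: rv (g i) + \sum_(j | h j < 0) a j *: rv (g j).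
  rewrite Em (bigID (fun j => 0 <= h j)) /=; congr (_ + _).
  by apply: eq_bigl => j; rewrite ltNge.
have gp i : 0 <= h i -> fcone g' (rv (g i)).
  by move=> hi; have := fcone_gen g' (inl i); rewrite /= hi.
have gpn i j : 0 <= h i -> h j < 0 -> fcone g' (rv (h i *: g j - h j *: g i)).
  by move=> hi hj; have := fcone_gen g' (inr (i, j)); rewrite /= hi hj.
have [Spz|Spnz] := eqVneq Sp 0.
  have Snz : Sn = 0 by apply/eqP; rewrite eq_le Sn0 andbT; move: ym; rewrite yE Spz; lra.
  have an j : h j < 0 -> a j = 0.
    move=> hj; move/eqP: Snz; rewrite psumr_eq0; last first.
      by move=> i hi; rewrite mulr_ge0 // oppr_ge0 lerz0 ltW.
    move/allP/(_ j (mem_index_enum _)); rewrite hj /= mulf_eq0 oppr_eq0 intr_eq0.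
    by rewrite (lt_eqF hj) orbF => /eqP.
  rewrite mE [X in _ + X]big1 ?addr0; last by move=> j /an ->; rewrite scale0r.
  by apply: fcone_sum => i hi; apply: fconeZ => //; exact: gp.
have Sp1 : 0 < Sp by rewrite lt_neqAle eq_sym Spnz.
(* Each negative generator is combined with all nonnegative ones in the proportions a_i h_i / Sp.
   What remains of the nonnegative part has weight 1 - Sn / Sp, which is >= 0 because m lies in the
   half-space. *)
have -> : m = (1 - Sn / Sp) *: (\sum_(i | 0 <= h i) a i *: rv (g i)) +
   \sum_(i | 0 <= h i) \sum_(j | h j < 0) (a i * a j / Sp) *: rv (h i *: g j - h j *: g i).
  have -> : \sum_(i | 0 <= h i) \sum_(j | h j < 0) (a i * a j / Sp) *: rv (h i *: g j - h j *: g i)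
     = (Sp / Sp) *: (\sum_(j | h j < 0) a j *: rv (g j)) +
       (Sn / Sp) *: (\sum_(i | 0 <= h i) a i *: rv (g i)).
    have -> : (Sp / Sp) *: (\sum_(j | h j < 0) a j *: rv (g j)) =
        \sum_(i | 0 <= h i) \sum_(j | h j < 0) (a i * a j / Sp * (h i)%:~R) *: rv (g j).
      rewrite /Sp mulr_suml scaler_suml; apply: eq_bigr => i _.
      rewrite scaler_sumr; apply: eq_bigr => j _; rewrite scalerA; congr (_ *: _).
      by rewrite -/Sp; ring.
    have -> : (Sn / Sp) *: (\sum_(i | 0 <= h i) a i *: rv (g i)) =
        \sum_(i | 0 <= h i) \sum_(j | h j < 0) (a i * a j / Sp * - (h j)%:~R) *: rv (g i).
      rewrite /Sn mulr_suml scaler_sumr; apply: eq_bigr => i _.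
      rewrite scalerA mulr_suml scaler_suml; apply: eq_bigr => j _; congr (_ *: _).
      by ring.
    rewrite -big_split; apply: eq_bigr => i _; rewrite -big_split; apply: eq_bigr => j _.
    by rewrite rvD rvN !rvZ scalerBr !scalerA mulrN scaleNr.
  by rewrite divff // scale1r scalerBl scale1r [_ + _ *: _]addrC addrA subrK.
apply: fconeD.
  apply: fconeZ; first by rewrite subr_ge0 ler_pdivrMr // mul1r -subr_ge0 -yE.
  by apply: fcone_sum => i hi; apply: fconeZ => //; exact: gp.
apply: fcone_sum => i hi; apply: fcone_sum => j hj; apply: fconeZ; last exact: gpn.
by rewrite !mulr_ge0 // invr_ge0.
Qed.

Lemma VconeT : Vcone setT.
Proof.
exists ('I_n * bool)%type, (fun t => if t.2 then delta_mx 0 t.1 else - delta_mx 0 t.1).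
apply/seteqP; split => m // _.
exists (fun t => if t.2 then Num.max 0 (m 0 t.1) else Num.max 0 (- m 0 t.1)).
  by move=> [i []] /=; rewrite le_max lexx.
rewrite -(pair_bigA _ (fun i b => (if b then Num.max 0 (m 0 i) else Num.max 0 (- m 0 i)) *:
   rv (if b then delta_mx 0 i else - delta_mx 0 i))) /=.
apply/rowP => l; rewrite summxE (bigD1 l) //= [X in _ = _ + X]big1 ?addr0; last first.
  move=> i il; rewrite summxE big_bool /= !mxE eqxx eq_sym (negbTE il) /=.
  by rewrite ?oppr0 !mulr0 addr0.
rewrite summxE big_bool /= !mxE !eqxx /= mulr1 mulrN1.
by case: (leP 0 (m 0 l)) => h1; case: (leP 0 (- m 0 l)) => h2; lra.
Qed.

Lemma Vcone_halves (s : seq 'rV[int]_n) :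
  Vcone [set m | forall y, y \in s -> 0 <= pairing y m].
Proof.
elim: s => [|y s IH].
  rewrite (_ : mkset _ = setT); first exact: VconeT.
  by apply/seteqP; split.
rewrite (_ : mkset _ = [set m | (forall z, z \in s -> 0 <= pairing z m) /\ 0 <= pairing y m]).
  exact: Vcone_half.
apply/seteqP; split => m /=.
  by move=> H; split => [z zs|]; apply: H; rewrite ?mem_head // in_cons zs orbT.
by move=> [H1 H2] z; rewrite in_cons => /orP [/eqP ->|/H1].
Qed.

Lemma matrix_fcone r (G : 'M[int]_(r, n)) :
  [set m | exists2 a : 'rV[R]_r, forall j, 0 <= a 0 j & m = a *m map_mx intr G] =
  fcone (fun j => row j G).
Proof.
have E (a : 'rV[R]_r) : a *m map_mx intr G = \sum_j a 0 j *: rv (row j G).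
  by rewrite mulmx_sum_row; apply: eq_bigr => j _; rewrite /rv map_row.
apply/seteqP; split => m /=.
  by move=> [a a0 ->]; exists (fun j => a 0 j) => //; rewrite E.
move=> [a a0 ->]; exists (\row_j a j) => [j|]; first by rewrite mxE.
by rewrite E; apply: eq_bigr => j _; rewrite mxE.
Qed.

Lemma rational_cone_Vcone c (C : set 'rV[R]_n) : rational_cone c C -> Vcone C.
Proof. by case=> r [G [_ ->]]; exists 'I_r, (fun j => row j G); exact: matrix_fcone. Qed.

End Cones.

Lemma Vcone_image {R : realType} (n n' : nat) (C : set 'rV[R]_n) (A : 'M[int]_(n, n')) :
  Vcone C -> Vcone [set m | exists2 v, C v & m = v *m map_mx intr A].
Proof.
case=> J [g ->]; exists J, (fun j => g j *m A); apply/seteqP; split => m /=.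
  move=> [_ [a a0 ->] ->]; exists a => //; rewrite mulmx_suml.
  by apply: eq_bigr => j _; rewrite -scalemxAl /rv map_mxM.
move=> [a a0 ->]; exists (\sum_j a j *: rv (g j)); first by exists a.
by rewrite mulmx_suml; apply: eq_bigr => j _; rewrite -scalemxAl /rv map_mxM.
Qed.

(* The intersection is the image of the cone of pairs (a, b) >= 0 with a G = b G'. *)
Lemma Vcone_cap {R : realType} (n : nat) (C C' : set 'rV[R]_n) :
  Vcone C -> Vcone C' -> Vcone (C `&` C').
Proof.
case=> J [g ->] [J' [g' ->]].
pose r := #|J|; pose r' := #|J'|.
pose G : 'M[int]_(r, n) := \matrix_i g (enum_val i).
pose G' : 'M[int]_(r', n) := \matrix_i g' (enum_val i).
pose A : 'M[int]_(r + r', n) := col_mx G 0.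
pose D : 'M[int]_(r + r', n) := col_mx G (- G').
(* Nonnegativity of all coordinates, and the equation a G = b G' as two opposite inequalities per
   column. *)
pose s : seq 'rV[int]_(r + r') := [seq delta_mx 0 i | i <- enum 'I_(r + r')] ++
  [seq (col j D)^T | j <- enum 'I_n] ++ [seq - (col j D)^T | j <- enum 'I_n].
have sP (v : 'rV[R]_(r + r')) : (forall y, y \in s -> 0 <= pairing y v) <->
    (forall i, 0 <= v 0 i) /\ v *m map_mx intr D = 0.
  have pd i : pairing (delta_mx 0 i) v = v 0 i.
    rewrite pairing_dot dotE (bigD1 i) //= !mxE !eqxx mul1r big1 ?addr0 // => j ji.
    by rewrite !mxE eqxx /= (negbTE ji) mul0r.
  have pc j : pairing (col j D)^T v = (v *m map_mx intr D) 0 j.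
    by rewrite pairing_dot dotC dotE [RHS]mxE; apply: eq_bigr => i _; rewrite !mxE.
  split=> [H|[H1 H2] y].
    split=> [i|]; first by rewrite -pd H // mem_cat map_f ?mem_enum.
    apply/rowP => j; rewrite -pc [RHS]mxE; apply/eqP; rewrite eq_le; apply/andP; split.
      rewrite -oppr_ge0; have := H (- (col j D)^T).
      rewrite !pairing_dot rvN dotNl; apply.
      by rewrite !mem_cat (map_f (fun j => - (col j D)^T)) ?mem_enum ?orbT.
    by rewrite H // !mem_cat (map_f (fun j => (col j D)^T)) ?mem_enum ?orbT.
  rewrite !mem_cat => /or3P [] /mapP [j _ ->]; first by rewrite pd.
    by rewrite pc H2 mxE.
  by rewrite pairing_dot rvN dotNl -pairing_dot pc H2 mxE oppr0.
have := Vcone_image A (@Vcone_halves R _ s).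
congr Vcone; apply/seteqP.
have GE (a : 'rV[R]_r) : a *m map_mx intr G = \sum_j a 0 (enum_rank j) *: rv (g j).
  rewrite mulmx_sum_row (reindex enum_rank) /=; last exact/onW_bij/enum_rank_bij.
  by apply: eq_bigr => j _; rewrite -map_row rowK enum_rankK.
have GE' (a : 'rV[R]_r') : a *m map_mx intr G' = \sum_j a 0 (enum_rank j) *: rv (g' j).
  rewrite mulmx_sum_row (reindex enum_rank) /=; last exact/onW_bij/enum_rank_bij.
  by apply: eq_bigr => j _; rewrite -map_row rowK enum_rankK.
have AE (v : 'rV[R]_(r + r')) : v *m map_mx intr A = lsubmx v *m map_mx intr G.
  by rewrite -{1}(hsubmxK v) map_col_mx mul_row_col map_mx0 mulmx0 addr0.
have DE (v : 'rV[R]_(r + r')) : v *m map_mx intr D =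
    lsubmx v *m map_mx intr G - rsubmx v *m map_mx intr G'.
  by rewrite -{1}(hsubmxK v) map_col_mx mul_row_col map_mxN mulmxN.
split => m /=.
  move=> [v /sP [v0 vD] ->]; rewrite AE; split.
    by rewrite GE; exists (fun j => lsubmx v 0 (enum_rank j)) => // j; rewrite mxE.
  move/eqP: vD; rewrite DE subr_eq0 => /eqP ->; rewrite GE'.
  by exists (fun j => rsubmx v 0 (enum_rank j)) => // j; rewrite mxE.
move=> [[a a0 Ea] [b b0 Eb]].
exists (row_mx (\row_i a (enum_val i)) (\row_i b (enum_val i))); last first.
  by rewrite AE row_mxKl GE Ea; apply: eq_bigr => j _; rewrite mxE enum_rankK.
apply/sP; split.
  move=> i; case: (split_ordP i) => j ->.
    by rewrite row_mxEl mxE.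
  by rewrite row_mxEr mxE.
have Ga : \sum_j (\row_i a (enum_val i)) 0 (enum_rank j) *: rv (g j) = m.
  by rewrite Ea; apply: eq_bigr => j _; rewrite mxE enum_rankK.
have Gb : \sum_j (\row_i b (enum_val i)) 0 (enum_rank j) *: rv (g' j) = m.
  by rewrite Eb; apply: eq_bigr => j _; rewrite mxE enum_rankK.
by rewrite DE row_mxKl row_mxKr GE GE' Ga Gb subrr.
Qed.

(** * Neighbourhoods of points in rational cones *)

Section LocalCones.
Context {R : realType} {n : nat}.
Implicit Types (m v w d : 'rV[R]_n) (x y : 'rV[int]_n).

Definition close (ep : R) v v' := forall i, `|v' 0 i - v 0 i| < ep.

Definition locally v (Q : 'rV[R]_n -> Prop) :=
  exists2 ep : R, 0 < ep & forall v', close ep v v' -> Q v'.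

Lemma locally_nbhs v Q : locally v Q <-> (\forall v' \near v, Q v').
Proof.
split.
  move=> [ep ep0 H]; apply/nbhs_ballP; exists ep => //= v' vv'; apply: H => i.
  by have := vv'.2 0 i; rewrite /ball /= distrC.
move/nbhs_ballP => [ep /= ep0 H]; exists ep => // v' vv'; apply: H; split => // i j.
by rewrite (ord1 i) /ball /= distrC; exact: vv'.
Qed.

Lemma locallyW v (Q Q' : 'rV[R]_n -> Prop) : (forall v', Q v' -> Q' v') ->
  locally v Q -> locally v Q'.
Proof. by move=> QQ' [ep ep0 H]; exists ep => // v' /H/QQ'. Qed.

Lemma locallyT v (Q : 'rV[R]_n -> Prop) : (forall v', Q v') -> locally v Q.
Proof. by exists 1. Qed.

Lemma locallyI v (Q Q' : 'rV[R]_n -> Prop) : locally v Q -> locally v Q' ->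
  locally v (fun v' => Q v' /\ Q' v').
Proof.
move=> [ep ep0 H] [ep' ep'0 H']; exists (Num.min ep ep'); first by rewrite lt_min ep0.
move=> v' vv'; split; [apply: H|apply: H'] => i; apply: lt_le_trans (vv' i) _.
  by rewrite ge_min lexx.
by rewrite ge_min lexx orbT.
Qed.

Lemma locally_seq (T : eqType) (s : seq T) v (Q : T -> 'rV[R]_n -> Prop) :
  (forall t, t \in s -> locally v (Q t)) ->
  locally v (fun v' => forall t, t \in s -> Q t v').
Proof.
elim: s => [|t s IH] H; first exact: locallyT.
have := locallyI (H t (mem_head _ _)) (IH (fun t' t's => H t' (mem_behead (s := t :: s) t's))).
by apply: locallyW => v' [H1 H2] t'; rewrite in_cons => /orP [/eqP ->|/H2].
Qed.

Lemma locally_fin (T : finType) v (Q : T -> 'rV[R]_n -> Prop) :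
  (forall t, locally v (Q t)) -> locally v (fun v' => forall t, Q t v').
Proof.
move=> H; have := @locally_seq _ (enum T) v Q (fun t _ => H t).
by apply: locallyW => v' H' t; apply: H'; rewrite mem_enum.
Qed.

Lemma locally_dot (c : R) v w : c < dot v w -> locally v (fun v' => c < dot v' w).
Proof.
move=> cv; pose S := \sum_i `|w 0 i| + 1.
have S0 : 0 < S by apply: ltr_wpDl => //; apply: sumr_ge0 => i _.
exists ((dot v w - c) / S); first by rewrite divr_gt0 // subr_gt0.
move=> v' vv'.
have : `|dot v' w - dot v w| <= (dot v w - c) / S * (\sum_i `|w 0 i|).
  rewrite -dotNl -dotDl dotE.
  rewrite mulr_sumr; apply: le_trans (ler_norm_sum _ _ _) _; apply: ler_sum => i _.
  by rewrite normrM !mxE ler_wpM2r // ltW.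
have lt : (dot v w - c) / S * (\sum_i `|w 0 i|) < dot v w - c.
  rewrite -mulrA gtr_pMr ?subr_gt0 // mulrC ltr_pdivrMr // mul1r /S ltrDl //.
by move/le_lt_trans/(_ lt); rewrite ltr_distl => /andP [H _]; lra.
Qed.

(** A separating functional from Farkas' lemma stays negative nearby. *)
Lemma fcone_closed (J : finType) (g : J -> 'rV[int]_n) m :
  ~ fcone g m -> locally m (fun m' => ~ fcone g m').
Proof.
move/fcone_farkas => [w [gw mw]].
have : 0 < dot m (- w) by rewrite dotNr oppr_gt0.
move/locally_dot; apply: locallyW => m'; rewrite dotNr oppr_gt0 => m'w /(fcone_ge0 gw).
by rewrite leNgt m'w.
Qed.

Definition par x y := forall i j, x 0 i * y 0 j = x 0 j * y 0 i.

(** m lies in a rational subspace of codimension two. There are countably many of these; outside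
    them a point lies on at most one rational hyperplane and, by [singular_in_codim2], on the
    singular locus of no diagram. *)
Definition in_codim2 m := exists x y, [/\ ~ par x y, pairing x m = 0 & pairing y m = 0].

Lemma clear_denominators (q : 'rV[rat]_n) :
  exists (D : int) z, D != 0 /\ map_mx intr z = D%:~R *: q.
Proof.
exists (\prod_i denq (q 0 i)), (\row_i (numq (q 0 i) * \prod_(j | j != i) denq (q 0 j))).
split; first by apply/prodf_neq0 => i _; exact: denq_neq0.
apply/rowP => i; rewrite !mxE [in RHS](bigD1 i) //= !intrM.
have nz : (denq (q 0 i))%:~R != 0 :> rat by rewrite intr_eq0 denq_neq0.
have H (a b c : rat) : b != 0 -> a * c = b * c * (a / b) by move=> b0; field.
by rewrite -[X in _ = _ * X]divq_num_den; exact: H.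
Qed.

Lemma map_ratr_intr p r (G : 'M[int]_(p, r)) :
  map_mx ratr (map_mx intr G : 'M[rat]_(p, r)) = map_mx intr G :> 'M[R]_(p, r).
Proof. by apply/matrixP => i j; rewrite !mxE ratr_int. Qed.

(** Two independent rational vectors are orthogonal to all rows; cleared of denominators they are
    the required witnesses. *)
Lemma rowspan_in_codim2 r (G : 'M[int]_(r, n)) (a : 'rV[R]_r) :
  (\rank (map_mx intr G : 'M[rat]_(r, n)) + 2 <= n)%N -> in_codim2 (a *m map_mx intr G).
Proof.
set Gq : 'M[rat]_(r, n) := map_mx intr G => rk.
pose K := kermx Gq^T.
have [B [EB free]] : exists B : 'M[rat]_(\rank K, n), (B :=: K)%MS /\ row_free B.
  by exists (row_base K); rewrite row_base_free; split => //; exact: eq_row_base.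
have rkK : (1 < \rank K)%N by rewrite mxrank_ker mxrank_tr; lia.
pose i0 : 'I_(\rank K) := Ordinal (ltn_trans (ltnSn 0) rkK).
pose i1 : 'I_(\rank K) := Ordinal rkK.
have ker i : row i B *m Gq^T = 0.
  by apply/sub_kermxP; apply: submx_trans (row_sub _ _) _; rewrite EB.
have vanish (q : 'rV[rat]_n) D z : q *m Gq^T = 0 -> map_mx intr z = D%:~R *: q :> 'rV[rat]_n ->
    pairing z (a *m map_mx intr G) = 0.
  move=> qG zq; rewrite /pairing trmx_mul mulmxA.
  have -> : map_mx intr z *m (map_mx intr G : 'M[R]_(r, n))^T =
      map_mx ratr (map_mx intr z *m Gq^T).
    by rewrite map_mxM -map_trmx !map_ratr_intr.
  by rewrite zq -scalemxAl qG scaler0 map_mx0 mul0mx mxE.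
have [D0 [z0 [D00 E0]]] := clear_denominators (row i0 B).
have [D1 [z1 [D10 E1]]] := clear_denominators (row i1 B).
exists z0, z1; split; [|exact: vanish (ker i0) E0|exact: vanish (ker i1) E1].
move=> pz; have pB i j : B i0 i * B i1 j = B i0 j * B i1 i.
  have e0 i' : (z0 0 i')%:~R = D0%:~R * B i0 i' :> rat by move/rowP/(_ i'): E0; rewrite !mxE.
  have e1 i' : (z1 0 i')%:~R = D1%:~R * B i1 i' :> rat by move/rowP/(_ i'): E1; rewrite !mxE.
  have := congr1 (fun t : int => t%:~R : rat) (pz i j); rewrite !intrM !e0 !e1.
  have nz : D0%:~R * D1%:~R != 0 :> rat by rewrite mulf_neq0 ?intr_eq0.
  move=> E; apply: (mulfI nz); move: E.
  by rewrite !mulrA -[X in X * _]mulrA; nra.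
have inj (u : 'rV_(\rank K)) : u *m B = 0 -> u = 0 by move/eqP; rewrite mulmx_free_eq0 // => /eqP.
have i01 : i0 != i1 by [].
case: (pselect (exists j, B i1 j != 0)) => [[j nz]|H].
  have := inj (B i1 j *: delta_mx 0 i0 - B i0 j *: delta_mx 0 i1).
  have -> : (B i1 j *: delta_mx 0 i0 - B i0 j *: delta_mx 0 i1) *m B = 0 :> 'rV_n.
    apply/rowP => i; rewrite mulmxBl -!scalemxAl -!rowE !mxE.
    by rewrite mulrC pB subrr.
  move/(_ erefl)/rowP/(_ i0); rewrite !mxE !eqxx (negbTE i01) mulr0 subr0 mulr1.
  by move/eqP; rewrite (negbTE nz).
have := inj (delta_mx 0 i1); have -> : (delta_mx 0 i1 : 'rV__) *m B = 0.
  apply/rowP => j; rewrite -rowE !mxE; apply/eqP/negPn/negP => nz; apply: H; by exists j.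
move/(_ erefl)/rowP/(_ i1); rewrite !mxE !eqxx => /eqP; by rewrite oner_eq0.
Qed.

Definition interior_in x (C : set 'rV[R]_n) m := locally m (fun m' => pairing x m' = 0 -> C m').

(** Consider the generators occurring in m with positive coefficient. Either their span has
    codimension at least two, or they span the hyperplane; then a small displacement inside it is
    absorbed by changing these coefficients, which stay positive. *)
Lemma cone_boundary_in_codim2 (C : set 'rV[R]_n) x m : rational_cone 1 C -> x != 0 ->
  (forall m', C m' -> pairing x m' = 0) -> C m -> in_codim2 m \/ interior_in x C m.
Proof.
case=> r [G [rk CE]] x0 Cx; rewrite {1}CE => -[a a0 Em].
pose GS : 'M[int]_(r, n) := \matrix_(i, j) if 0 < a 0 i then G i j else 0.
have aGS (c : 'rV[R]_r) : (forall i, ~~ (0 < a 0 i) -> c 0 i = 0) ->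
    c *m map_mx intr G = c *m map_mx intr GS.
  move=> c0; apply/rowP => j; rewrite !mxE; apply: eq_bigr => i _; rewrite !mxE.
  by case: ifP => // /negbT/c0 ->; rewrite !mul0r.
have {}Em : m = a *m map_mx intr GS.
  rewrite Em; apply: aGS => i; rewrite -leNgt => ai.
  by apply/eqP; rewrite eq_le ai a0.
have [rk2|rk1] := leqP (\rank (map_mx intr GS : 'M[rat]_(r, n)) + 2)%N n.
  by left; rewrite Em; exact: rowspan_in_codim2.
right.
pose GR : 'M[R]_(r, n) := map_mx intr GS.
have rkR : \rank GR = \rank (map_mx intr GS : 'M[rat]_(r, n)).
  by rewrite /GR -map_ratr_intr mxrank_map.
pose X : 'cV[R]_n := (rv x)^T.
have rkX : \rank (kermx X) = n.-1.
  rewrite mxrank_ker mxrank_tr rank_rV rv_eq0 x0 subn1 //.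
have subK : (GR <= kermx X)%MS.
  apply/row_subP => i; apply/sub_kermxP; apply/matrixP => i' j'; rewrite !ord1.
  have -> : (row i GR *m X) 0 0 = dot (row i GR) (rv x) by [].
  rewrite mxE dotC; case: (ltP 0 (a 0 i)) => ai.
    have -> : row i GR = rv (row i G).
      by apply/rowP => j; rewrite !mxE ai.
    apply: (Cx); rewrite CE; exists (delta_mx 0 i); last by rewrite -rowE /rv map_row.
    by move=> j; rewrite mxE ler0n.
  have -> : row i GR = 0 by apply/rowP => j; rewrite !mxE ltNge ai.
  by rewrite dot0r.
have n0 : (0 < n)%N.
  case: (n) x x0 {Cx X rkX subK} => // x; case/negP; apply/eqP/rowP => -[].
  by [].
have eqK : (kermx X <= GR)%MS.
  rewrite -(mxrank_leqif_sup subK).2 eqn_leq (mxrankS subK) /= rkX rkR.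
  by move: rk1; rewrite addn2 ltnS -subn1 leq_subLR add1n.
pose pin := pinvmx GR.
have : locally m (fun m' => forall i, 0 < a 0 i ->
    dot m (col i pin)^T - a 0 i < dot m' (col i pin)^T).
  apply: locally_fin => i; case: (ltP 0 (a 0 i)) => ai; last exact: locallyT.
  have : dot m (col i pin)^T - a 0 i < dot m (col i pin)^T by rewrite gtrBl.
  by move/locally_dot; apply: locallyW.
apply: locallyW => m' H pm'.
have dK : (m' - m <= GR)%MS.
  apply: submx_trans eqK; apply/sub_kermxP; apply/matrixP => i' j'; rewrite !ord1.
  have -> : ((m' - m) *m X) 0 0 = dot (m' - m) (rv x) by [].
  rewrite dotC dotDr dotNr -!pairing_dot pm' Cx ?subr0 ?mxE //.
  by rewrite CE; exists a => //; rewrite Em aGS // => i; rewrite -leNgt => ai;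
    apply/eqP; rewrite eq_le ai a0.
pose b := (m' - m) *m pin.
have Eb : m' - m = b *m GR by rewrite /b mulmxKpV.
pose c : 'rV[R]_r := \row_i if 0 < a 0 i then a 0 i + b 0 i else 0.
rewrite CE; exists c.
  move=> i; rewrite mxE; case: ifP => // ai.
  have -> : b 0 i = dot (m' - m) (col i pin)^T.
    by rewrite /dot trmxK /b !mxE; apply: eq_bigr => j _; rewrite !mxE.
  by rewrite dotDl dotNl; have := H i ai; lra.
rewrite aGS; last by move=> i /negbTE ai; rewrite mxE ai.
have -> : c *m GR = (a + b) *m GR.
  apply/rowP => j; rewrite !mxE; apply: eq_bigr => i _; rewrite !mxE.
  by case: ifP => // _; rewrite !mulr0.
by rewrite mulmxDl -Eb -Em addrC subrK.
Qed.

(* A cone containing a relative neighbourhood of one of its points in the subspace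
   orthogonal to N spans that subspace. *)
Lemma Vcone_rational c (N : 'M[int]_(c, n)) (C : set 'rV[R]_n) m :
  row_free (map_mx intr N : 'M[rat]_(c, n)) -> Vcone C ->
  (forall m', C m' -> m' *m (map_mx intr N)^T = 0) -> C m ->
  locally m (fun m' => m' *m (map_mx intr N)^T = 0 -> C m') -> rational_cone c C.
Proof.
move=> Nfree [J [g CE]] CN Cm loc.
pose G : 'M[int]_(#|J|, n) := \matrix_i g (enum_val i).
have CG : C = [set m | exists2 a : 'rV[R]__, forall j, 0 <= a 0 j & m = a *m map_mx intr G].
  rewrite CE matrix_fcone; apply/seteqP; split => m' /=.
    move=> [a a0 ->]; exists (fun i => a (enum_val i)) => //.
    rewrite (reindex enum_rank) /=; last exact/onW_bij/enum_rank_bij.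
    by apply: eq_bigr => j _; rewrite rowK !enum_rankK.
  move=> [a a0 ->]; exists (fun j => a (enum_rank j)) => //.
  rewrite [LHS](reindex enum_rank) /=; last exact/onW_bij/enum_rank_bij.
  by apply: eq_bigr => j _; rewrite rowK enum_rankK.
exists #|J|, G; split => //.
pose GR : 'M[R]_(_, n) := map_mx intr G; pose NR : 'M[R]_(c, n) := map_mx intr N.
have rkG : \rank GR = \rank (map_mx intr G : 'M[rat]_(_, n)).
  by rewrite /GR -map_ratr_intr mxrank_map.
have rkN : \rank NR = c.
  by rewrite /NR -map_ratr_intr mxrank_map; apply/eqP.
have cn : (c <= n)%N by rewrite -rkN rank_leq_col.
have rkK : \rank (kermx NR^T) = (n - c)%N by rewrite mxrank_ker mxrank_tr rkN.
have s1 : (GR <= kermx NR^T)%MS.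
  apply/row_subP => i; apply/sub_kermxP; apply: CN; rewrite CE.
  rewrite /GR -map_row rowK; exact: fcone_gen.
have CGR m' : C m' -> (m' <= GR)%MS by rewrite CG => -[a _ ->]; exact: submxMl.
have s2 : (kermx NR^T <= GR)%MS.
  apply/row_subP => i.
  have : row i (kermx NR^T) *m NR^T = 0 by apply/sub_kermxP; exact: row_sub.
  move: (row i _) => d dN.
  have [ep ep0 H] := loc.
  pose S := \sum_j `|d 0 j| + 1.
  have S0 : 0 < S by apply: ltr_wpDl => //; apply: sumr_ge0 => j _.
  have Cd : C (m + (ep / S) *: d).
    apply: H; last by rewrite mulmxDl CN // add0r -scalemxAl dN scaler0.
    move=> j; rewrite !mxE addrAC subrr add0r normrM gtr0_norm ?divr_gt0 //.
    rewrite -mulrA gtr_pMr // mulrC ltr_pdivrMr // mul1r /S (bigD1 j) //=.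
    rewrite -addrA ltrDl ltr_wpDl // sumr_ge0 //.
  have -> : d = (ep / S)^-1 *: ((m + (ep / S) *: d) - m).
    by rewrite addrAC subrr add0r scalerA mulVf ?scale1r // gt_eqF // divr_gt0.
  by apply: scalemx_sub; rewrite addmx_sub ?eqmx_opp ?CGR.
rewrite -rkG; have := mxrankS s1; have := mxrankS s2; rewrite rkK => h1 h2.
by have -> : \rank GR = (n - c)%N; [apply/eqP; rewrite eqn_leq h1 h2|rewrite subnK].
Qed.

Lemma par_sym x y : par x y -> par y x.
Proof. by move=> p i j; rewrite mulrC -p mulrC. Qed.

Lemma nonpar_free x y : ~ par x y ->
  row_free (map_mx intr (col_mx x y) : 'M[rat]_(1 + 1, n)).
Proof.
move=> nxy; apply: inj_row_free => u; rewrite map_col_mx -(hsubmxK u) mul_row_col.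
set a := lsubmx u; set b := rsubmx u => E.
have Ei i : a 0 0 * (x 0 i)%:~R + b 0 0 * (y 0 i)%:~R = 0.
  by move/rowP/(_ i): E; rewrite !mxE !big_ord1 !mxE.
have rat_par : (forall i j, (x 0 i)%:~R * (y 0 j)%:~R = (x 0 j)%:~R * (y 0 i)%:~R :> rat) -> False.
  by move=> H; apply: nxy => i j; have := H i j; rewrite -!intrM => /intr_inj.
have a0 : a 0 0 = 0.
  apply/eqP/negPn/negP => nz; apply: rat_par => i j; apply: (mulfI nz).
  by rewrite !mulrA -[a 0 0 * _](addrK (b 0 0 * (y 0 i)%:~R)) Ei
     -[a 0 0 * _](addrK (b 0 0 * (y 0 j)%:~R)) Ei; ring.
have b0 : b 0 0 = 0.
  apply/eqP/negPn/negP => nz; apply: rat_par => i j; apply: (mulfI nz).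
  have ei := Ei i; have ej := Ei j; move: ei ej; rewrite a0 !mul0r !add0r => ei ej.
  by rewrite mulrCA ej [in RHS]mulrCA ei !mulr0.
have -> : a = 0 by apply/matrixP => i j; rewrite !ord1 a0 mxE.
have -> : b = 0 by apply/matrixP => i j; rewrite !ord1 b0 mxE.
exact: row_mx0.
Qed.

End LocalCones.

(** * Generic paths *)

Section GenericParabolas.
Context {R : realType} {n : nat}.
Implicit Types (v w p : 'rV[R]_n) (x y : 'rV[int]_n) (c t tau : R).

Lemma roots_finite (P : {poly R}) : P != 0 -> finite_set [set t | root P t].
Proof.
move=> P0; apply: contrapT => /(infinite_set_fset (size P)) [B sB].
apply/negP; rewrite -ltnNge; apply: max_poly_roots => //; last exact: finmap.fset_uniq.
by apply/allP => t tB; exact: sB.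
Qed.

(** The roots of countably many nonzero polynomials form a countable set, of measure zero, whereas
    the interval has positive measure. *)
Lemma avoid_roots (T : countType) (P : T -> {poly R}) c : 0 < c ->
  (forall i, P i != 0) -> exists2 tau, 0 < tau < c & forall i, ~~ root (P i) tau.
Proof.
move=> c0 P0; apply: contrapT => H.
have cU : countable (\bigcup_(i in [set: T]) [set t | root (P i) t]).
  apply: bigcup_countable; first exact: countableP.
  by move=> i _; apply: finite_set_countable; apply: roots_finite.
have : countable [set` `]0, c[%R].
  apply: sub_countable cU; apply: subset_card_le => t /=; rewrite in_itv /= => tc.
  apply: contrapT => nt; apply: H; exists t => // i; apply/negP => rt.
  by apply: nt; exists i.
move/countable_lebesgue_measure0; rewrite lebesgue_measure_itv /= lte_fin c0.
by rewrite -EFinB => -[] /eqP; rewrite subr0 gt_eqF.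
Qed.

(* A nonzero linear form in p + (tau^(n+1), ..., tau^(2n)) is a nonzero polynomial in tau,
   also after elimination of the time of a parabola; so all but countably many tau are generic. *)
Definition bump_pt tau p : 'rV[R]_n := p + \row_j tau ^+ (n.+1 + j).

Definition lpol w c : {poly R} := c%:P + \sum_j w 0 j *: 'X^(n.+1 + j).

Lemma lpolE w c tau : (lpol w c).[tau] = c + dot w (\row_j tau ^+ (n.+1 + j)).
Proof.
rewrite /lpol hornerD hornerC horner_sum dotE; congr (_ + _).
by apply: eq_bigr => j _; rewrite hornerZ hornerXn mxE.
Qed.

Lemma coef_lpol w c (j : 'I_n) : (lpol w c)`_(n.+1 + j) = w 0 j.
Proof.
rewrite /lpol coefD coefC addSn /= add0r coef_sum (bigD1 j) //= big1 ?addr0.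
  by rewrite coefZ coefXn eqxx mulr1.
move=> i ij; rewrite coefZ coefXn eqSS eqn_add2l.
by rewrite eq_sym (negbTE (_ : i != j :> nat)) ?mulr0.
Qed.

Lemma size_lpol w c : (size (lpol w c) <= (n + n).+1)%N.
Proof.
apply: leq_trans (size_polyD _ _) _; rewrite geq_max; apply/andP; split.
  by rewrite (leq_trans (size_polyC_leq1 _)).
apply: leq_trans (size_sum _ _ _) _; apply/bigmax_leqP => j _.
apply: leq_trans (size_scale_leq _ _) _; rewrite size_polyXn addSn ltnS.
by rewrite -addnS leq_add2l.
Qed.

(** The exponents run from n + 1 to 2n so that the square of a nonconstant [lpol] has degree above
    2n, the largest degree of any [lpol]. *)
Lemma size_lpol_ge w c : w != 0 -> (n.+2 <= size (lpol w c))%N.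
Proof.
move=> w0; have [j wj] : exists j, w 0 j != 0.
  apply: contrapT => H; case/negP: w0; apply/eqP/rowP => j; rewrite mxE; apply/eqP.
  by apply/negPn/negP => wj; apply: H; exists j.
rewrite ltnNge; apply/negP => sz; move: wj; rewrite -(coef_lpol w c j).
by rewrite nth_default ?eqxx // (leq_trans sz) // addSn ltnS leq_addr.
Qed.

Lemma lpol_neq0 w c : w != 0 -> lpol w c != 0.
Proof.
by move=> w0; rewrite -size_poly_gt0 (leq_trans _ (size_lpol_ge c w0)).
Qed.

Definition parab p w1 w2 t : 'rV[R]_n := p + t *: w1 + t ^+ 2 *: w2.

(* A parabola meeting all rational hyperplanes transversally, avoiding all rational
   subspaces of codimension two, with end points on no rational hyperplane. *)
Definition generic_parab p w1 w2 :=
  [/\ forall x, x != 0 -> pairing x (parab p w1 w2 0) != 0,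
      forall x, x != 0 -> pairing x (parab p w1 w2 1) != 0,
      forall x t, x != 0 -> pairing x (parab p w1 w2 t) = 0 ->
        dot (rv x) (w1 + (2 * t) *: w2) != 0
    & forall t, ~ in_codim2 (parab p w1 w2 t)].

(** One [tau] has to serve all pairs in [W], because the two arcs to be compared must keep common
    end points. *)
Lemma generic_parab_exists p (W : seq ('rV[R]_n * 'rV[R]_n)) c : 0 < c ->
  exists2 tau, 0 < tau < c & forall W1, W1 \in W ->
    generic_parab (bump_pt tau p) W1.1 W1.2.
Proof.
move=> c0.
pose a (i : nat) x := dot (rv x) (nth (0, 0) W i).2.
pose b (i : nat) x := dot (rv x) (nth (0, 0) W i).1.
pose C x := lpol (rv x) (dot (rv x) p).
(* [Q1] and [Q2] are the values at the two end points, [Q3] is the discriminant in t, whose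
   vanishing means tangency, and [Q4] is the resultant in t of two such quadratics, whose vanishing
   means a common zero. The value 1 fills the cases without a condition. *)
pose Q1 x := if x == 0 then 1 else C x.
pose Q2 i x := if x == 0 then 1 else C x + (a i x + b i x)%:P.
pose Q3 i x := if (x == 0) || (a i x == 0) then 1 else (b i x ^+ 2)%:P - (4 * a i x) *: C x.
pose Q4 i x y := if `[< par x y >] then 1 else
   if (a i x == 0) && (a i y == 0) then
     if (b i x == 0) && (b i y == 0) then 1 else b i x *: C y - b i y *: C x
   else (a i x *: C y - a i y *: C x) ^+ 2 -
        (a i x * b i y - a i y * b i x) *: (b i x *: C y - b i y *: C x).
have linC u u' x y : u *: C x - u' *: C y =
    lpol (u *: rv x - u' *: rv y) (u * dot (rv x) p - u' * dot (rv y) p).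
  rewrite /C /lpol !scalerDr opprD addrACA; congr (_ + _).
    by rewrite -!mul_polyC -!polyCM -polyCB.
  rewrite !scaler_sumr -sumrB; apply: eq_bigr => j _.
  by rewrite !mxE scalerBl !scalerA.
have nz_par (u u' : R) x y : ~ par x y -> (u != 0) || (u' != 0) -> u *: rv x - u' *: rv y != 0.
  move=> nxy uu; apply/negP => /eqP E; apply: nxy => l j.
  have Ei l' : u * (x 0 l')%:~R = u' * (y 0 l')%:~R.
    by apply/eqP; rewrite -subr_eq0; move/rowP/(_ l'): E; rewrite !mxE => ->.
  suff : (x 0 l)%:~R * (y 0 j)%:~R = (x 0 j)%:~R * (y 0 l)%:~R :> R.
    by rewrite -!intrM => /intr_inj.
  case/orP: uu => nz; apply: (mulfI nz); first by rewrite !mulrA !Ei; ring.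
  by rewrite [LHS]mulrCA -Ei [RHS]mulrCA -Ei; ring.
pose P (t : nat * 'rV[int]_n * 'rV[int]_n) : {poly R} :=
  Q1 t.1.2 * Q2 t.1.1 t.1.2 * Q3 t.1.1 t.1.2 * Q4 t.1.1 t.1.2 t.2.
have P0 s : P s != 0.
  case: s => [[i x] y]; rewrite /P /= !mulf_eq0 !negb_or -!andbA; apply/and4P; split.
  - by rewrite /Q1; case: (x =P 0) => [_|/eqP x0]; rewrite ?oner_neq0 // lpol_neq0 ?rv_eq0.
  - rewrite /Q2; case: (x =P 0) => [_|/eqP x0]; rewrite ?oner_neq0 //.
    have -> : C x + (a i x + b i x)%:P = lpol (rv x) (dot (rv x) p + (a i x + b i x)).
      by rewrite /C /lpol addrAC -polyCD.
    by rewrite lpol_neq0 ?rv_eq0.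
  - rewrite /Q3; case: (x =P 0) => [_|/eqP x0] /=; first by rewrite oner_neq0.
    case: (a i x =P 0) => [_|/eqP a0]; first by rewrite oner_neq0.
    have -> : (b i x ^+ 2)%:P - (4 * a i x) *: C x =
        lpol (- (4 * a i x) *: rv x) (b i x ^+ 2 - 4 * a i x * dot (rv x) p).
      rewrite /C /lpol scalerDr opprD addrA; congr (_ + _).
        by rewrite -mul_polyC -polyCM -polyCB.
      rewrite scaler_sumr -sumrN; apply: eq_bigr => j _.
      by rewrite !mxE scalerA -scaleNr mulNr.
    rewrite lpol_neq0 // scaler_eq0 oppr_eq0 !mulf_eq0 (negbTE a0) rv_eq0 (negbTE x0).
    by rewrite pnatr_eq0.
  - rewrite /Q4; case: asboolP => [_|nxy]; first by rewrite oner_neq0.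
    case: ifP => [_|/negbT aa].
      case: ifP => [_|/negbT bb]; first by rewrite oner_neq0.
      rewrite linC lpol_neq0 // nz_par //; last by rewrite orbC -negb_and andbC.
      by move=> /par_sym.
    have nyx : ~ par y x by move=> /par_sym.
    set F := _ *: C y - _; set G := _ *: C y - _.
    have sF : (n.+2 <= size F)%N.
      rewrite /F linC size_lpol_ge // nz_par //; by rewrite -negb_and.
    have F0 : F != 0 by rewrite -size_poly_gt0 (leq_trans _ sF).
    (* If the resultant vanished, F^2 would be a scalar multiple of G, but F^2 has degree at least
       2n + 2 and G at most 2n. *)
    apply/negP; rewrite subr_eq0 => /eqP E.
    have : (size (F ^+ 2) <= (n + n).+1)%N.
      rewrite E; apply: leq_trans (size_scale_leq _ _) _.
      by rewrite /G linC size_lpol.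
    rewrite expr2 size_mul //; move: sF; move: (size _) => sz; clear; lia.
have [tau tc H] := avoid_roots c0 P0.
exists tau => // W1 /(nthP (0, 0)) [i iW <-].
set p' := bump_pt tau p.
have Cx x : (C x).[tau] = dot (rv x) p'.
  by rewrite /C lpolE /p' /bump_pt dotDr.
have Qs x y : [/\ (Q1 x).[tau] != 0, (Q2 i x).[tau] != 0, (Q3 i x).[tau] != 0 & (Q4 i x y).[tau] != 0].
  have := H (i, x, y); rewrite /root /P /= !hornerM !mulf_eq0 !negb_or -!andbA.
  by case/and4P.
have gE x t : pairing x (parab p' (nth (0, 0) W i).1 (nth (0, 0) W i).2 t) =
    dot (rv x) p' + t * b i x + t ^+ 2 * a i x.
  by rewrite pairing_dot /parab !dotDr !dotZr.
have e0 x : x != 0 -> dot (rv x) p' != 0.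
  by move=> x0; have [+ _ _ _] := Qs x x; rewrite /Q1 (negbTE x0) Cx.
split.
- by move=> x x0; rewrite gE expr0n /= !mul0r !addr0; exact: e0.
- move=> x x0; rewrite gE expr1n !mul1r; have [_ + _ _] := Qs x x.
  by rewrite /Q2 (negbTE x0) hornerD hornerC Cx [a i x + _]addrC addrA.
- move=> x t x0; rewrite gE => g0; rewrite dotDr dotZr -/(a i x) -/(b i x).
  apply/negP => /eqP d0.
  case: (eqVneq (a i x) 0) => [az|anz].
    move: d0 g0; rewrite az mulr0 addr0 => ->; rewrite !mulr0 !addr0 => /eqP.
    by rewrite (negbTE (e0 x x0)).
  have [_ _ + _] := Qs x x; rewrite /Q3 (negbTE x0) (negbTE anz) /=.
  rewrite hornerD hornerC hornerN hornerZ Cx => /negP; apply; apply/eqP.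
  have -> : b i x = - (2 * t * a i x) by move: d0; lra.
  have -> : dot (rv x) p' = - (t * b i x + t ^+ 2 * a i x) by move: g0; lra.
  have -> : b i x = - (2 * t * a i x) by move: d0; lra.
  by ring.
move=> t [x [y [nxy]]]; rewrite !gE => gx gy.
have x0 : x != 0 by apply/eqP => x0; apply: nxy => l j; rewrite x0 !mxE !mul0r.
have [_ _ _] := Qs x y; rewrite /Q4; case: asboolP => // _.
case: ifP => [/andP [/eqP ax /eqP ay]|_].
  case: ifP => [/andP [/eqP bx /eqP by_]|_].
    by move: gx; rewrite ax bx !mulr0 !addr0 => /eqP; rewrite (negbTE (e0 x x0)).
  rewrite hornerD hornerN !hornerZ !Cx => /negP; apply; apply/eqP.
  move: gx gy; rewrite ax ay !mulr0 !addr0 => gx gy.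
  have -> : dot (rv x) p' = - (t * b i x) by lra.
  have -> : dot (rv y) p' = - (t * b i y) by lra.
  by ring.
have hl (u u' : R) x' y' : (u *: C x' - u' *: C y').[tau] =
    u * dot (rv x') p' - u' * dot (rv y') p' by rewrite hornerD hornerN !hornerZ !Cx.
rewrite hornerD hornerN horner_exp hornerZ !hl => /negP; apply; apply/eqP.
have -> : dot (rv x) p' = - (t * b i x + t ^+ 2 * a i x) by move: gx; lra.
have -> : dot (rv y) p' = - (t * b i y + t ^+ 2 * a i y) by move: gy; lra.
by ring.
Qed.

End GenericParabolas.

(** * Smoothness and transversality of curves *)

Section Curves.
Context {R : realType} {n : nat}.
Implicit Types (v w p : 'rV[R]_n) (t : R) (gamma : R -> 'rV[R]_n).

Lemma parab_is_derive p w1 w2 t :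
  is_derive t 1 (parab p w1 w2) (w1 + (2 * t) *: w2).
Proof.
have cv : (fun h : R => h^-1 *: ((parab p w1 w2 \o shift t) (h *: 1) - parab p w1 w2 t))
    @ 0^' --> w1 + (2 * t) *: w2.
  apply: cvg_trans (_ : (fun h : R => w1 + (2 * t + h) *: w2) @ 0^' --> _).
    apply: near_eq_cvg; near=> h.
    have h0 : h != 0 by near: h; exact: nbhs_dnbhs_neq.
    rewrite /= /parab /shift /= scaler1.
    have -> : p + (h + t) *: w1 + (h + t) ^+ 2 *: w2 - (p + t *: w1 + t ^+ 2 *: w2) =
        h *: (w1 + (2 * t + h) *: w2).
      by apply/rowP => i; rewrite !mxE; ring.
    by rewrite scalerA mulVf // scale1r.
  rewrite -[X in _ --> w1 + X *: w2]addr0.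
  apply: cvgD; first exact: cvg_cst.
  apply: cvgZr_tmp; apply: cvgD; first exact: cvg_cst.
  exact: cvg_within.
split; first by apply/cvg_ex; exists (w1 + (2 * t) *: w2).
by apply: cvg_lim.
Unshelve. all: by end_near.
Qed.

Lemma derive1_parab p w1 w2 t : derive1 (parab p w1 w2) t = w1 + (2 * t) *: w2.
Proof. by rewrite derive1E; have [_ ->] := parab_is_derive p w1 w2 t. Qed.

Lemma parab_smooth p w1 w2 i t : derivable (derive1n i (parab p w1 w2)) t 1.
Proof.
have H : exists q u1 u2, derive1n i (parab p w1 w2) = parab q u1 u2.
  elim: i => [|i [q [u1 [u2 IH]]]]; first by exists p, w1, w2.
  exists u1, (2 *: u2), 0; rewrite derive1nS IH; apply/funext => s.
  by rewrite derive1_parab /parab scaler0 addr0 scalerA mulrC.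
have [q [u1 [u2 ->]]] := H.
by have [] := parab_is_derive q u1 u2 t.
Qed.

Lemma curve_locally gamma t (Q : 'rV[R]_n -> Prop) : derivable gamma t 1 ->
  locally (gamma t) Q -> exists2 ep : R, 0 < ep & forall s, `|s - t| < ep -> Q (gamma s).
Proof.
move=> /derivable1_diffP/differentiable_continuous ct /locally_nbhs /ct /nbhs_ballP.
move=> [ep /= ep0 H]; exists ep => // s st; apply: H.
by rewrite /ball /= distrC.
Qed.

(** The difference quotient of <w, gamma> tends to a nonzero limit, so the zero at t is isolated. *)
Lemma curve_transversal gamma t w : derivable gamma t 1 -> dot w (gamma t) = 0 ->
  dot w (derive1 gamma t) != 0 ->
  exists2 ep : R, 0 < ep & forall s, s != t -> `|s - t| < ep -> dot w (gamma s) != 0.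
Proof.
move=> dg wt wd.
have cv : (fun h : R => h^-1 *: ((gamma \o shift t) (h *: 1) - gamma t)) @ 0^' --> derive1 gamma t.
  by rewrite derive1E; exact: dg.
have : locally (derive1 gamma t) (fun v => dot v w != 0).
  rewrite dotC in wd; case: (ltgtP (dot (derive1 gamma t) w) 0) => [|lt|E].
  - rewrite -oppr_gt0 -dotNr => /locally_dot; apply: locallyW => v.
    by rewrite dotNr oppr_gt0 => /lt_eqF ->.
  - by move/locally_dot: lt; apply: locallyW => v /gt_eqF ->.
  - by rewrite E eqxx in wd.
move=> /locally_nbhs /cv; rewrite /nbhs /= => /nbhs_ballP [ep /= ep0 H].
exists ep => // s st se; have := H (s - t).
rewrite /ball /= sub0r normrN => /(_ se); rewrite subr_eq0 => /(_ st).
rewrite scaler1 /shift /= subrK dotC dotZr dotDr dotNr wt subr0.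
by rewrite mulf_eq0 negb_or => /andP [].
Qed.

End Curves.

(** * The lattice of a seed *)

Section SeedLattice.
Context {n : nat} (Gamma : fixed_data n) (e : 'I_n -> 'rV[int]_n).
Hypothesis FD : is_fixed_data Gamma.
Hypothesis INJ : injectivity_assumption Gamma.
Hypothesis SEED : is_seed Gamma e.
Implicit Types (x y : 'rV[int]_n).

Local Notation Np := (Nplus Gamma e).
Local Notation form := (@Defs.form n).

Lemma coord_exists x : exists a : 'I_n -> int, x = \sum_j a j *: e j.
Proof.
have [[_ _ sp] _ _] := SEED; have [a ->] := sp x I.
by exists a; apply: eq_bigl => j; rewrite inE.
Qed.

Definition coord x : 'I_n -> int := projT1 (cid (coord_exists x)).

Lemma coordE x : x = \sum_j coord x j *: e j.
Proof. exact: projT2 (cid (coord_exists x)). Qed.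

Lemma coord_uniq (a : 'I_n -> int) j : coord (\sum_j a j *: e j) j = a j.
Proof.
have [[_ ind _] _ _] := SEED; apply/eqP; rewrite -subr_eq0; apply/eqP.
apply: (ind (fun j => coord (\sum_j a j *: e j) j - a j)); last by rewrite inE.
rewrite (eq_bigl xpredT) => [|i]; last by rewrite inE.
under eq_bigr do rewrite scalerBl.
by rewrite sumrB -coordE subrr.
Qed.

Lemma coordD x y j : coord (x + y) j = coord x j + coord y j.
Proof.
rewrite {1}(coordE x) {1}(coordE y) -big_split /=.
by under eq_bigr do rewrite -scalerDl; rewrite coord_uniq.
Qed.

Lemma coordZ (a : int) x j : coord (a *: x) j = a * coord x j.
Proof.
rewrite {1}(coordE x) scaler_sumr.
by under eq_bigr do rewrite scalerA; rewrite coord_uniq.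
Qed.

Definition deg x : int := \sum_(i in Iuf Gamma) coord x i.

Lemma degD : {morph deg : x y / x + y}.
Proof. by move=> x y; rewrite /deg -big_split; apply: eq_bigr => i _; rewrite coordD. Qed.

Lemma degMn x j : deg (x *+ j) = deg x *+ j.
Proof. exact: (linMn degD). Qed.

Lemma deg0 : deg 0 = 0. Proof. exact: (lin0 degD). Qed.

Lemma has_degree_coord x d : has_degree Gamma e x d ->
  (forall i, 0 <= coord x i) /\ (forall i, i \notin Iuf Gamma -> coord x i = 0) /\ deg x = d%:Z.
Proof.
case=> a [Ex Ed]; pose b (j : 'I_n) : int := if j \in Iuf Gamma then (a j)%:Z else 0.
have {}Ex : x = \sum_j b j *: e j.
  rewrite Ex big_mkcond; apply: eq_bigr => j _; rewrite /b; case: ifP => _; last by rewrite scale0r.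
  by rewrite -scaler_nat natz.
have cb j : coord x j = b j by rewrite Ex coord_uniq.
split => [i|]; first by rewrite cb /b; case: ifP.
split => [i /negbTE iI|]; first by rewrite cb /b iI.
rewrite /deg (eq_bigr (fun i => (a i)%:Z)) => [|i iI]; last by rewrite cb /b iI.
by rewrite Ed; elim/big_rec2: _ => // i y1 y2 _ ->; rewrite PoszD.
Qed.

Lemma NpP x : Np x <-> [/\ forall i, 0 <= coord x i,
  forall i, i \notin Iuf Gamma -> coord x i = 0 & 0 < deg x].
Proof.
split.
  by move=> [d d0 /has_degree_coord [? [? ->]]]; split.
move=> [c0 cI d0]; exists (absz (deg x)); first by rewrite absz_gt0 gt_eqF.
exists (fun i => absz (coord x i)); split.
  rewrite {1}(coordE x) [RHS]big_mkcond; apply: eq_bigr => j _.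
  case: ifP => [_|/negbT/cI ->]; last by rewrite scale0r.
  by rewrite -scaler_nat natz gez0_abs.
apply/eqP; rewrite -eqz_nat gtz0_abs //; apply/eqP.
rewrite /deg; elim/big_rec2: _ => // i y1 y2 _ ->.
by rewrite PoszD gez0_abs.
Qed.

Lemma Np_deg x : Np x -> 0 < deg x. Proof. by case/NpP. Qed.

Lemma Np_neq0 x : Np x -> x != 0.
Proof. by move/Np_deg => H; apply/eqP => E; rewrite E deg0 in H. Qed.

Lemma NpD x y : Np x -> Np y -> Np (x + y).
Proof.
move=> /NpP [a1 a2 a3] /NpP [b1 b2 b3]; apply/NpP; split.
- by move=> i; rewrite coordD addr_ge0.
- by move=> i iI; rewrite coordD a2 ?b2.
- by rewrite degD addr_gt0.
Qed.

Lemma NpMn x j : (0 < j)%N -> Np x -> Np (x *+ j).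
Proof.
case: j => // j _ Nx; elim: j => [|j IH]; first by rewrite mulr1n.
by rewrite mulrSr; apply: NpD.
Qed.

Lemma Np_degree x : Np x -> has_degree Gamma e x (absz (deg x)).
Proof.
move=> Nx; have [d d0 hd] := Nx; have [_ [_ ->]] := has_degree_coord hd.
by rewrite absz_nat.
Qed.

Lemma sublattice_sum (A : set 'rV[int]_n) (I : Type) (s : seq I) (p : pred I)
    (f : I -> 'rV[int]_n) (a : I -> int) : sublattice A -> (forall i, p i -> A (f i)) ->
  A (\sum_(i <- s | p i) a i *: f i).
Proof.
move=> [A0 AB] Af.
have AN x : A x -> A (- x) by move=> Ax; rewrite -sub0r; exact: AB.
have AD x y : A x -> A y -> A (x + y) by move=> Ax Ay; rewrite -[y]opprK; apply: AB; last exact: AN.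
have AMn x j : A x -> A (x *+ j).
  by move=> Ax; elim: j => [|j IH]; rewrite ?mulr0n // mulrSr; exact: AD.
elim/big_rec: _ => // i x pi Ax; apply: AD => //.
case: (a i) => j; first by rewrite -natz scaler_nat; apply/AMn/Af.
by rewrite NegzE scaleNr -natz scaler_nat; apply/AN/AMn/Af.
Qed.

Lemma Np_Nuf x : Np x -> Nuf Gamma x.
Proof.
move=> /NpP [_ cI _]; rewrite (coordE x) (bigID (mem (Iuf Gamma))) /=.
rewrite [X in _ + X]big1 ?addr0; last by move=> i /cI ->; rewrite scale0r.
have [[_ sl _ _] _ _ _ _] := FD; have [_ [eN _ _] _] := SEED.
by apply: sublattice_sum.
Qed.

Lemma pstarD x y : pstar Gamma (x + y) = pstar Gamma x + pstar Gamma y.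
Proof. by rewrite /pstar map_mxD mulmxDl. Qed.

Lemma pstarMn x j : pstar Gamma (x *+ j) = pstar Gamma x *+ j.
Proof. exact: (linMn pstarD). Qed.

Lemma pstar0 : pstar Gamma 0 = 0. Proof. exact: (lin0 pstarD). Qed.

Lemma pstar_neq0 x : Np x -> pstar Gamma x != 0.
Proof.
move=> Nx; apply/eqP => E; case/negP: (Np_neq0 Nx); apply/eqP.
have [[_ [N0 _] _ _] _ _ _ _] := FD.
by apply: INJ; rewrite ?E ?pstar0 //; exact: Np_Nuf.
Qed.

Lemma pairingDl (F : fieldType) (m : 'rV[F]_n) : {morph (fun x => pairing x m) : x y / x + y}.
Proof. by move=> x y; rewrite /pairing map_mxD mulmxDl mxE. Qed.

Lemma pairingDr (F : fieldType) x (m m' : 'rV[F]_n) :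
  pairing x (m + m') = pairing x m + pairing x m'.
Proof. by rewrite /pairing linearD mulmxDr mxE. Qed.

Lemma pairingMn (F : fieldType) x (m : 'rV[F]_n) j : pairing x (m *+ j) = pairing x m *+ j.
Proof. exact: (linMn (@pairingDr F x)). Qed.

Lemma form_pairing x y : form Gamma x y = pairing y (pstar Gamma x).
Proof.
rewrite /form /pairing -/(pstar Gamma x) -[LHS]/((pstar Gamma x *m (map_mx intr y)^T) 0 0).
by rewrite !mxE; apply: eq_bigr => i _; rewrite !mxE mulrC.
Qed.

Lemma form_skew x y : form Gamma x y = - form Gamma y x.
Proof. by have [[-> _ _ _] _ _ _ _] := FD. Qed.

Lemma formDl z : {morph (form Gamma)^~ z : x y / x + y}.
Proof. by move=> x y; rewrite /form map_mxD !mulmxDl mxE. Qed.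

Lemma linear_pairing (F : fieldType) (f : 'rV[int]_n -> F) :
  {morph f : x y / x + y} -> forall x, pairing x (\row_l f (delta_mx 0 l)) = f x.
Proof.
move=> fD x; rewrite {2}(row_sum_delta x) /pairing mxE.
have -> : f (\sum_(j < n) x 0 j *: delta_mx 0 j) = \sum_j f (x 0 j *: delta_mx 0 j).
  by elim/big_rec2: _ => [|i a b _ <-]; rewrite ?(lin0 fD) ?fD.
apply: eq_bigr => l _; rewrite !mxE; case: (x 0 l) => j.
  by rewrite -[in RHS]natz scaler_nat (linMn fD) mulr_natl.
by rewrite NegzE scaleNr -[in RHS]natz scaler_nat (linN fD) (linMn fD) mulrNz mulNr -pmulrn mulr_natl.
Qed.

Definition base (K : nat) : seq 'rV[int]_n :=
  undup [seq x <- [seq \sum_i (f i : nat)%:Z *: e i | f : {ffun 'I_n -> 'I_K.+1}] |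
    `[< Np x /\ deg x <= K%:Z >]].

Lemma base_uniq K : uniq (base K). Proof. exact: undup_uniq. Qed.

Lemma mem_base K x : x \in base K <-> Np x /\ deg x <= K%:Z.
Proof.
rewrite mem_undup mem_filter; split; first by case/andP => /asboolP.
move=> [Nx xK]; apply/andP; split; first exact/asboolP.
have [c0 cI d0] := (NpP x).1 Nx.
have cK i : (absz (coord x i) < K.+1)%N.
  rewrite ltnS -lez_nat gez0_abs //; apply: le_trans xK.
  case: (boolP (i \in Iuf Gamma)) => iI; last by rewrite cI // ltW.
  by rewrite /deg (bigD1 i) //= lerDl sumr_ge0.
apply/mapP; exists [ffun i => Ordinal (cK i)]; first by rewrite mem_enum.
by rewrite {1}(coordE x); apply: eq_bigr => i _; rewrite ffunE /= gez0_abs.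
Qed.

Lemma Np_scale_inv (a : int) y : Np (a *: y) -> 0 < a -> Np y.
Proof.
move=> /NpP [c0 cI d0] a0; apply/NpP; split.
- by move=> i; have := c0 i; rewrite coordZ pmulr_rge0.
- by move=> i /cI; rewrite coordZ => /eqP; rewrite mulf_eq0 gt_eqF //= => /eqP.
- move: d0; rewrite /deg; under eq_bigr do rewrite coordZ.
  by rewrite -mulr_sumr pmulr_rgt0.
Qed.

Lemma degZ (a : int) y : deg (a *: y) = a * deg y.
Proof. by rewrite /deg mulr_sumr; apply: eq_bigr => i _; rewrite coordZ. Qed.

Lemma primitive_part x : Np x ->
  exists n0 i, [/\ primitive n0, Np n0, (0 < i)%N & x = n0 *+ i].
Proof.
have [N] := ubnP (absz (deg x)); elim: N x => // N IH x xN Nx.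
case: (pselect (primitive x)) => [px|npx].
  by exists x, 1%N; split.
have [a [y [Ex a1]]] : exists a y, x = a *: y /\ `|a| <> 1.
  apply: contrapT => H; apply: npx; split; first exact: Np_neq0.
  by move=> a y Ex; apply: contrapT => a1; apply: H; exists a, y.
have x0 := Np_neq0 Nx.
have [b [z [Ez b1]]] : exists b z, x = b *: z /\ 1 < b.
  have a0 : a != 0 by apply/eqP => a0; move: x0; rewrite Ex a0 scale0r eqxx.
  case: (ltP 0 a) => [a_gt0|a_le0].
    by exists a, y; split => //; move: a1; rewrite gtr0_norm //; lia.
  exists (- a), (- y); split; first by rewrite scaleNr scalerN opprK.
  by move: a1; rewrite ler0_norm //; lia.
have b0 : 0 < b by apply: lt_trans b1.
have Nz : Np z by apply: (@Np_scale_inv b) => //; rewrite -Ez.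
have dz := Np_deg Nz.
have [|n0 [i [p0 N0 i0 Ez']]] := IH z _ Nz.
  have : deg x = b * deg z by rewrite Ez degZ.
  have : deg z < b * deg z by rewrite ltr_pMl.
  by move: xN dz; clear; lia.
exists n0, (i * absz b)%N; split => //; first by rewrite muln_gt0 i0 absz_gt0 gt_eqF.
by rewrite Ez Ez' mulrnA -[in RHS]scaler_nat natz gtz0_abs.
Qed.

(** After division by gcd(a, b), Gauss' lemma shows that a divides all entries of n0; primitivity
    then makes it 1. *)
Lemma primitive_div n0 x (a b : nat) : primitive n0 -> (0 < a)%N -> x *+ a = n0 *+ b ->
  exists c, x = n0 *+ c /\ b = (a * c)%N.
Proof.
move=> [n00 pn] a0 E; pose g := gcdn a b.
have g0 : (0 < g)%N by rewrite gcdn_gt0 a0.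
have [a' Ea] : exists a', a = (a' * g)%N by apply/dvdnP; exact: dvdn_gcdl.
have [b' Eb] : exists b', b = (b' * g)%N by apply/dvdnP; exact: dvdn_gcdr.
have cop : coprime a' b'.
  by rewrite /coprime -(eqn_pmul2r g0) mul1n muln_gcdl -Ea -Eb.
have a'0 : (0 < a')%N by case: (a') Ea a0 => // ->.
have {}E : x *+ a' = n0 *+ b'.
  apply/rowP => l; move/rowP/(_ l): E; rewrite Ea Eb !mulrnA !mulmxnE => E.
  apply: (mulIf (x := g%:R)); last by rewrite !mulr_natr.
  by rewrite pnatr_eq0 -lt0n.
have [y Ey] : exists y, n0 = a'%:Z *: y.
  exists (\row_(l < n) (n0 0%R l %/ a'%:Z)%Z); apply/rowP => l; rewrite !mxE mulrC divzK //.
  rewrite -(@Gauss_dvdzr _ b'%:Z) //; apply/dvdzP; exists (x 0 l).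
  move/rowP/(_ l): E; rewrite !mulmxnE -(mulr_natr (x 0 l)) -(mulr_natr (n0 0 l)) !natz => E.
  by rewrite mulrC -E.
have /eqP := pn _ _ Ey; rewrite -[1]/(1%:Z) eqz_nat => /eqP a'1.
rewrite absz_nat in a'1; exists b'; rewrite a'1 mulr1n in E; split => //.
by rewrite Ea a'1 mul1n mulnC.
Qed.

Lemma primitive_par n0 x : primitive n0 -> Np n0 -> Np x -> par x n0 ->
  exists2 i, (0 < i)%N & x = n0 *+ i.
Proof.
move=> p0 N0 Nx pxn; have [q nq] : exists q, n0 0 q != 0.
  apply: contrapT => H; case/negP: (p0.1); apply/eqP/rowP => q; rewrite mxE.
  by apply/eqP/negPn/negP => nq; apply: H; exists q.
have E : n0 0 q *: x = x 0 q *: n0.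
  by apply/rowP => l; rewrite !mxE mulrC pxn.
have dE : n0 0 q * deg x = x 0 q * deg n0 by rewrite -!degZ E.
have dx := Np_deg Nx; have d0 := Np_deg N0.
have {}E : x *+ absz (n0 0 q) = n0 *+ absz (x 0 q).
  rewrite -!scaler_nat !natz; case: (ltgtP 0 (n0 0 q)) => [h|h|h]; last by rewrite -h eqxx in nq.
    have h' : 0 < x 0 q by rewrite -(pmulr_lgt0 _ d0) -dE mulr_gt0.
    by rewrite !gtz0_abs.
  have h' : x 0 q < 0 by rewrite -(pmulr_llt0 _ d0) -dE nmulr_rlt0.
  by rewrite !ltz0_abs // !scaleNr E.
have [|i [Ei _]] := primitive_div p0 _ E; first by rewrite absz_gt0.
exists i => //; case: i Ei => // Ei.
by move: (Np_neq0 Nx); rewrite Ei mulr0n eqxx.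
Qed.

(** Pigeonhole: two multiples of x lie in the same one of finitely many cosets. *)
Lemma Ncirc_multiple x : exists2 N, (0 < N)%N & Ncirc Gamma (x *+ N).
Proof.
have [_ _ [[N0 NB] [s sP]] _ _] := FD.
have /choice [f fP] : forall i : nat, exists y, y \in s /\ Ncirc Gamma (x *+ i - y).
  by move=> i; have [y ys H] := sP (x *+ i); exists y.
have : ~~ uniq [seq f i | i <- iota 0 (size s).+1].
  apply/negP => u; have := uniq_leq_size u (s2 := s).
  rewrite size_map size_iota ltnn => H; suff: false by []; apply: H.
  by move=> y /mapP [i _ ->]; have [] := fP i.
case/(uniqPn 0) => i [j [ij]]; rewrite size_map size_iota => js.
have is_ := ltn_trans ij js.
rewrite !(nth_map 0%N) ?size_iota // !nth_iota // !add0n => E.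
exists (j - i)%N; first by rewrite subn_gt0.
rewrite mulrnBr; last exact: ltnW.
have [_ Hi] := fP i; have [_ Hj] := fP j.
by have := NB _ _ Hj Hi; rewrite -E opprB addrA subrK.
Qed.

Lemma sublatticeMn (A : set 'rV[int]_n) x j : sublattice A -> A x -> A (x *+ j).
Proof.
move=> [A0 AB] Ax; have AN z : A z -> A (- z) by move=> Az; rewrite -sub0r; exact: AB.
elim: j => [|j IH]; rewrite ?mulr0n // mulrSr -[x in _ + x]opprK.
by apply: AB; last exact: AN.
Qed.

Lemma Ncirc_period n0 : exists2 r, (0 < r)%N &
  forall j, Ncirc Gamma (n0 *+ j) <-> (r %| j)%N.
Proof.
have [_ _ [sl _] _ _] := FD; have [NN0 NB] := sl.
have ex : exists r, (0 < r)%N && `[< Ncirc Gamma (n0 *+ r) >].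
  by have [N N0 HN] := Ncirc_multiple n0; exists N; rewrite N0; apply/asboolP.
case: (ex_minnP ex) => r /andP [r0 /asboolP Hr] rmin; exists r => // j.
split => [Hj|/dvdnP [c ->]]; last by rewrite mulnC mulrnA; exact: sublatticeMn.
have Hm : Ncirc Gamma (n0 *+ (j %% r)).
  have := NB _ _ Hj (sublatticeMn (j %/ r) sl Hr).
  by rewrite {1}(divn_eq j r) mulrnDr -mulrnA mulnC addrAC subrr add0r.
rewrite /dvdn; case: (posnP (j %% r)) => [//|jr].
have := rmin (j %% r)%N; rewrite jr /=.
have /asboolP -> := Hm => /(_ isT).
by rewrite leqNgt ltn_mod r0.
Qed.

Lemma neq0_entry (n0 : 'rV[int]_n) : n0 != 0 -> exists q, n0 0 q != 0.
Proof.
move=> n00; apply: contrapT => H; case/negP: n00; apply/eqP/rowP => q; rewrite mxE.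
by apply/eqP/negPn/negP => nq; apply: H; exists q.
Qed.

(** Two generators of the same monoid are natural multiples of each other, hence equal by comparing
    degrees; so [circ_gen] returns the expected one. *)
Lemma circ_gen_primitive (R : realType) n0 : primitive n0 -> Np n0 ->
  exists r, [/\ (0 < r)%N, @circ_gen n Gamma R n0 = n0 *+ r,
    @circ_generator n Gamma R n0 (n0 *+ r) &
    forall j, Ncirc Gamma (n0 *+ j) <-> (r %| j)%N].
Proof.
move=> p0 N0; have [r r0 rP] := Ncirc_period n0; exists r.
have n00 := Np_neq0 N0.
suff G : @circ_generator n Gamma R n0 (n0 *+ r).
  split => //; rewrite /circ_gen; case: xgetP => [y Ey Gy|/(_ (n0 *+ r)) //].
  have [a Ea] := (Gy (n0 *+ r)).1 ((G _).2 (ex_intro _ 1%N erefl)).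
  have [b Eb] := (G y).1 ((Gy y).2 (ex_intro _ 1%N erefl)).
  have dr : deg n0 *+ r = deg n0 *+ r *+ b *+ a.
    by rewrite -!degMn -Eb -Ea.
  have d0 : 0 < deg n0 *+ r by rewrite pmulrn_lgt0 // Np_deg.
  have b1 : b = 1%N.
    move: dr d0; move: (deg n0 *+ r) => d; rewrite -mulrnA -[d *+ (b * a)]mulr_natr => dr d0.
    have : (b * a)%:R = 1 :> int.
      apply: (mulfI (x := d)); first by rewrite gt_eqF.
      by rewrite mulr1 -dr.
    by rewrite natz => -[] /eqP; rewrite muln_eq1 => /andP [/eqP].
  by rewrite Eb b1.
move=> x; split.
  move=> [Nx [t t0 Et]].
  have [q nq] := neq0_entry n00.
  have xq l : (x 0 l)%:~R = t * (n0 0 l)%:~R :> R by move/rowP/(_ l): Et; rewrite !mxE.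
  have [x0|x0] := eqVneq x 0; first by exists 0%N; rewrite x0.
  have E : x *+ absz (n0 0 q) = n0 *+ absz (x 0 q).
    apply/rowP => l; rewrite !mulmxnE -(mulr_natr (x 0 l)) -(mulr_natr (n0 0 l)) !natz !abszE.
    apply/eqP; rewrite -(eqr_int R) !intrM !intr_norm !xq normrM (ger0_norm t0).
    by apply/eqP; ring.
  have [|i [Ei _]] := primitive_div p0 _ E; first by rewrite absz_gt0.
  by move: Nx; rewrite Ei => /rP /dvdnP [c ->]; exists c; rewrite mulnC mulrnA.
move=> [j ->]; split; first by rewrite -mulrnA; apply/rP; rewrite dvdn_mulr.
exists (r * j)%:R => //; apply/rowP => l.
by rewrite !mxE -mulrnA mulmxnE -[n0 0 l *+ _]mulr_natl intrM natz -pmulrn.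
Qed.

(** The j-th vector of the basis dual to (d_i e_i), in coordinates. *)
Lemma Mcirc_dual j : Mcirc Gamma (\row_l ((coord (delta_mx 0 l) j)%:~R / (dd Gamma j)%:R)).
Proof.
move=> y Ny; have [_ _ [_ _ /(_ y Ny) [a Ea]]] := SEED.
rewrite (@linear_pairing rat (fun x => (coord x j)%:~R / (dd Gamma j)%:R)); last first.
  by move=> x1 x2; rewrite coordD intrD mulrDl.
have -> : coord y j = a j * (dd Gamma j)%:Z.
  rewrite Ea (eq_bigl xpredT) => [|i]; last by rewrite inE.
  under eq_bigr do rewrite -scaler_nat scalerA.
  by rewrite coord_uniq natz.
have d0 : (dd Gamma j)%:R != 0 :> rat.
  by have [_ [dpos _] _ _ _] := FD; rewrite pnatr_eq0 -lt0n.
by rewrite intrM -[((dd Gamma j)%:Z)%:~R]pmulrn mulfK // intr_int.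
Qed.

(** By duality lam n0 lies in [Ncirc], so it is a natural multiple of the generator r n0 of the
    ray. *)
Lemma integral_multiple n0 r (lam : rat) : primitive n0 -> Np n0 ->
  (forall j, Ncirc Gamma (n0 *+ j) <-> (r %| j)%N) -> 0 <= lam ->
  (forall m, Mcirc Gamma m -> lam * pairing n0 m \is a Num.int) ->
  exists N : nat, lam = (r * N)%:R.
Proof.
move=> p0 N0 rP lam0 H; have n00 := Np_neq0 N0.
have d0 j : (dd Gamma j)%:R != 0 :> rat.
  by have [_ [dpos _] _ _ _] := FD; rewrite pnatr_eq0 -lt0n.
have /choice [z zP] : forall j, exists z : int, lam * (coord n0 j)%:~R = z%:~R * (dd Gamma j)%:R.
  move=> j; have /intrP [z Ez] := H _ (Mcirc_dual j); exists z.
  rewrite -Ez (@linear_pairing rat (fun x => (coord x j)%:~R / (dd Gamma j)%:R)); last first.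
    by move=> x1 x2; rewrite coordD intrD mulrDl.
  by rewrite -mulrA divfK.
pose y := \sum_j z j *: (e j *+ dd Gamma j).
have Ny : Ncirc Gamma y.
  have [_ _ [Hd _ _]] := SEED; have [_ _ [sl _] _ _] := FD.
  by apply: sublattice_sum => // i _; apply: Hd; rewrite inE.
have cy j : (coord y j)%:~R = lam * (coord n0 j)%:~R :> rat.
  rewrite zP /y; under eq_bigr do rewrite -scaler_nat scalerA.
  by rewrite coord_uniq natz intrM.
have [j nj] : exists j, coord n0 j != 0.
  apply: contrapT => Hc; case/negP: n00; apply/eqP; rewrite (coordE n0).
  apply: big1 => j _; suff -> : coord n0 j = 0 by rewrite scale0r.
  by apply/eqP/negPn/negP => nq; apply: Hc; exists j.
have c0 : 0 < coord n0 j by have [c0 _ _] := (NpP n0).1 N0; rewrite lt_neqAle eq_sym nj c0.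
have E : y *+ absz (coord n0 j) = n0 *+ absz (coord y j).
  have cy0 : 0 <= coord y j by rewrite -(ler_int rat) cy mulr_ge0 // ler0z ltW.
  rewrite -!scaler_nat !natz gtz0_abs // gez0_abs //.
  rewrite [in LHS](coordE y) [in RHS](coordE n0) !scaler_sumr.
  apply: eq_bigr => i _; rewrite !scalerA; congr (_ *: _).
  by apply/eqP; rewrite -(eqr_int rat) !intrM !cy; apply/eqP; ring.
have [|i [Ei _]] := primitive_div p0 _ E; first by rewrite absz_gt0.
move: Ny; rewrite Ei => /rP /dvdnP [c Ec]; exists c.
have := cy j; rewrite Ei -scaler_nat coordZ Ec intrM natz mulnC.
have nj' : (coord n0 j)%:~R != 0 :> rat by rewrite intr_eq0.
by move/(mulIf nj') => <-; rewrite -pmulrn.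
Qed.

End SeedLattice.

(** * The monoid P inside the lattice [Mcirc] *)

Section Cone.
Context {n : nat} (Gamma : fixed_data n) (e : 'I_n -> 'rV[int]_n).
Context {R : realType} (sigma : set 'rV[R]_n).
Hypothesis FD : is_fixed_data Gamma.
Hypothesis INJ : injectivity_assumption Gamma.
Hypothesis SEED : is_seed Gamma e.
Hypothesis GC : good_cone Gamma e sigma.
Implicit Types (x y : 'rV[int]_n).

Local Notation Np := (Nplus Gamma e).
Local Notation P := (monP Gamma sigma).
Local Notation deg := (deg SEED).
Local Notation coord := (coord SEED).

Lemma sigma_fcone : exists r (G : 'M[int]_(r, n)),
  \rank (map_mx intr G : 'M[rat]_(r, n)) = n /\ sigma = fcone (fun j => row j G).
Proof.
have [[r [G [rk ->]]] _ _] := GC; exists r, G; split; first by rewrite -[RHS]rk addn0.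
exact: matrix_fcone.
Qed.

Lemma monP0 : P 0.
Proof.
split; first by move=> y _; rewrite /pairing trmx0 mulmx0 mxE.
by have [r [G [_ ->]]] := sigma_fcone; rewrite map_mx0; exact: fcone0.
Qed.

Lemma monPD m m' : P m -> P m' -> P (m + m').
Proof.
move=> [M1 S1] [M2 S2]; split.
  by move=> y Ny; rewrite pairingDr rpredD ?M1 ?M2.
move: S1 S2; have [r [G [_ ->]]] := sigma_fcone; rewrite map_mxD; exact: fconeD.
Qed.

Lemma monP_pstar x : Np x -> P (pstar Gamma x).
Proof.
move=> /(NpP SEED) [c0 cI _].
have -> : pstar Gamma x = \sum_(i in Iuf Gamma) pstar Gamma (e i) *+ absz (coord x i).
  rewrite {1}(coordE SEED x) (bigID (mem (Iuf Gamma))) /= [X in _ + X]big1 ?addr0; last first.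
    by move=> i /cI ->; rewrite scale0r.
  elim/big_rec2: _ => [|i a b iI <-]; first exact: pstar0.
  by rewrite pstarD -pstarMn -scaler_nat natz gez0_abs.
elim/big_rec: _ => [|i m iI Pm]; first exact: monP0.
apply: monPD => //; have [_ _ /(_ i iI) [Pe _]] := GC.
by elim: (absz _) => [|j IH]; rewrite ?mulr0n ?mulrS; [exact: monP0|exact: monPD].
Qed.

(** As sigma has full dimension, translation by m stays inside sigma at a large multiple of the sum
    of the generators. Hence every element of [Mcirc] is a difference of two elements of P. *)
Lemma monP_deep m : Mcirc Gamma m -> exists2 q, P q & P (q + m).
Proof.
move=> Mm; have [r [G [rk sE]]] := sigma_fcone.
have /row_fullP [B BG] : row_full (map_mx intr G : 'M[rat]_(r, n)) by rewrite /row_full rk.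
pose b := m *m B; have mE : m = b *m map_mx intr G by rewrite -mulmxA BG mulmx1.
pose t := (\sum_j (Num.truncn `|b 0%R j|).+1)%N.
have tb j : 0 <= t%:R + b 0 j.
  have : `|b 0 j| < t%:R.
    have := truncnS_gt `|b 0 j|; move/lt_le_trans; apply; rewrite ler_nat.
    by rewrite /t (bigD1 j) //= leq_addr.
  by rewrite ltr_norml => /andP [h _]; rewrite -lerBlDl sub0r ltW.
have [q Eq] : exists q : 'rV[int]_n, map_mx intr q = \sum_j t%:R *: map_mx intr (row j G) :> 'rV[rat]_n.
  exists (\sum_j t%:Z *: row j G); apply/rowP => l; rewrite !mxE !summxE rmorph_sum.
  by apply: eq_bigr => j _; rewrite !mxE /= intrM.
have Mq : Mcirc Gamma (map_mx intr q).
  move=> y _; rewrite /pairing !mxE; apply: rpred_sum => i _.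
  by rewrite !mxE rpredM // intr_int.
exists (map_mx intr q).
  split => //; rewrite sE; exists (fun=> t%:R) => // .
  rewrite Eq; apply/rowP => l; rewrite !mxE !summxE rmorph_sum; apply: eq_bigr => j _.
  by rewrite !mxE /= rmorphM /= ratr_nat ratr_int.
split; first by move=> y Ny; rewrite pairingDr rpredD ?Mq ?Mm.
rewrite sE; exists (fun j => ratr (t%:R + b 0 j)) => [j|]; first by rewrite ler0q.
rewrite Eq mE; apply/rowP => l; rewrite !mxE !summxE -big_split rmorph_sum; apply: eq_bigr => j _.
by rewrite !mxE /= -mulrDl rmorphM /= ratr_int.
Qed.

(** Strict convexity excludes the negative of each nonzero generator, so Farkas' lemma gives a
    functional positive there and nonnegative on sigma; the sum over all generators is taken. *)
Lemma sigma_functional : exists w : 'rV[R]_n,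
  (forall m, sigma m -> 0 <= dot m w) /\ (forall m, sigma m -> m != 0 -> 0 < dot m w).
Proof.
have [r [G [rk sE]]] := sigma_fcone; have [_ sc _] := GC.
have /choice [w wP] : forall j : 'I_r, exists w, (forall i, 0 <= dot (@rv R n (row i G)) w) /\
    (row j G != 0 -> 0 < dot (@rv R n (row j G)) w).
  move=> j; have [->|Gj] := eqVneq (row j G) 0.
    by exists 0; split => // i; rewrite dotC dot0l.
  have [|w [w0 wj]] := @fcone_farkas R n _ (fun j => row j G) (- @rv R n (row j G)).
    rewrite -sE => H; move: Gj; rewrite -(rv_eq0 (R := R)) => /negP; apply; apply/eqP.
    by apply: sc H; rewrite sE; exact: (fcone_gen (fun j => row j G)).
  by exists w; split => // _; rewrite dotNl oppr_lt0 in wj.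
pose W := \sum_j w j.
have gW j : 0 <= dot (@rv R n (row j G)) W.
  by rewrite dotC dot_suml sumr_ge0 // => i _; rewrite dotC; apply: (wP i).1.
have gW' j : row j G != 0 -> 0 < dot (@rv R n (row j G)) W.
  move=> Gj; rewrite dotC dot_suml (bigD1 j) //= ltr_wpDr //; last by rewrite dotC; apply: (wP j).2.
  by rewrite sumr_ge0 // => i _; rewrite dotC; apply: (wP i).1.
exists W; split => m; rewrite sE; first exact: fcone_ge0.
move=> [a a0 Em] m0; rewrite lt_neqAle Em dot_suml.
rewrite sumr_ge0 ?andbT => [|j _]; last by rewrite dotZl mulr_ge0.
rewrite eq_sym; apply: contra m0 => H; rewrite Em; apply/eqP/big1 => j _.
move: H; rewrite psumr_eq0 => [|i _]; last by rewrite dotZl mulr_ge0.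
move/allP/(_ j); rewrite mem_index_enum => /(_ isT) /=; rewrite dotZl mulf_eq0.
case/orP => [/eqP -> |]; first by rewrite scale0r.
by have [->|Gj] := eqVneq (row j G) 0; [rewrite rv0 scaler0|rewrite gt_eqF // gW'].
Qed.

(** A functional positive on sigma away from 0 bounds the degree along p^*. This keeps the sums for
    the coefficient at z^q finite. *)
Lemma monP_bounded q : exists N : nat, forall x, Np x -> P (q - pstar Gamma x) -> deg x <= N%:Z.
Proof.
have [w [w0 wpos]] := sigma_functional.
pose f (i : 'I_n) := dot (map_mx ratr (pstar Gamma (e i))) w.
have fpos i : i \in Iuf Gamma -> 0 < f i.
  move=> iI; have [_ _ /(_ i iI) [[_ Se] e0]] := GC; apply: wpos => //.
  apply: contra e0 => /eqP E; apply/eqP/rowP => l; move/rowP/(_ l): E; rewrite !mxE.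
  by move/eqP; rewrite fmorph_eq0 => /eqP.
pose C := \sum_(i in Iuf Gamma) (f i)^-1.
exists (Num.truncn (C * dot (map_mx ratr q) w)).+1 => x Nx [_ Sx].
have [c0 cI _] := (NpP SEED x).1 Nx.
have fx : dot (map_mx ratr (pstar Gamma x)) w = \sum_(i in Iuf Gamma) (coord x i)%:~R * f i.
  rewrite {1}(coordE SEED x) (bigID (mem (Iuf Gamma))) /= [X in _ + X]big1 ?addr0; last first.
    by move=> i /cI ->; rewrite scale0r.
  elim/big_rec2: _ => [|i a b iI <-]; first by rewrite pstar0 map_mx0 dot0l.
  rewrite pstarD map_mxD dotDl -[coord x i]gez0_abs // -natz scaler_nat pstarMn; congr (_ + _).
  elim: (absz _) => [|j IH]; first by rewrite mulr0n map_mx0 dot0l mul0r.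
  by rewrite mulrSr map_mxD dotDl IH mulrSr intrD mulrDl mul1r.
have : dot (map_mx ratr (pstar Gamma x)) w <= dot (map_mx ratr q) w.
  have := w0 _ Sx; rewrite map_mxB -scaleN1r dotDl dotZl mulN1r subr_ge0 //.
rewrite fx => H.
have C0 i : i \in Iuf Gamma -> 1 <= C * f i.
  move=> iI; rewrite /C (bigD1 i) //= mulrDl mulVf ?gt_eqF ?fpos // lerDl.
  apply: mulr_ge0; last by rewrite ltW ?fpos.
  by rewrite sumr_ge0 // => j /andP [jI _]; rewrite invr_ge0 ltW ?fpos.
have C1 : 0 <= C by rewrite sumr_ge0 // => j jI; rewrite invr_ge0 ltW ?fpos.
have : (deg x)%:~R <= C * dot (map_mx ratr q) w.
  apply: le_trans (ler_wpM2l C1 H); rewrite mulr_sumr /deg rmorph_sum /=.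
  apply: ler_sum => i iI; rewrite mulrCA -[leLHS]mulr1; apply: ler_wpM2l; first by rewrite ler0z.
  exact: C0.
move/le_lt_trans => /(_ _ (truncnS_gt _)) => h; apply: ltW.
by rewrite -(ltr_int R) -[(_%:Z)%:~R]pmulrn.
Qed.

End Cone.

(** * Exponents of the walls *)

Section WallExponents.
Context {n : nat} (Gamma : fixed_data n) (e : 'I_n -> 'rV[int]_n).
Context {R : realType} {k : fieldType} (sigma : set 'rV[R]_n).
Hypothesis char0 : [pchar k] =i pred0.
Hypothesis FD : is_fixed_data Gamma.
Hypothesis INJ : injectivity_assumption Gamma.
Hypothesis SEED : is_seed Gamma e.
Hypothesis GC : good_cone Gamma e sigma.

Local Notation Np := (Nplus Gamma e).
Local Notation P := (monP Gamma sigma).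
Local Notation phat := (phat Gamma k sigma).
Local Notation wall := (wall Gamma k sigma).
Local Notation pstar := (pstar Gamma).
Local Notation deg := (deg SEED).
Local Notation form := (@Defs.form n Gamma).
Local Notation base := (base SEED).
Implicit Types (v x y : 'rV[int]_n) (w : wall) (D : set wall) (m : 'rV[R]_n).

(** The triple consists of the primitive vector n0 on the ray of v, the multiplicity of v, and the
    multiple of n0 generating [Ncirc] on the ray; off N^+ it is a dummy. *)
Lemma primitive_data v : exists t : 'rV[int]_n * nat * nat, Np v ->
  [/\ primitive t.1.1, Np t.1.1, (0 < t.1.2)%N, v = t.1.1 *+ t.1.2 &
   [/\ (0 < t.2)%N, @circ_gen n Gamma R t.1.1 = t.1.1 *+ t.2 &
     forall j, Ncirc Gamma (t.1.1 *+ j) <-> (t.2 %| j)%N]].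
Proof.
case: (pselect (Np v)) => Nv; last by exists (0, 0%N, 0%N).
have [n0 [i [p0 N0 i0 E]]] := primitive_part SEED Nv.
have [r [r0 rE _ rP]] := circ_gen_primitive FD SEED R p0 N0.
by exists (n0, i, r).
Qed.

Definition pdata v := projT1 (cid (primitive_data v)).
Definition prim v := (pdata v).1.1.
Definition mult v := (pdata v).1.2.
Definition per v := (pdata v).2.

Lemma pdataP v : Np v -> [/\ primitive (prim v), Np (prim v), (0 < mult v)%N, v = prim v *+ mult v &
   [/\ (0 < per v)%N, @circ_gen n Gamma R (prim v) = prim v *+ per v &
     forall j, Ncirc Gamma (prim v *+ j) <-> (per v %| j)%N]].
Proof. exact: projT2 (cid (primitive_data v)). Qed.

Lemma rVint_mulrn_inj x : x != 0 -> injective (fun j : nat => x *+ j).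
Proof.
move=> /neq0_entry [q xq] i j /rowP/(_ q); rewrite !mulmxnE.
exact: mulrIn.
Qed.

Lemma prim_uniq n0 i : primitive n0 -> Np n0 -> (0 < i)%N ->
  prim (n0 *+ i) = n0 /\ mult (n0 *+ i) = i.
Proof.
move=> p0 N0 i0; have Nv : Np (n0 *+ i) by exact: NpMn.
have [p1 N1 i1 E _] := pdataP Nv.
have [|c [Ec Ei]] := primitive_div p0 _ (esym E); first by [].
have [|c' [Ec' Ei']] := primitive_div p1 _ E; first by [].
have c1 : c = 1%N.
  move: Ei; rewrite Ei' -{1}[i]muln1 -mulnA => /eqP; rewrite eqn_pmul2l // eq_sym muln_eq1.
  by case/andP => _ /eqP.
split; first by rewrite Ec c1 mulr1n.
by move: Ei; rewrite c1 muln1 => <-.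
Qed.

(* The wall of direction n0 = prim v acts through n0' = per v n0 = dl v v: the factor
   (1 + z^(p^*(v)))^c of its function is the letter (v, c dl v). *)
Definition dl v : rat := (per v)%:R / (mult v)%:R.

Lemma dlE v : Np v -> dl v * (mult v)%:R = (per v)%:R.
Proof. by move=> /pdataP [_ _ i0 _ _]; rewrite divfK // pnatr_eq0 -lt0n. Qed.

Lemma dl_gt0 v : Np v -> 0 < dl v.
Proof. by move=> /pdataP [_ _ i0 _ [r0 _ _]]; rewrite divr_gt0 // ltr0n. Qed.

(** The constant term is 1 by definition, so [wser w 0 = 1] holds by conversion. *)
Definition wser w (j : nat) : k :=
  if j == 0%N then 1 else hext (wfun w) (pstar (wdir w) *+ j).

Lemma wserP w : is_wall e w -> isser (pstar (wdir w)) (wser w) (wfun w).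
Proof.
move=> [_ _ _ Nw [c /wall_seriesE]] => /(_ (pstar_neq0 FD INJ SEED Nw)) sF.
suff -> : wser w = (fun j => if (0 < j)%N then c j else 1) by [].
apply/funext => -[|j] //; rewrite /wser /=.
have PM : P (pstar (wdir w) *+ j.+1).
  by rewrite -pstarMn; apply: (monP_pstar SEED GC); exact: NpMn.
by rewrite (hext_mkP _ PM) (sF.1 (mkP PM) j.+1).
Qed.

Lemma nontrivialP l w : is_wall e w -> nontrivial_to_order e l w <->
  exists j, [/\ (0 < j)%N, wser w j != 0 & deg (wdir w *+ j) <= l%:Z].
Proof.
move=> ww; have sF := wserP ww; have [_ _ _ Nw _] := ww.
have v0 := pstar_neq0 FD INJ SEED Nw.
have PM j : P (pstar (wdir w) *+ j.+1).
  by rewrite -pstarMn; apply: (monP_pstar SEED GC); exact: NpMn.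
split.
  move=> [c [j [d [/wall_seriesE sc j0 cj hd dl]]]]; have {}sc := sc v0; exists j; split => //.
    case: j j0 cj {hd} => // j _ cj.
    by rewrite -(sF.1 (mkP (PM j)) j.+1) // (sc.1 (mkP (PM j)) j.+1).
  by have [_ [_ ->]] := has_degree_coord SEED hd; rewrite lez_nat.
move=> [j [j0 cj dj]]; exists (wser w), j, (absz (deg (wdir w *+ j))); split => //.
- apply/wall_seriesE => //.
  by suff -> : (fun j => if (0 < j)%N then wser w j else 1) = wser w by []; apply/funext => -[].
- by apply: Np_degree; exact: NpMn.
- by rewrite -lez_nat gtz0_abs // Np_deg //; exact: NpMn.
Qed.

(* The exponent of 1 + z^(p^*(v)) in the factorization of the function of w; below, cexp D v m
   is its sum over the walls through m. *)
Definition wx w v : k := if wdir w == prim v then dec (wser w) (mult v) else 0.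

Lemma wx_prim w v : wx w v != 0 -> wdir w = prim v.
Proof. by rewrite /wx; case: (wdir w =P prim v) => //; rewrite eqxx. Qed.

(** Otherwise F would agree with 1 up to X^i, and uniqueness of the exponents would give
    [dec F i = 0]. *)
Lemma dec_neq0 (F : nat -> k) i : F 0%N = 1 -> (0 < i)%N -> dec F i != 0 ->
  exists j, [/\ (0 < j)%N, (j <= i)%N & F j != 0].
Proof.
move=> F0 i0 d0; apply: contrapT => H; case/negP: d0; apply/eqP.
apply: (@bprod_inj k char0 i.+1 (dec F) (fun=> 0) _ i); last by rewrite i0 ltnSn.
apply: eqm_trans (eqm_sym (@decP k char0 F i.+1 F0)) (eqm_trans _ (eqm_sym (@bprod0 _ char0 i.+1))).
move=> j ji; rewrite coef_poly ji coef1; case: j ji => [|j] ji; first by rewrite F0.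
by apply/eqP/negPn/negP => Fj; apply: H; exists j.+1.
Qed.

Lemma wx_nontrivial w v l : is_wall e w -> Np v -> wx w v != 0 -> deg v <= l%:Z ->
  nontrivial_to_order e l w.
Proof.
move=> ww Nv; have [p0 N0 i0 E _] := pdataP Nv; rewrite /wx; case: (wdir w =P prim v) => [wv|_]; last by rewrite eqxx.
move=> /(dec_neq0 (erefl : wser w 0%N = 1) i0) [j [j0 ji wj]] vl.
apply/(nontrivialP _ ww); exists j; split => //; apply: le_trans vl.
rewrite [in leRHS]E wv !degMn -[_ *+ j]mulr_natl -[_ *+ mult v]mulr_natl !natz.
by rewrite ler_wpM2r ?lez_nat // ltW // (Np_deg SEED).
Qed.

Definition cexp D v m : k := \sum_(w \in D `&` [set w | wsupp w m]) wx w v.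

Lemma form_parallel x i j : form (x *+ i) (x *+ j) = 0.
Proof.
have D z : {morph (form)^~ z : a b / a + b} by exact: formDl.
by rewrite (linMn (D _)) form_skew // (linMn (D _)) (B_alt (form_skew FD)) mul0rn oppr0 mul0rn.
Qed.

(** Letters on one ray do not affect each other's exponents, so their word multiplies by the product
    of their binomial series in z^(p^*(n0)). *)
Lemma run_ray (K : nat) (n0 : 'rV[int]_n) (s : seq nat) (lam c : nat -> k) ell h y :
  0 < deg n0 -> supp deg h -> deg y <= K%:Z -> (forall i, i \in s -> (0 < i)%N) ->
  (forall i, i \in s -> lam i * (ell (n0 *+ i) + bk form y (n0 *+ i)) = c i) ->
  run form K ell [seq (n0 *+ i, lam i) | i <- s] h y =
  \sum_(m < K.+1) (\prod_(i <- s) bser K.+1 i (c i))`_m * h (y - n0 *+ m).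
Proof.
move=> d0 sh; have hz x a : deg x <= K%:Z -> (K < a)%N -> h (x - n0 *+ a) = 0.
  by move=> xK Ka; exact: (supp_far (degD SEED) sh d0 xK Ka).
elim: s y => [|i s IH] y yK s0 sc.
  rewrite big_nil big_ord_recl big1 ?addr0; last by move=> j _; rewrite coef1 mul0r.
  by rewrite coef1 mul1r mulr0n subr0.
have i0 : (0 < i)%N by apply: s0; rewrite in_cons eqxx.
set Q := \prod_(j <- s) bser K.+1 j (c j) in IH *.
rewrite big_cons /= /wop.
have dn a x : deg x <= K%:Z -> deg (x - n0 *+ a) <= K%:Z.
  move=> xK; rewrite (deg_subMn (degD SEED)); have : 0 <= deg n0 *+ a by rewrite mulrn_wge0 // ltW.
  by move: xK; clear; lia.
have sI j : j \in s -> j \in i :: s by rewrite in_cons => ->; rewrite orbT.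
(* Multiplication by the series p along the ray: linear in p, with X^a acting as the shift by a n0.
   Pulling out the factor of i as a sum of powers X^(i j) reduces to the induction hypothesis. *)
pose Phi x (p : {poly k}) := \sum_(m < K.+1) p`_m * h (x - n0 *+ m).
have PhiX x a p : deg x <= K%:Z -> Phi x ('X^a * p) = Phi (x - n0 *+ a) p.
  move=> xK; rewrite /Phi; case: (leqP a K) => aK; last first.
    rewrite big1 => [|[m mK] _]; last by rewrite coefXnM /= (leq_ltn_trans _ aK) ?mul0r // -ltnS.
    rewrite big1 // => m _; rewrite -addrA -opprD -mulrnDr hz ?mulr0 //.
    by rewrite (leq_trans aK) // leq_addr.
  rewrite -(big_mkord xpredT (fun m : nat => ('X^a * p)`_m * h (x - n0 *+ m))).
  rewrite -(big_mkord xpredT (fun m : nat => p`_m * h (x - n0 *+ a - n0 *+ m))).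
  rewrite (@big_cat_nat _ _ _ a) //=; last by rewrite ltnW.
  rewrite big_nat_cond big1 ?add0r; last first.
    by move=> m /andP [/andP [_ ma] _]; rewrite coefXnM ma mul0r.
  rewrite -{1}[a]add0n big_addn [RHS](@big_cat_nat _ _ _ (K.+1 - a)) ?leq_subr //=.
  rewrite [X in _ = _ + X]big_nat_cond [X in _ = _ + X]big1 ?addr0; last first.
    move=> m /andP [/andP [ma _] _]; rewrite -addrA -opprD -mulrnDr hz ?mulr0 //.
    by move: ma; rewrite leq_subLR.
  apply: eq_bigr => m _; rewrite coefXnM ltnNge leq_addl /= addnK.
  by rewrite -[in RHS]addrA -opprD -mulrnDr addnC.
have PhiD x p p' : Phi x (p + p') = Phi x p + Phi x p'.
  by rewrite /Phi -big_split; apply: eq_bigr => m _; rewrite coefD mulrDl.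
have PhiZ x a p : Phi x (a *: p) = a * Phi x p.
  by rewrite /Phi mulr_sumr; apply: eq_bigr => m _; rewrite coefZ mulrA.
transitivity (Phi y (\sum_(j < K.+1) gbin (c i) j *: ('X^(i * j) * Q))); last first.
  congr (Phi y _); rewrite [bser K.+1 i _]/bser poly_def raddf_sum /= mulr_suml; apply: eq_bigr => j _.
  by rewrite comp_polyZ comp_Xn_poly -exprM -scalerAl.
rewrite (big_morph (Phi y) (PhiD y) (_ : Phi y 0 = 0)); last first.
  by rewrite /Phi big1 // => m _; rewrite coef0 mul0r.
apply: eq_bigr => j _; rewrite PhiZ PhiX // sc ?in_cons ?eqxx // -mulrnA; congr (_ * _).
apply: IH; [exact: dn|by move=> i' /sI /s0|move=> i' si'].
rewrite -(sc i' (sI _ si')); congr (_ * (_ + _)).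
rewrite (linB (bkDl char0 (@formDl _ Gamma) _)) {2}/bk form_parallel.
by rewrite -[0]/(0%:~R) char0_ratr_int // subr0.
Qed.

Variables (q0 : 'rV[rat]_n) (xt : 'rV[int]_n) (K : nat).
(** The exponents from which products of letters can reach the target [xt]. This set is stable under
    subtracting elements of N^+, and only values on it matter for the coefficient at [xt]. *)
Definition Reg y := y = xt \/ Np (xt - y).
Hypothesis topK : deg xt <= K%:Z.

(* The coefficients of h along q0 + p^*(N), cut off to the exponents which contribute at xt. *)
Definition hX (h : phat) y : k := if `[< Reg y >] then hext h (q0 + pstar y) else 0.
Definition qell y : k := ratr (pairing y q0).
Definition agr (h h' : 'rV[int]_n -> k) := forall y, Reg y -> h y = h' y.

Lemma hX_in h y : Reg y -> hX h y = hext h (q0 + pstar y).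
Proof. by move=> Ry; rewrite /hX asboolT. Qed.

Definition nonneg_supp (h : phat) := forall y, Reg y -> deg y < 0 -> hext h (q0 + pstar y) = 0.

Lemma hX_supp h : nonneg_supp h -> supp deg (hX h).
Proof. by move=> hn y y0; rewrite /hX; case: asboolP => // Ry; exact: hn. Qed.

Lemma Reg_deg y : Reg y -> deg y <= K%:Z.
Proof.
case=> [-> //|/(Np_deg SEED)]; rewrite (linB (degD SEED)); move: topK; clear; lia.
Qed.

Lemma Reg_sub y v j : Reg y -> Np v -> Reg (y - v *+ j).
Proof.
case: j => [|j]; first by rewrite mulr0n subr0.
move=> Ry Nv; right; have Nvj : Np (v *+ j.+1) by exact: NpMn.
case: Ry => [->|Ny]; first by rewrite subKr.
by rewrite opprB addrA addrAC; exact: NpD.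
Qed.

Lemma qell_lin : lin qell.
Proof. by move=> y y'; rewrite /qell pairingDl char0_ratrD. Qed.

Definition wpos (ws : seq ('rV[int]_n * k)) := forall f, f \in ws -> Np f.1.

Lemma wpos_wf ws : wpos ws -> wf deg ws.
Proof. by move=> H; apply/allP => f /H; exact: Np_deg. Qed.

Lemma run_agr ws h h' : wpos ws -> agr h h' -> agr (run form K qell ws h) (run form K qell ws h').
Proof.
elim: ws => //= f ws IH Hw hh y Ry; apply: eq_bigr => j _; congr (_ * _).
apply: IH => //; first by move=> g gw; apply: Hw; rewrite in_cons gw orbT.
by apply: Reg_sub => //; apply: Hw; rewrite in_cons eqxx.
Qed.

Definition ray (s : int) w : seq ('rV[int]_n * k) :=
  [seq (wdir w *+ i, s%:~R * wx w (wdir w *+ i) * ratr (dl (wdir w *+ i))) | i <- iota 1 K].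

(** [wall_crossing] with the sign as a parameter, convertible to it for the sign given by a path. *)
Definition crossing_op (s : int) w : phat -> phat :=
  hsubst (fun m : P => hmul (zmon k (val m))
    (hexpz (wfun w) (s * Num.floor (pairing (@circ_gen n Gamma R (wdir w)) (val m))))).

Lemma ray_wpos s w : is_wall e w -> wpos (ray s w).
Proof.
move=> [_ _ _ Nw _] f /mapP [i]; rewrite mem_iota => /andP [i0 _] ->.
exact: NpMn.
Qed.

(** The exponent is constant along the ray since the form is alternating, and [monP_bounded] bounds
    the number of terms. *)
Lemma crossing_op_sum s w h y : is_wall e w -> Reg y -> P (q0 + pstar y) -> exists N,
  let a := s * Num.floor (pairing (@circ_gen n Gamma R (wdir w)) (q0 + pstar y)) in
  hext (crossing_op s w h) (q0 + pstar y) =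
  \sum_(j < N + K.+1) spowz (wser w) a j * hext h (q0 + pstar (y - wdir w *+ j)).
Proof.
move=> ww Ry Pq; have sF := wserP ww; have [_ _ p0 Nw _] := ww.
have v0 := pstar_neq0 FD INJ SEED Nw.
have Pv : P (pstar (wdir w)) by exact: monP_pstar GC _ Nw.
set n0 := wdir w in p0 Nw v0 Pv sF *; pose v := pstar n0.
pose a (z : 'rV[rat]_n) : int := s * Num.floor (pairing (@circ_gen n Gamma R n0) z).
pose q := q0 + pstar y.
have [_ _ _ _ [_ rE _]] := pdataP Nw.
have [pn _] := prim_uniq p0 Nw (ltn0Sn 0); rewrite mulr1n in pn; rewrite pn in rE.
have pv0 : pairing n0 v = 0 by rewrite -form_pairing (B_alt (form_skew FD)).
have Dn (z : 'rV[rat]_n) i : pairing (n0 *+ i) z = pairing n0 z *+ i.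
  exact: (linMn (@pairingDl _ _ z)).
have aE z j : a (z - v *+ j) = a z.
  have E : pairing n0 (z - v *+ j) = pairing n0 z.
    by rewrite (linB (f := pairing n0) (fun b c => pairingDr n0 b c)) pairingMn pv0 mul0rn subr0.
  by rewrite /a rE (Dn (z - v *+ j)) (Dn z) E.
have [N HN] := monP_bounded SEED GC q; exists N => /=.
have far j : (N + K.+1 <= j)%N -> ~ P (val (mkP Pq) - v *+ j).
  move=> Nj; rewrite /= -/q -pstarMn => /HN; case: j Nj => [|j] Nj; first by rewrite addnS in Nj.
  move=> /(_ (NpMn SEED (ltn0Sn j) Nw)); rewrite (degMn SEED).
  have : j.+1%:Z <= deg n0 *+ j.+1 by rewrite -[leLHS]natz ler_wMn2r //; have := Np_deg SEED Nw; lia.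
  by move: Nj; clear; lia.
rewrite (hext_mkP _ Pq) /crossing_op.
rewrite (hsubst_ser (monP0 GC) (monPD GC) h Pv v0 (erefl : wser w 0%N = 1) sF aE far).
by apply: eq_bigr => j _; rewrite (linB (@pstarD _ _)) pstarMn addrA.
Qed.

Lemma crossing_op_supp s w h : is_wall e w -> nonneg_supp h -> nonneg_supp (crossing_op s w h).
Proof.
move=> ww hn y Ry y0; case: (pselect (P (q0 + pstar y))) => Pq; last by rewrite hext_out.
have [N ->] := crossing_op_sum s h ww Ry Pq; have [_ _ _ Nw _] := ww.
apply: big1 => j _; rewrite hn ?mulr0 //; first exact: Reg_sub.
rewrite (deg_subMn (degD SEED)); have : 0 <= deg (wdir w) *+ j.
  by rewrite mulrn_wge0 // ltW // (Np_deg SEED).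
by move: y0; clear; lia.
Qed.

(** At q in P the floor is exact, as n0' is in [Ncirc]. Since [dl (n0 *+ i)] times i n0 is n0', the
    letter (i n0, s e_i dl) has exponent s e_i <n0', q>, where e_i is the exponent of the i-th
    factor of the wall function. This is the exponent of the i-th factor in f^(s <n0', q>). *)
Lemma crossing_op_run s w h : is_wall e w -> nonneg_supp h ->
  agr (hX (crossing_op s w h)) (run form K qell (ray s w) (hX h)).
Proof.
move=> ww hn y Ry; have yK := Reg_deg Ry.
have sF := wserP ww; have [_ _ p0 Nw _] := ww.
have v0 := pstar_neq0 FD INJ SEED Nw.
have Pv : P (pstar (wdir w)) by exact: monP_pstar GC _ Nw.
set n0 := wdir w in p0 Nw v0 Pv sF *; pose v := pstar n0.
have [_ _ _ _ [r0 rE rP]] := pdataP Nw; pose r := per n0.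
have [pn mn] := prim_uniq p0 Nw (ltn0Sn 0); rewrite mulr1n in pn mn.
pose a (z : 'rV[rat]_n) : int := s * Num.floor (pairing (@circ_gen n Gamma R n0) z).
pose q := q0 + pstar y.
have cE : @circ_gen n Gamma R n0 = n0 *+ r by rewrite -{1}pn rE pn.
have pv0 : pairing n0 v = 0 by rewrite -form_pairing; have := form_skew FD n0 n0; lra.
have Dn z i : pairing (n0 *+ i) z = i%:R * pairing n0 z :> rat.
  by rewrite (linMn (@pairingDl _ _ z)) mulr_natl.
have shift j : q - v *+ j = q0 + pstar (y - n0 *+ j).
  by rewrite /q (linB (@pstarD _ _)) pstarMn addrA.
rewrite {1}/hX; case: asboolP => // _; rewrite -/q.
have far j : (K < j)%N -> hext h (q - v *+ j) = 0.
  move=> Kj; rewrite shift; apply: hn; first exact: Reg_sub.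
  rewrite (deg_subMn (degD SEED)).
  have : j%:Z <= deg n0 *+ j by rewrite -[j%:Z]natz ler_wMn2r //; have := Np_deg SEED Nw; lia.
  by move: yK Kj; clear; lia.
have hXE j : hX h (y - n0 *+ j) = hext h (q - v *+ j).
  by rewrite /hX asboolT ?shift //; exact: Reg_sub.
(* If q is outside P then so is every q - j v, since P is stable under adding v; both sides
   vanish. *)
case: (pselect (P q)) => Pq; last first.
  pose lam i := s%:~R * wx w (n0 *+ i) * ratr (dl (n0 *+ i)).
  rewrite hext_out // (@run_ray K n0 (iota 1 K) lam
    (fun i => lam i * (qell (n0 *+ i) + bk form y (n0 *+ i))) qell (hX h) y) //; first last.
  - by move=> i; rewrite mem_iota => /andP [].
  - exact: hX_supp.
  - exact: Np_deg.
  rewrite big1 // => j _; rewrite hXE hext_out ?mulr0 // => H; apply: Pq.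
  by rewrite -[q](subrK (v *+ j)); apply: (monPD GC) => //; exact: (PMn (monP0 GC) (monPD GC)).
have [N /= ->] := crossing_op_sum s h ww Ry Pq; rewrite -/n0 -/q -/(a q).
have -> : \sum_(j < N + K.+1) spowz (wser w) (a q) j * hext h (q0 + pstar (y - n0 *+ j)) =
    \sum_(j < K.+1) spowz (wser w) (a q) j * hext h (q - v *+ j).
  rewrite addnC -(big_mkord xpredT (fun j => spowz (wser w) (a q) j * hext h (q0 + pstar (y - n0 *+ j)))).
  rewrite (@big_cat_nat _ _ _ K.+1) ?leq_addr //= big_mkord [X in _ + X]big_nat_cond.
  rewrite [X in _ + X]big1 ?addr0; first by apply: eq_bigr => j _; rewrite shift.
  by move=> j /andP [/andP [Kj _] _]; rewrite -shift far ?mulr0.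
rewrite (@run_ray K n0 (iota 1 K) _ (fun i => (a q)%:~R * dec (wser w) i) qell (hX h) y) //; first last.
- move=> i; rewrite mem_iota => /andP [i0 _].
  have [pni mni] := prim_uniq p0 Nw i0.
  have [_ _ _ _ [_ rEi _]] := pdataP (NpMn SEED i0 Nw).
  have ri : per (n0 *+ i) = r.
    by apply: (rVint_mulrn_inj p0.1); rewrite -cE -{1}pni -rEi pni.
  rewrite /wx pni eqxx mni /dl ri mni /qell /bk -char0_ratrD // form_pairing -pairingDr -/q Dn.
  have -> : (a q)%:~R = s%:~R * ratr (r%:R * pairing n0 q) :> k.
    rewrite /a intrM; congr (_ * _); rewrite cE Dn -[X in X = _]char0_ratr_int floorK //.
    rewrite -Dn; apply: Pq.1; rewrite -pn; exact/rP.
  have E : ratr (r%:R / i%:R) * ratr (i%:R * pairing n0 q) = ratr (r%:R * pairing n0 q) :> k.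
    by rewrite -char0_ratrM //; congr ratr; field; rewrite pnatr_eq0 -lt0n.
  by rewrite -E; ring.
- by move=> i; rewrite mem_iota => /andP [].
- exact: hX_supp.
- exact: Np_deg.
apply: eq_bigr => -[j jK] _ /=; rewrite hXE; congr (_ * _).
have := spowz_poly char0 (a q) (erefl : wser w 0%N = 1) (@decP k char0 (wser w) K.+1 (erefl : wser w 0%N = 1)) jK.
by rewrite coef_poly jK => ->; rewrite /bprod /index_iota subSS subn0.
Qed.
End WallExponents.

(** * The letters crossed at one time *)

Section Blocks.
Context {n : nat} (Gamma : fixed_data n) (e : 'I_n -> 'rV[int]_n).
Context {R : realType} {k : fieldType} (sigma : set 'rV[R]_n).
Hypothesis char0 : [pchar k] =i pred0.
Hypothesis FD : is_fixed_data Gamma.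
Hypothesis INJ : injectivity_assumption Gamma.
Hypothesis SEED : is_seed Gamma e.
Hypothesis GC : good_cone Gamma e sigma.

Local Notation Np := (Nplus Gamma e).
Local Notation P := (monP Gamma sigma).
Local Notation phat := (phat Gamma k sigma).
Local Notation wall := (wall Gamma k sigma).
Local Notation pstar := (pstar Gamma).
Local Notation deg := (deg SEED).
Local Notation form := (@Defs.form n Gamma).
Local Notation base := (base SEED).
Local Notation cexp := (cexp FD SEED).
Local Notation dl := (@dl n Gamma e R FD SEED).
Local Notation wx := (wx FD SEED).
Local Notation ray := (ray FD SEED).
Local Notation prim := (@prim n Gamma e R FD SEED).
Local Notation mult := (@mult n Gamma e R FD SEED).
Local Notation per := (@per n Gamma e R FD SEED).
Local Notation pdataP := (@pdataP n Gamma e R FD SEED _).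
Local Notation Reg := (@Reg n Gamma e).
Local Notation agr := (@agr n Gamma e k).
Local Notation wpos := (@wpos n Gamma e k).
Implicit Types (v x y : 'rV[int]_n) (w : wall) (D : set wall) (m : 'rV[R]_n).

Section Words.
Variable K : nat.
Local Notation E := (@eqv k _ deg form K).
Local Notation word := (seq ('rV[int]_n * k)).

Let dD := degD SEED.
Let fD := @formDl n Gamma.
Let fS := form_skew FD.

(** The letter is moved to its place in [Ls]; letters with exponent zero are trivial and all others
    on its way commute with it. *)
Lemma insert_letter v (l : k) (Ls : seq 'rV[int]_n) (lam : 'rV[int]_n -> k) :
  uniq Ls -> (v \in Ls) || (K%:Z < deg v) -> 0 < deg v -> (forall u, u \in Ls -> 0 < deg u) ->
  (forall u, u \in Ls -> lam u = 0 \/ form v u = 0) ->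
  E ((v, l) :: [seq (u, lam u) | u <- Ls])
    [seq (u, lam u + (if u == v then l else 0)) | u <- Ls].
Proof.
move=> + + v0; elim: Ls => [|u Ls IH] /=.
  by move=> _ vK _ _; exact: eqv_big.
move=> /andP [uLs uL] vin Ls0 com.
have u0 : 0 < deg u by apply: Ls0; rewrite in_cons eqxx.
have Ls0' z : z \in Ls -> 0 < deg z by move=> zL; apply: Ls0; rewrite in_cons zL orbT.
have wfm (f : 'rV[int]_n -> k) : wf deg [seq (u, f u) | u <- Ls].
  by apply/allP => z /mapP [z' z'L ->]; exact: Ls0'.
have [uv|uv] := eqVneq u v.
  have Em : [seq (z, lam z + (if z == v then l else 0)) | z <- Ls] = [seq (z, lam z) | z <- Ls].
    apply/eq_in_map => z zL; case: eqP => [zv|]; last by rewrite addr0.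
    by move: uLs; rewrite uv -zv zL.
  rewrite Em -uv addrC; apply: (@eqv_cat k _ _ _ _ dD [:: (u, l); (u, lam u)] [:: (u, l + lam u)]) => //=.
    by rewrite u0.
  exact: (eqv_add char0 dD fD fS).
rewrite addr0; apply: (@eqv_trans _ _ _ _ _ _ ((u, lam u) :: (v, l) :: [seq (z, lam z) | z <- Ls])).
  apply: (@eqv_cat k _ _ _ _ dD [:: (v, l); (u, lam u)] [:: (u, lam u); (v, l)]) => //=.
    by rewrite u0 v0.
  have [->|fvu] := com u (mem_head _ _); last exact: (eqv_comm char0 fD fS).
  apply: (@eqv_trans _ _ _ _ _ _ [:: (v, l)]).
    apply: (@eqv_cat k _ _ _ _ dD [:: (v, l)] [:: (v, l)] [:: (u, 0)] [::]); rewrite /= ?u0 ?v0 //.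
    exact: (eqv_0 char0).
  apply: eqv_sym; apply: (@eqv_cat k _ _ _ _ dD [:: (u, 0)] [::] [:: (v, l)]); rewrite /= ?u0 ?v0 //.
  exact: (eqv_0 char0).
apply: (@eqv_cat k _ _ _ _ dD [:: (u, lam u)] [:: (u, lam u)]) => //=; rewrite ?u0 ?v0 ?wfm //.
apply: IH => // [|z zL].
  by move: vin; rewrite in_cons eq_sym (negbTE uv).
by apply: com; rewrite in_cons zL orbT.
Qed.

Lemma eqv_zeros (Ls : seq 'rV[int]_n) : (forall u, u \in Ls -> 0 < deg u) ->
  E [seq (u, 0) | u <- Ls] [::].
Proof.
elim: Ls => [|u Ls IH] Ls0 //=.
have Ls0' z : z \in Ls -> 0 < deg z by move=> zL; apply: Ls0; rewrite in_cons zL orbT.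
apply: (@eqv_cat k _ _ _ _ dD [:: (u, 0)] [::] _ [::]) => //=; last exact: IH.
  by apply/allP => z /mapP [z' z'L ->]; exact: Ls0'.
exact: (eqv_0 char0).
Qed.

Lemma collect_word (ws : word) (Ls : seq 'rV[int]_n) : uniq Ls ->
  (forall u, u \in Ls -> 0 < deg u) -> wf deg ws ->
  (forall f, f \in ws -> (f.1 \in Ls) || (K%:Z < deg f.1)) ->
  (forall f g, f \in ws -> g \in ws -> form f.1 g.1 = 0) ->
  E ws [seq (u, \sum_(f <- ws | f.1 == u) f.2) | u <- Ls].
Proof.
move=> uL Ls0; elim: ws => [|f ws IH] wfs inL com /=.
  under eq_map do rewrite big_nil.
  exact: (eqv_sym (eqv_zeros Ls0)).
have /andP [f0 wfs'] := wfs.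
have tl g : g \in ws -> g \in f :: ws by rewrite in_cons => ->; rewrite orbT.
pose lam u := \sum_(g <- ws | g.1 == u) g.2.
apply: (@eqv_trans _ _ _ _ _ _ (f :: [seq (u, lam u) | u <- Ls])).
  apply: (@eqv_cat k _ _ _ _ dD [:: f] [:: f]) => //=; first by rewrite f0.
  by apply: IH => // [g /tl|g g' /tl gw /tl]; [exact: inL|exact: com].
have := @insert_letter f.1 f.2 Ls lam uL (inL f (mem_head _ _)) f0 Ls0.
rewrite -surjective_pairing => H.
apply: (eqv_trans (H _)) => [u uLs|].
  case: (pselect (exists2 g, g \in ws & g.1 = u)) => [[g gw <-]|ng].
    by right; apply: com; rewrite ?mem_head ?tl.
  left; rewrite /lam big_seq_cond big1 // => g /andP [gw /eqP gu].
  by case: ng; exists g.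
suff -> : [seq (u, lam u + (if u == f.1 then f.2 else 0)) | u <- Ls] =
   [seq (u, \sum_(f0 <- (f :: ws) | f0.1 == u) f0.2) | u <- Ls] by [].
apply: eq_map => u; rewrite big_cons eq_sym /lam; case: ifP => _; last by rewrite addr0.
by rewrite addrC.
Qed.

Lemma time_blocks (A : Type) (T : seq R) (s : seq (R * A)) :
  sorted (fun a b : R => b < a) T -> sorted (fun u v : R * A => v.1 <= u.1) s ->
  all (fun u => u.1 \in T) s -> s = flatten [seq [seq u <- s | u.1 == t] | t <- T].
Proof.
move=> sT; elim: s => [|u s IH] /=; first by move=> _ _; elim: T {sT}.
move=> su /andP [uT sinT].
have tr : transitive (fun u v : R * A => v.1 <= u.1) by move=> a b c ba ac; exact: le_trans ac ba.
have trT : transitive (fun a b : R => b < a) by move=> a b c ba ac; exact: lt_trans ac ba.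
have su1 : all (fun v : R * A => v.1 <= u.1) s by apply: order_path_min su.
have {}IH := IH (path_sorted su) sinT.
have [T1 [T2 ET]] : exists T1 T2, T = T1 ++ u.1 :: T2.
  by case/splitPr: uT => T1 T2; exists T1, T2.
have uqT : uniq T by apply: sorted_uniq sT => // x; rewrite ltxx.
have T1s t : t \in T1 -> u.1 < t.
  move=> tT1; move: sT; rewrite ET; elim: T1 tT1 {ET} => // a T1 IHT.
  rewrite in_cons cat_cons [sorted _ _]/= => /orP [/eqP ->|tT1] pa.
    by have /allP := order_path_min trT pa; apply; rewrite mem_cat mem_head orbT.
  exact: IHT (path_sorted pa).
have nil1 t : t \in T1 -> [seq v <- s | v.1 == t] = [::].
  move=> /T1s ut; elim: (s) su1 => //= v s' IHs /andP [vu su1]; rewrite IHs //.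
  by case: eqP => // vt; move: ut; rewrite -vt ltNge vu.
have fl1 (f : R -> seq (R * A)) : (forall t, t \in T1 -> f t = [::]) -> flatten [seq f t | t <- T1] = [::].
  elim: (T1) => //= a T3 IHT H; rewrite H ?mem_head //; apply: IHT => t tT.
  by apply: H; rewrite in_cons tT orbT.
rewrite [in LHS]IH ET !map_cat !flatten_cat /= eqxx.
rewrite fl1 // fl1 => [|t tT1]; last by rewrite (lt_eqF (T1s _ tT1)) nil1.
congr (_ :: _ ++ flatten _); apply/eq_in_map => t tT2; case: ifP => // /eqP ut.
by move: uqT; rewrite ET cat_uniq => /and3P [_ _] /=; rewrite ut tT2.
Qed.

End Words.

Lemma wsupp_Vcone w : is_wall e w -> Vcone (wsupp w).
Proof. by case => /rational_cone_Vcone. Qed.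

Lemma wsupp_closed w m : is_wall e w -> ~ wsupp w m -> locally m (fun m' => ~ wsupp w m').
Proof. by move=> /wsupp_Vcone [J [g ->]]; exact: fcone_closed. Qed.

Lemma wall_interior D w m : D w -> ~ singular_locus D m -> wsupp w m -> interior_in (wdir w) (wsupp w) m.
Proof.
move=> Dw ns wm; apply: contrapT => nb; apply: ns; left; exists w => //; split => //.
by move=> H; apply: nb; apply/locally_nbhs.
Qed.

(** Off the singular locus both walls contain a neighbourhood of m in their hyperplanes. If these
    differed, the intersection of the walls would be a rational cone of codimension two through m,
    and m would be singular. *)
Lemma walls_parallel D w w' m : (forall w, D w -> is_wall e w) -> D w -> D w' ->
  ~ singular_locus D m -> wsupp w m -> wsupp w' m -> wdir w = wdir w'.
Proof.
move=> Dwall Dw Dw' ns wm w'm; have ww := Dwall _ Dw; have ww' := Dwall _ Dw'.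
have [_ wp p0 Nw _] := ww; have [_ wp' p0' Nw' _] := ww'.
case: (pselect (par (wdir w) (wdir w'))) => [pr|npr].
  have [i i0 Ei] := primitive_par SEED p0' Nw' Nw pr.
  have [|c [_ /esym/eqP]] := primitive_div (x := wdir w') (a := i) (b := 1) p0 i0.
    by rewrite mulr1n -Ei.
  by rewrite muln_eq1 => /andP [/eqP i1 _]; rewrite Ei i1 mulr1n.
exfalso; apply: (ns); right; exists w, w'; split => //.
have kill m' : m' *m (map_mx intr (col_mx (wdir w) (wdir w')))^T = 0 <->
    pairing (wdir w) m' = 0 /\ pairing (wdir w') m' = 0.
  rewrite map_col_mx tr_col_mx mul_mx_row /pairing.
  have H x : map_mx intr x *m m'^T = (m' *m (map_mx intr x)^T)^T.
    by rewrite trmx_mul trmxK.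
  rewrite !H [X in _ <-> X = _ /\ _]mxE [X in _ <-> _ /\ X = _]mxE; split.
    move/eqP; rewrite row_mx_eq0 => /andP [/eqP -> /eqP ->].
    by rewrite !mxE.
  move=> [h1 h2]; apply/eqP; rewrite row_mx_eq0; apply/andP; split; apply/eqP/matrixP => i j.
    by rewrite !ord1 [RHS]mxE -[RHS]h1 mxE.
  by rewrite !ord1 [RHS]mxE -[RHS]h2 mxE.
apply: (@Vcone_rational R n 2 (col_mx (wdir w) (wdir w')) _ m).
- exact: nonpar_free.
- by apply: Vcone_cap; exact: wsupp_Vcone.
- by move=> m' [/wp h /wp' h']; apply/kill.
- by [].
have i1 := wall_interior Dw ns wm; have i2 := wall_interior Dw' ns w'm.
by apply: locallyW (locallyI i1 i2) => m' [h1 h2] /kill [e1 e2]; split; [exact: h1|exact: h2].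
Qed.

Definition eps (gamma : R -> 'rV[R]_n) (t : R) v : int := - sgz (pairing v (derive1 gamma t)).

(** All v of degree at most K orthogonal to the point are listed, also those with exponent zero; the
    diagram enters only through [cexp]. *)
Definition block K D gamma (t : R) : seq ('rV[int]_n * k) :=
  [seq (v, (eps gamma t v)%:~R * cexp D v (gamma t) * ratr (dl v)) |
    v <- base K & pairing v (gamma t) == 0].

Lemma cexp_sum D v m (s : seq wall) : uniq s -> (forall w, w \in s -> D w /\ wsupp w m) ->
  (forall w, D w -> wsupp w m -> wx w v != 0 -> w \in s) ->
  cexp D v m = \sum_(w <- s) wx w v.
Proof.
move=> us sD sw; apply: fsbig_mem => //.
  by move=> w ws; apply/mem_set; exact: sD.
by move=> w [Dw wm] ws; apply/eqP; apply: contraNT ws; exact: sw.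
Qed.
End Blocks.

(** * Path-ordered products as words *)

Section PathProducts.
Context {n : nat} (Gamma : fixed_data n) (e : 'I_n -> 'rV[int]_n).
Context {R : realType} {k : fieldType} (sigma : set 'rV[R]_n).
Hypothesis char0 : [pchar k] =i pred0.
Hypothesis FD : is_fixed_data Gamma.
Hypothesis INJ : injectivity_assumption Gamma.
Hypothesis SEED : is_seed Gamma e.
Hypothesis GC : good_cone Gamma e sigma.

Local Notation Np := (Nplus Gamma e).
Local Notation P := (monP Gamma sigma).
Local Notation phat := (phat Gamma k sigma).
Local Notation wall := (wall Gamma k sigma).
Local Notation pstar := (pstar Gamma).
Local Notation deg := (deg SEED).
Local Notation form := (@Defs.form n Gamma).
Local Notation base := (base SEED).
Local Notation cexp := (cexp FD SEED).
Local Notation dl := (@dl n Gamma e R FD SEED).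
Local Notation wx := (wx FD SEED).
Local Notation ray := (ray FD SEED).
Local Notation prim := (@prim n Gamma e R FD SEED).
Local Notation mult := (@mult n Gamma e R FD SEED).
Local Notation per := (@per n Gamma e R FD SEED).
Local Notation pdataP := (@pdataP n Gamma e R FD SEED _).
Local Notation Reg := (@Reg n Gamma e).
Local Notation agr := (@agr n Gamma e k).
Local Notation wpos := (@wpos n Gamma e k).
Implicit Types (v x y : 'rV[int]_n) (w : wall) (D : set wall) (m : 'rV[R]_n).
Local Notation qell := (@qell n k).
Local Notation hX := (@hX n Gamma e R k sigma).
Local Notation E K := (@eqv k _ deg form K).
Local Notation block := (block FD SEED).

(** All walls crossed at time t have the same direction, so their letters commute and can be
    collected; the exponents at v add up to [cexp]. *)
Lemma block_eqv D (l K : nat) gamma t (s : seq wall) :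
  is_scattering_diagram e D -> admissible D gamma -> 0 <= t <= 1 -> (K <= l)%N ->
  uniq s ->
  (forall w, w \in s <-> [/\ D w, nontrivial_to_order e l w & wsupp w (gamma t)]) ->
  E K (flatten [seq ray K (eps gamma t (wdir w)) w | w <- s]) (block K D gamma t).
Proof.
move=> [Dw _] [_ _ ns _ tr] t01 Kl us sP.
have wallS w : w \in s -> is_wall e w by move/sP => [/Dw].
have ray_in f w : f \in ray K (eps gamma t (wdir w)) w ->
  exists2 i, (0 < i)%N & f.1 = wdir w *+ i.
  by case/mapP => i; rewrite mem_iota => /andP [i0 _] ->; exists i.
have inS f : f \in flatten [seq ray K (eps gamma t (wdir w)) w | w <- s] ->
    exists w i, [/\ w \in s, (0 < i)%N & f.1 = wdir w *+ i].
  by case/flattenP => r /mapP [w ws ->] /ray_in [i i0 Ei]; exists w, i.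
pose Ls := [seq v <- base K | pairing v (gamma t) == 0].
pose WS := flatten [seq ray K (eps gamma t (wdir w)) w | w <- s].
suff bE : [seq (u, \sum_(f <- WS | f.1 == u) f.2) | u <- Ls] = block K D gamma t.
  rewrite -bE; apply: (collect_word char0 FD).
  - by rewrite filter_uniq // base_uniq.
  - by move=> u; rewrite mem_filter => /andP [_ /(mem_base SEED) [/Np_deg]].
  - apply/allP => f /inS [w [i [/wallS [_ _ _ Nw _] i0 ->]]].
    exact/(Np_deg SEED)/NpMn.
  - move=> f /inS [w [i [ws i0 ->]]]; have [_ wp _ Nw _] := wallS _ ws.
    have [_ _ wm] := (sP w).1 ws.
    case: (ltP K%:Z (deg (wdir w *+ i))) => dK; first by rewrite orbT.
    rewrite orbF mem_filter; apply/andP; split; last by apply/(mem_base SEED); split => //; exact: NpMn.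
    by rewrite (linMn (@pairingDl _ _ (gamma t))) (wp _ wm) mul0rn.
  - move=> f g /inS [w [i [ws i0 ->]]] /inS [w' [i' [ws' i'0 ->]]].
    have [D1 _ m1] := (sP w).1 ws; have [D2 _ m2] := (sP w').1 ws'.
    rewrite (walls_parallel SEED Dw D1 D2 (ns t t01) m1 m2).
    exact: form_parallel.
apply/eq_in_map => v; rewrite mem_filter => /andP [pv /(mem_base SEED) [Nv vK]]; congr (_, _).
have [p0 N0 i0 Ev _] := pdataP Nv.
rewrite (@cexp_sum _ _ _ _ _ _ FD SEED D v (gamma t) s us); first last.
- move=> w D1 wm wv; apply/sP; split => //; apply: (wx_nontrivial char0 INJ GC (Dw _ D1) Nv wv).
  by apply: le_trans vK _; rewrite lez_nat.
- by move=> w /sP [].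
rewrite /WS big_flatten big_map mulr_sumr mulr_suml; apply: eq_big_seq => w ws.
have [_ _ pw Nw _] := wallS _ ws.
(* v is a positive multiple of [prim v], so both are crossed with the same sign. *)
have epsE : eps gamma t v = eps gamma t (prim v).
  rewrite /eps [in LHS]Ev (linMn (@pairingDl _ _ _)) -[_ *+ mult v]mulr_natr sgzM.
  by rewrite (@gtr0_sgz _ (mult v)%:R) ?mulr1 // ltr0n.
rewrite big_map; case: (wdir w =P prim v) => wv.
  rewrite -big_filter (eq_filter (a2 := pred1 (mult v))) => [|i /=]; last first.
    by rewrite wv [X in (_ == X) = _]Ev (inj_eq (rVint_mulrn_inj p0.1)).
  have mi : mult v \in iota 1 K.
    rewrite mem_iota i0 add1n ltnS -lez_nat; apply: le_trans vK.
    rewrite [in leRHS]Ev (degMn SEED) -[leLHS]mulr1 -[_ *+ _]mulr_natl natz ler_wpM2l //.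
    by have := Np_deg SEED N0; lia.
  by rewrite (filter_pred1_uniq (iota_uniq _ _) mi) big_seq1 /= wv -Ev epsE.
rewrite /wx; case: eqP => [//|_]; rewrite mulr0 mul0r big1_seq // => i /andP [/eqP H].
rewrite mem_iota => /andP [ii _]; case: wv.
by have [E1 _] := @prim_uniq n Gamma e R FD SEED _ _ pw Nw ii; rewrite /= in H; rewrite -H E1.
Qed.

(** Compactness of [0, 1]: finitely many intervals cover it, each containing at most its centre as a
    point of S. *)
Lemma finite_isolated (S : set R) :
  (forall t, 0 <= t <= 1 -> exists2 ep : R, 0 < ep & forall s, s != t -> `|s - t| < ep -> ~ S s) ->
  finite_set [set t | 0 <= t <= 1 /\ S t].
Proof.
move=> H.
have /choice [f fP] : forall t : R, exists ep : R, 0 < ep /\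
    (0 <= t <= 1 -> forall s, s != t -> `|s - t| < ep -> ~ S s).
  move=> t; case: (boolP (0 <= t <= 1)) => t01; last by exists 1.
  by have [ep ep0 epP] := H t t01; exists ep.
have := @segment_compact R 0 1; rewrite compact_cover => /(_ R `[0, 1]%classic (fun t => ball t (f t))).
case.
- by move=> t _; apply: ball_open; exact: (fP t).1.
- by move=> t t01; exists t => //; apply: ballxx; exact: (fP t).1.
move=> F FD01 cov; have fF := finite_fset F; apply: sub_finite_set fF.
move=> s [s01 Ss]; have [|t tF] := cov s; first by rewrite /= in_itv.
rewrite /ball /= => st; have := FD01 t tF; rewrite inE /= in_itv /= => t01.
have [-> //|nst] := eqVneq s t.
by case: ((fP t).2 t01 s nst _ Ss); rewrite distrC.
Qed.

Lemma crossing_times_finite D gamma w : (forall w, D w -> is_wall e w) -> admissible D gamma -> D w ->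
  finite_set [set t : R | 0 <= t <= 1 /\ wsupp w (gamma t)].
Proof.
move=> Dw [sm _ _ _ tr] D1; apply: finite_isolated => t t01.
have ww := Dw _ D1; have [_ wp _ _ _] := ww.
have dg : derivable gamma t 1 := sm 0%N t.
case: (pselect (wsupp w (gamma t))) => wm; last first.
  have [ep ep0 H] := curve_locally dg (wsupp_closed ww wm).
  by exists ep => // s _; exact: H.
have [|ep ep0 H] := curve_transversal dg (w := rv (wdir w)) (wp _ wm : dot _ _ = 0).
  exact: tr t01 D1 wm.
by exists ep => // s st /(H _ st) /eqP nz /wp.
Qed.

(** Finitely many walls matter to order l > 0 and each is met finitely often. So the choice in
    [path_product_order] does not fall back on its default. *)
Lemma crossing_seq_exists D gamma l : (0 < l)%N -> is_scattering_diagram e D ->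
  admissible D gamma -> exists s, crossing_seq e D gamma l s.
Proof.
move=> l0 [Dw Dfin] adm.
have fin : finite_set [set u : R * wall |
    [/\ 0 <= u.1 <= 1, D u.2, nontrivial_to_order e l u.2 & wsupp u.2 (gamma u.1)]].
  apply: (@sub_finite_set _ _ (\bigcup_(w in D `&` nontrivial_to_order e l)
     [set (t, w) | t in [set t : R | 0 <= t <= 1 /\ wsupp w (gamma t)]])).
    by move=> [t w] /= [t01 D1 nt wm]; exists w => //; exists t.
  apply: bigcup_finite; first exact: Dfin.
  by move=> w [D1 _]; apply: finite_image; exact: crossing_times_finite adm D1.
have /finite_seqP [s0 Es0] := fin.
pose s := sort (fun u v : R * wall => u.1 <= v.1) (undup s0).
exists s; split; first by rewrite sort_uniq undup_uniq.
  by apply: sort_sorted => u v; exact: le_total.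
move=> t w; rewrite mem_sort mem_undup.
have -> : ((t, w) \in s0) <-> [set` s0] (t, w) by [].
by rewrite -Es0.
Qed.

Lemma foldl_comp (A B : Type) (f : A -> B -> B) (s : seq A) (th : B -> B) h :
  foldl (fun th u => f u \o th) th s h = foldr f (th h) (rev s).
Proof.
elim: s th => //= u s IH th.
by rewrite IH rev_cons foldr_rcons.
Qed.

Lemma flatten_eqv K (T : eqType) (s : seq T) (f g : T -> seq ('rV[int]_n * k)) :
  (forall t, t \in s -> [/\ wf deg (f t), wf deg (g t) & E K (f t) (g t)]) ->
  E K (flatten [seq f t | t <- s]) (flatten [seq g t | t <- s]).
Proof.
elim: s => [|t s IH] H //=; have [ft gt fg] := H t (mem_head _ _).
have H' u : u \in s -> u \in t :: s by rewrite in_cons => ->; rewrite orbT.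
apply: (eqv_cat (degD SEED)) => //; last by apply: IH => u /H' /H.
apply/allP => a /flattenP [r /mapP [u us ->]]; have [/allP fu _ _] := H u (H' _ us).
exact: fu.
Qed.

Lemma block_wf K D gamma t : wf deg (block K D gamma t).
Proof.
apply/allP => a /mapP [v]; rewrite mem_filter => /andP [_ /(mem_base SEED) [Nv _]] -> /=.
exact: Np_deg.
Qed.

Lemma cexp_neq0 D v m : (forall w, D w -> is_wall e w) -> cexp D v m != 0 -> exists w,
  [/\ D w, wsupp w m & wx w v != 0].
Proof.
move=> Dw c0; apply: contrapT => H; case/negP: c0; apply/eqP.
rewrite (@cexp_sum _ _ _ _ _ _ FD SEED D v m [::]) ?big_nil //.
by move=> w D1 wm wv; case: H; exists w.
Qed.

Lemma cexp_crossing D K v m : is_scattering_diagram e D -> v \in base K -> cexp D v m != 0 ->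
  exists w, [/\ D w, wsupp w m, wx w v != 0 & nontrivial_to_order e K w].
Proof.
move=> [Dw _] /(mem_base SEED) [Nv vK] /(cexp_neq0 Dw) [w [D1 wm wv]]; exists w; split => //.
exact: (wx_nontrivial char0 INJ GC (Dw _ D1) Nv wv).
Qed.

(** Times without any crossing are allowed in T, so one T can serve two diagrams. *)
Definition covers (D : set wall) (gamma : R -> 'rV[R]_n) (K : nat) (T : seq R) :=
  [/\ sorted (fun a b : R => b < a) T, forall t, t \in T -> 0 <= t <= 1 &
    forall t w, 0 <= t <= 1 -> D w -> nontrivial_to_order e K w -> wsupp w (gamma t) -> t \in T].

(** Each crossing acts as the word of its ray; grouping by time turns the simultaneous crossings
    into a block. The order l may exceed K, but the additional walls bring only letters that are
    invisible up to degree K. *)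
Lemma path_product_order_word D gamma (l K : nat) T q0 xt h y :
  is_scattering_diagram e D -> admissible D gamma -> (0 < l)%N -> (K <= l)%N ->
  covers D gamma K T -> deg xt <= K%:Z ->
  nonneg_supp SEED q0 xt h -> Reg xt y ->
  hX q0 xt (path_product_order e D gamma l h) y =
  run form K (qell q0) (flatten [seq block K D gamma t | t <- T]) (hX q0 xt h) y.
Proof.
move=> Dd adm l0 Kl [sT T01 Tcov] topK hn Ry; have [Dw Dfin] := Dd.
have [_ _ ns _ tr] := adm.
rewrite /path_product_order; case: xgetP => [s _ [us ss sP]|/(_ _)]; last first.
  by have [s sP] := crossing_seq_exists l0 Dd adm => /(_ s).
rewrite (foldl_comp (fun u => wall_crossing gamma u.1 u.2)).
set s' := rev s.
have us' : uniq s' by rewrite rev_uniq.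
have ss' : sorted (fun u v : R * wall => v.1 <= u.1) s' by rewrite rev_sorted.
have sP' t w : (t, w) \in s' <-> [/\ 0 <= t <= 1, D w, nontrivial_to_order e l w & wsupp w (gamma t)].
  by rewrite mem_rev.
pose f (u : R * wall) := ray K (eps gamma u.1 (wdir u.2)) u.2.
have wpf u : u \in s' -> wpos (f u).
  case: u => t w /sP' [_ /Dw ww _ _]; by rewrite /f /=; apply: ray_wpos ww.
have step : forall r, (forall u, u \in r -> u \in s') ->
    nonneg_supp SEED q0 xt (foldr (fun u => wall_crossing gamma u.1 u.2) h r) /\
    agr xt (hX q0 xt (foldr (fun u => wall_crossing gamma u.1 u.2) h r))
      (run form K (qell q0) (flatten [seq f u | u <- r]) (hX q0 xt h)).
  elim=> [|[t w] r IH] rs //=.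
  have rs' u : u \in r -> u \in s' by move=> ur; apply: rs; rewrite in_cons ur orbT.
  rewrite run_cat.
  have us0 : (t, w) \in s' by apply: rs; rewrite mem_head.
  have [_ /Dw ww _ _] := (sP' t w).1 us0; have [IH1 IH2] := IH rs'.
  have S := crossing_op_supp FD INJ GC topK (eps gamma t (wdir w)) ww IH1.
  split; first by move=> z Rz z0; exact: (S z Rz z0).
  move=> z Rz; rewrite (crossing_op_run char0 FD INJ GC topK (eps gamma t (wdir w)) ww IH1 Rz).
  exact: (run_agr SEED q0 K (wpf _ us0) IH2 Rz).
have [_ ->] // := step _ (fun _ => id).
(* T together with all crossing times to order l, over which both words are cut into pieces. *)
pose T2 := sort (fun a b : R => b <= a) (undup (T ++ [seq u.1 | u <- s'])).
have mT2 t : (t \in T2) = (t \in T ++ [seq u.1 | u <- s']) by rewrite mem_sort mem_undup.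
have sT2 : sorted (fun a b : R => b < a) T2.
  have : sorted (fun a b : R => b <= a) T2 by apply: sort_sorted => a b; exact: le_total.
  have : uniq T2 by rewrite sort_uniq undup_uniq.
  clear; elim: T2 => //= a T2 IH /andP [aT uT] pT.
  have sT := path_sorted pT; have {IH uT}IH := IH uT sT.
  case: T2 aT pT IH {sT} => //= b T2 + /andP [ba _] ->; rewrite in_cons negb_or => /andP [ab _].
  by rewrite andbT lt_neqAle ba andbT eq_sym.
have T2T : [seq t <- T2 | t \in T] = T.
  apply: (irr_sorted_eq (leT := fun a b : R => b < a)) => //.
  - by move=> a b c ba ac; exact: lt_trans ac ba.
  - by apply: sorted_filter sT2 => a b c ba ac; exact: lt_trans ac ba.
  by move=> t; rewrite mem_filter mT2 mem_cat; case: (t \in T).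
have T201 t : t \in T2 -> 0 <= t <= 1.
  rewrite mT2 mem_cat => /orP [/T01 //|/mapP [[t' w] /sP' [t01 _ _ _] ->]] //.
have -> : flatten [seq f u | u <- s'] = flatten [seq flatten [seq f u | u <- [seq u <- s' | u.1 == t]] | t <- T2].
  rewrite [in LHS](time_blocks sT2 ss'); last by apply/allP => u us0; rewrite mT2 mem_cat map_f ?orbT.
  by elim: (T2) => //= t T3 IH; rewrite map_cat flatten_cat IH.
have wfb t : wf deg (flatten [seq f u | u <- [seq u <- s' | u.1 == t]]).
  apply: (wpos_wf SEED) => a /flattenP [r /mapP [u]]; rewrite mem_filter => /andP [_ us0] ->.
  exact: wpf.
have <- : flatten [seq if t \in T then block K D gamma t else [::] | t <- T2] =
    flatten [seq block K D gamma t | t <- T].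
  rewrite -[in RHS]T2T; elim: (T2) => //= t T3 IH.
  by case: ifP => _ /=; rewrite IH.
have yK := Reg_deg topK Ry.
apply: (flatten_eqv (K := K) _ (qell_lin char0 q0) (hX_supp hn) yK) => t tT2.
have t01 := T201 t tT2.
split => //; first by case: ifP => // _; exact: block_wf.
have B : E K (flatten [seq f u | u <- [seq u <- s' | u.1 == t]]) (block K D gamma t).
  have -> : [seq f u | u <- [seq u <- s' | u.1 == t]] =
     [seq ray K (eps gamma t (wdir w)) w | w <- [seq u.2 | u <- [seq u <- s' | u.1 == t]]].
    rewrite -map_comp; apply/eq_in_map => u; rewrite mem_filter => /andP [/eqP ut _].
    by rewrite /f ut.
  apply: (block_eqv Dd adm t01 Kl).
    rewrite map_inj_in_uniq ?filter_uniq // => -[t1 w1] [t2 w2]; rewrite !mem_filter /=.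
    by move=> /andP [/eqP -> _] /andP [/eqP -> _] ->.
  move=> w; split.
    by case/mapP => -[t1 w1]; rewrite mem_filter /= => /andP [/eqP -> /sP' [? ? ? ?]] ->.
  move=> [D1 nt wm]; apply/mapP; exists (t, w) => //; rewrite mem_filter /= eqxx.
  exact/sP'.
case: ifP => tT //; apply: (eqv_trans B).
(* Outside T no wall nontrivial to order K is met, so all exponents in the block are zero. *)
suff -> : block K D gamma t = [seq (v, 0) | v <- base K & pairing v (gamma t) == 0].
  by apply: (eqv_zeros char0) => u; rewrite mem_filter => /andP [_ /(mem_base SEED) [/Np_deg]].
apply/eq_in_map => v; rewrite mem_filter => /andP [_ vb]; congr (_, _).
have -> : cexp D v (gamma t) = 0; last by rewrite mulr0 mul0r.
apply/eqP/negPn/negP => /(cexp_crossing Dd vb) [w [D1 wm _ nt]].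
by rewrite (Tcov t w) in tT.
Qed.

(** From l = max(1, K) on, the coefficient does not depend on l, so it is the limit. *)
Lemma path_product_word D gamma (K : nat) T q0 xt h y :
  is_scattering_diagram e D -> admissible D gamma ->
  covers D gamma K T -> deg xt <= K%:Z ->
  nonneg_supp SEED q0 xt h -> Reg xt y ->
  hX q0 xt (path_product e D gamma h) y =
  run form K (qell q0) (flatten [seq block K D gamma t | t <- T]) (hX q0 xt h) y.
Proof.
move=> Dd adm cov topK hn Ry.
pose a0 := run form K (qell q0) (flatten [seq block K D gamma t | t <- T]) (hX q0 xt h) y.
have H l : (maxn 1 K <= l)%N -> hX q0 xt (path_product_order e D gamma l h) y = a0.
  by rewrite geq_max => /andP [l0 Kl]; exact: path_product_order_word.
rewrite -/a0 hX_in //; case: (pselect (P (q0 + pstar y))) => Py; last first.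
  by rewrite -(H _ (leqnn _)) hX_in // !hext_out.
rewrite (hext_mkP _ Py) /path_product.
have N0 : \forall l \near \oo, path_product_order e D gamma l h (mkP Py) = a0.
  by exists (maxn 1 K) => // l /H; rewrite hX_in // (hext_mkP _ Py).
case: xgetP => [a _ Na|/(_ a0 N0) //].
near \oo => l.
have <- : path_product_order e D gamma l h (mkP Py) = a by near: l.
by near: l.
Unshelve. all: by end_near.
Qed.
End PathProducts.

(** * Comparison along two arcs *)

Section ParabolicArcs.
Context {n : nat} (Gamma : fixed_data n) (e : 'I_n -> 'rV[int]_n).
Context {R : realType} {k : fieldType} (sigma : set 'rV[R]_n).
Hypothesis char0 : [pchar k] =i pred0.
Hypothesis FD : is_fixed_data Gamma.
Hypothesis INJ : injectivity_assumption Gamma.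
Hypothesis SEED : is_seed Gamma e.
Hypothesis GC : good_cone Gamma e sigma.

Local Notation Np := (Nplus Gamma e).
Local Notation P := (monP Gamma sigma).
Local Notation phat := (phat Gamma k sigma).
Local Notation wall := (wall Gamma k sigma).
Local Notation pstar := (pstar Gamma).
Local Notation deg := (deg SEED).
Local Notation form := (@Defs.form n Gamma).
Local Notation base := (base SEED).
Local Notation cexp := (cexp FD SEED).
Local Notation dl := (@dl n Gamma e R FD SEED).
Local Notation wx := (wx FD SEED).
Local Notation ray := (ray FD SEED).
Local Notation prim := (@prim n Gamma e R FD SEED).
Local Notation mult := (@mult n Gamma e R FD SEED).
Local Notation per := (@per n Gamma e R FD SEED).
Local Notation pdataP := (@pdataP n Gamma e R FD SEED _).
Local Notation Reg := (@Reg n Gamma e).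
Local Notation agr := (@agr n Gamma e k).
Local Notation wpos := (@wpos n Gamma e k).
Implicit Types (w : wall) (D : set wall) (m : 'rV[R]_n).
Local Notation block := (block FD SEED).

(** Wall boundaries and codimension-two intersections are spanned by rational vectors, so a curve
    avoiding all rational codimension-two subspaces avoids the singular locus of any diagram. *)
Lemma singular_in_codim2 D m : (forall w, D w -> is_wall e w) -> singular_locus D m -> in_codim2 m.
Proof.
move=> Dw [[w D1 [wm nb]]|[w [w' [D1 D2 [r [G [rk CE]]] wm]]]].
  have [rc wp [w0 _] _ _] := Dw _ D1.
  have [//|H] := cone_boundary_in_codim2 rc w0 (fun m' h => wp m' h) wm.
  by case: nb; apply/locally_nbhs.
move: wm; rewrite CE => -[a _ ->]; apply: rowspan_in_codim2.
by rewrite -[leqRHS]rk.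
Qed.

Lemma parab_admissible D (p w1 w2 : 'rV[R]_n) : is_scattering_diagram e D -> generic_parab p w1 w2 ->
  (forall t, 0 <= t <= 1 -> w1 + (2 * t) *: w2 != 0) -> admissible D (parab p w1 w2).
Proof.
move=> [Dw _] [g0 g1 gt gZ] dn.
have nsup (t : R) : (forall x, x != 0 -> pairing x (parab p w1 w2 t) != 0) ->
    ~ Defs.support D (parab p w1 w2 t).
  move=> g [w D1 wm]; have [_ wp [w0 _] _ _] := Dw _ D1.
  by have /negP := g _ w0; apply; apply/eqP/wp.
split.
- by move=> i t; exact: parab_smooth.
- by move=> t t01; rewrite derive1_parab; exact: dn.
- by move=> t _ /(singular_in_codim2 Dw) /gZ.
- by split; exact: nsup.
move=> t w _ D1 wm; have [_ wp [w0 _] _ _] := Dw _ D1.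
by rewrite derive1_parab; apply: gt => //; exact: wp.
Qed.

(** It runs from b + c at t = 0 to b - c at t = 1, with a bump reaching height a at t = 1/2. *)
Definition quad (b c a t : R) := b + c * (1 - 2 * t) + 4 * t * (1 - t) * a.

(** The signs at 0 and 1 are opposite, so there is a root r. The cofactor of t - r is affine in t
    and negative at both ends, hence on all of [0, 1]. *)
Lemma quad_root b c a : `|b| < c -> exists r, [/\ 0 < r < 1, quad b c a r = 0,
  forall t, 0 <= t <= 1 -> quad b c a t = 0 -> t = r,
  forall t, 0 <= t <= 1 -> 0 < quad b c a t -> t < r & - 2 * c + 4 * a * (1 - 2 * r) < 0].
Proof.
rewrite ltr_norml => /andP [bc cb].
pose p : {poly R} := (- (b + c))%:P + (2 * c - 4 * a) *: 'X + (4 * a) *: 'X^2.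
have pE t : p.[t] = - quad b c a t by rewrite /p /quad !(hornerD, hornerZ, hornerX, hornerXn, hornerC); ring.
have [|r /andP [r0 r1]] := @poly_ivt R p 0 1 ler01.
  rewrite !pE /quad; apply/andP; split; lra.
rewrite /root pE oppr_eq0 => /eqP qr.
pose L t := - 2 * c + 4 * a * (1 - t - r).
have qL t : quad b c a t = (t - r) * L t.
  by rewrite -[LHS]subr0 -qr /quad /L; ring.
have L0 : L 0 < 0.
  have : 0 < quad b c a 0 by rewrite /quad; lra.
  rewrite qL sub0r mulNr -mulrN; case: (ltgtP 0 r) r0 => // [r0 _|<- _]; last by rewrite mul0r ltxx.
  by rewrite pmulr_rgt0 // oppr_gt0.
have L1 : L 1 < 0.
  have : quad b c a 1 < 0 by rewrite /quad; lra.
  rewrite qL; case: (ltgtP r 1) r1 => // [r1 _|-> _]; last by rewrite subrr mul0r ltxx.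
  by rewrite pmulr_rlt0 // subr_gt0.
have Lt t : 0 <= t <= 1 -> L t < 0.
  move=> /andP [t0 t1]; have -> : L t = (1 - t) * L 0 + t * L 1 by rewrite /L; ring.
  case: (ltgtP 0 t) t0 => // [t0 _|<- _]; last by rewrite subr0 mul1r mul0r addr0.
  have h1 : t * L 1 < 0 by rewrite pmulr_rlt0.
  have h2 : (1 - t) * L 0 <= 0 by rewrite mulr_ge0_le0 // ?subr_ge0 // ltW.
  lra.
have rn0 : r != 0.
  apply/eqP => r00; move: qr; rewrite r00 /quad => q0; lra.
have rn1 : r != 1.
  apply/eqP => r00; move: qr; rewrite r00 /quad => q0; lra.
exists r; split => //.
- by rewrite !lt_neqAle r0 r1 eq_sym rn0 rn1.
- move=> t t01; rewrite qL => /eqP; rewrite mulf_eq0 (lt_eqF (Lt t t01)) orbF subr_eq0.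
  by move/eqP.
- by move=> t t01; rewrite qL nmulr_lgt0 ?Lt // subr_lt0.
have := Lt r; rewrite r0 r1 /L => /(_ isT); lra.
Qed.

(** A root is bounded away from the end points. If |1 - 2r| < 1/2, then 4r(1 - r) >= 3/4; otherwise
    the bump has to outweigh at least c/2 - |b| > c/4. *)
Lemma quad_root_interior b c a r : `|b| < c / 4 -> 0 <= r <= 1 -> quad b c a r = 0 ->
  Num.min (3 / 4) (c / 4) <= 4 * r * (1 - r) * (`|a| + 1).
Proof.
move=> bc /andP [r0 r1] q0; have [b1 b2] : - (c / 4) < b /\ b < c / 4.
  by move: bc; rewrite ltr_norml => /andP [].
have a0 : 0 <= `|a| by [].
have k0 : 0 <= 4 * r * (1 - r) by rewrite mulr_ge0 ?subr_ge0 // mulr_ge0.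
have c0 : 0 < c by lra.
rewrite ge_min; case: (lerP (1/2) `|1 - 2 * r|) => h; apply/orP; [right|left].
  have [a1 a2] : a <= `|a| /\ - a <= `|a| by rewrite ler_norm -normrN ler_norm.
  have h1 : 4 * r * (1 - r) * a <= 4 * r * (1 - r) * `|a| by exact: ler_wpM2l.
  have h2 : 4 * r * (1 - r) * - a <= 4 * r * (1 - r) * `|a| by exact: ler_wpM2l.
  move: q0; rewrite /quad => q0.
  move: h; rewrite ler_normr => /orP [h|h].
    have h3 : c * (1 / 2) <= c * (1 - 2 * r) by rewrite ler_wpM2l // ltW.
    lra.
  have h3 : c * (1 / 2) <= c * - (1 - 2 * r) by rewrite ler_wpM2l // ltW.
  lra.
move: h; rewrite ltr_norml => /andP [h1 h2].
have h3 : 3 / 4 <= 4 * r * (1 - r) by nra.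
by apply: (le_trans h3); rewrite ler_peMr // lerDr.
Qed.

Lemma blocks_perm (A T : eqType) (L : seq A) (s : seq T) (r : A -> T) : uniq s -> uniq L ->
  (forall x, x \in L -> r x \in s) -> perm_eq (flatten [seq [seq x <- L | r x == t] | t <- s]) L.
Proof.
move=> us uL rs; apply: uniq_perm => //.
  elim: s us {rs} => //= t s IH /andP [ts us].
  rewrite cat_uniq filter_uniq // IH // andbT /=; apply/hasPn => x /flattenP [b /mapP [t' t's ->]].
  rewrite mem_filter => /andP [/eqP rx xL]; rewrite mem_filter negb_and rx.
  by apply/orP; left; apply: contra ts => /eqP <-.
move=> x; apply/flattenP/idP => [[b /mapP [t _ ->]]|xL].
  by rewrite mem_filter => /andP [].
by exists [seq z <- L | r z == r x]; rewrite ?mem_filter ?eqxx //; apply/map_f/rs.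
Qed.

Lemma blocks_index (A : eqType) (L : seq A) (s : seq R) (r : A -> R) x1 x2 :
  sorted (fun a b : R => b < a) s -> x1 \in L -> x2 \in L -> r x1 \in s -> r x2 \in s ->
  let F := flatten [seq [seq x <- L | r x == t] | t <- s] in
  (index x1 F < index x2 F)%N -> r x2 <= r x1.
Proof.
move=> + x1L x2L; elim: s => //= t s IH ss r1 r2.
have trT : transitive (fun a b : R => b < a) by move=> a b c ba ac; exact: lt_trans ac ba.
have /allP tmax := order_path_min trT ss.
have {}IH := IH (path_sorted ss).
rewrite !index_cat !mem_filter x1L x2L !andbT.
case: (r x2 =P t) r2 => [r2t _|/eqP r2t]; last first.
  rewrite in_cons (negbTE r2t) /= => r2; case: (r x1 =P t) r1 => [-> _ _|/eqP r1t].
    by apply/ltW/tmax.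
  by rewrite in_cons (negbTE r1t) /= ltn_add2l => r1; exact: IH.
case: (r x1 =P t) r1 => [-> _ _|/eqP r1t]; first by rewrite r2t.
rewrite in_cons (negbTE r1t) /= => _ H.
have : (index x2 [seq x <- L | r x == t] < size [seq x <- L | r x == t])%N.
  by rewrite index_mem mem_filter r2t eqxx.
by move: H; clear; lia.
Qed.

Section Arcs.
Variables (K : nat) (y v u p : 'rV[R]_n) (eta : R).
Hypothesis uE : forall x : 'rV[int]_n, pairing x u = (deg x)%:~R.
Hypothesis eta0 : 0 < eta.
Hypothesis away : forall (x : 'rV[int]_n) (s t : R), x \in base K -> pairing x y != 0 -> s = 1 \/ s = -1 ->
  0 <= t <= 1 -> quad (pairing x p) (eta * (deg x)%:~R) (s * pairing x v) t != 0.
Hypothesis near : forall x : 'rV[int]_n, x \in base K -> pairing x y = 0 ->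
  `|pairing x p| < eta * (deg x)%:~R / 4.

(** The point at time t is p + eta (1 - 2t) u + 4 s t (1 - t) v: a path from p + eta u to p - eta u
    through p + s v. *)
Definition arc (s t : R) := parab (p + eta *: u) (- 2 * eta *: u + (4 * s) *: v) (- (4 * s) *: v) t.

Lemma pairing_arc s t x :
  pairing x (arc s t) = quad (pairing x p) (eta * (deg x)%:~R) (s * pairing x v) t.
Proof.
by rewrite /arc /parab -uE !pairing_dot !(dotDr, dotZr) /quad; ring.
Qed.

Lemma arc_derive s t x : pairing x (derive1 (arc s) t) =
  - 2 * (eta * (deg x)%:~R) + 4 * (s * pairing x v) * (1 - 2 * t).
Proof.
by rewrite /arc derive1_parab -uE !pairing_dot !(dotDr, dotZr); ring.
Qed.

Definition vanishing := [seq x <- base K | pairing x y == 0].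

Lemma arc_vanishing s t x : s = 1 \/ s = -1 -> 0 <= t <= 1 -> x \in base K ->
  pairing x (arc s t) = 0 -> x \in vanishing.
Proof.
move=> s1 t01 xb; rewrite pairing_arc mem_filter xb andbT => /eqP q0.
by apply: contraTT q0 => /away ->.
Qed.

(** Each vanishing x is crossed exactly once and downwards, hence with sign +1, and the other x are
    not met. An x2 standing after x1 in the word has been crossed no later than x1, so it is
    nonpositive when x1 is crossed. *)
Lemma arc_word D s : is_scattering_diagram e D -> s = 1 \/ s = -1 -> exists r T L,
  [/\ covers e D (arc s) K T,
    flatten [seq block K D (arc s) t | t <- T] =
      [seq (x, cexp D x (arc s (r x)) * ratr (dl x)) | x <- L],
    perm_eq L vanishing,
    forall x, x \in vanishing -> 0 < r x < 1 /\ pairing x (arc s (r x)) = 0 &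
    forall x1 x2, x1 \in vanishing -> x2 \in vanishing -> (index x1 L < index x2 L)%N ->
      pairing x2 (arc s (r x1)) <= 0].
Proof.
move=> [Dw _] s1.
have d0 x : x \in base K -> 0 < eta * (deg x)%:~R.
  by move=> /(mem_base SEED) [/(Np_deg SEED) dx _]; rewrite mulr_gt0 // ltr0z.
have /choice [r rP] : forall x, exists r : R, x \in vanishing -> [/\ 0 < r < 1,
    pairing x (arc s r) = 0, forall t, 0 <= t <= 1 -> pairing x (arc s t) = 0 -> t = r,
    forall t, 0 <= t <= 1 -> 0 < pairing x (arc s t) -> t < r & pairing x (derive1 (arc s) r) < 0].
  move=> x; case: (boolP (x \in vanishing)) => xv; last by exists 0.
  move: xv; rewrite mem_filter => /andP [/eqP xy xb].
  have [|r [r01 q0 qu qp qd]] := @quad_root (pairing x p) (eta * (deg x)%:~R) (s * pairing x v).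
    by have := near xb xy; have := d0 x xb; lra.
  exists r => _; split => //; rewrite ?pairing_arc ?arc_derive //.
  - by move=> t t01; rewrite pairing_arc; exact: qu.
  - by move=> t t01; rewrite pairing_arc; exact: qp.
pose T := sort (fun a b : R => b <= a) (undup [seq r x | x <- vanishing]).
have uT : uniq T by rewrite sort_uniq undup_uniq.
have mT x : x \in vanishing -> r x \in T.
  by move=> xv; rewrite mem_sort mem_undup map_f.
have sT : sorted (fun a b : R => b < a) T.
  have := uT; have : sorted (fun a b : R => b <= a) T by apply: sort_sorted => a b; exact: le_total.
  clear; elim: T => //= a T2 IH pT /andP [aT uT].
  have {}IH := IH (path_sorted pT) uT.
  case: T2 aT pT IH {uT} => //= b T2 + /andP [ba _] ->; rewrite in_cons negb_or => /andP [ab _].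
  by rewrite andbT lt_neqAle ba andbT eq_sym.
have T01 t : t \in T -> 0 <= t <= 1.
  by rewrite mem_sort mem_undup => /mapP [x /rP [/andP [r0 r1] _ _ _ _] ->]; rewrite !ltW.
pose L := flatten [seq [seq x <- vanishing | r x == t] | t <- T].
have uV : uniq vanishing by rewrite filter_uniq // base_uniq.
exists r, T, L; split.
- split=> // t w t01 D1 /(nontrivialP FD INJ SEED GC _ (Dw _ D1)) [j [j0 _ jK]] wm.
  have [_ wp _ Nw _] := Dw _ D1.
  have wv : wdir w \in vanishing.
    apply: (arc_vanishing s1 t01); last exact: wp.
    apply/(mem_base SEED); split => //; apply: le_trans jK; rewrite (degMn SEED).
    by case: j j0 => // j _; rewrite mulrS lerDl mulrn_wge0 // ltW // Np_deg.
  have [_ _ ru _ _] := rP _ wv; rewrite (ru t t01); last exact: wp.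
  exact: mT.
- rewrite /L map_flatten -map_comp; congr flatten; apply/eq_in_map => t tT /=.
  have t01 := T01 t tT.
  have -> : block K D (arc s) t = [seq (x, (eps (arc s) t x)%:~R * cexp D x (arc s t) * ratr (dl x)) |
      x <- [seq x <- vanishing | r x == t]].
    congr map; rewrite -filter_predI; apply/eq_in_filter => x xb /=.
    apply/idP/andP => [/eqP px|[/eqP rx xy]].
      have xv := arc_vanishing s1 t01 xb px; have [_ _ ru _ _] := rP _ xv.
      by rewrite (ru t t01 px); split => //; move: xv; rewrite mem_filter => /andP [].
    have xv : x \in vanishing by rewrite mem_filter xy.
    by have [_ <- _ _ _] := rP _ xv; rewrite rx.
  apply/eq_in_map => x; rewrite mem_filter => /andP [/eqP rx xv]; congr (_, _).
  have [_ _ _ _ rd] := rP _ xv.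
  by rewrite /eps -rx (ltr0_sgz rd) opprK mul1r.
- exact: blocks_perm.
- by move=> x /rP [].
move=> x1 x2 v1 v2 lt12; have [/andP [a1 a2] _ _ _ _] := rP _ v1.
have := blocks_index sT v1 v2 (mT _ v1) (mT _ v2) lt12.
rewrite leNgt => /negP H; rewrite leNgt; apply/negP => p2; apply: H.
by have [_ _ _ h _] := rP _ v2; apply: h => //; rewrite !ltW.
Qed.

End Arcs.
End ParabolicArcs.

(** * Integrality of exponents read off on P *)

Section ReadingExponents.
Context {n : nat} (Gamma : fixed_data n) (e : 'I_n -> 'rV[int]_n).
Context {R : realType} {k : fieldType} (sigma : set 'rV[R]_n).
Hypothesis char0 : [pchar k] =i pred0.
Hypothesis FD : is_fixed_data Gamma.
Hypothesis INJ : injectivity_assumption Gamma.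
Hypothesis SEED : is_seed Gamma e.
Hypothesis GC : good_cone Gamma e sigma.

Local Notation Np := (Nplus Gamma e).
Local Notation P := (monP Gamma sigma).
Local Notation phat := (phat Gamma k sigma).
Local Notation wall := (wall Gamma k sigma).
Local Notation pstar := (pstar Gamma).
Local Notation deg := (deg SEED).
Local Notation form := (@Defs.form n Gamma).
Local Notation base := (base SEED).
Local Notation cexp := (cexp FD SEED).
Local Notation dl := (@dl n Gamma e R FD SEED).
Local Notation wx := (wx FD SEED).
Local Notation ray := (ray FD SEED).
Local Notation prim := (@prim n Gamma e R FD SEED).
Local Notation mult := (@mult n Gamma e R FD SEED).
Local Notation per := (@per n Gamma e R FD SEED).
Local Notation pdataP := (@pdataP n Gamma e R FD SEED _).
Local Notation Reg := (@Reg n Gamma e).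
Local Notation agr := (@agr n Gamma e k).
Local Notation wpos := (@wpos n Gamma e k).
Implicit Types (w : wall) (D : set wall) (m : 'rV[R]_n).
Local Notation block := (block FD SEED).
Local Notation qell := (@qell n k).
Local Notation hX := (@hX n Gamma e R k sigma).
Local Notation vanishing := (vanishing SEED).

Lemma ratr_dl_neq0 v : Np v -> (ratr (dl v) : k) != 0.
Proof.
by move=> Nv; rewrite char0_ratr_eq0 // gt_eqF // (dl_gt0 FD SEED).
Qed.

(** [dl v] rescales v to the generator of [Ncirc] on its ray. *)
Lemma dl_pairing v (q : 'rV[rat]_n) : Np v -> dl v * pairing v q = pairing (prim v *+ per v) q.
Proof.
move=> Nv; have [_ _ i0 Ev _] := pdataP Nv.
have Dn (z : 'rV[int]_n) i : pairing (z *+ i) q = pairing z q *+ i.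
  exact: (linMn (@pairingDl _ _ q)).
have -> : pairing v q = (mult v)%:R * pairing (prim v) q by rewrite {1}Ev Dn mulr_natl.
by rewrite Dn -[_ *+ per v]mulr_natl mulrA (dlE FD SEED).
Qed.

Lemma dl_qell v q : Np v -> P q -> intk (ratr (dl v) * qell q v).
Proof.
move=> Nv Pq; have [_ _ _ _ [_ _ rP]] := pdataP Nv.
rewrite -char0_ratrM // dl_pairing //.
have /intrP [z ->] := Pq.1 _ ((rP _).2 (dvdnn _)).
by exists z; rewrite char0_ratr_int.
Qed.

Lemma bk_qell v x : bk form x v = qell (pstar x) v :> k.
Proof. by rewrite /bk form_pairing. Qed.

(** A coordinate functional m with <v, m> nonzero is the difference of q + m and q in P, so one of
    them works. *)
Lemma qell_neq0 v : Np v -> exists2 q, P q & qell q v != 0.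
Proof.
move=> Nv; have [j cj] : exists j, coord SEED v j != 0.
  apply: contrapT => H; case/negP: (Np_neq0 SEED Nv); apply/eqP; rewrite (coordE SEED v).
  apply: big1 => j _; suff -> : coord SEED v j = 0 by rewrite scale0r.
  by apply/eqP/negPn/negP => cj; apply: H; exists j.
have [q Pq Pq'] := monP_deep GC (Mcirc_dual FD SEED j).
set m := \row_l _ in Pq'.
have mv : pairing v m != 0.
  rewrite (@linear_pairing n rat (fun x => (coord SEED x j)%:~R / (dd Gamma j)%:R)); last first.
    by move=> x1 x2; rewrite coordD intrD mulrDl.
  have [_ [dpos _] _ _ _] := FD.
  by rewrite mulf_neq0 ?intr_eq0 // invr_eq0 pnatr_eq0 -lt0n.
have [q0|q0] := eqVneq (pairing v q) 0; last first.
  by exists q; rewrite // char0_ratr_eq0.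
by exists (q + m); rewrite // char0_ratr_eq0 // pairingDr q0 add0r.
Qed.

(** Integrality on P extends to [Mcirc] by differences; then [integral_multiple] applies on the
    primitive vector. *)
Lemma dl_multiple v l : Np v -> Qpos l -> (forall q, P q -> intk (l * qell q v)) ->
  exists N : nat, l = N%:R * ratr (dl v).
Proof.
move=> Nv [lam lam0 ->] H; have [p0 N0 i0 Ev [r0 _ rP]] := pdataP Nv.
have HP q : P q -> lam * pairing v q \is a Num.int.
  move=> /H [z]; rewrite -char0_ratrM // -[RHS]char0_ratr_int => /(char0_ratr_inj char0) ->.
  exact: intr_int.
have [||N EN] := @integral_multiple _ _ _ FD SEED _ _ (lam * (mult v)%:R) p0 N0 rP.
- by rewrite mulr_ge0.
- move=> m Mm; have [q Pq Pqm] := monP_deep GC Mm.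
  have -> : lam * (mult v)%:R * pairing (prim v) m = lam * pairing v (q + m) - lam * pairing v q.
    rewrite pairingDr mulrDr [X in _ = X - _]addrC addrK -mulrA; congr (_ * _).
    have -> : pairing v m = pairing (prim v *+ mult v) m by rewrite -Ev.
    by rewrite (linMn (@pairingDl _ _ m)) mulr_natl.
  by rewrite rpredB ?HP.
exists N; have -> : lam = N%:R * dl v.
  apply: (mulIf (x := (mult v)%:R)); first by rewrite pnatr_eq0 -lt0n.
  by rewrite EN natrM mulrC -mulrA (dlE FD SEED).
by rewrite char0_ratrM // ratr_nat.
Qed.

Lemma run_delta0_out K ell (ws : seq ('rV[int]_n * k)) x : wpos ws -> ~ (x = 0 \/ Np x) ->
  run form K ell ws delta0 x = 0.
Proof.
elim: ws x => [|f ws IH] x wp nx /=.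
  by rewrite /delta0; case: eqP => // x0; case: nx; left.
have Nf : Np f.1 by apply: wp; rewrite mem_head.
apply: big1 => j _; rewrite IH ?mulr0 //; first by move=> g gw; apply: wp; rewrite in_cons gw orbT.
case: (nat_of_ord j) => [|i]; first by rewrite mulr0n subr0.
have Ni : Np (f.1 *+ i.+1) by exact: NpMn.
move=> [H|H]; apply: nx; right; last by rewrite -[x](subrK (f.1 *+ i.+1)); exact: NpD.
by move/eqP: H; rewrite subr_eq0 => /eqP ->.
Qed.

Lemma blocks_wpos K D gamma (T : seq R) : wpos (flatten [seq block K D gamma t | t <- T]).
Proof.
move=> f /flattenP [b /mapP [t _ ->] /mapP [x]]; rewrite mem_filter => /andP [_ /(mem_base SEED) [Nx _]].
by move->.
Qed.

(** Along q + p^*(N) the monomial z^q is [delta0], because p^* is injective on the exponents that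
    occur. So the word yields the coefficients of the image of z^q. *)
Lemma run_delta0_path D gamma K T q x : is_scattering_diagram e D -> admissible D gamma ->
  covers e D gamma K T -> P q -> x = 0 \/ Np x -> deg x <= K%:Z ->
  run form K (qell q) (flatten [seq block K D gamma t | t <- T]) delta0 x =
  hext (path_product e D gamma (zmon k q)) (q + pstar x).
Proof.
move=> Dd adm cov Pq Nx xK.
have Rx : Reg x x by left.
have R0 y : Reg x y -> pstar y = 0 -> y = 0.
  move=> Ry py0; have [[_ sl _ _] _ _ _ _] := FD; have [N0 NB] := sl.
  apply: INJ => //; last by rewrite py0 pstar0.
  have Nx' : Nuf Gamma x by case: Nx => [->|/(Np_Nuf FD SEED)].
  case: Ry => [-> //|/(Np_Nuf FD SEED) Nxy].
  by rewrite -[y](subKr x); exact: NB.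
have hE y : Reg x y -> hext (zmon k q : phat) (q + pstar y) = delta0 y.
  move=> Ry; rewrite /delta0; case: (y =P 0) => [->|y0].
    by rewrite pstar0 addr0 (hext_mkP _ Pq) /zmon /= eqxx.
  case: (pselect (P (q + pstar y))) => Py; last by rewrite hext_out.
  rewrite (hext_mkP _ Py) /zmon /= -[X in _ == X]addr0 (inj_eq (addrI q)).
  by case: eqP => // /(R0 _ Ry).
have hn : nonneg_supp SEED q x (zmon k q : phat).
  move=> y Ry; rewrite hE // /delta0; case: eqP => // ->.
  by rewrite (deg0 SEED) ltxx.
have := path_product_word char0 FD INJ GC Dd adm cov xK hn Rx.
rewrite hX_in // => ->.
apply: (run_agr SEED q K (blocks_wpos (K := K) (D := D) (gamma := gamma) (T := T)) _ Rx) => y Ry.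
by rewrite hX_in // hE.
Qed.

Lemma path_product_agree D gamma gamma' K T T' q : is_scattering_diagram e D ->
  admissible D gamma -> admissible D gamma' -> covers e D gamma K T -> covers e D gamma' K T' ->
  path_product e D gamma = path_product e D gamma' -> P q ->
  agree deg K (run form K (qell q) (flatten [seq block K D gamma t | t <- T]) delta0)
    (run form K (qell q) (flatten [seq block K D gamma' t | t <- T']) delta0).
Proof.
move=> Dd a1 a2 c1 c2 E Pq x xK.
case: (pselect (x = 0 \/ Np x)) => Nx; last first.
  by transitivity (0 : k); [|symmetry]; apply: run_delta0_out Nx; exact: blocks_wpos.
apply: (etrans (run_delta0_path Dd a1 c1 Pq Nx xK)); rewrite E; symmetry.
exact: (run_delta0_path Dd a2 c2 Pq Nx xK).
Qed.

Lemma small_exists (s : seq (R * R)) : (forall ab, ab \in s -> 0 < ab.2) ->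
  exists2 c, 0 < c & forall ab, ab \in s -> c * ab.1 < ab.2.
Proof.
elim: s => [|[a b] s IH] H; first by exists 1.
have [|c c0 cP] := IH; first by move=> ab abs; apply: H; rewrite in_cons abs orbT.
have b0 : 0 < b := H _ (mem_head _ _).
have a1 : 0 < `|a| + 1 by rewrite ltr_wpDl.
exists (Num.min c (b / (`|a| + 1))); first by rewrite lt_min c0 divr_gt0.
move=> [a' b']; rewrite in_cons => /orP [/eqP [-> ->]|/[dup] abs /cP /=].
  apply: (@le_lt_trans _ _ (b / (`|a| + 1) * `|a|)).
    apply: (@le_trans _ _ (Num.min c (b / (`|a| + 1)) * `|a|)); last first.
      by rewrite ler_wpM2r // ge_min lexx orbT.
    by rewrite ler_wpM2l ?ler_norm // le_min ltW // divr_ge0 // ltW.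
  by rewrite mulrAC ltr_pdivrMr // ltr_pM2l // ltrDl.
have b'0 := H _ (mem_behead (s := _ :: _) abs); rewrite /= in b'0.
case: (lerP 0 a') => a'0 h.
  by apply: le_lt_trans h; rewrite ler_wpM2r // ge_min lexx.
apply: le_lt_trans b'0; rewrite mulr_ge0_le0 ?ltW // lt_min c0 divr_gt0 //.
Qed.

Lemma bump_locally (y : 'rV[R]_n) (Q : 'rV[R]_n -> Prop) : locally y Q ->
  exists2 c, 0 < c & forall tau, 0 < tau < c -> Q (bump_pt tau y).
Proof.
move=> [ep ep0 H]; exists (Num.min ep 1); first by rewrite lt_min ep0 ltr01.
move=> tau /andP [t0]; rewrite lt_min => /andP [te t1]; apply: H => j.
have -> : bump_pt tau y 0 j - y 0 j = tau ^+ (n.+1 + j) by rewrite !mxE addrAC subrr add0r.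
rewrite addSn exprS normrM (ger0_norm (ltW t0)).
apply: le_lt_trans te; rewrite -[leRHS]mulr1 (ler_wpM2l (ltW t0)) //.
by rewrite ger0_norm ?exprn_ge0 ?exprn_ile1 ?(ltW t0) ?(ltW t1).
Qed.

Lemma locally_close c (y : 'rV[R]_n) : 0 < c -> locally y (fun p => close c y p).
Proof. by move=> c0; exists c. Qed.

Lemma locally_pairing (c : R) (x : 'rV[int]_n) (y : 'rV[R]_n) : c < pairing x y ->
  locally y (fun p => c < pairing x p).
Proof.
rewrite pairing_dot dotC => /locally_dot; apply: locallyW => p.
by rewrite pairing_dot dotC.
Qed.

Lemma locally_pairingN (c : R) (x : 'rV[int]_n) (y : 'rV[R]_n) : pairing x y < c ->
  locally y (fun p => pairing x p < c).
Proof.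
move=> h; have : - c < dot y (- rv x) by rewrite dotNr dotC -pairing_dot ltrN2.
by move/locally_dot; apply: locallyW => p; rewrite dotNr dotC -pairing_dot ltrN2.
Qed.
End ReadingExponents.

(** * Comparing exponents on the two sides of a point *)

Section ArcComparison.
Context {n : nat} (Gamma : fixed_data n) (e : 'I_n -> 'rV[int]_n).
Context {R : realType} {k : fieldType} (sigma : set 'rV[R]_n).
Hypothesis char0 : [pchar k] =i pred0.
Hypothesis FD : is_fixed_data Gamma.
Hypothesis INJ : injectivity_assumption Gamma.
Hypothesis SEED : is_seed Gamma e.
Hypothesis GC : good_cone Gamma e sigma.

Local Notation Np := (Nplus Gamma e).
Local Notation P := (monP Gamma sigma).
Local Notation phat := (phat Gamma k sigma).
Local Notation wall := (wall Gamma k sigma).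
Local Notation pstar := (pstar Gamma).
Local Notation deg := (deg SEED).
Local Notation form := (@Defs.form n Gamma).
Local Notation base := (base SEED).
Local Notation cexp := (cexp FD SEED).
Local Notation dl := (@dl n Gamma e R FD SEED).
Local Notation wx := (wx FD SEED).
Local Notation ray := (ray FD SEED).
Local Notation prim := (@prim n Gamma e R FD SEED).
Local Notation mult := (@mult n Gamma e R FD SEED).
Local Notation per := (@per n Gamma e R FD SEED).
Local Notation pdataP := (@pdataP n Gamma e R FD SEED _).
Local Notation Reg := (@Reg n Gamma e).
Local Notation agr := (@agr n Gamma e k).
Local Notation wpos := (@wpos n Gamma e k).
Implicit Types (w : wall) (D : set wall) (m : 'rV[R]_n).
Local Notation block := (block FD SEED).
Local Notation qell := (@qell n k).
Local Notation vanishing := (vanishing SEED).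

(** A direction in which every hyperplane x^perp with x in N^+ is crossed from one and the same
    side. *)
Lemma degree_functional : exists u : 'rV[R]_n, forall x, pairing x u = (deg x)%:~R.
Proof.
exists (\row_l (deg (delta_mx 0 l))%:~R) => x.
rewrite (@linear_pairing n R (fun x => (deg x)%:~R)) // => a b.
by rewrite (degD SEED) intrD.
Qed.

Lemma chain_absurd (A1 A2 A3 A4 A5 c : R) : A4 * A2 * (A3 + 1) < c * A5 * (A3 + 1) ->
  c * (A5 * (A3 + 1)) < A1 * A2 -> A1 * A2 <= A4 * (A3 + 1) * A2 -> False.
Proof. lra. Qed.

(** By [segment], a hyperplane of degree at most K meets the segment from y - v to y + v only if it
    contains y. By [skew_order], the form of two vectors orthogonal to y has the sign of the
    difference of their slopes <x, v> / deg x. *)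
Section Compare.
Variables (D : set wall) (nu : 'rV[int]_n) (K : nat) (y v : 'rV[R]_n) (rho : R).
Hypothesis Dd : is_scattering_diagram e D.
Hypothesis Dcons : consistent e D.
Hypothesis Nnu : Np nu.
Hypothesis degnu : deg nu = K%:Z.
Hypothesis rho0 : 0 < rho.
Hypothesis nuy : pairing nu y = 0.
Hypothesis nuv : pairing nu v = 0.
Hypothesis segment : forall x, x \in base K -> pairing x y = 0 \/
  0 < pairing x (y + v) * pairing x (y - v).
Hypothesis skew_order : forall x1 x2, x1 \in base K -> x2 \in base K ->
  pairing x1 y = 0 -> pairing x2 y = 0 ->
  ratr (form x1 x2) = rho * ((deg x1)%:~R * pairing x2 v - (deg x2)%:~R * pairing x1 v).
Hypothesis IH : forall x, x \in base K -> deg x < K%:Z -> forall m, pairing x m = 0 -> ~ in_codim2 m ->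
  exists N : nat, cexp D x m = N%:R.

Variable u : 'rV[R]_n.
Hypothesis uE : forall x : 'rV[int]_n, pairing x u = (deg x)%:~R.

Let sides (p : 'rV[R]_n) (eta : R) (x : 'rV[int]_n) :=
  (eta * (deg x)%:~R < pairing x (p + v) /\ eta * (deg x)%:~R < pairing x (p - v)) \/
  (pairing x (p + v) < - (eta * (deg x)%:~R) /\ pairing x (p - v) < - (eta * (deg x)%:~R)).

Lemma sides_exists : exists2 eta, 0 < eta & forall x, x \in base K -> pairing x y != 0 -> sides y eta x.
Proof.
pose s := flatten [seq [:: ((deg x)%:~R : R, `|pairing x (y + v)|); ((deg x)%:~R, `|pairing x (y - v)|)] |
  x <- base K & pairing x y != 0].
have [|eta eta0 H] := @small_exists R s.
  move=> ab /flattenP [l /mapP [x]]; rewrite mem_filter => /andP [xy xb] ->.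
  have [/eqP|] := segment xb; first by rewrite (negbTE xy).
  move=> h; have h1 : pairing x (y + v) != 0 by apply: contraTneq h => ->; rewrite mul0r ltxx.
  have h2 : pairing x (y - v) != 0 by apply: contraTneq h => ->; rewrite mulr0 ltxx.
  by rewrite !inE => /orP [/eqP ->|/eqP ->] /=; rewrite normr_gt0.
exists eta => // x xb xy.
have inS ab : ab \in [:: ((deg x)%:~R : R, `|pairing x (y + v)|); ((deg x)%:~R, `|pairing x (y - v)|)] -> ab \in s.
  move=> h; apply/flattenP; eexists; last exact: h.
  by apply/mapP; exists x => //; rewrite mem_filter xy.
have h1 := H _ (inS _ (mem_head _ _)); have h2 := H _ (inS _ (mem_last _ _)).
rewrite /= in h1 h2.
have [/eqP|h] := segment xb; first by rewrite (negbTE xy).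
have [p1|p1|p1] := ltgtP 0 (pairing x (y + v)).
- have p2 : 0 < pairing x (y - v) by rewrite pmulr_rgt0 in h.
  by left; rewrite !gtr0_norm in h1 h2.
- have p2 : pairing x (y - v) < 0 by rewrite nmulr_rgt0 in h.
  by right; rewrite !ltr0_norm // in h1 h2; lra.
by rewrite -p1 mul0r ltxx in h.
Qed.

(** As 4t(1 - t) lies in [0, 1], the value without the eta-term is a convex combination of those at
    p + v and p - v, so it exceeds the margin. *)
Lemma sides_quad (p : 'rV[R]_n) eta x (s t : R) : 0 < eta -> x \in base K -> sides p eta x ->
  s = 1 \/ s = -1 -> 0 <= t <= 1 ->
  quad (pairing x p) (eta * (deg x)%:~R) (s * pairing x v) t != 0.
Proof.
move=> eta0 /(mem_base SEED) [/(Np_deg SEED) dx _].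
rewrite /sides !pairing_dot !dotDr dotNr -!pairing_dot /quad.
set b := pairing x p; set a := pairing x v; set d := eta * _ => H s1 /andP [t0 t1].
have d0 : 0 < d by rewrite mulr_gt0 // ltr0z.
have l0 : 0 <= 4 * t * (1 - t) by rewrite mulr_ge0 ?subr_ge0 // mulr_ge0.
have l1 : 4 * t * (1 - t) <= 1.
  by have := sqr_ge0 (1 - 2 * t); rewrite expr2; lra.
have dt1 : - d <= d * (1 - 2 * t) by rewrite -mulrN1 ler_pM2l //; lra.
have dt2 : d * (1 - 2 * t) <= d by rewrite -[leRHS]mulr1 ler_pM2l //; lra.
set L := 4 * t * (1 - t) in l0 l1 *; rewrite -/L.
case: H => -[h1 h2].
  have : d < b + L * (s * a).
    case: s1 => ->; rewrite ?mul1r ?mulN1r.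
      have := mulr_ge0 l0 (ltW (_ : 0 < b + a - d)); nra.
    nra.
  by move=> h; rewrite gt_eqF //; lra.
have : b + L * (s * a) < - d.
  case: s1 => ->; rewrite ?mul1r ?mulN1r; nra.
by move=> h; rewrite lt_eqF //; lra.
Qed.

Lemma sides_locally eta x : sides y eta x -> locally y (fun p => sides p eta x).
Proof.
have E1 p : pairing x (p + v) = pairing x p + pairing x v by exact: pairingDr.
have E2 p : pairing x (p - v) = pairing x p - pairing x v by rewrite !pairing_dot dotDr dotNr.
rewrite /sides; case=> -[]; rewrite E1 E2 => h1 h2.
  have g1 : eta * (deg x)%:~R - pairing x v < pairing x y by lra.
  have g2 : eta * (deg x)%:~R + pairing x v < pairing x y by lra.
  apply: locallyW (locallyI (locally_pairing g1) (locally_pairing g2)) => p [k1 k2].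
  by left; rewrite E1 E2; split; lra.
have g1 : pairing x y < - (eta * (deg x)%:~R) - pairing x v by lra.
have g2 : pairing x y < - (eta * (deg x)%:~R) + pairing x v by lra.
apply: locallyW (locallyI (locally_pairingN g1) (locally_pairingN g2)) => p [k1 k2].
by right; rewrite E1 E2; split; lra.
Qed.

Let V := vanishing K y.

Lemma vanishingP x : x \in V <-> [/\ x \in base K, Np x, 0 < deg x, deg x <= K%:Z & pairing x y = 0].
Proof.
rewrite mem_filter; split.
  move=> /andP [/eqP xy xb]; have [Nx xK] := (mem_base SEED _ _).1 xb.
  by split => //; exact: Np_deg.
by move=> [xb _ _ _ ->]; rewrite eqxx.
Qed.

(** deg x1 deg x2 times the difference of the two slopes. *)
Let Dl (x1 x2 : 'rV[int]_n) : R := (deg x1)%:~R * pairing x2 v - (deg x2)%:~R * pairing x1 v.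

(** c bounds the perturbation of y. The three conditions let each vanishing x be crossed on the
    arcs, prevent the perturbation from reversing the order given by distinct slopes, and keep the
    crossing of nu^perp within ep of y + v or y - v. The minimum is the lower bound of
    [quad_root_interior]. *)
Lemma radius_exists eta ep : 0 < eta -> 0 < ep -> exists2 c, 0 < c &
  [/\ forall x, x \in V -> c < eta * (deg x)%:~R / 4,
    forall x1 x2, x1 \in V -> x2 \in V -> Dl x1 x2 < 0 ->
      c * (((deg x1)%:~R + (deg x2)%:~R) * (`|pairing x1 v| + 1)) <
      Num.min (3 / 4) (eta * (deg x1)%:~R / 4) * - Dl x1 x2 &
    forall j, c * (1 + `|u 0 j| / K%:R + `|v 0 j| / (eta * K%:R)) < ep].
Proof.
move=> eta0 ep0.
have K0 : 0 < (K%:R : R).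
  by have := Np_deg SEED Nnu; rewrite degnu ltr0n.
pose s1 := [seq (1 : R, eta * (deg x)%:~R / 4) | x <- V].
pose s2 := [seq (((deg z.1)%:~R + (deg z.2)%:~R) * (`|pairing z.1 v| + 1),
  Num.min (3 / 4) (eta * (deg z.1)%:~R / 4) * - Dl z.1 z.2) | z <- [seq z <- [seq (x1, x2) | x1 <- V, x2 <- V] | Dl z.1 z.2 < 0]].
pose s3 := [seq (1 + `|u 0 j| / K%:R + `|v 0 j| / (eta * K%:R), ep) | j <- enum 'I_n].
have d0 x : x \in V -> 0 < eta * (deg x)%:~R / 4 :> R.
  by move=> /vanishingP [_ _ dx _ _]; rewrite divr_gt0 // mulr_gt0 // ltr0z.
have [|c c0 H] := @small_exists R (s1 ++ s2 ++ s3).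
  move=> ab; rewrite !mem_cat => /or3P [/mapP [x xV ->]|/mapP [z]|/mapP [j _ ->]] //=; first exact: d0.
  rewrite mem_filter => /andP [zD /allpairsP [[x1 x2] /= [x1V x2V Ez]]] -> /=.
  rewrite mulr_gt0 ?oppr_gt0 // lt_min divr_gt0 //= Ez; exact: d0.
exists c => //; split.
- move=> x xV; have := H (1, eta * (deg x)%:~R / 4); rewrite /= mulr1; apply.
  by rewrite mem_cat; apply/orP; left; apply/mapP; exists x.
- move=> x1 x2 x1V x2V D12.
  apply: (H (((deg x1)%:~R + (deg x2)%:~R) * (`|pairing x1 v| + 1),
    Num.min (3 / 4) (eta * (deg x1)%:~R / 4) * - Dl x1 x2)).
  rewrite !mem_cat; apply/or3P; apply: Or32; apply/mapP; exists (x1, x2) => //.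
  by rewrite mem_filter D12 /=; apply/allpairsP; exists (x1, x2).
move=> j; apply: (H (1 + `|u 0 j| / K%:R + `|v 0 j| / (eta * K%:R), ep)).
by rewrite !mem_cat; apply/or3P; apply: Or33; apply/mapP; exists j; rewrite ?mem_enum.
Qed.

(** Since <nu, v> = 0, the crossing time satisfies eta K (1 - 2r) = - <nu, p>; thus r is close to
    1/2, where the arc passes near y + s v. *)
Lemma crossing_close (p : 'rV[R]_n) eta c ep (s r : R) : 0 < eta -> 0 < c -> close c y p ->
  `|pairing nu p| < c -> s = 1 \/ s = -1 -> c < eta * K%:R / 4 ->
  (forall j, c * (1 + `|u 0 j| / K%:R + `|v 0 j| / (eta * K%:R)) < ep) ->
  pairing nu (arc v u p eta s r) = 0 -> close ep (y + s *: v) (arc v u p eta s r).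
Proof.
move=> eta0 c0 yp bc s1 cK H; rewrite (pairing_arc _ _ _ uE) nuv mulr0 /quad mulr0 addr0 degnu => q0 j.
have K0 : 0 < (K%:R : R).
  by have := Np_deg SEED Nnu; rewrite degnu ltr0n.
rewrite -[(K%:Z)%:~R]/(K%:R) in q0.
set z := 1 - 2 * r in q0.
have eK : 0 < eta * K%:R by rewrite mulr_gt0.
have Ez : eta * z = - pairing nu p / K%:R.
  by apply: (mulIf (lt0r_neq0 K0)); rewrite divfK ?lt0r_neq0 //; move: q0; lra.
have Ez' : z = - pairing nu p / (eta * K%:R).
  by apply: (mulIf (lt0r_neq0 eK)); rewrite divfK ?lt0r_neq0 //; move: q0; lra.
have z1 : `|z| <= c / (eta * K%:R).
  by rewrite Ez' normrM normrN normfV (gtr0_norm eK) ler_pM2r ?invr_gt0 // ltW.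
have zle1 : `|z| <= 1.
  by apply: le_trans z1 _; rewrite ler_pdivrMr // mul1r; lra.
have z2 : `|eta * z| <= c / K%:R.
  by rewrite Ez normrM normrN normfV (gtr0_norm K0) ler_pM2r ?invr_gt0 // ltW.
have -> : arc v u p eta s r 0 j - (y + s *: v) 0 j =
    (p 0 j - y 0 j) + (eta * z) * u 0 j - s * (z * z) * v 0 j.
  by rewrite /arc /parab !mxE /z; ring.
apply: le_lt_trans (H j); apply: le_trans (ler_normB _ _) _.
have n1 : `|p 0 j - y 0 j| <= c by apply/ltW/yp.
have n2 : `|eta * z * u 0 j| <= c / K%:R * `|u 0 j| by rewrite normrM ler_wpM2r.
have n3 : `|s * (z * z) * v 0 j| <= c / (eta * K%:R) * `|v 0 j|.
  rewrite normrM ler_wpM2r // normrM.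
  have -> : `|s| = 1 by case: s1 => ->; rewrite ?normrN normr1.
  by rewrite mul1r normrM; apply: le_trans z1; rewrite ler_piMr.
have n4 := ler_normD (p 0 j - y 0 j) (eta * z * u 0 j).
have -> : c * (1 + `|u 0 j| / K%:R + `|v 0 j| / (eta * K%:R)) =
  c + c / K%:R * `|u 0 j| + c / (eta * K%:R) * `|v 0 j| by ring.
lra.
Qed.

Lemma arc_ends (p : 'rV[R]_n) eta (s s' : R) :
  arc v u p eta s 0 = arc v u p eta s' 0 /\ arc v u p eta s 1 = arc v u p eta s' 1.
Proof. by split; apply/rowP => j; rewrite /arc /parab !mxE; ring. Qed.

(* The arcs through y + v and y - v, from y + eta u to y - eta u, cross the same hyperplanes;
   those meeting at y are crossed in an order given by the sign of the form on one arc, and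
   in the opposite order on the other, which is the situation of rank2_positivity. *)
Lemma comparison :
  locally (y + v) (fun m => pairing nu m = 0 -> cexp D nu m = cexp D nu (y + v)) ->
  locally (y - v) (fun m => pairing nu m = 0 -> cexp D nu m = cexp D nu (y - v)) ->
  exists N : nat, cexp D nu (y - v) = cexp D nu (y + v) + N%:R.
Proof.
move=> [ep1 ep10 loc1] [ep2 ep20 loc2].
have K0 : 0 < (K%:R : R).
  by have := Np_deg SEED Nnu; rewrite degnu ltr0n.
have nuV : nu \in V.
  have := Np_deg SEED Nnu => d0; apply/vanishingP; split=> //; rewrite ?degnu //.
  by apply/(mem_base SEED); rewrite degnu.
pose ep := Num.min ep1 ep2; have ep0 : 0 < ep by rewrite lt_min ep10.
have [eta eta0 sid] := sides_exists.
have [c c0 [cb cD cp]] := radius_exists eta0 ep0.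
have Q1 : locally y (fun p => forall x, x \in V -> `|pairing x p| < c).
  apply: locally_seq => x /vanishingP [_ _ _ _ xy].
  have h1 : - c < pairing x y by rewrite xy oppr_lt0.
  have h2 : pairing x y < c by rewrite xy.
  apply: locallyW (locallyI (locally_pairing h1) (locally_pairingN h2)) => p [k1 k2].
  by rewrite ltr_norml k1.
have Q2 : locally y (fun p => forall x, x \in [seq x <- base K | pairing x y != 0] -> sides p eta x).
  apply: locally_seq => x; rewrite mem_filter => /andP [xy xb].
  exact: sides_locally (sid _ xb xy).
have [c1 c10 HQ] := bump_locally (locallyI (locally_close y c0) (locallyI Q1 Q2)).
(* Both arcs start at p + eta u, so a single perturbation makes both generic. *)
pose W := [seq (- 2 * eta *: u + (4 * s) *: v, - (4 * s) *: v) | s <- [:: 1 : R; -1]].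
have [tau tau01 gen] := generic_parab_exists (y + eta *: u) W c10.
have bE : bump_pt tau (y + eta *: u) = bump_pt tau y + eta *: u by rewrite /bump_pt addrAC.
set p := bump_pt tau y in bE.
have [pc [pb ps]] := HQ _ tau01.
pose A := arc v u p eta.
have genA s : s = 1 \/ s = -1 ->
    generic_parab (p + eta *: u) (- 2 * eta *: u + (4 * s) *: v) (- (4 * s) *: v).
  move=> s1; rewrite -bE.
  apply: (gen (- 2 * eta *: u + (4 * s) *: v, - (4 * s) *: v)).
  by case: s1 => ->; rewrite /W !inE eqxx ?orbT.
have adm s : s = 1 \/ s = -1 -> admissible D (A s).
  move=> s1; apply: (parab_admissible Dd (genA s s1)) => t _.
  apply/eqP => E0; have := arc_derive v p eta uE s t nu.
  rewrite /arc derive1_parab E0 nuv mulr0 mulr0 mul0r addr0 degnu pairing_dot dotC dot0l.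
  have : 0 < eta * K%:R by rewrite mulr_gt0.
  by rewrite -[(K%:Z)%:~R]/(K%:R); lra.
have away x (s t : R) : x \in base K -> pairing x y != 0 -> s = 1 \/ s = -1 ->
    0 <= t <= 1 -> quad (pairing x p) (eta * (deg x)%:~R) (s * pairing x v) t != 0.
  move=> xb xy s1 t01; apply: sides_quad => //; apply: ps.
  by rewrite mem_filter xy.
have near x : x \in base K -> pairing x y = 0 -> `|pairing x p| < eta * (deg x)%:~R / 4.
  move=> xb xy; have xV : x \in V by rewrite mem_filter xy eqxx.
  exact: lt_trans (pb _ xV) (cb _ xV).
have [r1 [T1 [L1 [cov1 W1 P1 R1 _]]]] := arc_word FD INJ GC uE eta0 away near Dd (or_introl erefl).
have [r2 [T2 [L2 [cov2 W2 P2 R2 O2]]]] := arc_word FD INJ GC uE eta0 away near Dd (or_intror erefl).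
have ppE : path_product e D (A 1) = path_product e D (A (-1)).
  have [E0 E1] := arc_ends p eta 1 (-1).
  by apply: Dcons => //; apply: adm; [left|right].
have LV x : x \in L2 -> x \in V by rewrite (perm_mem P2).
pose Cp x := cexp D x (A 1 (r1 x)); pose Cm x := cexp D x (A (-1) (r2 x)).
have Uniq : uniq L2 by rewrite (perm_uniq P2); apply: filter_uniq; exact: base_uniq.
(* On the arc through y - v larger slopes are crossed earlier. If x1, crossed later, had the larger
   slope, combining the equation for x1 with the inequality for x2 would bound 4r(1 - r) times the
   slope defect by c, against the choice of c. *)
have form0 x1 x2 : x1 \in L2 -> x2 \in L2 -> (index x1 L2 < index x2 L2)%N -> 0 <= form x1 x2.
  move=> /LV v1 /LV v2 /(O2 _ _ v1 v2) q2.
  have [b1 _ d1 _ y1] := (vanishingP x1).1 v1; have [b2 _ d2 _ y2] := (vanishingP x2).1 v2.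
  have E12 := skew_order b1 b2 y1 y2.
  suff : 0 <= (ratr (form x1 x2) : R) by rewrite ler0q.
  rewrite E12; apply: mulr_ge0; first exact: ltW.
  change (0 <= Dl x1 x2); rewrite leNgt; apply/negP => Dneg; clear E12.
  have [/andP [ra rb] q1] := R2 _ v1.
  have r01 : 0 <= r2 x1 <= 1 by rewrite !ltW.
  rewrite (pairing_arc _ _ _ uE) in q1; rewrite (pairing_arc _ _ _ uE) in q2.
  have := quad_root_interior (near _ b1 y1) r01 q1.
  have hD := cD _ _ v1 v2 Dneg.
  rewrite mulN1r normrN => mu.
  move: q1 q2; rewrite /quad !mulN1r; set mm := 4 * r2 x1 * (1 - r2 x1) in mu *.
  set f1 : R := (deg x1)%:~R in hD mu *; set f2 : R := (deg x2)%:~R in hD *.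
  set a1 := pairing x1 v in hD mu *; set a2 := pairing x2 v in hD *.
  have f10 : 0 < f1 by rewrite ltr0z.
  have f20 : 0 < f2 by rewrite ltr0z.
  have := pb _ v1; have := pb _ v2; rewrite !ltr_norml.
  set e1 := pairing x1 p; set e2 := pairing x2 p => /andP [e2a e2b] /andP [e1a e1b] q1 q2.
  have k2 : f1 * (e2 + eta * f2 * (1 - 2 * r2 x1) + mm * - a2) <= 0 by rewrite pmulr_rle0.
  have k1 : f2 * (e1 + eta * f1 * (1 - 2 * r2 x1) + mm * - a1) = 0 by rewrite q1 mulr0.
  have DE : Dl x1 x2 = f1 * a2 - f2 * a1 by [].
  have k3 : mm * - Dl x1 x2 <= f2 * e1 - f1 * e2 by rewrite DE; lra.
  have k4 : f2 * e1 - f1 * e2 < c * (f1 + f2).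
    have h1 : f2 * e1 < f2 * c by rewrite ltr_pM2l.
    have h2 : f1 * - c < f1 * e2 by rewrite ltr_pM2l.
    lra.
  have a10 : 0 < `|a1| + 1 by rewrite ltr_wpDl.
  have k5 : mm * - Dl x1 x2 * (`|a1| + 1) < c * (f1 + f2) * (`|a1| + 1).
    apply: (le_lt_trans (ler_wpM2r (ltW a10) k3)); rewrite (ltr_pM2r a10); exact: k4.
  have k7 : 0 <= - Dl x1 x2 by rewrite oppr_ge0; exact: ltW.
  exact: (chain_absurd k5 hD (ler_wpM2r k7 mu)).
(* [L2], the crossing order on the arc through y - v, is the sorted list; the functionals come from
   the points of P. *)
have [N EN] : exists N : nat, Cm nu = Cp nu + N%:R.
  apply: (@rank2_positivity k char0 _ deg form K (degD SEED) (@formDl n Gamma) (form_skew FD) L2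
    Uniq _ _ _ form0 (fun x => ratr (dl x)) (fun ell => exists2 q, P q & ell = qell q) Cp Cm L1).
  - by move=> x /LV /vanishingP [].
  - by move=> x /LV /vanishingP [].
  - move=> x1 x2 i j /LV /vanishingP [_ N1 _ _ y1] /LV /vanishingP [_ N2 _ _ y2] i0 j0 dK.
    have Nx : Np (x1 *+ i + x2 *+ j) := NpD SEED (NpMn SEED i0 N1) (NpMn SEED j0 N2).
    have bx : x1 *+ i + x2 *+ j \in base K by apply/(mem_base SEED); split; [exact: Nx|exact: dK].
    have yx : pairing (x1 *+ i + x2 *+ j) y = 0.
      by rewrite pairingDl !(linMn (@pairingDl _ _ y)) y1 y2 !mul0rn addr0.
    rewrite (perm_mem P2); apply/vanishingP.
    exact: (And5 bx Nx (Np_deg SEED Nx) dK yx).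
  - by apply: perm_trans P1 _; rewrite perm_sym.
  - move=> x /LV /vanishingP [_ Nx _ _ _]; split; last exact: (ratr_dl_neq0 (R := R) char0 FD SEED Nx).
    have dp : 0 < dl x := dl_gt0 FD SEED Nx.
    by exists (dl x); [exact: ltW dp|].
  - move=> x1 x2 /LV /vanishingP [_ N1 _ _ _] /LV /vanishingP [_ N2 _ _ _].
    rewrite bk_qell; exact: (dl_qell char0 FD SEED N1 (monP_pstar SEED GC N2)).
  - by move=> ell x [q Pq ->] /LV /vanishingP [_ Nx _ _ _]; exact: (dl_qell char0 FD SEED Nx Pq).
  - by move=> ell [q Pq ->]; exact: qell_lin.
  - move=> x /LV /vanishingP [_ Nx _ _ _]; have [q Pq q0] := qell_neq0 char0 FD SEED GC Nx.
    by exists (qell q); [exists q|].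
  - move=> x l /LV /vanishingP [_ Nx _ _ _] ql H; apply: (dl_multiple char0 FD SEED GC Nx ql) => q Pq.
    by apply: H; exists q.
  - move=> x /LV xV dx; have [xb _ _ _ _] := (vanishingP x).1 xV.
    have [_ q0] := R1 _ xV; apply: (IH xb dx q0).
    by have [_ _ _ gZ] := genA 1 (or_introl erefl); exact: gZ.
  - move=> ell [q Pq ->]; rewrite /Cp /Cm -W1 -W2.
    exact: (path_product_agree char0 FD INJ GC Dd (adm _ (or_introl erefl)) (adm _ (or_intror erefl)) cov1 cov2 ppE Pq).
  - by rewrite (perm_mem P2).
  - by [].
have cK : c < eta * K%:R / 4 by have := cb _ nuV; rewrite degnu.
have bn : `|pairing nu p| < c by exact: pb.
exists N; have [_ q1] := R1 _ nuV; have [_ q2] := R2 _ nuV.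
have c1' := crossing_close eta0 c0 pc bn (or_introl erefl) cK cp q1.
have c2' := crossing_close eta0 c0 pc bn (or_intror erefl) cK cp q2.
rewrite scale1r in c1'; rewrite scaleN1r in c2'.
have <- : Cm nu = cexp D nu (y - v).
  have cl : close ep2 (y - v) (A (-1) (r2 nu)).
    by move=> j; apply: lt_le_trans (c2' j) _; rewrite ge_min lexx orbT.
  exact: (loc2 _ cl q2).
have <- : Cp nu = cexp D nu (y + v).
  have cl : close ep1 (y + v) (A 1 (r1 nu)).
    by move=> j; apply: lt_le_trans (c1' j) _; rewrite ge_min lexx.
  exact: (loc1 _ cl q1).
exact: EN.
Qed.

End Compare.
End ArcComparison.

(** * General points of rational hyperplanes *)

Section GenericPoints.
Context {n : nat} (Gamma : fixed_data n) (e : 'I_n -> 'rV[int]_n).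
Context {R : realType} {k : fieldType} (sigma : set 'rV[R]_n).
Hypothesis char0 : [pchar k] =i pred0.
Hypothesis FD : is_fixed_data Gamma.
Hypothesis INJ : injectivity_assumption Gamma.
Hypothesis SEED : is_seed Gamma e.
Hypothesis GC : good_cone Gamma e sigma.

Local Notation Np := (Nplus Gamma e).
Local Notation P := (monP Gamma sigma).
Local Notation phat := (phat Gamma k sigma).
Local Notation wall := (wall Gamma k sigma).
Local Notation pstar := (pstar Gamma).
Local Notation deg := (deg SEED).
Local Notation form := (@Defs.form n Gamma).
Local Notation base := (base SEED).
Local Notation cexp := (cexp FD SEED).
Local Notation dl := (@dl n Gamma e R FD SEED).
Local Notation wx := (wx FD SEED).
Local Notation ray := (ray FD SEED).
Local Notation prim := (@prim n Gamma e R FD SEED).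
Local Notation mult := (@mult n Gamma e R FD SEED).
Local Notation per := (@per n Gamma e R FD SEED).
Local Notation pdataP := (@pdataP n Gamma e R FD SEED _).
Local Notation Reg := (@Reg n Gamma e).
Local Notation agr := (@agr n Gamma e k).
Local Notation wpos := (@wpos n Gamma e k).
Implicit Types (w : wall) (D : set wall) (m : 'rV[R]_n).
Local Notation block := (block FD SEED).

Lemma par_trans_neq0 (nu z1 z2 : 'rV[int]_n) : nu != 0 -> par z1 nu -> par z2 nu -> par z1 z2.
Proof.
move=> /neq0_entry [q nq] p1 p2 i j.
apply: (mulfI nq); apply: (mulfI nq).
have := p1 i q; have := p1 j q; have := p2 i q; have := p2 j q; rewrite /par => e1 e2 e3 e4.
transitivity ((z1 0 i * nu 0 q) * (z2 0 j * nu 0 q)); first by ring.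
by rewrite e4 e1; transitivity ((z1 0 q * nu 0 j) * (z2 0 q * nu 0 i)); [ring|rewrite -e3 -e2; ring].
Qed.

(** The displacement by powers of t is corrected in one coordinate q, with nu_q nonzero, to stay in
    nu^perp. On points of nu^perp a form z acts through [wz z], which is nonzero unless z is
    parallel to nu. *)
Lemma generic_nearby (nu : 'rV[int]_n) m ep : 0 < ep -> nu != 0 -> pairing nu m = 0 ->
  exists m', [/\ close ep m m', pairing nu m' = 0 & ~ in_codim2 m'].
Proof.
move=> ep0 nu0 num; have [q nq] := neq0_entry nu0.
have nqR : (nu 0 q)%:~R != 0 :> R by rewrite intr_eq0.
pose bt (t : R) : 'rV[R]_n := \row_j t ^+ (n.+1 + j).
pose mt t : 'rV[R]_n := m + bt t - (dot (rv nu) (bt t) / (nu 0 q)%:~R) *: delta_mx 0 q.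
pose wz (z : 'rV[int]_n) : 'rV[R]_n := rv z - ((z 0 q)%:~R / (nu 0 q)%:~R) *: rv nu.
have dd z : dot (rv z) (delta_mx 0 q : 'rV[R]_n) = (z 0 q)%:~R.
  rewrite dotE (bigD1 q) //= !mxE !eqxx mulr1 big1 ?addr0 // => j jq.
  by rewrite !mxE eqxx (negbTE jq) mulr0.
have mE z t : pairing z (mt t) = pairing z m + dot (wz z) (bt t).
  rewrite !pairing_dot /mt /wz !(dotDr, dotNr, dotZr, dotDl, dotNl, dotZl) dd; ring.
have wz0 z : ~ par z nu -> wz z != 0.
  move=> np; apply/eqP => E; apply: np => i j; apply/eqP; rewrite -(eqr_int R) !intrM; apply/eqP.
  have zE l : (z 0 l)%:~R = (z 0 q)%:~R / (nu 0 q)%:~R * (nu 0 l)%:~R :> R.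
    by move/rowP/(_ l): E; rewrite !mxE => /eqP; rewrite subr_eq0 => /eqP.
  by rewrite (zE i) (zE j); ring.
pose S := 1 + \sum_j `|(nu 0 j)%:~R : R| / `|(nu 0 q)%:~R|.
have S0 : 0 < S by rewrite ltr_wpDr // sumr_ge0 // => j _; rewrite divr_ge0.
pose PP z := if `[< par z nu >] then 1 : {poly R} else lpol (wz z) (pairing z m).
have [||t /andP [t0]] := @avoid_roots R _ PP (Num.min 1 (ep / S)).
- by rewrite lt_min ltr01 divr_gt0.
- by move=> z; rewrite /PP; case: asboolP => h; [exact: oner_neq0|by apply: lpol_neq0; exact: wz0].
rewrite lt_min => /andP [t1 tep] H; exists (mt t).
have pw (j : nat) : 0 <= t ^+ (n.+1 + j) <= t.
  rewrite exprn_ge0 ?(ltW t0) //= addSn exprS -[leRHS]mulr1 (ler_wpM2l (ltW t0)) //.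
  by rewrite exprn_ile1 ?(ltW t0) ?(ltW t1).
split.
- move=> j; have -> : mt t 0 j - m 0 j = t ^+ (n.+1 + j) - dot (rv nu) (bt t) / (nu 0 q)%:~R * (delta_mx 0 q : 'rV[R]_n) 0 j.
    by rewrite /mt /bt !mxE; ring.
  have tS : t * S < ep by rewrite -ltr_pdivlMr.
  apply: le_lt_trans tS; rewrite mulrDr mulr1; apply: le_trans (ler_normB _ _) _.
  have /andP [pw0 pw1] := pw j; apply: lerD; first by rewrite ger0_norm.
  rewrite normrM; have d1 : `|(delta_mx 0 q : 'rV[R]_n) 0 j| <= 1.
    by rewrite mxE; case: (_ && _); rewrite ?normr1 ?normr0.
  apply: le_trans (ler_wpM2l (normr_ge0 _) d1) _; rewrite mulr1 normrM normfV dotE.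
  rewrite -mulr_suml mulrA ler_pM2r ?invr_gt0 ?normr_gt0 // mulr_sumr.
  apply: le_trans (ler_norm_sum _ _ _) _; apply: ler_sum => i _.
  rewrite normrM !mxE mulrC ler_wpM2r // ger0_norm; by have /andP [] := pw i.
- rewrite mE num add0r; have -> : wz nu = 0; last by rewrite dot0l.
  by rewrite /wz divff // scale1r subrr.
have nz z : ~ par z nu -> pairing z (mt t) != 0.
  move=> np; have := H z; rewrite /PP; case: asboolP => // _.
  by rewrite /root lpolE mE.
move=> [z1 [z2 [np e1 e2]]].
have p1 : par z1 nu by apply: contrapT => /nz; rewrite e1 eqxx.
have p2 : par z2 nu by apply: contrapT => /nz; rewrite e2 eqxx.
exact: np (par_trans_neq0 nu0 p1 p2).
Qed.

Lemma pairing_par (v z : 'rV[int]_n) m : v != 0 -> par z v -> pairing v m = 0 -> pairing z m = 0.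
Proof.
move=> /neq0_entry [q vq] p vm.
have vqR : (v 0 q)%:~R != 0 :> R by rewrite intr_eq0.
apply: (mulfI vqR); rewrite mulr0 -[RHS](mulr0 (z 0 q)%:~R) -vm !pairing_dot -!dotZl.
congr (dot _ _); apply/rowP => j; rewrite !mxE -!intrM; congr (_%:~R).
by rewrite mulrC p.
Qed.

Lemma cexp_finite D v : is_scattering_diagram e D -> Np v -> exists s : seq wall,
  (forall w, w \in s -> D w) /\
  forall m, cexp D v m = \sum_(w <- s | `[< wsupp w m >]) wx w v.
Proof.
move=> [Dw Dfin] Nv.
have l0 : (0 < absz (deg v))%N by rewrite absz_gt0 gt_eqF // (Np_deg SEED).
have /finite_seqP [s0 Es] := Dfin _ l0; pose s := undup s0.
have sP w : w \in s <-> D w /\ nontrivial_to_order e (absz (deg v)) w.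
  by rewrite mem_undup; have -> : (w \in s0) <-> [set` s0] w by []; rewrite -Es.
exists s; split => [w /sP [] //|m].
rewrite -big_filter; apply: cexp_sum; first by rewrite filter_uniq // undup_uniq.
  by move=> w; rewrite mem_filter => /andP [/asboolP wm /sP []].
move=> w D1 wm wv; rewrite mem_filter; apply/andP; split; first exact/asboolP.
apply/sP; split => //; apply: (wx_nontrivial char0 INJ GC (Dw _ D1) Nv wv).
by rewrite gtz0_abs // (Np_deg SEED).
Qed.

(** Finitely many walls contribute. Each either misses a neighbourhood of m or, m being nonsingular,
    contains one within v^perp. *)
Lemma cexp_locally D v m : is_scattering_diagram e D -> Np v -> pairing v m = 0 ->
  ~ singular_locus D m ->
  locally m (fun m' => pairing v m' = 0 -> cexp D v m' = cexp D v m).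
Proof.
move=> Dd Nv vm ns; have [Dw _] := Dd; have [s [sD cE]] := cexp_finite Dd Nv.
have L : locally m (fun m' => forall w, w \in s -> wx w v != 0 -> pairing v m' = 0 -> wsupp w m' <-> wsupp w m).
  apply: locally_seq => w /sD D1; have ww := Dw _ D1.
  case: (pselect (wsupp w m)) => wm; last first.
    by apply: locallyW (wsupp_closed ww wm) => m' nm _ _; split.
  apply: locallyW (wall_interior D1 ns wm) => m' H wv vm'; split => // _; apply: H.
  have [p0 _ i0 Ev _] := pdataP Nv.
  rewrite (wx_prim wv); apply: pairing_par vm'; first exact: Np_neq0 Nv.
  by move=> i j; rewrite {2 4}Ev !mulmxnE -!(mulr_natr (prim v 0 _)); ring.
apply: locallyW L => m' H vm'; rewrite !cE.
rewrite big_mkcond [RHS]big_mkcond; apply: eq_big_seq => w ws.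
have [->|wv] := eqVneq (wx w v) 0; first by rewrite !if_same.
by congr (if _ then _ else _); apply/asbool_equiv_eq/H.
Qed.

(** With f1 and f2 the forms of nu with x1 and x2, the combination f2 x1 - f1 x2 vanishes at x. As x
    is general in nu^perp, it is parallel to nu; comparing degrees and forms with x1 and x2 gives
    the identity. *)
Lemma skew_identity (nu x1 x2 : 'rV[int]_n) (x : 'rV[R]_n) (s0 : R) : Np nu ->
  pairing nu x = 0 -> ~ in_codim2 x ->
  pairing x1 x = - s0 * ratr (form nu x1) -> pairing x2 x = - s0 * ratr (form nu x2) ->
  (deg nu)%:~R * form x1 x2 = (deg x1)%:~R * form nu x2 - (deg x2)%:~R * form nu x1.
Proof.
move=> Nnu nux nZ; set f1 := form nu x1; set f2 := form nu x2 => e1 e2.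
have [q nq] := neq0_entry (Np_neq0 SEED Nnu).
have nqQ : (nu 0 q)%:~R != 0 :> rat by rewrite intr_eq0.
have fZl (a : int) (z z' : 'rV[int]_n) : form (a *: z) z' = a%:~R * form z z'.
  by rewrite !form_pairing /pairing /Defs.pstar map_mxZ -scalemxAl !linearZ /= !mxE.
have fZr (a : int) (z z' : 'rV[int]_n) : form z (a *: z') = a%:~R * form z z'.
  by rewrite (form_skew FD) fZl (form_skew FD z') mulrN opprK.
have fDr z : {morph form z : a b / a + b} by move=> a b; exact: (BDr (@formDl n Gamma) (form_skew FD)).
pose g1 : int := numq f1 * denq f2; pose g2 : int := numq f2 * denq f1.
pose N0 : int := denq f1 * denq f2.
have N00 : N0%:~R != 0 :> rat by rewrite intr_eq0 mulf_neq0 // denq_neq0.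
have G1 : g1%:~R = N0%:~R * f1 by rewrite /g1 /N0 !intrM -{3}(divq_num_den f1); field; rewrite intr_eq0 denq_neq0.
have G2 : g2%:~R = N0%:~R * f2 by rewrite /g2 /N0 !intrM -{3}(divq_num_den f2); field; rewrite intr_eq0 denq_neq0.
pose w := g2 *: x1 - g1 *: x2.
have pw : par w nu.
  apply: contrapT => np; apply: nZ; exists w, nu; split => //.
  have E z : pairing z x = dot (rv z) x by exact: pairing_dot.
  have gR (g : int) (f : rat) : g%:~R = N0%:~R * f -> g%:~R = N0%:~R * ratr f :> R.
    by move=> h; rewrite -[LHS]ratr_int h rmorphM /= ratr_int.
  rewrite E /w rvD rvN !rvZ dotDl dotNl !dotZl -!E e1 e2 (gR _ _ G1) (gR _ _ G2); ring.
have wE : nu 0 q *: w = w 0 q *: nu.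
  by apply/rowP => j; rewrite [LHS]mxE [RHS]mxE mulrC; exact: pw.
have dE : (nu 0 q)%:~R * (g2%:~R * (deg x1)%:~R - g1%:~R * (deg x2)%:~R) = (w 0 q)%:~R * (deg nu)%:~R :> rat.
  have := congr1 deg wE; rewrite !(degZ SEED) /w (linB (degD SEED)) !(degZ SEED) => h.
  by rewrite -!intrM -intrB -intrM h intrM.
have F1 : (nu 0 q)%:~R * (g1%:~R * form x1 x2) = (w 0 q)%:~R * f1.
  have := congr1 (form x1) wE; rewrite !fZr /w (linB (fDr x1)) !fZr (B_alt (form_skew FD)).
  rewrite (form_skew FD x1 nu) -/f1; lra.
have F2 : (nu 0 q)%:~R * (g2%:~R * form x1 x2) = (w 0 q)%:~R * f2.
  have := congr1 (form x2) wE; rewrite !fZr /w (linB (fDr x2)) !fZr (B_alt (form_skew FD)).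
  rewrite (form_skew FD x2 nu) (form_skew FD x2 x1) -/f2; lra.
rewrite G1 in F1 dE; rewrite G2 in F2 dE.
have [f10|f10] := eqVneq f1 0; last first.
  have K1 : (nu 0 q)%:~R * (N0%:~R * form x1 x2) = (w 0 q)%:~R by apply: (mulIf f10); rewrite -F1; ring.
  apply: (mulfI N00); apply: (mulfI nqQ); rewrite -K1 in dE.
  by move: dE; rewrite /f1 /f2; lra.
have [f20|f20] := eqVneq f2 0; last first.
  have K1 : (nu 0 q)%:~R * (N0%:~R * form x1 x2) = (w 0 q)%:~R by apply: (mulIf f20); rewrite -F2; ring.
  apply: (mulfI N00); apply: (mulfI nqQ); rewrite -K1 in dE.
  by move: dE; rewrite /f1 /f2; lra.
rewrite f10 f20 !mulr0 subrr.
have p1 : par x1 nu.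
  apply: contrapT => np; apply: nZ; exists x1, nu; split => //.
  by rewrite e1 f10 raddf0 mulr0.
have xE : nu 0 q *: x1 = x1 0 q *: nu by apply/rowP => j; rewrite !mxE mulrC p1.
have := congr1 (form^~ x2) xE; rewrite /= !fZl -/f2 f20 mulr0 => /eqP.
by rewrite mulf_eq0 (negbTE nqQ) /= => /eqP ->; rewrite mulr0.
Qed.
End GenericPoints.

(** * Integrality by tracing *)

Section Tracing.
Context {n : nat} (Gamma : fixed_data n) (e : 'I_n -> 'rV[int]_n).
Context {R : realType} {k : fieldType} (sigma : set 'rV[R]_n).
Hypothesis char0 : [pchar k] =i pred0.
Hypothesis FD : is_fixed_data Gamma.
Hypothesis INJ : injectivity_assumption Gamma.
Hypothesis SEED : is_seed Gamma e.
Hypothesis GC : good_cone Gamma e sigma.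

Local Notation Np := (Nplus Gamma e).
Local Notation P := (monP Gamma sigma).
Local Notation phat := (phat Gamma k sigma).
Local Notation wall := (wall Gamma k sigma).
Local Notation pstar := (pstar Gamma).
Local Notation deg := (deg SEED).
Local Notation form := (@Defs.form n Gamma).
Local Notation base := (base SEED).
Local Notation cexp := (cexp FD SEED).
Local Notation dl := (@dl n Gamma e R FD SEED).
Local Notation wx := (wx FD SEED).
Local Notation ray := (ray FD SEED).
Local Notation prim := (@prim n Gamma e R FD SEED).
Local Notation mult := (@mult n Gamma e R FD SEED).
Local Notation per := (@per n Gamma e R FD SEED).
Local Notation pdataP := (@pdataP n Gamma e R FD SEED _).
Local Notation Reg := (@Reg n Gamma e).
Local Notation agr := (@agr n Gamma e k).
Local Notation wpos := (@wpos n Gamma e k).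
Implicit Types (w : wall) (D : set wall) (m : 'rV[R]_n).

Lemma isser_one_plus (v : 'rV[rat]_n) : v != 0 ->
  isser v (fun j => 'C(1, j)%:R) (one_plus_z v : phat).
Proof.
move=> v0; split => q; rewrite /one_plus_z /zmon.
  move=> j ->; rewrite -[X in _ == X](mulr0n v) (inj_eq (rV_mulrn_inj v0)).
  have -> : (v *+ j == v) = (j == 1%N).
    by rewrite -[X in _ == X](mulr1n v) (inj_eq (rV_mulrn_inj v0)).
  by case: j => [|[|j]]; rewrite ?addr0 ?add0r.
move=> H; case: eqP => [E|_]; first by case: (H 0%N); rewrite mulr0n.
by case: eqP => [E|_]; rewrite ?addr0 //; case: (H 1%N); rewrite mulr1n.
Qed.

Lemma isser_binomial (v : 'rV[rat]_n) c : P v -> v != 0 ->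
  isser v (fun j => 'C(c, j)%:R) (hexp (one_plus_z v : phat) c).
Proof.
move=> Pv v0; have := isser_exp (monP0 GC) (monPD GC) c Pv v0 (isser_one_plus v0).
suff -> : spow (fun j => 'C(1, j)%:R) c = (fun j => 'C(c, j)%:R : k) by [].
elim: c => [|c IH]; first by apply/funext => -[].
apply/funext => m; rewrite /spow iterS -/(spow _ c) IH /conv.
case: m => [|m]; first by rewrite big_ord_recl big_ord0 !bin0 mulr1 addr0.
rewrite big_ord_recl big_ord_recl big1 ?addr0 => [|i _]; last by rewrite mul0r.
by rewrite /= bin0 bin1 !mul1r subn0 subSS subn0 binS natrD.
Qed.

(** A power of a single binomial is its own factorization, and factorizations are unique. *)
Lemma wx_binomial w v (i0 c : nat) : primitive (wdir w) -> Np (wdir w) -> (0 < i0)%N ->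
  isser (pstar (wdir w) *+ i0) (fun j => 'C(c, j)%:R) (wfun w) -> Np v ->
  wx w v = if v == wdir w *+ i0 then c%:R else 0.
Proof.
move=> p0 N0 i00 [s1 s2] Nv; have [_ _ mv Ev _] := pdataP Nv.
have [pn mn] := @prim_uniq n Gamma e R FD SEED _ _ p0 N0 i00.
have [wv|wv] := eqVneq (wdir w) (prim v); last first.
  have -> : wx w v = 0 by apply/eqP/negPn/negP => /wx_prim E; rewrite E eqxx in wv.
  by case: eqP => // E; rewrite E pn eqxx in wv.
have -> : wx w v = dec (wser w) (mult v) by rewrite /wx wv eqxx.
have -> : (v == wdir w *+ i0) = (mult v == i0).
  by rewrite wv {1}Ev (inj_eq (rVint_mulrn_inj _)) //; rewrite -wv; exact: p0.1.
move: (mult v) mv => i {Ev} ii; pose N := i.+1.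
pose E j : k := if j == i0 then c%:R else 0.
have -> : (if i == i0 then c%:R else 0) = E i by [].
have w0 : wser w 0%N = 1 by [].
apply: (@bprod_inj k char0 N); last by rewrite ii ltnSn.
apply: eqm_trans (eqm_sym (@decP k char0 (wser w) N w0)) _ => m mN.
have v0 := pstar_neq0 FD INJ SEED N0.
have PM j : P (pstar (wdir w) *+ j).
  exact: (PMn (monP0 GC) (monPD GC)) (monP_pstar SEED GC N0).
have -> : (\poly_(j < N) wser w j)`_m = if (i0 %| m)%N then 'C(c, m %/ i0)%:R else 0.
  rewrite coef_poly mN /wser; case: eqP => [->|m0]; first by rewrite dvdn0 div0n bin0.
  rewrite (hext_mkP _ (PM m)); case: ifP => [/dvdnP [j Ej]|nd].
    by rewrite (s1 _ j) ?Ej ?mulnK //= mulnC mulrnA.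
  apply: s2 => j /= /esym; rewrite -mulrnA => /(rV_mulrn_inj v0) Ej.
  by rewrite -Ej dvdn_mulr in nd.
rewrite /bprod; case: (ltnP i0 N) => iN.
  have mi : i0 \in index_iota 1 N by rewrite mem_index_iota i00.
  rewrite (bigD1_seq i0) ?iota_uniq //= /E eqxx.
  have R1 : eqm N (bser N i0 (c%:R : k) * \prod_(j <- index_iota 1 N | j != i0) bser N j (if j == i0 then (c%:R : k) else 0))
      (bser N i0 (c%:R : k) * 1).
    apply: eqmM => //; rewrite big_seq_cond.
    elim/big_ind: _ => // [p1 p2 h1 h2|j /andP []].
      by apply: eqm_trans (eqmM h1 h2) _ => l lN; rewrite mul1r.
    by rewrite mem_index_iota => /andP [j0 _] /negbTE ->; exact: bser0.
  by rewrite (R1 m mN) mulr1 coef_bser // gbin_nat.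
have R1 : eqm N (\prod_(1 <= j < N) bser N j (E j)) 1.
  rewrite big_seq; elim/big_ind: _ => // [p1 p2 h1 h2|j].
    by apply: eqm_trans (eqmM h1 h2) _ => l lN; rewrite mul1r.
  rewrite mem_index_iota => /andP [j0 jN]; rewrite /E (ltn_eqF (leq_trans jN iN)).
  exact: bser0.
rewrite (R1 m mN) coef1; case: m mN {R1} => [|m] mN; first by rewrite dvdn0 div0n bin0.
case: ifP => // /(dvdn_leq (ltn0Sn m)); rewrite leqNgt (leq_trans mN) //.
Qed.

Lemma pairing_ratr (x : 'rV[int]_n) (q : 'rV[rat]_n) :
  pairing x (map_mx ratr q) = ratr (pairing x q) :> R.
Proof.
rewrite /pairing !mxE rmorph_sum; apply: eq_bigr => j _.
by rewrite !mxE rmorphM /= ratr_int.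
Qed.

Section Trace.
Variables (D : set wall) (nu : 'rV[int]_n) (K : nat).
Hypothesis cluster : is_cluster_diagram e D.
Hypothesis Nnu : Np nu.
Hypothesis degnu : deg nu = K%:Z.
Hypothesis IH : forall x, x \in base K -> deg x < K%:Z -> forall m, pairing x m = 0 -> ~ in_codim2 m ->
  exists N : nat, cexp D x m = N%:R.

Let p : 'rV[R]_n := map_mx ratr (pstar nu).

Lemma pairing_p z : pairing z p = ratr (form nu z).
Proof. by rewrite pairing_ratr form_pairing. Qed.

Lemma gap (y v : 'rV[R]_n) rho : 0 < rho -> pairing nu y = 0 -> pairing nu v = 0 ->
  (forall x, x \in base K -> pairing x y = 0 \/ 0 < pairing x (y + v) * pairing x (y - v)) ->
  (forall x1 x2, x1 \in base K -> x2 \in base K -> pairing x1 y = 0 -> pairing x2 y = 0 ->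
    ratr (form x1 x2) = rho * ((deg x1)%:~R * pairing x2 v - (deg x2)%:~R * pairing x1 v)) ->
  ~ in_codim2 (y + v) -> ~ in_codim2 (y - v) ->
  exists N : nat, cexp D nu (y - v) = cexp D nu (y + v) + N%:R.
Proof.
move=> r0 ny nv seg sk Z1 in_codim2'; have [Dd Dc _ _] := cluster; have [Dw _] := Dd.
have [u uE] := degree_functional (R := R) SEED.
have L m : pairing nu m = 0 -> ~ in_codim2 m ->
    locally m (fun m' => pairing nu m' = 0 -> cexp D nu m' = cexp D nu m).
  move=> nm nZ; apply: cexp_locally => //.
  by move/(singular_in_codim2 Dw).
apply: (comparison char0 INJ GC Dd Dc Nnu degnu r0 ny nv seg sk IH uE); apply: L => //.
  by rewrite pairingDr ny nv addr0.
by rewrite pairing_dot dotDr dotNr -!pairing_dot ny nv subrr.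
Qed.

Variable x : 'rV[R]_n.
Hypothesis nux : pairing nu x = 0.
Hypothesis xZ : ~ in_codim2 x.

Let L (s : R) := x + s *: p.
(** L s lies on no rational hyperplane transversal to the line. The rational hyperplanes through L s
    then contain the whole line, so L s is as general in nu^perp as x. *)
Let good (s : R) := forall z, pairing z p != 0 -> pairing z (L s) != 0.

Lemma pairing_L z s : pairing z (L s) = pairing z x + s * pairing z p.
Proof. by rewrite !pairing_dot dotDr dotZr. Qed.

Lemma nup : pairing nu p = 0.
Proof. by rewrite pairing_p (B_alt (form_skew FD)) raddf0. Qed.

Lemma nuL s : pairing nu (L s) = 0.
Proof. by rewrite pairing_L nup mulr0 addr0. Qed.

Lemma good_nonin_codim2 s : good s -> ~ in_codim2 (L s).
Proof.
move=> gs [z1 [z2 [np e1 e2]]]; apply: xZ; exists z1, z2.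
have H z : pairing z (L s) = 0 -> pairing z x = 0.
  move=> e0; have zp : pairing z p = 0 by apply/eqP/negPn/negP => /gs; rewrite e0 eqxx.
  by move: e0; rewrite pairing_L zp mulr0 addr0.
by split => //; exact: H.
Qed.

Lemma good0 : good 0.
Proof.
move=> z zp; rewrite pairing_L mul0r addr0; apply/eqP => zx; apply: xZ; exists z, nu; split => //.
by move=> pz; move: zp; rewrite (pairing_par (Np_neq0 SEED Nnu) pz nup) eqxx.
Qed.

(** Both points are treated at once: the product of the two values is a polynomial in t with leading
    coefficient minus the square of <z, p>. *)
Lemma good_exists (s c : R) : 0 < c -> exists2 t, 0 < t < c & good (s + t) /\ good (s - t).
Proof.
move=> c0; pose Q (z : 'rV[int]_n) : {poly R} := if pairing z p == 0 then 1 else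
  (pairing z (L s))%:P ^+ 2 - ((pairing z p) *: 'X) ^+ 2.
have [|t t0 H] := @avoid_roots R _ Q c c0.
  move=> z; rewrite /Q; case: ifP => [_|zp]; first exact: oner_neq0.
  apply/eqP => /(congr1 (fun q : {poly R} => q`_2)).
  rewrite coef0 coefB -polyC_exp coefC exprZn coefZ coefXn mulr1 sub0r => /eqP.
  by rewrite oppr_eq0 sqrf_eq0 zp.
have H' z : pairing z p != 0 -> pairing z (L s) ^+ 2 - (t * pairing z p) ^+ 2 != 0.
  move=> /negbTE zp; have := H z; rewrite /Q zp /root !hornerE.
  by rewrite [t * _]mulrC.
exists t => //; split => z zp; have := H' z zp; rewrite subr_sqr mulf_eq0 negb_or !pairing_L;
  case/andP => h1 h2.
  by move: h2; rewrite mulrDl addrA.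
by move: h1; rewrite mulrBl addrA.
Qed.

Lemma same_side z a b : a < b -> pairing z (L a) != 0 -> pairing z (L b) != 0 ->
  (forall t, a < t < b -> pairing z (L t) != 0) -> 0 < pairing z (L b) * pairing z (L a).
Proof.
move=> ab; rewrite !pairing_L; set c := pairing z x; set d := pairing z p => ha hb H.
have [d0|d0] := eqVneq d 0.
  by move: ha; rewrite d0 !mulr0 !addr0 -expr2 => ha; rewrite exprn_even_gt0 //= ha orbT.
rewrite lt_neqAle eq_sym mulf_neq0 //= leNgt; apply/negP => neg.
pose t := - c / d; have ct : c = - t * d by rewrite /t; field.
suff : a < t < b by move/H; rewrite pairing_L -/c -/d ct mulNr addNr eqxx.
have E : (c + b * d) * (c + a * d) = d ^+ 2 * ((b - t) * (a - t)) by rewrite ct; ring.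
move: neg; rewrite E pmulr_rlt0 ?exprn_even_gt0 ?d0 // => neg.
apply/andP; split; rewrite ltNge; apply/negP => h.
  have : 0 <= (b - t) * (a - t) by rewrite mulr_ge0 // subr_ge0 // (le_trans h) // ltW.
  by rewrite leNgt neg.
have : 0 <= (b - t) * (a - t) by rewrite mulr_le0 // subr_le0 // (le_trans _ h) // ltW.
by rewrite leNgt neg.
Qed.

(** For z orthogonal to L z0 one has <z, x> = - z0 {nu, z}. So [skew_identity] expresses the form by
    the slopes along t p^*(nu), with rho = 1 / (t deg nu). *)
Lemma line_gap z0 t : 0 < t -> good (z0 + t) -> good (z0 - t) ->
  (forall z, z \in base K -> pairing z (L z0) = 0 \/
     0 < pairing z (L (z0 + t)) * pairing z (L (z0 - t))) ->
  exists N : nat, cexp D nu (L (z0 - t)) = cexp D nu (L (z0 + t)) + N%:R.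
Proof.
move=> t0 g1 g2 seg.
have E1 : L (z0 + t) = L z0 + t *: p by rewrite /L scalerDl addrA.
have E2 : L (z0 - t) = L z0 - t *: p by rewrite /L scalerBl addrA.
have d0 : 0 < (deg nu)%:~R :> R by rewrite ltr0z (Np_deg SEED).
rewrite E1 E2; apply: (@gap _ _ (t * (deg nu)%:~R)^-1).
- by rewrite invr_gt0 mulr_gt0.
- exact: nuL.
- by rewrite pairing_dot dotZr -pairing_dot nup mulr0.
- by move=> z zb; rewrite -E1 -E2; exact: seg.
- move=> x1 x2 _ _ y1 y2.
  have Zf z : pairing z (L z0) = 0 -> pairing z x = - z0 * ratr (form nu z).
    by rewrite pairing_L pairing_p => /eqP; rewrite addr_eq0 => /eqP ->; rewrite mulNr.
  have /(congr1 (ratr : rat -> R)) := skew_identity FD SEED Nnu nux xZ (Zf _ y1) (Zf _ y2).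
  rewrite rmorphB !rmorphM /= !ratr_int => S.
  have Pt z : pairing z (t *: p) = t * ratr (form nu z).
    by rewrite pairing_dot dotZr -pairing_dot pairing_p.
  have -> : (deg x1)%:~R * pairing x2 (t *: p) - (deg x2)%:~R * pairing x1 (t *: p) =
     t * ((deg nu)%:~R * ratr (form x1 x2)) by rewrite S !Pt; ring.
  by field; rewrite ?gt_eqF.
- by rewrite -E1; exact: good_nonin_codim2.
- by rewrite -E2; exact: good_nonin_codim2.
Qed.

(** Without candidate times between a and b, one comparison centred at the midpoint is enough. A
    candidate time z1 is passed by a comparison centred at L z1 itself, over a symmetric interval
    free of other crossings. *)
Lemma trace_finite (Zs : seq R) a b : a < b -> good a -> good b ->
  (forall z t, z \in base K -> pairing z p != 0 -> a < t < b -> pairing z (L t) = 0 -> t \in Zs) ->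
  exists N : nat, cexp D nu (L a) = cexp D nu (L b) + N%:R.
Proof.
elim: Zs a b => [|z1 Zs IHZ] a b ab ga gb HZ.
  pose z0 := (a + b) / 2; pose t := (b - a) / 2.
  have Eb : b = z0 + t by rewrite /z0 /t; field.
  have Ea : a = z0 - t by rewrite /z0 /t; field.
  rewrite Eb [in L a]Ea; apply: line_gap; rewrite -?Ea -?Eb //.
    by rewrite divr_gt0 // subr_gt0.
  move=> z zb; have [zp|zp] := eqVneq (pairing z p) 0.
    rewrite !pairing_L zp !mulr0 !addr0; have [->|h] := eqVneq (pairing z x) 0; first by left.
    by right; rewrite -expr2 exprn_even_gt0 //= h orbT.
  right; apply: same_side => //; [exact: ga|exact: gb|move=> s sab].
  by apply/eqP => /(HZ _ _ zb zp sab).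
case: (boolP (a < z1 < b)) => zab; last first.
  apply: IHZ => // z t zb zp tab zt; have := HZ z t zb zp tab zt.
  by rewrite in_cons => /orP [/eqP tz|//]; rewrite -tz tab in zab.
have /andP [az zb'] := zab.
(* c is smaller than the distances from z1 to a, to b and to all other candidate times. *)
have [|c c0 H] := @small_exists R ([:: (1 : R, z1 - a); (1, b - z1)] ++ [seq (1, `|s - z1|) | s <- Zs & s != z1]).
  move=> ab'; rewrite mem_cat !inE => /orP [/orP [/eqP ->|/eqP ->]|/mapP [s]] /=; rewrite ?subr_gt0 //.
  by rewrite mem_filter => /andP [sz _] -> /=; rewrite normr_gt0 subr_eq0.
have c1 : c < z1 - a by have := H (1, z1 - a); rewrite /= mulr1; apply; rewrite !in_cons eqxx.
have c2 : c < b - z1 by have := H (1, b - z1); rewrite /= mulr1; apply; rewrite !in_cons eqxx orbT.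
have c3 s : s \in Zs -> s != z1 -> c < `|s - z1|.
  move=> sZ sz; have := H (1, `|s - z1|); rewrite /= mulr1; apply.
  by rewrite !in_cons; apply/orP; right; apply/orP; right; apply/mapP; exists s; rewrite ?mem_filter ?sz.
have [t /andP [t0 tc] [g1 g2]] := good_exists z1 c0.
have sub a' b' : a <= a' -> b' <= b -> (z1 <= a' \/ b' <= z1) ->
    forall z s, z \in base K -> pairing z p != 0 -> a' < s < b' -> pairing z (L s) = 0 -> s \in Zs.
  move=> aa bb side z s zb zp /andP [s1 s2] zs.
  have := HZ z s zb zp; rewrite (le_lt_trans aa s1) (lt_le_trans s2 bb) => /(_ isT zs).
  rewrite in_cons => /orP [/eqP sz|//]; case: side; rewrite -sz => h.
    by move: (lt_le_trans s1 h); rewrite ltxx.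
  by move: (lt_le_trans s2 h); rewrite ltxx.
have [N1 E1] : exists N : nat, cexp D nu (L a) = cexp D nu (L (z1 - t)) + N%:R.
  by apply: IHZ => //; [lra|apply: sub; [lra|lra|right; lra]].
have [N2 E2] : exists N : nat, cexp D nu (L (z1 + t)) = cexp D nu (L b) + N%:R.
  by apply: IHZ => //; [lra|apply: sub; [lra|lra|left; lra]].
have [|N3 E3] := line_gap t0 g1 g2; last first.
  by exists (N2 + N3 + N1)%N; rewrite E1 E3 E2 !natrD !addrA.
move=> z zb; have [zp|zp] := eqVneq (pairing z p) 0.
  rewrite !pairing_L zp !mulr0 !addr0; have [->|h] := eqVneq (pairing z x) 0; first by left.
  by right; rewrite -expr2 exprn_even_gt0 //= h orbT.
have [->|h1] := eqVneq (pairing z (L z1)) 0; first by left.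
right; apply: same_side; [lra|exact: g2|exact: g1|move=> s /andP [s1 s2]].
apply/eqP => zs; have sz : s != z1 by apply: contra h1 => /eqP <-; rewrite zs.
have sab : a < s < b by apply/andP; split; lra.
have := HZ z s zb zp sab zs; rewrite in_cons (negbTE sz) /= => /c3 /(_ sz).
rewrite lter_normr; apply/negP; rewrite negb_or -!leNgt; apply/andP; split; lra.
Qed.

(* As L s / s tends to p^*(nu), the point L s lies, for s large, only on walls containing
   p^*(nu), that is, on incoming ones. *)
Lemma trace_end : exists S : R, forall s, S < s -> exists N : nat, cexp D nu (L s) = N%:R.
Proof.
have [Dd _ Hin Hout] := cluster; have [Dw _] := Dd.
have [ws [wsD cE]] := cexp_finite char0 FD INJ SEED GC Dd Nnu.
have [p0 N0 i0 Enu _] := pdataP Nnu.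
have winit w : initial_diagram e w -> exists N : nat, wx w nu = N%:R.
  move=> iw; have ww := Dw _ (Hin _ iw); have [_ _ pw Nw _] := ww.
  case: iw => i iI wE.
  have s1 : isser (pstar (wdir w) *+ 1) (fun j => 'C(1, j)%:R) (wfun w).
    by rewrite wE mulr1n; apply: isser_one_plus; rewrite wE /= in Nw; exact: (pstar_neq0 FD INJ SEED Nw).
  rewrite (wx_binomial pw Nw (ltn0Sn 0) s1 Nnu).
  by case: ifP => _; [exists 1%N|exists 0%N].
have far : locally p (fun m' => forall w, w \in ws -> wx w nu != 0 -> ~ initial_diagram e w -> ~ wsupp w m').
  apply: locally_seq => w wws; have D1 := wsD _ wws; have ww := Dw _ D1.
  have [wv|wv] := eqVneq (wx w nu) 0; first exact: locallyT.
  case: (pselect (initial_diagram e w)) => iw; first exact: locallyT.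
  have np : ~ wsupp w p.
    move=> wp; apply: (Hout _ D1 iw); rewrite /incoming (wx_prim wv).
    have -> : map_mx ratr (pstar (prim nu)) = (mult nu)%:R^-1 *: p :> 'rV[R]_n.
      have -> : p = (mult nu)%:R *: map_mx ratr (pstar (prim nu)).
        by rewrite /p {1}Enu pstarMn -scaler_nat map_mxZ /= ratr_nat.
      by rewrite scalerA mulVf ?scale1r // pnatr_eq0 -lt0n.
    have [J [g Eg]] := wsupp_Vcone ww; move: wp; rewrite Eg; apply: fconeZ.
    by rewrite invr_ge0.
  by apply: locallyW (wsupp_closed ww np) => m' h _ _.
case: far => ep ep0 far.
(* Beyond this bound p + x / s is within ep of p; as walls are cones, it lies on the same walls as L
   s. *)
exists (\sum_j `|x 0 j| / ep) => s Ss.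
have s0 : 0 < s by apply: le_lt_trans Ss; rewrite sumr_ge0 // => j _; rewrite divr_ge0 // ltW.
have cl : close ep p (p + s^-1 *: x).
  move=> j; rewrite !mxE addrAC subrr add0r normrM normfV (gtr0_norm s0) mulrC ltr_pdivrMr //.
  rewrite mulrC -ltr_pdivrMr //; apply: le_lt_trans Ss.
  by rewrite (bigD1 j) //= lerDl sumr_ge0 // => i _; rewrite divr_ge0 // ltW.
have Ls : L s = s *: (p + s^-1 *: x).
  by rewrite scalerDr scalerA divff ?gt_eqF // scale1r addrC.
rewrite cE big_seq_cond; elim/big_ind: _ => [|a b [N1 ->] [N2 ->]|w /andP [wws /asboolP wL]].
- by exists 0%N.
- by exists (N1 + N2)%N; rewrite natrD.
have [->|wv] := eqVneq (wx w nu) 0; first by exists 0%N.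
case: (pselect (initial_diagram e w)) => iw; first exact: winit.
case: (far _ cl _ wws wv iw); have [J [g Eg]] := wsupp_Vcone (Dw _ (wsD _ wws)).
have -> : p + s^-1 *: x = s^-1 *: L s by rewrite Ls scalerA mulVf ?gt_eqF // scale1r.
by move: wL; rewrite Eg; apply: fconeZ; rewrite invr_ge0 ltW.
Qed.

Lemma trace_nat : exists N : nat, cexp D nu x = N%:R.
Proof.
have [S HS] := trace_end; pose S1 := Num.max S 0.
have [t /andP [t0 _] [gt _]] := good_exists S1 ltr01.
have b0 : 0 < S1 + t by rewrite ltr_wpDl // le_max lexx orbT.
have Sb : S < S1 + t by apply: (@le_lt_trans _ _ S1); rewrite ?ltrDl // le_max lexx.
pose Zs := [seq - pairing z x / pairing z p | z <- base K].
have [|N1 E1] := @trace_finite Zs 0 (S1 + t) b0 good0 gt.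
  move=> z s zb zp _; rewrite pairing_L => /eqP; rewrite addrC addr_eq0 => /eqP sz.
  apply/mapP; exists z => //; rewrite -sz mulfK //.
have [N2 E2] := HS _ Sb.
exists (N2 + N1)%N; rewrite natrD -E2 -E1; congr (cexp D nu _).
by rewrite /L scale0r addr0.
Qed.

End Trace.

Lemma cexp_nat D v m : is_cluster_diagram e D -> Np v -> pairing v m = 0 -> ~ in_codim2 m ->
  exists N : nat, cexp D v m = N%:R.
Proof.
move=> cl; have [d] := ubnP (absz (deg v)); elim: d v m => // d IHd v m vd Nv vm mZ.
have dv : deg v = (absz (deg v))%:Z by rewrite gtz0_abs // (Np_deg SEED).
apply: (trace_nat cl Nv dv) => // x /(mem_base SEED) [Nx xd] xlt m' xm' Zm'.
have dx := Np_deg SEED Nx; apply: IHd Nx xm' Zm'; move: dx vd xlt; clear; lia.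
Qed.

(** The comparison applies in both directions about the midpoint, so the difference of the exponents
    and its negative are both natural numbers. *)
Lemma cexp_same_cell D v m m' : is_cluster_diagram e D -> Np v ->
  pairing v m = 0 -> pairing v m' = 0 -> ~ in_codim2 m -> ~ in_codim2 m' ->
  (forall z, z \in base (absz (deg v)) -> ~ par z v -> 0 < pairing z m * pairing z m') ->
  cexp D v m = cexp D v m'.
Proof.
move=> cl Nv.
have dv : deg v = (absz (deg v))%:Z by rewrite gtz0_abs // (Np_deg SEED).
have IH z : z \in base (absz (deg v)) -> deg z < (absz (deg v))%:Z -> forall m, pairing z m = 0 -> ~ in_codim2 m ->
    exists N : nat, cexp D z m = N%:R.
  by move=> /(mem_base SEED) [Nz _] _ m1; exact: cexp_nat.
have half m1 m2 : pairing v m1 = 0 -> pairing v m2 = 0 -> ~ in_codim2 m1 -> ~ in_codim2 m2 ->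
    (forall z, z \in base (absz (deg v)) -> ~ par z v -> 0 < pairing z m1 * pairing z m2) ->
    exists N : nat, cexp D v m2 = cexp D v m1 + N%:R.
  move=> v1 v2 Z1 in_codim2' H.
  pose y := 2^-1 *: (m1 + m2) : 'rV[R]_n; pose u := 2^-1 *: (m1 - m2) : 'rV[R]_n.
  have Ep : y + u = m1 by apply/rowP => j; rewrite !mxE; field.
  have Em : y - u = m2 by apply/rowP => j; rewrite !mxE; field.
  have yE z : pairing z y = 2^-1 * (pairing z m1 + pairing z m2).
    by rewrite !pairing_dot /y dotZr dotDr.
  have uE z : pairing z u = 2^-1 * (pairing z m1 - pairing z m2).
    by rewrite !pairing_dot /u dotZr dotDr dotNr.
  have vpar z m0 : par z v -> pairing v m0 = 0 -> pairing z m0 = 0.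
    by move=> pz; apply: pairing_par pz; exact: Np_neq0 Nv.
  have yv z : z \in base (absz (deg v)) -> pairing z y = 0 -> par z v.
    move=> zb zy; apply: contrapT => np; have := H z zb np.
    move/eqP: zy; rewrite yE mulf_eq0 invr_eq0 pnatr_eq0 /= addr_eq0 => /eqP ->.
    by rewrite mulNr oppr_gt0 ltNge -expr2 sqr_ge0.
  (* Vectors orthogonal to the midpoint are parallel to v, so their forms and slopes vanish and any
     positive rho does. *)
  rewrite -Ep -Em; apply: (gap cl Nv dv IH (rho := 1)).
  - exact: ltr01.
  - by rewrite yE v1 v2 addr0 mulr0.
  - by rewrite uE v1 v2 subr0 mulr0.
  - move=> z zb; case: (pselect (par z v)) => [pz|np]; [left|right; rewrite Ep Em; exact: H].
    by rewrite yE (vpar z m1) // (vpar z m2) // addr0 mulr0.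
  - move=> x1 x2 b1 b2 /(yv _ b1) p1 /(yv _ b2) p2.
    rewrite !uE !(vpar x1) // !(vpar x2) // subr0 !mulr0 subr0 mulr0.
    have [q vq] := neq0_entry (Np_neq0 SEED Nv).
    have xE z : par z v -> v 0 q *: z = z 0 q *: v.
      by move=> pz; apply/rowP => j; rewrite [LHS]mxE [RHS]mxE mulrC; exact: pz.
    have fZl (a : int) (z z' : 'rV[int]_n) : form (a *: z) z' = a%:~R * form z z'.
      by rewrite !form_pairing /pairing /Defs.pstar map_mxZ -scalemxAl !linearZ /= !mxE.
    have vqQ : (v 0 q)%:~R != 0 :> rat by rewrite intr_eq0.
    have F1 z : par z v -> form z v = 0.
      move=> pz; apply: (mulfI vqQ); rewrite mulr0 -fZl (xE _ pz) fZl.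
      by rewrite (B_alt (form_skew FD)) mulr0.
    have F2 : form x1 x2 = 0.
      apply: (mulfI vqQ); rewrite mulr0 -fZl (xE _ p1) fZl (form_skew FD) (F1 _ p2).
      by rewrite oppr0 mulr0.
    by rewrite F2 raddf0.
  - by rewrite Ep.
  - by rewrite Em.
move=> vm vm' Zm Zm' H.
have [N1 E1] := half _ _ vm vm' Zm Zm' H.
have [|N2 E2] := half _ _ vm' vm Zm' Zm; first by move=> z zb np; rewrite mulrC; exact: H.
move: E1; rewrite E2 -addrA -natrD => /eqP; rewrite addrC -subr_eq subrr eq_sym.
rewrite char0_natr_eq0 // addn_eq0 => /andP [/eqP -> _].
by rewrite addr0.
Qed.
End Tracing.

(** * The binomial diagram *)

Section BinomialDiagram.
Context {n : nat} (Gamma : fixed_data n) (e : 'I_n -> 'rV[int]_n).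
Context {R : realType} {k : fieldType} (sigma : set 'rV[R]_n).
Hypothesis char0 : [pchar k] =i pred0.
Hypothesis FD : is_fixed_data Gamma.
Hypothesis INJ : injectivity_assumption Gamma.
Hypothesis SEED : is_seed Gamma e.
Hypothesis GC : good_cone Gamma e sigma.

Local Notation Np := (Nplus Gamma e).
Local Notation P := (monP Gamma sigma).
Local Notation phat := (phat Gamma k sigma).
Local Notation wall := (wall Gamma k sigma).
Local Notation pstar := (pstar Gamma).
Local Notation deg := (deg SEED).
Local Notation form := (@Defs.form n Gamma).
Local Notation base := (base SEED).
Local Notation cexp := (cexp FD SEED).
Local Notation dl := (@dl n Gamma e R FD SEED).
Local Notation wx := (wx FD SEED).
Local Notation ray := (ray FD SEED).
Local Notation prim := (@prim n Gamma e R FD SEED).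
Local Notation mult := (@mult n Gamma e R FD SEED).
Local Notation per := (@per n Gamma e R FD SEED).
Local Notation pdataP := (@pdataP n Gamma e R FD SEED _).
Local Notation Reg := (@Reg n Gamma e).
Local Notation agr := (@agr n Gamma e k).
Local Notation wpos := (@wpos n Gamma e k).
Implicit Types (w : wall) (D : set wall) (m : 'rV[R]_n).
Local Notation block := (block FD SEED).
Local Notation hX := (@hX n Gamma e R k sigma).

Definition cell v (x : 'rV[R]_n) : set 'rV[R]_n := [set m | pairing v m = 0 /\
  forall z, z \in base (absz (deg v)) -> 0 <= pairing z x * pairing z m].

Lemma nonpar_neq0 v (x : 'rV[R]_n) z : pairing v x = 0 -> ~ in_codim2 x -> ~ par z v -> pairing z x != 0.
Proof. by move=> vx nZ np; apply/eqP => zx; apply: nZ; exists z, v. Qed.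

Lemma cell_self v (x : 'rV[R]_n) : pairing v x = 0 -> cell v x x.
Proof. by move=> vx; split => // z _; rewrite -expr2 sqr_ge0. Qed.

Lemma cell_Vcone v (x : 'rV[R]_n) : Vcone (cell v x).
Proof.
pose sg (z : 'rV[int]_n) := if 0 < pairing z x then z else if pairing z x < 0 then - z else 0.
have pN (z : 'rV[int]_n) m : pairing (- z) m = - pairing z m.
  by rewrite !pairing_dot rvN dotNl.
suff -> : cell v x = [set m | forall y, y \in [:: v, - v & [seq sg z | z <- base (absz (deg v))]] -> 0 <= pairing y m].
  exact: Vcone_halves.
have sgE (z : 'rV[int]_n) m : 0 <= pairing (sg z) m <-> 0 <= pairing z x * pairing z m.
  rewrite /sg; case: (ltgtP 0 (pairing z x)) => h.
  - by rewrite pmulr_rge0.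
  - by rewrite pN oppr_ge0 nmulr_rge0.
  - by rewrite -h mul0r pairing_dot rv0 dot0l.
apply/seteqP; split => m /=.
  move=> [vm H] y; rewrite !in_cons => /or3P [/eqP ->|/eqP ->|/mapP [z zb ->]].
  - by rewrite vm.
  - by rewrite pN vm oppr0.
  - exact/sgE/H.
move=> H; split.
  apply/eqP; rewrite eq_le; apply/andP; split; last by apply: H; rewrite mem_head.
  by rewrite -oppr_ge0 -pN; apply: H; rewrite !in_cons eqxx orbT.
move=> z zb; apply/sgE/H; rewrite !in_cons; apply/or3P; apply: Or33.
by apply/mapP; exists z.
Qed.

Lemma cell_rational v (x : 'rV[R]_n) : Np v -> pairing v x = 0 -> ~ in_codim2 x -> rational_cone 1 (cell v x).
Proof.
move=> Nv vx nZ; have v0 := Np_neq0 SEED Nv.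
have kill m : m *m (map_mx intr v)^T = 0 <-> pairing v m = 0.
  have E : (m *m (map_mx intr v)^T) 0 0 = pairing v m.
    by rewrite /pairing !mxE; apply: eq_bigr => j _; rewrite !mxE mulrC.
  split => [h|h]; first by rewrite -E h mxE.
  by apply/matrixP => i j; rewrite !ord1 E h mxE.
apply: (@Vcone_rational R n 1 v _ x).
- rewrite /row_free rank_rV; suff -> : (map_mx intr v : 'rV[rat]_n) != 0 by [].
  apply: contra v0 => /eqP h; apply/eqP/rowP => j; move/rowP/(_ j): h; rewrite !mxE => /eqP.
  by rewrite intr_eq0 => /eqP.
- exact: cell_Vcone.
- by move=> m [vm _]; apply/kill.
- exact: cell_self.
have L : locally x (fun m => forall z, z \in base (absz (deg v)) -> pairing v m = 0 -> 0 <= pairing z x * pairing z m).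
  apply: locally_seq => z _; case: (pselect (par z v)) => [pz|np].
    by apply: locallyT => m vm; rewrite (pairing_par v0 pz vm) mulr0.
  have zx := nonpar_neq0 vx nZ np; case: (ltgtP 0 (pairing z x)) => h; last by rewrite -h eqxx in zx.
    by apply: locallyW (locally_pairing h) => m zm _; rewrite mulr_ge0 // ltW.
  by apply: locallyW (locally_pairingN h) => m zm _; rewrite mulr_le0 // ltW.
by apply: locallyW L => m H /kill vm; split => // z zb; exact: H.
Qed.

Definition bwall v (x : 'rV[R]_n) (c : nat) : wall :=
  Wall (cell v x) (prim v) (hexp (one_plus_z (pstar v)) c).

Lemma bwall_isser v (x : 'rV[R]_n) c : Np v ->
  isser (pstar (prim v) *+ mult v) (fun j => 'C(c, j)%:R) (wfun (bwall v x c)).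
Proof.
move=> Nv; have [_ _ _ Ev _] := pdataP Nv; rewrite -pstarMn -Ev.
by apply: (isser_binomial GC); [exact: (monP_pstar SEED GC)|exact: (pstar_neq0 FD INJ SEED)].
Qed.

Lemma bwall_coef v (x : 'rV[R]_n) c (q : P) (j : nat) : Np v -> val q = pstar (prim v) *+ j ->
  wfun (bwall v x c) q = if (mult v %| j)%N then 'C(c, j %/ mult v)%:R else 0.
Proof.
move=> Nv Eq; have [s1 s2] := bwall_isser x c Nv; have [_ N0 i0 _ _] := pdataP Nv.
case: ifP => [/dvdnP [i Ei]|nd]; first by rewrite Ei mulnK //; apply: s1; rewrite Eq Ei mulnC mulrnA.
apply: s2 => i; rewrite Eq -mulrnA => /(rV_mulrn_inj (pstar_neq0 FD INJ SEED N0)) Ej.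
by rewrite Ej dvdn_mulr in nd.
Qed.

Lemma bwall_is_wall v (x : 'rV[R]_n) c : Np v -> pairing v x = 0 -> ~ in_codim2 x -> is_wall e (bwall v x c).
Proof.
move=> Nv vx nZ; have [p0 N0 i0 Ev _] := pdataP Nv.
have v0 := pstar_neq0 FD INJ SEED N0.
split => //; first exact: cell_rational.
  move=> m [vm _]; apply: pairing_par vm; first exact: Np_neq0 Nv.
  by move=> i j; rewrite {2 4}Ev !mulmxnE -!(mulr_natr (prim v 0 _)); ring.
exists (fun j => if (mult v %| j)%N then 'C(c, j %/ mult v)%:R else 0); apply/wall_seriesE => //.
split => q.
  move=> j Eq; rewrite (bwall_coef x c Nv Eq); case: j {Eq} => // .
  by rewrite dvdn0 div0n bin0.
move=> H; have [_ s2] := bwall_isser x c Nv; apply: s2 => j; rewrite -mulrnA; exact: H.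
Qed.

Lemma wx_bwall v (x : 'rV[R]_n) c z : Np v -> Np z -> wx (bwall v x c) z = if z == v then c%:R else 0.
Proof.
move=> Nv Nz; have [p0 N0 i0 Ev _] := pdataP Nv.
by rewrite (wx_binomial char0 FD INJ SEED GC (w := bwall v x c) p0 N0 i0 (bwall_isser x c Nv) Nz) -Ev.
Qed.

Lemma bwall_order v (x : 'rV[R]_n) c l : Np v -> pairing v x = 0 -> ~ in_codim2 x ->
  nontrivial_to_order e l (bwall v x c) -> deg v <= l%:Z.
Proof.
move=> Nv vx nZ /(nontrivialP FD INJ SEED GC _ (bwall_is_wall c Nv vx nZ)) [j [j0 wj jl]].
have [p0 N0 i0 Ev _] := pdataP Nv.
have Pj : P (pstar (prim v) *+ j).
  exact: (PMn (monP0 GC) (monPD GC)) (monP_pstar SEED GC N0).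
apply: le_trans jl; rewrite [in leLHS]Ev !(degMn SEED) -[_ *+ mult v]mulr_natl -[_ *+ j]mulr_natl !natz.
rewrite ler_wpM2r ?lez_nat //; first by rewrite ltW // (Np_deg SEED).
apply: dvdn_leq => //; move: wj; rewrite /wser (gtn_eqF j0) (hext_mkP _ Pj).
by rewrite (@bwall_coef v x c _ j Nv) //; case: ifP => //; rewrite eqxx.
Qed.

Section Final.
Variable Ds : set wall.
Hypothesis cluster : is_cluster_diagram e Ds.

(** The walls are indexed by general points, but points of one open cell give the same record, so a
    cell occurs once in the set. *)
Definition binomial_diagram : set wall := [set w | exists v (x : 'rV[R]_n) (c : nat),
  [/\ Np v, pairing v x = 0, ~ in_codim2 x, (0 < c)%N & cexp Ds v x = c%:R /\ w = bwall v x c]].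

Let same_cell v (x x' : 'rV[R]_n) := forall z, z \in base (absz (deg v)) -> ~ par z v ->
  0 < pairing z x * pairing z x'.

Lemma natr_inj_char0 (a b : nat) : a%:R = b%:R :> k -> a = b.
Proof.
wlog ab : a b / (a <= b)%N.
  by move=> H E; case/orP: (leq_total a b) => ab; [exact: H|apply/esym/H].
move=> /esym/eqP; rewrite -subr_eq0 -natrB // char0_natr_eq0 // subn_eq0 => ba.
by apply/eqP; rewrite eqn_leq ab.
Qed.

Lemma same_cell_bwall v (x x' : 'rV[R]_n) c c' : Np v -> pairing v x = 0 -> pairing v x' = 0 ->
  ~ in_codim2 x -> ~ in_codim2 x' -> same_cell v x x' -> cexp Ds v x = c%:R -> cexp Ds v x' = c'%:R ->
  bwall v x c = bwall v x' c'.
Proof.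
move=> Nv vx vx' Zx Zx' sc Ec Ec'.
have Ecc : c = c'.
  apply: natr_inj_char0; rewrite -Ec -Ec'.
  exact: (cexp_same_cell char0 FD INJ GC cluster Nv vx vx' Zx Zx' sc).
rewrite -Ecc /bwall; congr Wall; apply/seteqP.
have H (a b : 'rV[R]_n) m : (forall z, z \in base (absz (deg v)) -> ~ par z v -> 0 < pairing z a * pairing z b) ->
    cell v a m -> cell v b m.
  move=> sab [vm h]; split => // z zb; case: (pselect (par z v)) => [pz|np].
    by rewrite (pairing_par (Np_neq0 SEED Nv) pz vm) mulr0.
  have ab := sab z zb np; have am := h z zb.
  case: (ltgtP 0 (pairing z a)) => a0; last by rewrite -a0 mul0r ltxx in ab.
    by rewrite pmulr_rgt0 // in ab; rewrite pmulr_rge0 // in am; rewrite mulr_ge0 // ltW.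
  by rewrite nmulr_rgt0 // in ab; rewrite nmulr_rge0 // in am; rewrite mulr_le0 // ltW.
by split => m; apply: H => // z zb np; rewrite mulrC; exact: sc.
Qed.

Lemma cell_same_cell v (x m : 'rV[R]_n) : pairing v x = 0 -> ~ in_codim2 x -> pairing v m = 0 -> ~ in_codim2 m ->
  cell v x m -> same_cell v x m.
Proof.
move=> vx Zx vm Zm [_ H] z zb np; rewrite lt_neqAle H // andbT eq_sym mulf_neq0 //.
  exact: nonpar_neq0 np.
exact: nonpar_neq0 np.
Qed.

(** At a general m the only wall contributing at v is that of the cell of m, and there is none if
    the exponent is zero. *)
Lemma cexp_binomial v m : Np v -> pairing v m = 0 -> ~ in_codim2 m ->
  cexp binomial_diagram v m = cexp Ds v m.
Proof.
move=> Nv vm Zm; have [c Ec] := cexp_nat char0 FD INJ SEED GC cluster Nv vm Zm.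
have only w : binomial_diagram w -> wsupp w m -> wx w v != 0 -> (0 < c)%N /\ w = bwall v m c.
  move=> [v' [x [c' [Nv' vx Zx c0 [Ec' ->]]]]] wm; rewrite wx_bwall //.
  case: (v =P v') => [Ev _|_]; last by rewrite eqxx.
  rewrite -Ev in vx Ec' wm *; have sc := cell_same_cell vx Zx vm Zm wm.
  have E := same_cell_bwall Nv vx vm Zx Zm sc Ec' Ec; split => //.
  suff <- : c' = c by [].
  apply: natr_inj_char0; rewrite -Ec -Ec'.
  exact: (cexp_same_cell char0 FD INJ GC cluster Nv vx vm Zx Zm sc).
rewrite Ec; case: (posnP c) => [c0|c0].
  rewrite (@cexp_sum _ _ _ _ _ _ FD SEED _ v m [::]) ?big_nil ?c0 //.
  by move=> w Dw wm wv; have [] := only w Dw wm wv; rewrite c0.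
rewrite (@cexp_sum _ _ _ _ _ _ FD SEED _ v m [:: bwall v m c]) //.
- by rewrite big_seq1 wx_bwall // eqxx.
- move=> w; rewrite inE => /eqP ->; split; last exact: cell_self.
  by exists v, m, c.
- by move=> w Dw wm wv; have [_ ->] := only w Dw wm wv; rewrite mem_head.
Qed.

Lemma binomial_scattering : is_scattering_diagram e binomial_diagram.
Proof.
split; first by move=> w [v [x [c [Nv vx Zx c0 [_ ->]]]]]; exact: bwall_is_wall.
move=> l l0; pose s := base l.
(* A wall nontrivial to order l comes from some v of degree at most l and depends on x only through
   its signs on [base l], so there are finitely many. *)
pose pat (x : 'rV[R]_n) : {ffun 'I_(size s) -> bool} := [ffun i : 'I_(size s) => 0 < pairing (nth 0 s i) x].
pose good v f w := exists (x : 'rV[R]_n) (c : nat), [/\ Np v, pairing v x = 0, ~ in_codim2 x,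
  cexp Ds v x = c%:R & f = pat x /\ w = bwall v x c].
pose g (t : 'rV[int]_n * {ffun 'I_(size s) -> bool}) : wall := xget (bwall t.1 0 0) (good t.1 t.2).
pose ls := [seq g t | t <- [seq (v, f) | v <- s, f <- enum {ffun 'I_(size s) -> bool}]].
have fl : finite_set [set` ls] by apply/finite_seqP; exists ls.
apply: (sub_finite_set _ fl) => w [[v [x [c [Nv vx Zx c0 [Ec Ew]]]]] nt] /=.
have vl : v \in s by apply/(mem_base SEED); split => //; rewrite Ew in nt; exact: bwall_order nt.
have Gw : good v (pat x) w by exists x, c.
apply/mapP; exists (v, pat x); first by apply/allpairsP; exists (v, pat x); rewrite mem_enum.
rewrite /g /=; case: xgetP => [w' _ [x' [c' [_ vx' Zx' Ec' [Ep ->]]]]|/(_ w) //].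
rewrite Ew; apply: same_cell_bwall => // z zb np.
have zs : z \in s.
  have [Nz zv] := (mem_base SEED _ _).1 zb; have [_ vl'] := (mem_base SEED _ _).1 vl.
  by apply/(mem_base SEED); split => //; apply: le_trans zv _; rewrite gtz0_abs // (Np_deg SEED).
have zi : (index z s < size s)%N by rewrite index_mem.
have /ffunP /(_ (Ordinal zi)) := Ep; rewrite !ffunE /= nth_index // => sgn.
have zx := nonpar_neq0 vx Zx np; have zx' := nonpar_neq0 vx' Zx' np.
case: (ltgtP 0 (pairing z x)) => h; last by rewrite -h eqxx in zx.
  by rewrite mulr_gt0 // -sgn.
have h' : pairing z x' < 0 by rewrite lt_neqAle zx' leNgt -sgn -leNgt ltW.
by rewrite nmulr_rgt0.
Qed.

(** A nonsingular m may still lie in a rational codimension-two subspace. Both exponents are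
    constant nearby in v^perp, and a general point there is covered by [cexp_binomial]. *)
Lemma cexp_nonsingular v m : Np v -> pairing v m = 0 -> ~ singular_locus Ds m ->
  ~ singular_locus binomial_diagram m -> cexp Ds v m = cexp binomial_diagram v m.
Proof.
move=> Nv vm s1 s2; have [Dd _ _ _] := cluster.
have L1 := cexp_locally char0 FD INJ SEED GC Dd Nv vm s1.
have L2 := cexp_locally char0 FD INJ SEED GC binomial_scattering Nv vm s2.
have [ep ep0 H] := locallyI L1 L2.
have [m' [cm' vm' Zm']] := generic_nearby ep0 (Np_neq0 SEED Nv) vm.
have [h1 h2] := H _ cm'; rewrite -(h1 vm') -(h2 vm').
by rewrite cexp_binomial.
Qed.

Lemma covers_exists D1 D2 gamma K : is_scattering_diagram e D1 -> is_scattering_diagram e D2 ->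
  admissible D1 gamma -> admissible D2 gamma ->
  exists T, covers e D1 gamma K T /\ covers e D2 gamma K T.
Proof.
move=> d1 d2 a1 a2; pose l := maxn 1 K; have l0 : (0 < l)%N by rewrite leq_maxl.
have [s1 [_ _ P1]] := crossing_seq_exists l0 d1 a1.
have [s2 [_ _ P2]] := crossing_seq_exists l0 d2 a2.
pose T := sort (fun a b : R => b <= a) (undup ([seq u.1 | u <- s1] ++ [seq u.1 | u <- s2])).
have mT t : (t \in T) = (t \in [seq u.1 | u <- s1]) || (t \in [seq u.1 | u <- s2]).
  by rewrite mem_sort mem_undup mem_cat.
have sT : sorted (fun a b : R => b < a) T.
  have uT : uniq T by rewrite sort_uniq undup_uniq.
  have := uT; have : sorted (fun a b : R => b <= a) T by apply: sort_sorted => a b; exact: le_total.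
  clear; elim: T => //= a T2 IH pT /andP [aT uT].
  have {}IH := IH (path_sorted pT) uT.
  case: T2 aT pT IH {uT} => //= b T2 + /andP [ba _] ->; rewrite in_cons negb_or => /andP [ab _].
  by rewrite andbT lt_neqAle ba andbT eq_sym.
have T01 t : t \in T -> 0 <= t <= 1.
  by rewrite mT => /orP [/mapP [[t' w] /P1 [h _ _ _] ->]|/mapP [[t' w] /P2 [h _ _ _] ->]].
have mono D w : is_scattering_diagram e D -> D w -> nontrivial_to_order e K w -> nontrivial_to_order e l w.
  move=> [Dw _] /Dw ww /(nontrivialP FD INJ SEED GC _ ww) [j [j0 wj jK]].
  apply/(nontrivialP FD INJ SEED GC _ ww); exists j; split => //; apply: le_trans jK _.
  by rewrite lez_nat leq_maxr.
exists T; split; split => // t w t01 Dw nt wm; rewrite mT; apply/orP; [left|right]; apply/mapP; exists (t, w) => //.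
  by apply/P1; split => //; exact: (mono _ _ d1 Dw nt).
by apply/P2; split => //; exact: (mono _ _ d2 Dw nt).
Qed.

Lemma binomial_equivalent : equivalent e Ds binomial_diagram.
Proof.
move=> gamma a1 a2; have [Dd _ _ _] := cluster; have Db := binomial_scattering.
apply/funext => h; apply/funext => q.
have [N HN] := monP_bounded SEED GC (val q).
(* The target [xt] is taken so high that exponents of negative degree below it fall outside P when
   based at q0 = q - p^*(xt). This makes the coefficients of any [h] supported in degrees >= 0. *)
have [xt [K [x0 xK xdeg]]] : exists (xt : 'rV[int]_n) (K : nat), [/\ 0 <= deg xt, deg xt <= K%:Z &
    forall z, Np z -> deg (xt - z) < 0 -> ~ P (val q - pstar z)].
  case: (pselect (exists z, Np z)) => [[z0 Nz0]|nN]; last first.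
    by exists 0, 0%N; rewrite (deg0 SEED); split => // z Nz; case: nN; exists z.
  exists (z0 *+ N), (absz (deg z0) * N)%N; split.
    by rewrite (degMn SEED) mulrn_wge0 // ltW // (Np_deg SEED).
    by rewrite (degMn SEED) -mulr_natr PoszM gtz0_abs ?(Np_deg SEED) // natz.
  move=> z Nz; rewrite (linB (degD SEED)) (degMn SEED) => dz /(HN _ Nz) zN.
  have : N%:Z <= deg z0 *+ N by rewrite -[leLHS]natz ler_wMn2r //; have := Np_deg SEED Nz0; lia.
  by move: dz zN; clear; lia.
pose q0 := val q - pstar xt.
have qE : q0 + pstar xt = val q by rewrite subrK.
have hn : nonneg_supp SEED q0 xt h.
  move=> y [->|Ny] yd; first by move: yd; rewrite ltNge x0.
  rewrite hext_out // => Py; apply: (xdeg _ Ny); first by rewrite subKr.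
  by rewrite (linB (@pstarD _ _)) opprB addrA -/q0; move: Py; rewrite /q0 addrAC.
have Rx : Reg xt xt by left.
have [T [c1 c2]] := covers_exists K Dd Db a1 a2.
have := path_product_word char0 FD INJ GC Dd a1 c1 xK hn Rx.
have := path_product_word char0 FD INJ GC Db a2 c2 xK hn Rx.
have -> : [seq block K binomial_diagram gamma t | t <- T] = [seq block K Ds gamma t | t <- T].
  apply/eq_in_map => t tT; apply/eq_in_map => v; rewrite mem_filter => /andP [/eqP vt /(mem_base SEED) [Nv _]].
  have [_ T01 _] := c1; have [_ _ ns1 _ _] := a1; have [_ _ ns2 _ _] := a2.
  by rewrite (cexp_nonsingular Nv vt (ns1 _ (T01 _ tT)) (ns2 _ (T01 _ tT))).
by move=> <-; rewrite !hX_in // qE !hextE.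
Qed.

End Final.
End BinomialDiagram.

Theorem theorem1p13 (R : realType) (k : fieldType) (n : nat)
    (Gamma : fixed_data n) (e : 'I_n -> 'rV[int]_n) (sigma : set 'rV[R]_n)
    (Ds : set (wall Gamma k sigma)) :
  [pchar k] =i pred0 ->
  is_fixed_data Gamma -> injectivity_assumption Gamma -> is_seed Gamma e ->
  good_cone Gamma e sigma ->
  is_cluster_diagram e Ds ->
  exists D : set (wall Gamma k sigma),
    [/\ is_scattering_diagram e D, equivalent e Ds D,
        (forall w, D w -> exists (x : 'rV[int]_n) (c : nat),
           [/\ Nplus Gamma e x, (0 < c)%N
             & wfun w = hexp (one_plus_z (pstar Gamma x)) c])
      & (forall w, D w -> forall q, wfun w q != 0 ->
           exists2 a : nat, (0 < a)%N & wfun w q = a%:R)].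
Proof.
move=> char0 FD INJ SEED GC cl; exists (binomial_diagram FD SEED Ds); split.
- exact: binomial_scattering char0 FD INJ SEED GC Ds cl.
- exact: binomial_equivalent char0 FD INJ SEED GC Ds cl.
- by move=> w [v [x [c [Nv _ _ c0 [_ ->]]]]]; exists v, c.
move=> w [v [x [c [Nv _ _ c0 [_ ->]]]]] q /=.
have [s1 s2] := isser_binomial (k := k) GC c (monP_pstar SEED GC Nv) (pstar_neq0 FD INJ SEED Nv).
case: (pselect (exists j, val q = pstar Gamma v *+ j)) => [[j Ej]|nj]; last first.
  by rewrite s2 ?eqxx // => j Ej; apply: nj; exists j.
rewrite (s1 _ j Ej) => nz; exists 'C(c, j) => //.
by rewrite lt0n; apply: contraNneq nz => ->.
Qed.
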